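(* Let $c=1.109643839000099$. There exists a smooth, even, real-valued, zero-mean function $v:\mathbb{T}\to\mathbb{R}$, $v\ne0$, which is not $\frac{2\pi}{n}$-periodic for any integer $n\ge2$ and satisfies $c\,\partial_xv+Hv+v\,\partial_xv=0$ on $\mathbb{T}$, such that, setting $v^3(x):=\frac13v(3x)$, the operator $$\mathcal{L}f:=\Big(\frac c3+v^3\Big)\partial_xf+Hf-\frac1{2\pi}\int_{-\pi}^{\pi}v^3(x)\,\partial_xf(x)\,dx$$ admits an eigenvalue $-\lambda\in\mathbb{C}$ with negative real part and a smooth associated eigenfunction $f_{-\lambda}:\mathbb{T}\to\mathbb{C}$. Hence, $(-\lambda,\partial_xf_{-\lambda})$ is an eigenpair of the operator $$g\mapsto \frac c3\,\partial_xg+Hg+\partial_x(v^3g).$$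
   Context: $\mathbb{T}=\mathbb{R}/2\pi\mathbb{Z}$, and $\hat f_k=\frac1{2\pi}\int_{-\pi}^{\pi}f(x)e^{-ikx}\,dx$. $H$ is the Hilbert transform on $\mathbb{T}$: $\widehat{Hf}_k=-i\,\mathrm{sgn}(k)\hat f_k$ with $\mathrm{sgn}(0)=0$. Here $v^3$ denotes the rescaled function $\frac13 v(3\,\cdot)$, not a cube. Functions acted on by the operators are complex-valued; an eigenpair $(\mu,f)$ of an operator $L$ consists of $\mu\in\mathbb{C}$ and a nonzero function $f$ with $Lf=\mu f$. *)

(* Defs.v *)
From Stdlib Require Import Reals ZArith.
From Coquelicot Require Export Coquelicot.

Open Scope R_scope.

(** Functions on the torus [R / 2 pi Z] are represented by their
    [2 pi]-periodic lifts to [R]. *)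
Definition periodic {A : Type} (T : R) (f : R -> A) : Prop :=
  forall x, f (x + T) = f x.

Definition smooth (v : R -> R) : Prop := forall n x, ex_derive_n v n x.

Definition smoothC (f : R -> C) : Prop :=
  smooth (fun x => Re (f x)) /\ smooth (fun x => Im (f x)).

Definition smooth_on_torus (f : R -> C) : Prop :=
  smoothC f /\ periodic (2 * PI) f.

Definition DeriveC (f : R -> C) (x : R) : C :=
  (Derive (fun t => Re (f t)) x, Derive (fun t => Im (f t)) x).

Definition RIntC (f : R -> C) (a b : R) : C :=
  RInt (V := C_R_CompleteNormedModule) f a b.

(** [expi t] is [e^{i t}]. *)
Definition expi (t : R) : C := (cos t, sin t).

Definition fourier (f : R -> C) (k : Z) : C :=
  (RtoC (/ (2 * PI)) *
   RIntC (fun x => f x * expi (- (IZR k * x)))%C (- PI) PI)%C.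

(** [is_hilbert f h] reads [h = H f].  A continuous function on the torus is
    determined by its Fourier coefficients, so there is at most one such [h];
    there is one whenever [f] is smooth on the torus. *)
Definition is_hilbert (f h : R -> C) : Prop :=
  periodic (2 * PI) h /\ (forall x : R, continuous h x) /\
  forall k : Z,
    fourier h k = (- Ci * RtoC (IZR (Z.sgn k)) * fourier f k)%C.

Definition rescale3 (v : R -> R) (x : R) : R := / 3 * v (3 * x).

(** Operators containing [H] are given by their graphs: [opL c w f h] reads
    [h = L f], where [w] is the function multiplying the derivative. *)
Definition opL (c : R) (w : R -> R) (f h : R -> C) : Prop :=
  exists Hf : R -> C, is_hilbert f Hf /\
  forall x : R,
    h x = (RtoC (c / 3 + w x) * DeriveC f x + Hf x
           - RtoC (/ (2 * PI)) *
             RIntC (fun y => RtoC (w y) * DeriveC f y)%C (- PI) PI)%C.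

Definition opA (c : R) (w : R -> R) (g h : R -> C) : Prop :=
  exists Hg : R -> C, is_hilbert g Hg /\
  forall x : R,
    h x = (RtoC (c / 3) * DeriveC g x + Hg x
           + DeriveC (fun y => RtoC (w y) * g y)%C x)%C.

Definition eigenpair (op : (R -> C) -> (R -> C) -> Prop) (mu : C)
    (f : R -> C) : Prop :=
  smooth_on_torus f /\ (exists x, f x <> RtoC 0) /\
  op f (fun x => mu * f x)%C.

(** [c v' + H v + v v' = 0] *)
Definition travelling_wave (c : R) (v : R -> R) : Prop :=
  exists Hv : R -> C, is_hilbert (fun x => RtoC (v x)) Hv /\
  forall x : R,
    (RtoC (c * Derive v x) + Hv x + RtoC (v x * Derive v x))%C = RtoC 0.

(* Main.v *)
Require Import Defs.
From Stdlib Require Import Reals ZArith Lra Lia Psatz List.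
From Coquelicot Require Import Coquelicot.
Import ListNotations.
Open Scope R_scope.

(** In the coordinate [y = psi x], where [e^{i psi x} = (3 e^{ix} - 2) / (3 - 2 e^{ix})], the nearly
    cusped wave is resolved by few Fourier modes, and the Hilbert transform, being conformally
    invariant, keeps its form.  Put [w = c + v = ser W (psi x)] with [W = c + D * Y], where [D] is the
    symbol of [psi'] as a function of [y].  Differentiating [w^2 / 2] shows that [v] solves the wave
    equation as soon as [(W * W)_k / 2 = Y_k / |k|] for [k <> 0].  In the same way
    [f = e^{ix} (1 + 2/3 E) ser G (psi (3 x))], [E = e^{i psi (3 x)}], solves [L f = i nu f] as soon as
    [W * gam G = (sig + nu) G], with [sig = 1] on [k >= 0] and [sig = -1] on [k < 0]; the prefactor makes
    the two halves of the series lie in the two Hardy spaces, which gives [H f].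

    Both equations are solved by a contraction near a numerical solution, in [l^1] with a slowly growing
    exponential weight (hence smoothness).  Corrections are sought in the form [s * d], where [s] is an
    approximate convolution inverse of [W * D]; the linearization is then the identity plus an operator
    which is small on high modes, and on the low modes it is preconditioned on the right by a finite
    matrix.  Right preconditioning needs no invertibility: a fixed point of [x - F (A x)] yields the zero
    [A x] of [F].  All the bounds are computed in integer arithmetic.

    Minimal periodicity: for [j = n / 2] (rounded down) the point [2 pi j / n] lies in [[2 pi / 3, pi]],
    where [e^{i psi}] is so close to [-1] that [v] is larger than [v 0]. *)

(** * Symmetric finite sums over the integers *)

(** The parameter 2/3 of the change of variable balances the near cusp at 0: [psi'] is 5 at 0 and
    1/5 at [PI], where [c + v] is about 0.05 and 1.54, so the product of [W] and [D] takes the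
    comparable values 0.25 and 0.31 there and 50 modes suffice for an approximate inverse. Taking
    [v] as [psi'] times a series without constant term makes it an exact derivative, hence of zero
    mean, and lets the sign symbol pass through the convolution with [D]. The rescaled wave has
    period [2 PI / 3], while [f] lives in the Floquet class of Fourier modes congruent to 1 modulo
    3: the instability is subharmonic. Mode 0 is absent from [f], [H f] and [f'], so the integral
    term of the operator vanishes by itself. Numerically [nu] is near -0.071 + 0.142 i, which gives
    [i nu] a negative real part. The obstacle is size: after the inverse has been factored out, the
    columns of the remaining operator beyond mode 10 (wave) or 20 (eigenvalue) still have norm about
    0.58 or 0.63. The contraction rates are thus moderate, about 0.58 and 0.74, and the approximate
    solutions must carry the precision. *)

Fixpoint zs (f : Z -> R) (n : nat) : R :=
  match n with
  | O => f 0%Z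
  | S k => zs f k + (f (Z.of_nat (S k)) + f (- Z.of_nat (S k))%Z)
  end.

Lemma zs_le f g n :
  (forall k, (Z.abs k <= Z.of_nat n)%Z -> f k <= g k) -> zs f n <= zs g n.
Proof.
  induction n as [|n IH]; intros H.
  - apply H; simpl; lia.
  - cbn [zs]. apply Rplus_le_compat.
    + apply IH. intros k Hk. apply H. lia.
    + apply Rplus_le_compat; apply H; lia.
Qed.

Lemma zs_ext f g n :
  (forall k, (Z.abs k <= Z.of_nat n)%Z -> f k = g k) -> zs f n = zs g n.
Proof.
  intros H. apply Rle_antisym; apply zs_le; intros k Hk; rewrite (H k Hk); lra.
Qed.

Lemma zs_plus f g n : zs (fun k => f k + g k) n = zs f n + zs g n.
Proof. induction n as [|n IH]; cbn [zs]; [reflexivity | rewrite IH; lra]. Qed.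

Lemma zs_scal c f n : zs (fun k => c * f k) n = c * zs f n.
Proof. induction n as [|n IH]; cbn [zs]; [reflexivity | rewrite IH; lra]. Qed.

Lemma zs_minus f g n : zs (fun k => f k - g k) n = zs f n - zs g n.
Proof. induction n as [|n IH]; cbn [zs]; [reflexivity | rewrite IH; lra]. Qed.

Lemma zs_zero n : zs (fun _ => 0) n = 0.
Proof. induction n as [|n IH]; cbn [zs]; [reflexivity | rewrite IH; lra]. Qed.

Lemma zs_pos f n : (forall k, 0 <= f k) -> 0 <= zs f n.
Proof.
  intros H. rewrite <- (zs_zero n). apply zs_le. intros; apply H.
Qed.

Lemma zs_mono f n m : (forall k, 0 <= f k) -> (n <= m)%nat -> zs f n <= zs f m.
Proof.
  intros H. induction 1 as [|m _ IH]; [lra|].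
  cbn [zs]. generalize (H (Z.of_nat (S m))) (H (- Z.of_nat (S m))%Z). lra.
Qed.

Lemma zs_swap (f : Z -> Z -> R) n m :
  zs (fun i => zs (fun j => f i j) m) n = zs (fun j => zs (fun i => f i j) n) m.
Proof.
  induction n as [|n IH]; cbn [zs]; [reflexivity|].
  rewrite IH, !zs_plus. reflexivity.
Qed.

Lemma zs_finite f n m :
  (forall k, (Z.of_nat n < Z.abs k)%Z -> f k = 0) -> (n <= m)%nat -> zs f m = zs f n.
Proof.
  intros H. induction 1 as [|m Hm IH]; [reflexivity|].
  cbn [zs]. rewrite IH, !H; [lra | lia | lia].
Qed.

Lemma zs_term f n k :
  (forall k, 0 <= f k) -> (Z.abs k <= Z.of_nat n)%Z -> f k <= zs f n.
Proof.
  intros H. induction n as [|n IH]; intros Hk; cbn [zs].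
  - replace k with 0%Z by lia. lra.
  - generalize (H (Z.of_nat (S n))) (H (- Z.of_nat (S n))%Z) (zs_pos f n H).
    intros H1 H2 H3.
    destruct (Z.le_gt_cases (Z.abs k) (Z.of_nat n)) as [Hl|Hl].
    + specialize (IH Hl). lra.
    + destruct (Z.abs_eq_or_opp k) as [He|He].
      * replace k with (Z.of_nat (S n)) by lia. lra.
      * replace k with (- Z.of_nat (S n))%Z by lia. lra.
Qed.

Lemma zs_delta c p n : (Z.abs p <= Z.of_nat n)%Z ->
  zs (fun k => if (k =? p)%Z then c else 0) n = c.
Proof.
  induction n as [|n IH]; intros Hp; cbn [zs].
  - replace p with 0%Z by lia. reflexivity.
  - destruct (Z.le_gt_cases (Z.abs p) (Z.of_nat n)) as [Hl|Hl].
    + rewrite IH by exact Hl.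
      destruct (Z.eqb_spec (Z.of_nat (S n)) p); [lia|].
      destruct (Z.eqb_spec (- Z.of_nat (S n)) p); [lia|]. lra.
    + rewrite (zs_ext _ (fun _ => 0)).
      2:{ intros k Hk. destruct (Z.eqb_spec k p); [lia|reflexivity]. }
      rewrite zs_zero.
      destruct (Z.eqb_spec (Z.of_nat (S n)) p);
      destruct (Z.eqb_spec (- Z.of_nat (S n)) p); try lia; lra.
Qed.

Lemma zs_flip f n : zs (fun k => f (- k)%Z) n = zs f n.
Proof.
  induction n as [|n IH]; cbn [zs]; [reflexivity|].
  rewrite IH, Z.opp_involutive. lra.
Qed.

(** * Sums over intervals of integers, for moving the window of summation *)

Fixpoint isum (f : Z -> R) (lo : Z) (n : nat) : R :=
  match n with
  | O => 0
  | S k => isum f lo k + f (lo + Z.of_nat k)%Z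
  end.

Lemma isum_app f lo n m :
  isum f lo (n + m) = isum f lo n + isum f (lo + Z.of_nat n) m.
Proof.
  induction m as [|m IH].
  - rewrite Nat.add_0_r. simpl. lra.
  - rewrite Nat.add_succ_r. cbn [isum]. rewrite IH.
    replace (lo + Z.of_nat (n + m))%Z with (lo + Z.of_nat n + Z.of_nat m)%Z by lia.
    lra.
Qed.

Lemma isum_shift f lo n m :
  isum (fun k => f (k - m)%Z) lo n = isum f (lo - m) n.
Proof.
  induction n as [|n IH]; cbn [isum]; [reflexivity|].
  rewrite IH. do 2 f_equal. lia.
Qed.

Lemma isum_pos f lo n : (forall k, 0 <= f k) -> 0 <= isum f lo n.
Proof.
  intros H; induction n as [|n IH]; cbn [isum]; [lra|].
  generalize (H (lo + Z.of_nat n)%Z); lra.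
Qed.

Lemma isum_zero f lo n :
  (forall k, (lo <= k < lo + Z.of_nat n)%Z -> f k = 0) -> isum f lo n = 0.
Proof.
  induction n as [|n IH]; intros H; cbn [isum]; [reflexivity|].
  rewrite IH, H; [lra | lia | intros; apply H; lia].
Qed.

Lemma zs_isum f n : zs f n = isum f (- Z.of_nat n) (2 * n + 1).
Proof.
  induction n as [|n IH].
  - simpl. lra.
  - cbn [zs]. rewrite IH.
    replace (2 * S n + 1)%nat with (1 + ((2 * n + 1) + 1))%nat by lia.
    rewrite !isum_app. cbn [isum].
    replace (- Z.of_nat (S n) + Z.of_nat 1)%Z with (- Z.of_nat n)%Z by lia.
    replace (- Z.of_nat n + Z.of_nat (2 * n + 1) + Z.of_nat 0)%Z
      with (Z.of_nat (S n)) by lia.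
    replace (- Z.of_nat (S n) + Z.of_nat 0)%Z with (- Z.of_nat (S n))%Z by lia.
    lra.
Qed.

(** The translated window lies inside the symmetric window enlarged by [|m|], and the extra terms
    are nonnegative. This inclusion replaces translation invariance for sums that are known only
    through symmetric partial sums. *)
Lemma zs_shift_le f n m : (forall k, 0 <= f k) ->
  zs (fun k => f (k - m)%Z) n <= zs f (n + Z.abs_nat m).
Proof.
  intros H. rewrite !zs_isum, isum_shift.
  set (a := Z.abs_nat m).
  replace (2 * (n + a) + 1)%nat
    with (Z.to_nat (Z.of_nat a - m) + ((2 * n + 1) + Z.to_nat (Z.of_nat a + m)))%nat
    by lia.
  rewrite !isum_app.
  replace (- Z.of_nat (n + a) + Z.of_nat (Z.to_nat (Z.of_nat a - m)))%Z
    with (- Z.of_nat n - m)%Z by lia.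
  generalize (isum_pos f (- Z.of_nat (n + a)) (Z.to_nat (Z.of_nat a - m)) H).
  generalize (isum_pos f (- Z.of_nat n - m + Z.of_nat (2 * n + 1)) (Z.to_nat (Z.of_nat a + m)) H).
  lra.
Qed.

Lemma zs_shift_finite f N m n :
  (forall k, (Z.of_nat N < Z.abs k)%Z -> f k = 0) ->
  (Z.of_nat N + Z.abs m <= Z.of_nat n)%Z ->
  zs (fun k => f (k - m)%Z) n = zs f N.
Proof.
  intros H Hn. rewrite !zs_isum, isum_shift.
  replace (2 * n + 1)%nat
    with (Z.to_nat (Z.of_nat n - Z.of_nat N + m) +
          ((2 * N + 1) + Z.to_nat (Z.of_nat n - Z.of_nat N - m)))%nat by lia.
  rewrite !isum_app.
  rewrite (isum_zero f (- Z.of_nat n - m)) by (intros k Hk; apply H; lia).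
  replace (- Z.of_nat n - m + Z.of_nat (Z.to_nat (Z.of_nat n - Z.of_nat N + m)))%Z
    with (- Z.of_nat N)%Z by lia.
  rewrite (isum_zero f (- Z.of_nat N + Z.of_nat (2 * N + 1)))
    by (intros k Hk; apply H; lia).
  lra.
Qed.

(** * Symmetric finite sums with complex terms *)

Definition zsC (f : Z -> C) (n : nat) : C :=
  (zs (fun k => Re (f k)) n, zs (fun k => Im (f k)) n).

Lemma zsC_S f n :
  zsC f (S n) = (zsC f n + (f (Z.of_nat (S n)) + f (- Z.of_nat (S n))%Z))%C.
Proof. reflexivity. Qed.

Lemma zsC_0 f : zsC f 0 = f 0%Z.
Proof. unfold zsC. cbn [zs]. symmetry. apply surjective_pairing. Qed.

Lemma zsC_ext f g n :
  (forall k, (Z.abs k <= Z.of_nat n)%Z -> f k = g k) -> zsC f n = zsC g n.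
Proof.
  intros H. unfold zsC. f_equal; apply zs_ext; intros k Hk; rewrite H; auto.
Qed.

Lemma zsC_plus f g n : zsC (fun k => f k + g k)%C n = (zsC f n + zsC g n)%C.
Proof. unfold zsC. simpl. rewrite !zs_plus. reflexivity. Qed.

Lemma zsC_minus f g n : zsC (fun k => f k - g k)%C n = (zsC f n - zsC g n)%C.
Proof.
  induction n as [|n IH]; [rewrite !zsC_0; reflexivity|].
  rewrite !zsC_S, IH. ring.
Qed.

Lemma zsC_scal c f n : zsC (fun k => c * f k)%C n = (c * zsC f n)%C.
Proof.
  induction n as [|n IH]; [rewrite !zsC_0; reflexivity|].
  rewrite !zsC_S, IH. ring.
Qed.

Lemma zsC_scal_r c f n : zsC (fun k => f k * c)%C n = (zsC f n * c)%C.
Proof.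
  rewrite Cmult_comm, <- zsC_scal. apply zsC_ext. intros; ring.
Qed.

Lemma zsC_zero n : zsC (fun _ => RtoC 0) n = RtoC 0.
Proof. unfold zsC. simpl. rewrite !zs_zero. reflexivity. Qed.

Lemma zsC_swap (f : Z -> Z -> C) n m :
  zsC (fun i => zsC (fun j => f i j) m) n = zsC (fun j => zsC (fun i => f i j) n) m.
Proof. unfold zsC. simpl. f_equal; apply zs_swap. Qed.

Lemma zsC_delta c p n : (Z.abs p <= Z.of_nat n)%Z ->
  zsC (fun k => if (k =? p)%Z then c else RtoC 0) n = c.
Proof.
  intros Hp. transitivity (fst c, snd c); [|symmetry; apply surjective_pairing].
  unfold zsC. f_equal.
  - rewrite <- (zs_delta (fst c) p n Hp). apply zs_ext. intros k _.
    destruct (k =? p)%Z; reflexivity.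
  - rewrite <- (zs_delta (snd c) p n Hp). apply zs_ext. intros k _.
    destruct (k =? p)%Z; reflexivity.
Qed.

Lemma zsC_flip f n : zsC (fun k => f (- k)%Z) n = zsC f n.
Proof.
  unfold zsC. f_equal;
  [apply (zs_flip (fun k => Re (f k))) | apply (zs_flip (fun k => Im (f k)))].
Qed.

Lemma zsC_shift_finite f N m n :
  (forall k, (Z.of_nat N < Z.abs k)%Z -> f k = RtoC 0) ->
  (Z.of_nat N + Z.abs m <= Z.of_nat n)%Z ->
  zsC (fun k => f (k - m)%Z) n = zsC f N.
Proof.
  intros H Hn. unfold zsC. f_equal.
  - apply (zs_shift_finite (fun k => Re (f k))); auto.
    intros k Hk; rewrite H; auto.
  - apply (zs_shift_finite (fun k => Im (f k))); auto.
    intros k Hk; rewrite H; auto.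
Qed.

Lemma Cmod_zsC f n : Cmod (zsC f n) <= zs (fun k => Cmod (f k)) n.
Proof.
  induction n as [|n IH]; [rewrite zsC_0; simpl; lra|].
  rewrite zsC_S. cbn [zs].
  eapply Rle_trans; [apply Cmod_triangle|].
  apply Rplus_le_compat; [exact IH | apply Cmod_triangle].
Qed.

(** * Absolutely convergent sums over the integers *)

(** Summability is carried as a bound on all symmetric partial sums, never as the value of a series,
    so that estimates reduce to finite sums. *)
Definition asum (f : Z -> C) (B : R) : Prop :=
  forall n, zs (fun k => Cmod (f k)) n <= B.

Definition is_tsum (f : Z -> C) (s : C) : Prop :=
  is_lim_seq (zs (fun k => Re (f k))) (Re s) /\
  is_lim_seq (zs (fun k => Im (f k))) (Im s).

(** A total function: termwise equal families have equal sums with no convergence to discuss. *)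
Definition tsum (f : Z -> C) : C :=
  (real (Lim_seq (zs (fun k => Re (f k)))), real (Lim_seq (zs (fun k => Im (f k))))).

Lemma is_tsum_unique f s : is_tsum f s -> tsum f = s.
Proof.
  intros [H1 H2]. unfold tsum.
  rewrite (is_lim_seq_unique _ _ H1), (is_lim_seq_unique _ _ H2).
  symmetry. apply surjective_pairing.
Qed.

Lemma re_le_Cmod z : Rabs (Re z) <= Cmod z.
Proof. apply Rle_trans with (2 := Rmax_Cmod z). apply Rmax_l. Qed.

Lemma im_le_Cmod z : Rabs (Im z) <= Cmod z.
Proof. apply Rle_trans with (2 := Rmax_Cmod z). apply Rmax_r. Qed.

(** [|g|] and [|g| + g] have nonnegative terms and bounded partial sums, hence monotone convergence;
    [g] is their difference. *)
Lemma abs_summable_lim g B :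
  (forall n, zs (fun k => Rabs (g k)) n <= B) -> ex_finite_lim_seq (zs g).
Proof.
  intros H.
  assert (Hc : forall h : Z -> R, (forall k, 0 <= h k) -> (exists b, forall n, zs h n <= b) ->
                ex_finite_lim_seq (zs h)).
  { intros h Hh [b Hb]. apply ex_finite_lim_seq_incr with b; [|exact Hb].
    intros n. apply zs_mono; auto. }
  destruct (Hc (fun k => Rabs (g k))) as [l1 H1].
  { intros; apply Rabs_pos. } { exists B; exact H. }
  destruct (Hc (fun k => Rabs (g k) + g k)) as [l2 H2].
  { intros k. generalize (Rle_abs (- g k)). rewrite Rabs_Ropp. lra. }
  { exists (B + B). intros n. rewrite zs_plus. apply Rplus_le_compat; [apply H|].
    eapply Rle_trans; [|apply (H n)]. apply zs_le. intros; apply Rle_abs. }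
  exists (l2 - l1).
  eapply is_lim_seq_ext; [|apply (is_lim_seq_minus' _ _ _ _ H2 H1)].
  intros n. cbn beta. rewrite zs_plus. lra.
Qed.

Lemma asum_is_tsum f B : asum f B -> is_tsum f (tsum f).
Proof.
  intros H. split; cbn [tsum Re Im fst snd]; apply Lim_seq_correct'.
  - apply abs_summable_lim with B. intros n. eapply Rle_trans; [|apply (H n)].
    apply zs_le. intros; apply re_le_Cmod.
  - apply abs_summable_lim with B. intros n. eapply Rle_trans; [|apply (H n)].
    apply zs_le. intros; apply im_le_Cmod.
Qed.

(** The squared modulus is a polynomial in the two real limits, so the bound on the partial sums
    passes to the limit by comparing squares. *)
Lemma is_tsum_bound f s B : is_tsum f s -> asum f B -> Cmod s <= B.
Proof.
  intros [H1 H2] H.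
  assert (HB : 0 <= B).
  { eapply Rle_trans; [|apply (H O)]. apply zs_pos. intros; apply Cmod_ge_0. }
  assert (Hl : Re s * Re s + Im s * Im s <= B * B).
  { pose proof (is_lim_seq_plus' _ _ _ _ (is_lim_seq_mult' _ _ _ _ H1 H1)
                 (is_lim_seq_mult' _ _ _ _ H2 H2)) as H3.
    apply (is_lim_seq_le _ (fun _ => B * B) (Finite _) (Finite (B * B))) with (2 := H3);
      [|apply is_lim_seq_const].
    intros n. generalize (Rle_trans _ _ _ (Cmod_zsC f n) (H n)).
    intros Hn. generalize (Cmod_ge_0 (zsC f n)). intros Hp.
    assert (Cmod (zsC f n) * Cmod (zsC f n) <= B * B) by nra.
    unfold Cmod in H0. rewrite sqrt_sqrt in H0 by nra.
    simpl in H0. lra. }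
  unfold Cmod. rewrite <- (sqrt_square B HB). apply sqrt_le_1_alt.
  simpl. unfold Re, Im in Hl. lra.
Qed.

Lemma tsum_bound f B : asum f B -> Cmod (tsum f) <= B.
Proof. intros H. eapply is_tsum_bound; [eapply asum_is_tsum|]; exact H. Qed.

Lemma is_tsum_ext f g s : (forall k, f k = g k) -> is_tsum f s -> is_tsum g s.
Proof.
  intros H [H1 H2]; split; (eapply is_lim_seq_ext; [|eassumption]);
  intros n; apply zs_ext; intros; rewrite H; reflexivity.
Qed.

Lemma tsum_ext f g : (forall k, f k = g k) -> tsum f = tsum g.
Proof.
  intros H. unfold tsum.
  f_equal; f_equal; apply Lim_seq_ext; intros n; apply zs_ext; intros; rewrite H; reflexivity.
Qed.

Lemma is_tsum_plus f g s t :
  is_tsum f s -> is_tsum g t -> is_tsum (fun k => f k + g k)%C (s + t)%C.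
Proof.
  intros [H1 H2] [H3 H4]. split.
  - eapply is_lim_seq_ext; [|apply (is_lim_seq_plus' _ _ _ _ H1 H3)].
    intros n. simpl. rewrite <- zs_plus. reflexivity.
  - eapply is_lim_seq_ext; [|apply (is_lim_seq_plus' _ _ _ _ H2 H4)].
    intros n. simpl. rewrite <- zs_plus. reflexivity.
Qed.

Lemma is_tsum_scal c f s : is_tsum f s -> is_tsum (fun k => c * f k)%C (c * s)%C.
Proof.
  intros [H1 H2]. split.
  - eapply is_lim_seq_ext;
      [|apply (is_lim_seq_minus' _ _ _ _ (is_lim_seq_scal_l _ (Re c) _ H1)
                 (is_lim_seq_scal_l _ (Im c) _ H2))].
    intros n. cbn beta. rewrite <- !zs_scal, <- zs_minus. reflexivity.
  - eapply is_lim_seq_ext;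
      [|apply (is_lim_seq_plus' _ _ _ _ (is_lim_seq_scal_l _ (Re c) _ H2)
                 (is_lim_seq_scal_l _ (Im c) _ H1))].
    intros n. cbn beta. rewrite <- !zs_scal, <- zs_plus. reflexivity.
Qed.

Lemma is_tsum_minus f g s t :
  is_tsum f s -> is_tsum g t -> is_tsum (fun k => f k - g k)%C (s - t)%C.
Proof.
  intros H1 H2.
  apply is_tsum_ext with (fun k => f k + (- (1)) * g k)%C; [intros; ring|].
  replace (s - t)%C with (s + (- (1)) * t)%C by ring.
  apply is_tsum_plus; [exact H1 | apply is_tsum_scal; exact H2].
Qed.

Lemma is_tsum_finite f n :
  (forall k, (Z.of_nat n < Z.abs k)%Z -> f k = RtoC 0) -> is_tsum f (zsC f n).
Proof.
  intros H. split.
  - apply is_lim_seq_ext_loc with (fun _ => zs (fun k => Re (f k)) n).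
    + exists n. intros m Hm. symmetry. apply zs_finite; auto.
      intros k Hk; rewrite H; auto.
    + apply is_lim_seq_const.
  - apply is_lim_seq_ext_loc with (fun _ => zs (fun k => Im (f k)) n).
    + exists n. intros m Hm. symmetry. apply zs_finite; auto.
      intros k Hk; rewrite H; auto.
    + apply is_lim_seq_const.
Qed.

Lemma tsum_finite f n :
  (forall k, (Z.of_nat n < Z.abs k)%Z -> f k = RtoC 0) -> tsum f = zsC f n.
Proof. intros H. apply is_tsum_unique, is_tsum_finite, H. Qed.

Lemma is_tsum_flip f s : is_tsum f s -> is_tsum (fun k => f (- k)%Z) s.
Proof.
  intros [H1 H2]. split.
  - eapply is_lim_seq_ext; [|exact H1]. intros n.
    symmetry. apply (zs_flip (fun k => Re (f k))).
  - eapply is_lim_seq_ext; [|exact H2]. intros n.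
    symmetry. apply (zs_flip (fun k => Im (f k))).
Qed.

Lemma abs_summable_terms g B :
  (forall n, zs (fun k => Rabs (g k)) n <= B) ->
  is_lim_seq (fun n => g (Z.of_nat n)) 0 /\ is_lim_seq (fun n => g (- Z.of_nat n)%Z) 0.
Proof.
  intros H.
  assert (Hs : ex_finite_lim_seq (zs (fun k => Rabs (g k)))).
  { apply abs_summable_lim with B. intros n. eapply Rle_trans; [|apply (H n)].
    apply zs_le. intros; rewrite Rabs_Rabsolu; lra. }
  destruct Hs as [l Hl].
  assert (Hd : is_lim_seq (fun n => zs (fun k => Rabs (g k)) (S n) - zs (fun k => Rabs (g k)) n) 0).
  { replace (Finite 0) with (Finite (l - l)) by (f_equal; lra).
    apply is_lim_seq_minus'; [apply is_lim_seq_incr_1 in Hl; exact Hl | exact Hl]. }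
  cbn [zs] in Hd.
  split; apply is_lim_seq_incr_1; apply is_lim_seq_abs_0.
  - apply is_lim_seq_le_le with (u := fun _ => 0) (3 := Hd); [|apply is_lim_seq_const].
    intros n. split; [apply Rabs_pos|].
    generalize (Rabs_pos (g (- Z.of_nat (S n))%Z)). lra.
  - apply is_lim_seq_le_le with (u := fun _ => 0) (3 := Hd); [|apply is_lim_seq_const].
    intros n. split; [apply Rabs_pos|].
    generalize (Rabs_pos (g (Z.of_nat (S n))%Z)). lra.
Qed.

Lemma zs_shift1 g n :
  zs (fun k => g (k + 1)%Z) n = zs g n + (g (Z.of_nat (S n)) - g (- Z.of_nat n)%Z).
Proof.
  induction n as [|n IH].
  - simpl. lra.
  - cbn [zs]. rewrite IH.
    replace (Z.of_nat (S n) + 1)%Z with (Z.of_nat (S (S n))) by lia.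
    replace (- Z.of_nat (S n) + 1)%Z with (- Z.of_nat n)%Z by lia.
    lra.
Qed.

(** A shift by one alters a symmetric sum only by two boundary terms, which tend to 0 by absolute
    convergence. *)
Lemma is_tsum_shift1 f s B :
  asum f B -> is_tsum f s -> is_tsum (fun k => f (k + 1)%Z) s.
Proof.
  intros HB [H1 H2].
  assert (Hr : forall g : Z -> R, (forall k, Rabs (g k) <= Cmod (f k)) ->
     forall l : R, is_lim_seq (zs g) l -> is_lim_seq (zs (fun k => g (k + 1)%Z)) l).
  { intros g Hg l Hl.
    destruct (abs_summable_terms g B) as [T1 T2].
    { intros n. eapply Rle_trans; [|apply (HB n)]. apply zs_le. intros; apply Hg. }
    apply is_lim_seq_incr_1 in T1.
    eapply is_lim_seq_ext; [intros n; symmetry; apply zs_shift1|].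
    replace (Finite l) with (Finite (l + (0 - 0))) by (f_equal; lra).
    apply is_lim_seq_plus'; [exact Hl|]. apply is_lim_seq_minus'; assumption. }
  split.
  - apply (Hr (fun k => Re (f k))); [intros; apply re_le_Cmod | exact H1].
  - apply (Hr (fun k => Im (f k))); [intros; apply im_le_Cmod | exact H2].
Qed.

Lemma asum_shift f B m : asum f B -> asum (fun k => f (k - m)%Z) B.
Proof.
  intros H n. eapply Rle_trans; [|apply (H (n + Z.abs_nat m)%nat)].
  apply (zs_shift_le (fun k => Cmod (f k))). intros; apply Cmod_ge_0.
Qed.

Lemma asum_flip f B : asum f B -> asum (fun k => f (- k)%Z) B.
Proof. intros H n. rewrite (zs_flip (fun k => Cmod (f k))). apply H. Qed.

Lemma is_tsum_shift f s B m :
  asum f B -> is_tsum f s -> is_tsum (fun k => f (k - m)%Z) s.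
Proof.
  assert (Hn : forall m (f : Z -> C), asum f B -> is_tsum f s ->
             is_tsum (fun k => f (k + Z.of_nat m)%Z) s).
  { clear. induction m as [|m IH]; intros f HB Hf.
    - eapply is_tsum_ext; [|exact Hf]. intros k. f_equal. simpl. lia.
    - assert (H1 := is_tsum_shift1 f s B HB Hf).
      assert (H2 : asum (fun k => f (k + 1)%Z) B).
      { intros n. eapply Rle_trans; [|apply (asum_shift f B (-1) HB n)].
        apply zs_le. intros k _. replace (k - -1)%Z with (k + 1)%Z by lia. lra. }
      specialize (IH _ H2 H1). eapply is_tsum_ext; [|exact IH].
      intros k. cbn beta. f_equal. lia. }
  intros HB Hf.
  destruct (Z.le_gt_cases m 0) as [Hm|Hm].
  - specialize (Hn (Z.to_nat (- m)) f HB Hf). eapply is_tsum_ext; [|exact Hn].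
    intros k. cbn beta. f_equal. lia.
  (* The other sign of the shift is obtained by conjugating with the reflection [k |-> -k]. *)
  - specialize (Hn (Z.to_nat m) _ (asum_flip f B HB) (is_tsum_flip f s Hf)).
    eapply is_tsum_ext; [|apply (is_tsum_flip _ _ Hn)].
    intros k. cbn beta. f_equal. lia.
Qed.

(** Supplies the truncations behind the two density arguments below: the product of series and the
    vanishing of Fourier modes are first settled for finite sequences. *)
Lemma asum_tail f B : asum f B -> forall eps, 0 < eps ->
  exists n, asum (fun k => if (Z.abs k <=? Z.of_nat n)%Z then RtoC 0 else f k) eps.
Proof.
  intros H eps He.
  destruct (abs_summable_lim (fun k => Cmod (f k)) B) as [l Hl].
  { intros n. eapply Rle_trans; [|apply (H n)]. apply zs_le.
    intros; rewrite Rabs_pos_eq; [lra|apply Cmod_ge_0]. }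
  assert (Hle : forall n, zs (fun k => Cmod (f k)) n <= l).
  { intros n. apply (is_lim_seq_incr_compare _ _ Hl). intros m. apply zs_mono; auto.
    intros; apply Cmod_ge_0. }
  apply is_lim_seq_spec in Hl. destruct (Hl (mkposreal eps He)) as [n Hn].
  exists n. intros N. specialize (Hn n (le_n n)). simpl in Hn.
  rewrite Rabs_minus_sym, Rabs_pos_eq in Hn by (generalize (Hle n); lra).
  set (h := fun k => if (Z.abs k <=? Z.of_nat n)%Z then Cmod (f k) else 0).
  assert (Hh : zs h (N + n) = zs (fun k => Cmod (f k)) n).
  { rewrite (zs_finite h n (N + n)); [|intros k Hk|lia]; unfold h.
    - apply zs_ext. intros k Hk. destruct (Z.leb_spec (Z.abs k) (Z.of_nat n)); [reflexivity|lia].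
    - destruct (Z.leb_spec (Z.abs k) (Z.of_nat n)); [lia|reflexivity]. }
  eapply Rle_trans; [apply zs_mono with (m := (N + n)%nat); [intros; apply Cmod_ge_0 | lia]|].
  rewrite (zs_ext _ (fun k => Cmod (f k) - h k)).
  2:{ intros k _. unfold h. destruct (Z.leb_spec (Z.abs k) (Z.of_nat n)); rewrite ?Cmod_0; lra. }
  rewrite zs_minus, Hh. generalize (Hle (N + n)%nat). lra.
Qed.

(** * Weighted summable sequences and convolution *)

Definition wt (tau : R) (k : Z) : R := exp (tau * IZR (Z.abs k)).

Definition nrm (tau : R) (x : Z -> C) (B : R) : Prop :=
  forall n, zs (fun k => wt tau k * Cmod (x k)) n <= B.

Definition fin (a : Z -> C) (N : nat) : Prop :=
  forall k, (Z.of_nat N < Z.abs k)%Z -> a k = RtoC 0.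

Definition conv (a b : Z -> C) (k : Z) : C := tsum (fun m => a m * b (k - m)%Z)%C.

Lemma exp_le_mono x y : x <= y -> exp x <= exp y.
Proof. intros [H| ->]; [left; apply exp_increasing, H | lra]. Qed.

Lemma wt_pos tau k : 0 < wt tau k.
Proof. apply exp_pos. Qed.

Lemma wt_ge_1 tau k : 0 <= tau -> 1 <= wt tau k.
Proof.
  intros H. unfold wt. rewrite <- exp_0 at 1. apply exp_le_mono.
  apply Rmult_le_pos; [exact H|]. apply IZR_le. lia.
Qed.

Lemma exp_le_of tau x y : 0 <= tau -> (x <= y)%Z -> exp (tau * IZR x) <= exp (tau * IZR y).
Proof.
  intros H Hxy. apply exp_le_mono. apply Rmult_le_compat_l; [exact H|]. apply IZR_le, Hxy.
Qed.

Lemma wt_near tau i j N : 0 <= tau -> (Z.abs (i - j) <= Z.of_nat N)%Z ->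
  wt tau i <= exp (tau * INR N) * wt tau j.
Proof.
  intros Ht H. unfold wt. rewrite <- exp_plus, <- Rmult_plus_distr_l, INR_IZR_INZ, <- plus_IZR.
  apply exp_le_of; [exact Ht|lia].
Qed.

(** Submultiplicativity of the weight, which makes the weighted space an algebra for convolution. *)
Lemma wt_sub tau k m : 0 <= tau -> wt tau k <= wt tau m * wt tau (k - m).
Proof.
  intros Ht. unfold wt. rewrite <- exp_plus, <- Rmult_plus_distr_l, <- plus_IZR.
  apply exp_le_of; [exact Ht|lia].
Qed.

Lemma wt_Cmod_pos tau (x : Z -> C) k : 0 <= wt tau k * Cmod (x k).
Proof. apply Rmult_le_pos; [apply Rlt_le, wt_pos | apply Cmod_ge_0]. Qed.

Lemma nrm_nonneg tau x B : nrm tau x B -> 0 <= B.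
Proof. intros H. apply Rle_trans with (2 := H O). apply zs_pos, wt_Cmod_pos. Qed.

Lemma nrm_le tau x A B : A <= B -> nrm tau x A -> nrm tau x B.
Proof. intros H Hx n. eapply Rle_trans; [apply Hx|exact H]. Qed.

Lemma nrm_dom tau x y B :
  (forall k, Cmod (x k) <= Cmod (y k)) -> nrm tau y B -> nrm tau x B.
Proof.
  intros H Hy n. eapply Rle_trans; [|apply (Hy n)]. apply zs_le. intros k _.
  apply Rmult_le_compat_l; [apply Rlt_le, wt_pos|apply H].
Qed.

Lemma nrm_ext tau x y B : (forall k, x k = y k) -> nrm tau x B -> nrm tau y B.
Proof. intros H. apply nrm_dom. intros k. rewrite H. lra. Qed.

Lemma nrm_tau sig tau x B : sig <= tau -> nrm tau x B -> nrm sig x B.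
Proof.
  intros H Hx n. eapply Rle_trans; [|apply (Hx n)]. apply zs_le. intros k _.
  apply Rmult_le_compat_r; [apply Cmod_ge_0|]. apply exp_le_mono.
  apply Rmult_le_compat_r; [apply IZR_le; lia|exact H].
Qed.

Lemma nrm_plus tau x y A B :
  nrm tau x A -> nrm tau y B -> nrm tau (fun k => x k + y k)%C (A + B).
Proof.
  intros Hx Hy n. eapply Rle_trans; [|apply Rplus_le_compat; [apply (Hx n)|apply (Hy n)]].
  rewrite <- zs_plus. apply zs_le. intros k _. rewrite <- Rmult_plus_distr_l.
  apply Rmult_le_compat_l; [apply Rlt_le, wt_pos|apply Cmod_triangle].
Qed.

Lemma nrm_scal tau c x B : nrm tau x B -> nrm tau (fun k => c * x k)%C (Cmod c * B).
Proof.
  intros Hx n. eapply Rle_trans; [|apply Rmult_le_compat_l; [apply Cmod_ge_0|apply (Hx n)]].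
  rewrite <- zs_scal. apply zs_le. intros k _. rewrite Cmod_mult.
  apply Req_le. ring.
Qed.

Lemma nrm_opp tau x B : nrm tau x B -> nrm tau (fun k => - x k)%C B.
Proof. apply nrm_dom. intros k. rewrite Cmod_opp. lra. Qed.

Lemma nrm_minus tau x y A B :
  nrm tau x A -> nrm tau y B -> nrm tau (fun k => x k - y k)%C (A + B).
Proof. intros Hx Hy. exact (nrm_plus _ _ _ _ _ Hx (nrm_opp _ _ _ Hy)). Qed.

Lemma nrm_zero tau : nrm tau (fun _ => RtoC 0) 0.
Proof.
  intros n. rewrite (zs_ext _ (fun _ => 0)); [rewrite zs_zero; lra|].
  intros k _. rewrite Cmod_0. ring.
Qed.

Lemma nrm_wt tau x B k : nrm tau x B -> wt tau k * Cmod (x k) <= B.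
Proof.
  intros H. eapply Rle_trans; [|apply (H (Z.abs_nat k))].
  apply (zs_term (fun k => wt tau k * Cmod (x k))); [apply wt_Cmod_pos|lia].
Qed.

Lemma nrm_pt tau x B k : 0 <= tau -> nrm tau x B -> Cmod (x k) <= B.
Proof.
  intros Ht H. eapply Rle_trans; [|apply (nrm_wt _ _ _ k H)].
  generalize (wt_ge_1 tau k Ht) (Cmod_ge_0 (x k)). nra.
Qed.

Lemma nrm_asum tau x B : 0 <= tau -> nrm tau x B -> asum x B.
Proof.
  intros Ht H n. eapply Rle_trans; [|apply (H n)]. apply zs_le. intros k _.
  generalize (wt_ge_1 tau k Ht) (Cmod_ge_0 (x k)). nra.
Qed.

Lemma nrm_fin tau a N S : 0 <= tau -> fin a N -> zs (fun k => Cmod (a k)) N <= S ->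
  nrm tau a (exp (tau * INR N) * S).
Proof.
  intros Ht Ha HS n.
  apply Rle_trans with (zs (fun k => wt tau k * Cmod (a k)) (n + N)).
  { apply zs_mono; [apply wt_Cmod_pos|lia]. }
  rewrite (zs_finite _ N); [|intros k Hk; rewrite Ha, Cmod_0 by exact Hk; ring|lia].
  eapply Rle_trans; [|apply Rmult_le_compat_l; [apply Rlt_le, exp_pos|exact HS]].
  rewrite <- zs_scal. apply zs_le. intros k Hk.
  apply Rmult_le_compat_r; [apply Cmod_ge_0|]. rewrite INR_IZR_INZ. apply exp_le_of; auto.
Qed.

Lemma asum_nonneg f B : asum f B -> 0 <= B.
Proof. intros H. apply Rle_trans with (2 := H O). apply zs_pos. intros; apply Cmod_ge_0. Qed.

Lemma asum_pt f B k : asum f B -> Cmod (f k) <= B.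
Proof.
  intros H. eapply Rle_trans; [|apply (H (Z.abs_nat k))].
  apply (zs_term (fun k => Cmod (f k))); [intros; apply Cmod_ge_0|lia].
Qed.

Lemma asum_bounded_mult f g A B :
  asum f A -> (forall k, Cmod (g k) <= B) -> asum (fun k => f k * g k)%C (A * B).
Proof.
  intros Hf Hg n.
  assert (HB : 0 <= B) by (eapply Rle_trans; [apply Cmod_ge_0|apply (Hg 0%Z)]).
  eapply Rle_trans; [|apply Rmult_le_compat_r; [exact HB|apply (Hf n)]].
  rewrite Rmult_comm, <- zs_scal. apply zs_le. intros k _. rewrite Cmod_mult, Rmult_comm.
  apply Rmult_le_compat_r; [apply Cmod_ge_0|apply Hg].
Qed.

Lemma asum_conv a b A B k :
  asum a A -> asum b B -> asum (fun m => a m * b (k - m)%Z)%C (A * B).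
Proof.
  intros Ha Hb. apply (asum_bounded_mult a (fun m => b (k - m)%Z)); [exact Ha|].
  intros m. apply asum_pt, Hb.
Qed.

Lemma is_conv a b A B k : asum a A -> asum b B ->
  is_tsum (fun m => a m * b (k - m)%Z)%C (conv a b k).
Proof. intros Ha Hb. eapply asum_is_tsum, asum_conv; eassumption. Qed.

Lemma conv_ext a a' b b' k :
  (forall m, a m = a' m) -> (forall m, b m = b' m) -> conv a b k = conv a' b' k.
Proof. intros H1 H2. apply tsum_ext. intros m. rewrite H1, H2. reflexivity. Qed.

Lemma conv_plus_l a a' b A A' B k : asum a A -> asum a' A' -> asum b B ->
  conv (fun m => a m + a' m)%C b k = (conv a b k + conv a' b k)%C.
Proof.
  intros Ha Ha' Hb. apply is_tsum_unique.
  eapply is_tsum_ext; [|apply is_tsum_plus; eapply is_conv; eassumption].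
  intros m; cbn beta; ring.
Qed.

Lemma conv_plus_r a b b' A B B' k : asum a A -> asum b B -> asum b' B' ->
  conv a (fun m => b m + b' m)%C k = (conv a b k + conv a b' k)%C.
Proof.
  intros Ha Ha' Hb. apply is_tsum_unique.
  eapply is_tsum_ext; [|apply is_tsum_plus; eapply is_conv; eassumption].
  intros m; cbn beta; ring.
Qed.

Lemma conv_minus_l a a' b A A' B k : asum a A -> asum a' A' -> asum b B ->
  conv (fun m => a m - a' m)%C b k = (conv a b k - conv a' b k)%C.
Proof.
  intros Ha Ha' Hb. apply is_tsum_unique.
  eapply is_tsum_ext; [|apply is_tsum_minus; eapply is_conv; eassumption].
  intros m; cbn beta; ring.
Qed.

Lemma conv_minus_r a b b' A B B' k : asum a A -> asum b B -> asum b' B' ->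
  conv a (fun m => b m - b' m)%C k = (conv a b k - conv a b' k)%C.
Proof.
  intros Ha Ha' Hb. apply is_tsum_unique.
  eapply is_tsum_ext; [|apply is_tsum_minus; eapply is_conv; eassumption].
  intros m; cbn beta; ring.
Qed.

Lemma conv_scal_r c a b A B k : asum a A -> asum b B ->
  conv a (fun m => c * b m)%C k = (c * conv a b k)%C.
Proof.
  intros Ha Hb. apply is_tsum_unique.
  eapply is_tsum_ext; [|apply is_tsum_scal; eapply is_conv; eassumption].
  intros m; cbn beta; ring.
Qed.

Lemma conv_comm a b A B k : asum a A -> asum b B -> conv a b k = conv b a k.
Proof.
  intros Ha Hb. apply is_tsum_unique.
  pose proof (is_conv b a B A k Hb Ha) as H.
  pose proof (is_tsum_shift _ _ (B * A) k (asum_flip _ _ (asum_conv b a B A k Hb Ha))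
                (is_tsum_flip _ _ H)) as H2.
  eapply is_tsum_ext; [|exact H2]. intros m. cbn beta.
  replace (- (m - k))%Z with (k - m)%Z by lia. replace (k - (k - m))%Z with m by lia. ring.
Qed.

Lemma conv_finite_l a b N k : fin a N ->
  conv a b k = zsC (fun m => a m * b (k - m)%Z)%C N.
Proof. intros Ha. apply tsum_finite. intros m Hm. rewrite Ha by exact Hm. ring. Qed.

Lemma fin_conv a b N M : fin a N -> fin b M -> fin (conv a b) (N + M).
Proof.
  intros Ha Hb k Hk. rewrite (conv_finite_l a b N k Ha).
  rewrite (zsC_ext _ (fun _ => RtoC 0)); [apply zsC_zero|].
  intros m Hm. rewrite (Hb (k - m)%Z) by lia. ring.
Qed.

(** With two finite left factors, associativity is an exchange of two finite sums. This is why the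
    approximate solutions and the approximate inverse are kept finite and apart from the infinite
    corrections. *)
Lemma conv_fin_assoc a b z N M k : fin a N -> fin b M ->
  conv a (conv b z) k = conv (conv a b) z k.
Proof.
  intros Ha Hb.
  rewrite (conv_finite_l a _ N k Ha), (conv_finite_l _ z _ k (fin_conv a b N M Ha Hb)).
  rewrite (zsC_ext (fun m => conv a b m * z (k - m)%Z)%C
    (fun m => zsC (fun i => a i * (b (m - i)%Z * z (k - m)%Z)) N)%C).
  2:{ intros m _. rewrite (conv_finite_l a b N m Ha), <- zsC_scal_r.
      apply zsC_ext. intros; ring. }
  rewrite zsC_swap. apply zsC_ext. intros i Hi.
  rewrite zsC_scal, (conv_finite_l b z M _ Hb). f_equal.
  rewrite <- (zsC_shift_finite (fun j => b j * z (k - i - j)%Z)%C M i (N + M)).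
  - apply zsC_ext. intros j _. do 2 f_equal. lia.
  - intros j Hj. rewrite Hb by exact Hj. ring.
  - lia.
Qed.

Lemma zs_lim (u : nat -> Z -> R) (l : Z -> R) n :
  (forall k, is_lim_seq (fun M => u M k) (l k)) ->
  is_lim_seq (fun M => zs (u M) n) (zs l n).
Proof.
  intros H. induction n as [|n IH]; cbn [zs]; [apply H|].
  apply is_lim_seq_plus'; [exact IH|]. apply is_lim_seq_plus'; apply H.
Qed.

Lemma Cmod_le_abs z : Cmod z <= Rabs (Re z) + Rabs (Im z).
Proof.
  replace z with (RtoC (Re z) + Ci * RtoC (Im z))%C at 1.
  - eapply Rle_trans; [apply Cmod_triangle|].
    rewrite Cmod_mult, !Cmod_R, Cmod_Ci. lra.
  - destruct z as [x y]. unfold Ci, RtoC, Cmult, Cplus; simpl. f_equal; ring.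
Qed.

Lemma Cmod_sub_abs z w : Rabs (Cmod z - Cmod w) <= Cmod (z - w)%C.
Proof.
  apply Rabs_le. split.
  - generalize (Cmod_triangle z (w - z)%C). replace (z + (w - z))%C with w by ring.
    replace (w - z)%C with (- (z - w))%C by ring. rewrite Cmod_opp. lra.
  - generalize (Cmod_triangle w (z - w)%C). replace (w + (z - w))%C with z by ring. lra.
Qed.

Lemma Cmod_lim (u : nat -> C) (l : C) :
  is_lim_seq (fun n => Re (u n)) (Re l) -> is_lim_seq (fun n => Im (u n)) (Im l) ->
  is_lim_seq (fun n => Cmod (u n)) (Cmod l).
Proof.
  intros H1 H2.
  assert (H3 : is_lim_seq (fun n => Rabs (Re (u n) - Re l) + Rabs (Im (u n) - Im l)) 0).
  { replace (Finite 0) with (Finite (Rabs (Re l - Re l) + Rabs (Im l - Im l)))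
      by (rewrite !Rminus_diag, Rabs_R0, Rplus_0_r; reflexivity).
    apply is_lim_seq_plus';
      apply (is_lim_seq_abs _ (Finite _));
      (apply is_lim_seq_minus'; [assumption | apply is_lim_seq_const]). }
  assert (H4 : is_lim_seq (fun n => Cmod (u n) - Cmod l) 0).
  { apply is_lim_seq_abs_0.
    apply is_lim_seq_le_le with (u := fun _ => 0) (3 := H3); [|apply is_lim_seq_const].
    intros n. split; [apply Rabs_pos|].
    eapply Rle_trans; [apply Cmod_sub_abs|]. apply (Cmod_le_abs (u n - l)%C). }
  apply is_lim_seq_ext with (fun n => (Cmod (u n) - Cmod l) + Cmod l); [intros; lra|].
  replace (Finite (Cmod l)) with (Finite (0 + Cmod l)) by (f_equal; lra).
  apply is_lim_seq_plus'; [exact H4|apply is_lim_seq_const].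
Qed.

(** Young's inequality. For a truncated inner sum the weight is split by [wt_sub] and the two finite
    sums are exchanged, so that a shifted window of [b] appears and is bounded by [B]; then the
    truncation is removed by a limit. *)
Lemma conv_nrm tau a b A B : 0 <= tau -> nrm tau a A -> nrm tau b B ->
  nrm tau (conv a b) (A * B).
Proof.
  intros Ht Ha Hb n.
  assert (Hc : forall k, is_lim_seq
     (fun M => wt tau k * Cmod (zsC (fun m => a m * b (k - m)%Z)%C M))
     (wt tau k * Cmod (conv a b k))).
  { intros k. apply is_lim_seq_scal_l with (lu := Finite (Cmod (conv a b k))).
    destruct (is_conv a b A B k (nrm_asum _ _ _ Ht Ha) (nrm_asum _ _ _ Ht Hb)) as [H1 H2].
    apply Cmod_lim; [exact H1|exact H2]. }
  apply (is_lim_seq_le (fun M => zs (fun k => wt tau k * Cmod (zsC (fun m => a m * b (k - m)%Z)%C M)) n)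
    (fun _ => A * B) (Finite _) (Finite (A * B))) with (3 := is_lim_seq_const _).
  2:{ apply (zs_lim (fun M k => wt tau k * Cmod (zsC (fun m => a m * b (k - m)%Z)%C M))), Hc. }
  intros M.
  apply Rle_trans with
    (zs (fun k => zs (fun m => (wt tau m * Cmod (a m)) * (wt tau (k - m) * Cmod (b (k - m)%Z))) M) n).
  { apply zs_le. intros k _.
    eapply Rle_trans; [apply Rmult_le_compat_l; [apply Rlt_le, wt_pos|apply Cmod_zsC]|].
    rewrite <- zs_scal. apply zs_le. intros m _. rewrite Cmod_mult.
    apply Rle_trans with ((wt tau m * wt tau (k - m)) * (Cmod (a m) * Cmod (b (k - m)%Z)));
      [|apply Req_le; ring].
    apply Rmult_le_compat_r; [apply Rmult_le_pos; apply Cmod_ge_0|apply wt_sub, Ht]. }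
  rewrite zs_swap.
  apply Rle_trans with (zs (fun m => B * (wt tau m * Cmod (a m))) M).
  { apply zs_le. intros m _. rewrite zs_scal, (Rmult_comm B).
    apply Rmult_le_compat_l; [apply wt_Cmod_pos|].
    eapply Rle_trans; [apply (zs_shift_le (fun k => wt tau k * Cmod (b k)) n m), wt_Cmod_pos|].
    apply Hb. }
  rewrite zs_scal, Rmult_comm. apply Rmult_le_compat_r; [apply (nrm_nonneg _ _ _ Hb)|apply Ha].
Qed.

Lemma asum_nrm x B : asum x B -> nrm 0 x B.
Proof.
  intros H n. eapply Rle_trans; [|apply (H n)]. apply zs_le. intros k _.
  unfold wt. rewrite Rmult_0_l, exp_0. lra.
Qed.

Lemma conv_asum a b A B : asum a A -> asum b B -> asum (conv a b) (A * B).
Proof.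
  intros Ha Hb. apply (nrm_asum 0); [lra|].
  apply conv_nrm; [lra| apply asum_nrm; assumption | apply asum_nrm; assumption].
Qed.

Lemma conv_flip a b k :
  conv (fun m => a (- m)%Z) (fun m => b (- m)%Z) k = conv a b (- k).
Proof.
  unfold conv, tsum. f_equal; f_equal; apply Lim_seq_ext; intros n.
  - rewrite <- (zs_flip (fun m => Re (a m * b (- k - m)%Z)%C)). apply zs_ext. intros m _.
    replace (- k - - m)%Z with (- (k - m))%Z by lia. reflexivity.
  - rewrite <- (zs_flip (fun m => Im (a m * b (- k - m)%Z)%C)). apply zs_ext. intros m _.
    replace (- k - - m)%Z with (- (k - m))%Z by lia. reflexivity.
Qed.

Lemma conv_real a b k :
  (forall m, Im (a m) = 0) -> (forall m, Im (b m) = 0) -> Im (conv a b k) = 0.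
Proof.
  intros Ha Hb. unfold conv, tsum. cbn [Im snd].
  rewrite (Lim_seq_ext _ (fun _ => 0)); [rewrite Lim_seq_const; reflexivity|].
  intros n. rewrite (zs_ext _ (fun _ => 0)); [apply zs_zero|].
  intros m _. specialize (Ha m). specialize (Hb (k - m)%Z).
  unfold Im in *. simpl. rewrite Ha, Hb. ring.
Qed.

(** * A contraction principle *)

Section Contraction.

Variables (tau r kappa : R) (T : (Z -> C) -> Z -> C) (P : (Z -> C) -> Prop).
Hypothesis tau_pos : 0 <= tau.
Hypothesis kappa_pos : 0 <= kappa < 1.
Hypothesis P0 : P (fun _ => RtoC 0).
Hypothesis PT : forall x, P x -> nrm tau x r -> P (T x).
Hypothesis Pclosed : forall (u : nat -> Z -> C) x, (forall n, P (u n)) ->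
  (forall k, is_lim_seq (fun n => Re (u n k)) (Re (x k)) /\
             is_lim_seq (fun n => Im (u n k)) (Im (x k))) -> P x.
Hypothesis T_lip : forall x y B, P x -> P y -> nrm tau x r -> nrm tau y r ->
  nrm tau (fun k => x k - y k)%C B -> nrm tau (fun k => T x k - T y k)%C (kappa * B).
Hypothesis T_zero : nrm tau (T (fun _ => RtoC 0)) ((1 - kappa) * r).

Fixpoint iter_T (n : nat) : Z -> C :=
  match n with O => fun _ => RtoC 0 | S n => T (iter_T n) end.

Lemma r_nonneg : 0 <= r.
Proof. generalize (nrm_nonneg _ _ _ T_zero). nra. Qed.

Lemma kpow n : 0 <= kappa ^ n <= 1.
Proof. split; [apply pow_le; lra|]. rewrite <- (pow1 n). apply pow_incr; lra. Qed.

(** The partial geometric sums [(1 - kappa ^ n) * r] keep the whole orbit in the ball where [T_lip]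
    is available; [T_zero] is the first term of that sum. *)
Lemma iter_T_bounds n :
  P (iter_T n) /\ nrm tau (iter_T n) ((1 - kappa ^ n) * r) /\
  nrm tau (fun k => iter_T (S n) k - iter_T n k)%C (kappa ^ n * ((1 - kappa) * r)).
Proof.
  generalize r_nonneg. intros Hr.
  induction n as [|n (H1 & H2 & H3)].
  - split; [exact P0|]. split.
    + simpl. rewrite Rminus_diag, Rmult_0_l. apply nrm_zero.
    + simpl. rewrite Rmult_1_l. eapply nrm_ext; [|exact T_zero]. intros k. ring.
  - assert (B1 : nrm tau (iter_T n) r).
    { eapply nrm_le; [|exact H2]. generalize (kpow n). nra. }
    assert (H4 : nrm tau (iter_T (S n)) ((1 - kappa ^ S n) * r)).
    { eapply nrm_le; [|eapply nrm_ext; [|apply (nrm_plus _ _ _ _ _ H2 H3)]].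
      - simpl. apply Req_le. ring.
      - intros k. cbn beta. ring. }
    assert (H5 : P (iter_T (S n))) by (apply PT; assumption).
    assert (B2 : nrm tau (iter_T (S n)) r).
    { eapply nrm_le; [|exact H4]. generalize (kpow (S n)). nra. }
    repeat split; [exact H5|exact H4|].
    eapply nrm_le; [|apply (T_lip _ _ _ H5 H1 B2 B1 H3)].
    simpl. apply Req_le. ring.
Qed.

Lemma iter_T_in n : nrm tau (iter_T n) r.
Proof.
  eapply nrm_le; [|apply (iter_T_bounds n)]. generalize (kpow n) r_nonneg. nra.
Qed.

Lemma iter_T_cauchy n j :
  nrm tau (fun k => iter_T (n + j) k - iter_T n k)%C (kappa ^ n * r).
Proof.
  assert (H : nrm tau (fun k => iter_T (n + j) k - iter_T n k)%C
               ((kappa ^ n - kappa ^ (n + j)) * r)).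
  { induction j as [|j IH].
    - rewrite Nat.add_0_r, Rminus_diag, Rmult_0_l.
      eapply nrm_ext; [|apply nrm_zero]. intros k. cbn beta. ring.
    - rewrite Nat.add_succ_r.
      eapply nrm_le; [|eapply nrm_ext;
        [|apply (nrm_plus _ _ _ _ _ IH (proj2 (proj2 (iter_T_bounds (n + j)))))]].
      + simpl. apply Req_le. ring.
      + intros k. cbn beta. ring. }
  eapply nrm_le; [|exact H]. generalize (kpow (n + j)) (kpow n) r_nonneg. nra.
Qed.

Lemma kpow_small eps : 0 < eps -> exists N, forall n, (N <= n)%nat -> kappa ^ n * r < eps.
Proof.
  intros He.
  assert (Hl : is_lim_seq (fun n => kappa ^ n * r) 0).
  { replace (Finite 0) with (Rbar_mult (Finite 0) (Finite r)) by (simpl; f_equal; ring).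
    apply is_lim_seq_scal_r. apply is_lim_seq_geom. rewrite Rabs_pos_eq; lra. }
  apply is_lim_seq_spec in Hl. destruct (Hl (mkposreal eps He)) as [N HN].
  exists N. intros n Hn. specialize (HN n Hn). simpl in HN.
  rewrite Rminus_0_r in HN. apply Rle_lt_trans with (2 := HN). apply Rle_abs.
Qed.

(** The limit is built entry by entry, each entry being a Cauchy sequence. Closedness of [P] is
    therefore asked under entrywise limits only; [P] is the class of even real sequences for the
    wave and trivial for the eigenvalue problem. *)
Lemma contraction : exists x, P x /\ nrm tau x r /\ forall k, T x k = x k.
Proof.
  assert (Hc : forall (g : C -> R), (forall z w, Rabs (g z - g w) <= Cmod (z - w)%C) ->
     forall k, ex_finite_lim_seq (fun n => g (iter_T n k))).
  { intros g Hg k. apply ex_lim_seq_cauchy_corr. intros eps.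
    destruct (kpow_small (eps / 2)) as [N HN]; [generalize (cond_pos eps); lra|].
    exists N. intros n m Hn Hm.
    assert (Hd : forall q, (N <= q)%nat -> Rabs (g (iter_T q k) - g (iter_T N k)) < eps / 2).
    { intros q Hq. eapply Rle_lt_trans; [apply Hg|].
      replace q with (N + (q - N))%nat by lia.
      eapply Rle_lt_trans; [apply (nrm_pt tau _ _ k tau_pos (iter_T_cauchy N (q - N)))|].
      apply HN. lia. }
    generalize (Hd n Hn) (Hd m Hm). intros D1 D2.
    replace (g (iter_T n k) - g (iter_T m k)) with
      ((g (iter_T n k) - g (iter_T N k)) - (g (iter_T m k) - g (iter_T N k))) by ring.
    eapply Rle_lt_trans; [apply Rabs_triang|]. rewrite Rabs_Ropp. lra. }
  assert (Hre : forall k, ex_finite_lim_seq (fun n => Re (iter_T n k))).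
  { apply (Hc Re). intros z w. apply (re_le_Cmod (z - w)%C). }
  assert (Him : forall k, ex_finite_lim_seq (fun n => Im (iter_T n k))).
  { apply (Hc Im). intros z w. apply (im_le_Cmod (z - w)%C). }
  set (x := fun k => (real (Lim_seq (fun n => Re (iter_T n k))),
                      real (Lim_seq (fun n => Im (iter_T n k)))) : C).
  assert (Hx : forall k, is_lim_seq (fun n => Re (iter_T n k)) (Re (x k)) /\
                         is_lim_seq (fun n => Im (iter_T n k)) (Im (x k))).
  { intros k. split; [apply (Lim_seq_correct' _ (Hre k))|apply (Lim_seq_correct' _ (Him k))]. }
  (* On each finite window the Cauchy estimate passes to the limit, which upgrades entrywise
     convergence to convergence in norm. *)
  assert (Hd : forall n, nrm tau (fun k => x k - iter_T n k)%C (kappa ^ n * r)).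
  { intros n N.
    apply (is_lim_seq_le (fun j => zs (fun k => wt tau k * Cmod (iter_T (n + j) k - iter_T n k)%C) N)
      (fun _ => kappa ^ n * r) (Finite _) (Finite (kappa ^ n * r))) with (3 := is_lim_seq_const _).
    - intros j. apply iter_T_cauchy.
    - apply (zs_lim (fun j k => wt tau k * Cmod (iter_T (n + j) k - iter_T n k)%C)). intros k.
      apply (is_lim_seq_scal_l _ _ (Finite _)). destruct (Hx k) as [H1 H2].
      apply (is_lim_seq_incr_n _ n) in H1. apply (is_lim_seq_incr_n _ n) in H2.
      apply Cmod_lim; simpl.
      + apply is_lim_seq_minus'; [|apply is_lim_seq_const].
        eapply is_lim_seq_ext; [|exact H1]. intros j. rewrite Nat.add_comm. reflexivity.
      + apply is_lim_seq_minus'; [|apply is_lim_seq_const].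
        eapply is_lim_seq_ext; [|exact H2]. intros j. rewrite Nat.add_comm. reflexivity. }
  assert (HP : P x) by (apply (Pclosed iter_T x (fun n => proj1 (iter_T_bounds n)) Hx)).
  assert (Hr : nrm tau x r).
  { eapply nrm_le; [|eapply nrm_ext; [|apply (Hd O)]].
    - simpl. lra.
    - intros k. simpl. ring. }
  exists x. split; [exact HP|]. split; [exact Hr|]. intros k.
  (* [T x - x] is compared with [T (iter_T n) - iter_T (S n)], which is zero; both errors are of
     order [kappa ^ n]. *)
  assert (Hz : Cmod (T x k - x k)%C <= 0).
  { apply Rnot_lt_le. intros Hpos.
    destruct (kpow_small (Cmod (T x k - x k)%C / 2)) as [n Hn]; [lra|].
    specialize (Hn n (le_n n)).
    pose proof (nrm_pt tau _ _ k tau_pos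
      (T_lip x (iter_T n) _ HP (proj1 (iter_T_bounds n)) Hr (iter_T_in n) (Hd n))) as H1.
    pose proof (nrm_pt tau _ _ k tau_pos (Hd (S n))) as H2.
    cbn beta in H1, H2. cbn [iter_T] in H2.
    assert (H3 : Cmod (T x k - x k)%C <= kappa * (kappa ^ n * r) + kappa ^ S n * r).
    { replace (T x k - x k)%C with ((T x k - T (iter_T n) k) + - (x k - T (iter_T n) k))%C by ring.
      eapply Rle_trans; [apply Cmod_triangle|]. rewrite Cmod_opp. lra. }
    simpl in H3. generalize (kpow n) r_nonneg. nra. }
  generalize (Cmod_ge_0 (T x k - x k)%C). intros Hz'.
  assert (T x k - x k = 0)%C by (apply Cmod_eq_0; lra).
  replace (T x k) with (T x k - x k + x k)%C by ring. rewrite H. ring.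
Qed.

End Contraction.

(** * Trigonometric series *)

Definition ser (a : Z -> C) (y : R) : C := tsum (fun k => a k * expi (IZR k * y))%C.

Lemma C_eq (z w : C) : Re z = Re w -> Im z = Im w -> z = w.
Proof. destruct z, w; simpl; intros -> ->; reflexivity. Qed.

Lemma expi_plus s t : expi (s + t) = (expi s * expi t)%C.
Proof.
  unfold expi, Cmult; simpl. rewrite cos_plus, sin_plus. f_equal; ring.
Qed.

Lemma expi_0 : expi 0 = RtoC 1.
Proof. unfold expi. rewrite cos_0, sin_0. reflexivity. Qed.

Lemma Cmod_expi t : Cmod (expi t) = 1.
Proof.
  unfold Cmod, expi; cbn [fst snd].
  replace (cos t ^ 2 + sin t ^ 2) with 1; [apply sqrt_1|].
  rewrite <- (sin2_cos2 t). unfold Rsqr. ring.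
Qed.

Lemma expi_opp_l t : (expi (- t) * expi t)%C = RtoC 1.
Proof. rewrite <- expi_plus, Rplus_opp_l. apply expi_0. Qed.

Lemma expi_2PI_Z t (k : Z) : expi (t + 2 * PI * IZR k) = expi t.
Proof.
  assert (H : forall n t, expi (t + 2 * PI * INR n) = expi t).
  { clear. intros n t. unfold expi.
    replace (t + 2 * PI * INR n) with (t + 2 * INR n * PI) by ring.
    rewrite cos_period, sin_period. reflexivity. }
  destruct (Z.le_gt_cases 0 k) as [Hk|Hk].
  - specialize (H (Z.to_nat k) t). rewrite INR_IZR_INZ, Z2Nat.id in H by lia. exact H.
  - specialize (H (Z.to_nat (- k)) (t + 2 * PI * IZR k)).
    rewrite INR_IZR_INZ, Z2Nat.id, opp_IZR in H by lia. rewrite <- H. f_equal. ring.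
Qed.

Lemma asum_ser a A y : asum a A -> asum (fun k => a k * expi (IZR k * y))%C A.
Proof.
  intros Ha. rewrite <- (Rmult_1_r A).
  apply (asum_bounded_mult a (fun k => expi (IZR k * y))); [exact Ha|].
  intros k. rewrite Cmod_expi. lra.
Qed.

Lemma is_ser a A y : asum a A -> is_tsum (fun k => a k * expi (IZR k * y))%C (ser a y).
Proof. intros Ha. eapply asum_is_tsum, asum_ser, Ha. Qed.

Lemma ser_bound a A y : asum a A -> Cmod (ser a y) <= A.
Proof. intros Ha. apply tsum_bound, asum_ser, Ha. Qed.

Lemma ser_ext a b y : (forall k, a k = b k) -> ser a y = ser b y.
Proof. intros H. apply tsum_ext. intros k. rewrite H. reflexivity. Qed.

Lemma ser_plus a b A B y : asum a A -> asum b B ->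
  ser (fun k => a k + b k)%C y = (ser a y + ser b y)%C.
Proof.
  intros Ha Hb. apply is_tsum_unique.
  eapply is_tsum_ext; [|apply is_tsum_plus; eapply is_ser; eassumption].
  intros k; cbn beta; ring.
Qed.

Lemma ser_minus a b A B y : asum a A -> asum b B ->
  ser (fun k => a k - b k)%C y = (ser a y - ser b y)%C.
Proof.
  intros Ha Hb. apply is_tsum_unique.
  eapply is_tsum_ext; [|apply is_tsum_minus; eapply is_ser; eassumption].
  intros k; cbn beta; ring.
Qed.

Lemma ser_scal c a A y : asum a A -> ser (fun k => c * a k)%C y = (c * ser a y)%C.
Proof.
  intros Ha. apply is_tsum_unique.
  eapply is_tsum_ext; [|apply is_tsum_scal; eapply is_ser; eassumption].
  intros k; cbn beta; ring.
Qed.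

Lemma ser_finite a N y : fin a N -> ser a y = zsC (fun k => a k * expi (IZR k * y))%C N.
Proof. intros Ha. apply tsum_finite. intros k Hk. rewrite Ha by exact Hk. ring. Qed.

Lemma is_tsum_zsC (f : Z -> Z -> C) (s : Z -> C) N :
  (forall m, is_tsum (f m) (s m)) -> is_tsum (fun k => zsC (fun m => f m k) N) (zsC s N).
Proof.
  intros H. induction N as [|N IH].
  - rewrite zsC_0. eapply is_tsum_ext; [|apply (H 0%Z)]. intros k. rewrite zsC_0. reflexivity.
  - rewrite zsC_S. eapply is_tsum_ext; [|apply is_tsum_plus; [exact IH|apply is_tsum_plus; apply H]].
    intros k. cbn beta. rewrite zsC_S. reflexivity.
Qed.

Lemma ser_conv_finite a b N B y : fin a N -> asum b B ->
  ser (conv a b) y = (ser a y * ser b y)%C.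
Proof.
  intros Ha Hb. apply is_tsum_unique.
  rewrite (ser_finite a N y Ha), <- zsC_scal_r.
  eapply is_tsum_ext; [|apply (is_tsum_zsC
    (fun m k => (a m * expi (IZR m * y)) * (b (k - m)%Z * expi (IZR (k - m) * y)))%C)].
  - intros k. cbn beta. rewrite (conv_finite_l a b N k Ha), <- zsC_scal_r.
    apply zsC_ext. intros m _.
    replace (IZR k * y) with (IZR m * y + IZR (k - m) * y) by (rewrite minus_IZR; ring).
    rewrite expi_plus. ring.
  - intros m. apply is_tsum_scal.
    apply (is_tsum_shift (fun k => b k * expi (IZR k * y))%C _ B m);
      [apply asum_ser, Hb | eapply is_ser, Hb].
Qed.

Lemma asum_trunc a A n : asum a A ->
  asum (fun k => if (Z.abs k <=? Z.of_nat n)%Z then a k else RtoC 0) A.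
Proof.
  intros H N. eapply Rle_trans; [|apply (H N)]. apply zs_le. intros k _.
  destruct (_ <=? _)%Z; [lra|]. rewrite Cmod_0. apply Cmod_ge_0.
Qed.

(** Both sides depend continuously on [a] in the summable norm: splitting off a tail of mass [eps]
    reduces the claim to a finite [a], with error at most [2 * (eps * B)]. *)
Lemma ser_conv a b A B y : asum a A -> asum b B ->
  ser (conv a b) y = (ser a y * ser b y)%C.
Proof.
  intros Ha Hb.
  assert (HB := asum_nonneg _ _ Hb).
  set (d := (ser (conv a b) y - ser a y * ser b y)%C).
  assert (Hd : forall eps, 0 < eps -> Cmod d <= 2 * (eps * B)).
  { intros eps He. destruct (asum_tail a A Ha eps He) as [n Hn].
    set (t := fun k => if (Z.abs k <=? Z.of_nat n)%Z then RtoC 0 else a k) in Hn.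
    set (u := fun k => if (Z.abs k <=? Z.of_nat n)%Z then a k else RtoC 0).
    assert (Hu : asum u A) by (apply asum_trunc, Ha).
    assert (Hf : fin u n).
    { intros k Hk. unfold u. destruct (Z.leb_spec (Z.abs k) (Z.of_nat n)); [lia|reflexivity]. }
    assert (Hau : forall k, a k = (u k + t k)%C).
    { intros k. unfold u, t. destruct (_ <=? _)%Z; ring. }
    assert (E1 : ser a y = (ser u y + ser t y)%C).
    { rewrite (ser_ext _ _ _ Hau). eapply ser_plus; eassumption. }
    assert (E2 : ser (conv a b) y = (ser u y * ser b y + ser (conv t b) y)%C).
    { rewrite (ser_ext (conv a b) (fun k => conv u b k + conv t b k)%C).
      - erewrite ser_plus; [|eapply conv_asum; eassumption|eapply conv_asum; eassumption].
        rewrite (ser_conv_finite u b n B y Hf Hb). reflexivity.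
      - intros k. rewrite <- (conv_plus_l u t b A eps B k Hu Hn Hb).
        apply conv_ext; [exact Hau|reflexivity]. }
    unfold d. rewrite E1, E2.
    replace (ser u y * ser b y + ser (conv t b) y - (ser u y + ser t y) * ser b y)%C
      with (ser (conv t b) y + - (ser t y * ser b y))%C by ring.
    eapply Rle_trans; [apply Cmod_triangle|]. rewrite Cmod_opp, Cmod_mult.
    generalize (ser_bound _ _ y (conv_asum t b eps B Hn Hb)).
    generalize (ser_bound _ _ y Hn) (ser_bound _ _ y Hb)
      (Cmod_ge_0 (ser t y)) (Cmod_ge_0 (ser b y)). nra. }
  assert (Hz : Cmod d <= 0).
  { apply Rnot_lt_le. intros Hp.
    specialize (Hd (Cmod d / (4 * (B + 1)))).
    assert (0 < Cmod d / (4 * (B + 1))) by (apply Rdiv_lt_0_compat; lra).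
    specialize (Hd H).
    assert (Cmod d / (4 * (B + 1)) * B <= Cmod d / 4).
    { apply Rle_trans with (Cmod d / (4 * (B + 1)) * (B + 1)).
      - apply Rmult_le_compat_l; lra.
      - apply Req_le. field. lra. }
    lra. }
  generalize (Cmod_ge_0 d). intros Hz'.
  assert (Hd0 : d = RtoC 0) by (apply Cmod_eq_0; lra).
  unfold d in Hd0.
  replace (ser (conv a b) y) with (ser (conv a b) y - ser a y * ser b y + ser a y * ser b y)%C by ring.
  rewrite Hd0. ring.
Qed.

(** The rate is left existential because multiplication by [k] consumes part of it: no single
    weighted space is stable under differentiation, but this class is. *)
Definition geo (a : Z -> C) : Prop := exists tau B, 0 < tau /\ nrm tau a B.

Lemma geo_asum a : geo a -> exists A, asum a A.
Proof. intros (tau & B & Ht & H). exists B. apply (nrm_asum tau); [lra|exact H]. Qed.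

Lemma geo_common a b : geo a -> geo b ->
  exists tau A B, 0 < tau /\ nrm tau a A /\ nrm tau b B.
Proof.
  intros (s & A & Hs & Ha) (t & B & Ht & Hb). exists (Rmin s t), A, B.
  split; [apply Rmin_pos; assumption|]. split.
  - eapply nrm_tau; [apply Rmin_l|exact Ha].
  - eapply nrm_tau; [apply Rmin_r|exact Hb].
Qed.

Lemma geo_plus a b : geo a -> geo b -> geo (fun k => a k + b k)%C.
Proof.
  intros Ha Hb. destruct (geo_common a b Ha Hb) as (t & A & B & Ht & H1 & H2).
  exists t, (A + B). split; [exact Ht|]. apply nrm_plus; assumption.
Qed.

Lemma geo_minus a b : geo a -> geo b -> geo (fun k => a k - b k)%C.
Proof.
  intros Ha Hb. destruct (geo_common a b Ha Hb) as (t & A & B & Ht & H1 & H2).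
  exists t, (A + B). split; [exact Ht|]. apply nrm_minus; assumption.
Qed.

Lemma geo_scal c a : geo a -> geo (fun k => c * a k)%C.
Proof.
  intros (t & A & Ht & H). exists t, (Cmod c * A). split; [exact Ht|]. apply nrm_scal, H.
Qed.

Lemma geo_dom a b : (forall k, Cmod (a k) <= Cmod (b k)) -> geo b -> geo a.
Proof. intros H (t & A & Ht & Hb). exists t, A. split; [exact Ht|]. eapply nrm_dom; eassumption. Qed.

Lemma geo_ext a b : (forall k, a k = b k) -> geo a -> geo b.
Proof. intros H. apply geo_dom. intros k. rewrite H. lra. Qed.

Lemma geo_fin a N : fin a N -> geo a.
Proof.
  intros H. exists 1. eexists. split; [lra|]. eapply nrm_fin; [lra|exact H|apply Rle_refl].
Qed.

Lemma geo_conv a b : geo a -> geo b -> geo (conv a b).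
Proof.
  intros Ha Hb. destruct (geo_common a b Ha Hb) as (t & A & B & Ht & H1 & H2).
  exists t, (A * B). split; [exact Ht|]. apply conv_nrm; [lra|assumption|assumption].
Qed.

(** Half of the rate pays for the factor: [x <= 2 / t * exp (t / 2 * x)]. *)
Lemma geo_mul_k a : geo a -> geo (fun k => RtoC (IZR k) * a k)%C.
Proof.
  intros (t & A & Ht & H). exists (t / 2), (2 / t * A). split; [lra|]. intros n.
  eapply Rle_trans; [|apply Rmult_le_compat_l; [|apply (H n)]].
  2:{ apply Rlt_le, Rdiv_lt_0_compat; lra. }
  rewrite <- zs_scal. apply zs_le. intros k _. rewrite Cmod_mult, Cmod_R, <- abs_IZR.
  unfold wt. set (x := IZR (Z.abs k)).
  replace (t * x) with (t / 2 * x + t / 2 * x) by field. rewrite exp_plus.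
  assert (Hx : 0 <= x) by (apply IZR_le; lia).
  assert (Hb : x <= 2 / t * exp (t / 2 * x)).
  { apply Rmult_le_reg_l with (t / 2); [lra|].
    replace (t / 2 * (2 / t * exp (t / 2 * x))) with (exp (t / 2 * x)) by (field; lra).
    generalize (exp_ineq1_le (t / 2 * x)). lra. }
  apply Rle_trans with (exp (t / 2 * x) * ((2 / t * exp (t / 2 * x)) * Cmod (a k))).
  - apply Rmult_le_compat_l; [apply Rlt_le, exp_pos|].
    apply Rmult_le_compat_r; [apply Cmod_ge_0|exact Hb].
  - apply Req_le. ring.
Qed.

Definition dk (a : Z -> C) (k : Z) : C := (Ci * (RtoC (IZR k) * a k))%C.

Lemma geo_dk a : geo a -> geo (dk a).
Proof. intros H. apply geo_scal, geo_mul_k, H. Qed.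

Lemma sin_abs_le x : Rabs (sin x) <= Rabs x.
Proof.
  assert (H : forall x, 0 <= x -> Rabs (sin x) <= x).
  { clear. intros x [Hx| <-]; [|rewrite sin_0, Rabs_R0; lra].
    apply Rabs_le. split; [|left; apply sin_lt_x, Hx].
    destruct (Rle_lt_dec x PI) as [Hp|Hp].
    - generalize (sin_ge_0 x (Rlt_le _ _ Hx) Hp). lra.
    - generalize (SIN_bound x) PI_4 PI2_3_2. unfold PI2. lra. }
  destruct (Rle_lt_dec 0 x) as [Hx|Hx].
  - rewrite (Rabs_pos_eq x) by exact Hx. apply H, Hx.
  - rewrite <- (Rabs_Ropp (sin x)), <- sin_neg, (Rabs_left x) by exact Hx. apply H. lra.
Qed.

Lemma one_minus_cos x : 0 <= 1 - cos x <= Rabs x.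
Proof.
  replace x with (2 * (x / 2)) at 1 2 by field. rewrite cos_2a_sin.
  generalize (sin_abs_le (x / 2)) (SIN_bound (x / 2)). intros H1 H2.
  set (s := sin (x / 2)) in *. split; [nra|].
  assert (Rabs s <= 1) by (apply Rabs_le; lra).
  assert (Rabs (x / 2) = Rabs x / 2).
  { unfold Rdiv. rewrite Rabs_mult. f_equal. apply Rabs_pos_eq; lra. }
  assert (s * s = Rabs s * Rabs s) by (rewrite <- Rabs_mult; symmetry; apply Rabs_pos_eq; nra).
  generalize (Rabs_pos s). nra.
Qed.

Lemma expi_remainder t : Cmod (expi t - RtoC 1 - Ci * RtoC t)%C <= 2 * (t * t).
Proof.
  eapply Rle_trans; [apply Cmod_le_abs|].
  assert (Ht : t * t = Rabs t * Rabs t) by (rewrite <- Rabs_mult; symmetry; apply Rabs_pos_eq; nra).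
  assert (H1 : Rabs (cos t - 1) <= t * t).
  { replace t with (2 * (t / 2)) at 1 by field. rewrite cos_2a_sin.
    generalize (sin_abs_le (t / 2)). set (s := sin (t / 2)). intros Hs.
    assert (Rabs (t / 2) = Rabs t / 2).
    { unfold Rdiv. rewrite Rabs_mult. f_equal. apply Rabs_pos_eq; lra. }
    assert (s * s = Rabs s * Rabs s) by (rewrite <- Rabs_mult; symmetry; apply Rabs_pos_eq; nra).
    rewrite Rabs_left1 by nra. generalize (Rabs_pos s) (Rabs_pos t). nra. }
  assert (H2 : Rabs (sin t - t) <= t * t).
  { destruct (MVT_gen (fun x => sin x - x) 0 t (fun x => cos x - 1)) as (x & Hx & He).
    - intros x _. auto_derive; [exact I|ring].
    - intros x _. apply continuity_pt_filterlim.
      apply (ex_derive_continuous (fun x => sin x - x)). auto_derive. exact I.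
    - cbn beta in He. rewrite sin_0 in He.
      replace (sin t - t) with ((cos x - 1) * t) by lra.
      rewrite Rabs_mult, Ht. apply Rmult_le_compat_r; [apply Rabs_pos|].
      rewrite Rabs_minus_sym, Rabs_pos_eq; [|apply (one_minus_cos x)].
      eapply Rle_trans; [apply (one_minus_cos x)|].
      unfold Rmin, Rmax in Hx. destruct (Rle_dec 0 t);
        unfold Rabs; repeat destruct Rcase_abs; lra. }
  replace (Re (expi t - 1 - Ci * t)%C) with (cos t - 1) by (simpl; ring).
  replace (Im (expi t - 1 - Ci * t)%C) with (sin t - t) by (simpl; ring).
  lra.
Qed.

Lemma is_derive_quadratic (g : R -> R) x l M :
  (forall h, Rabs (g (x + h) - g x - h * l) <= M * (h * h)) -> is_derive g x l.
Proof.
  intros H. apply is_derive_Reals. intros eps He.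
  assert (HM : 0 <= M).
  { specialize (H 1). generalize (Rabs_pos (g (x + 1) - g x - 1 * l)). lra. }
  assert (Hd : 0 < eps / (M + 1)) by (apply Rdiv_lt_0_compat; lra).
  exists (mkposreal _ Hd). intros h Hh Hlt. simpl in Hlt.
  replace ((g (x + h) - g x) / h - l) with ((g (x + h) - g x - h * l) / h) by (field; exact Hh).
  unfold Rdiv. rewrite Rabs_mult, Rabs_inv.
  assert (Hp : 0 < Rabs h) by (apply Rabs_pos_lt, Hh).
  apply Rle_lt_trans with ((M * (h * h)) * / Rabs h).
  - apply Rmult_le_compat_r; [apply Rlt_le, Rinv_0_lt_compat, Hp|apply H].
  - replace (h * h) with (Rabs h * Rabs h) by (rewrite <- Rabs_mult; apply Rabs_pos_eq; nra).
    replace (M * (Rabs h * Rabs h) * / Rabs h) with (M * Rabs h) by (field; lra).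
    apply Rle_lt_trans with (M * (eps / (M + 1))); [apply Rmult_le_compat_l; lra|].
    apply Rlt_le_trans with ((M + 1) * (eps / (M + 1))).
    + apply Rmult_lt_compat_r; lra.
    + apply Req_le. field. lra.
Qed.

(** A quadratic remainder, uniform in [y], gives termwise differentiation directly. Its constant is
    twice a bound on the sum of [k^2 |a_k|], from [|e^{it} - 1 - it| <= 2 t^2]. *)
Lemma ser_remainder a : geo a -> exists M, forall y h,
  Cmod (ser a (y + h) - ser a y - RtoC h * ser (dk a) y)%C <= M * (h * h).
Proof.
  intros Ha. destruct (geo_asum _ Ha) as [A HA].
  destruct (geo_asum _ (geo_dk _ Ha)) as [A1 HA1].
  destruct (geo_asum _ (geo_mul_k _ (geo_mul_k _ Ha))) as [A2 HA2].
  exists (2 * A2). intros y h.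
  assert (H : is_tsum (fun k => a k * expi (IZR k * y) *
       (expi (IZR k * h) - RtoC 1 - Ci * RtoC (IZR k * h)))%C
     (ser a (y + h) - ser a y - RtoC h * ser (dk a) y)%C).
  { eapply is_tsum_ext; [|apply is_tsum_minus;
      [apply is_tsum_minus; eapply is_ser, HA | apply is_tsum_scal; eapply is_ser, HA1]].
    intros k. cbn beta. rewrite Rmult_plus_distr_l, expi_plus, RtoC_mult. unfold dk. ring. }
  apply (is_tsum_bound _ _ _ H). intros n.
  eapply Rle_trans; [|apply Rmult_le_compat_r; [nra|apply Rmult_le_compat_l; [lra|apply (HA2 n)]]].
  rewrite Rmult_comm, <- zs_scal, <- zs_scal. apply zs_le. intros k _.
  rewrite !Cmod_mult, Cmod_expi, Rmult_1_r, !Cmod_R.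
  eapply Rle_trans; [apply Rmult_le_compat_l; [apply Cmod_ge_0|apply expi_remainder]|].
  assert (E : Rabs (IZR k) * (Rabs (IZR k) * Cmod (a k)) = IZR k * IZR k * Cmod (a k)).
  { rewrite <- Rmult_assoc, <- Rabs_mult. f_equal. apply Rabs_pos_eq. nra. }
  rewrite E. apply Req_le. ring.
Qed.

Lemma is_derive_ser_Re a y : geo a -> is_derive (fun t => Re (ser a t)) y (Re (ser (dk a) y)).
Proof.
  intros Ha. destruct (ser_remainder a Ha) as [M HM].
  apply is_derive_quadratic with M. intros h. eapply Rle_trans; [|apply (HM y h)].
  eapply Rle_trans; [|apply re_le_Cmod]. apply Req_le. f_equal. simpl. unfold Re. ring.
Qed.

Lemma is_derive_ser_Im a y : geo a -> is_derive (fun t => Im (ser a t)) y (Im (ser (dk a) y)).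
Proof.
  intros Ha. destruct (ser_remainder a Ha) as [M HM].
  apply is_derive_quadratic with M. intros h. eapply Rle_trans; [|apply (HM y h)].
  eapply Rle_trans; [|apply im_le_Cmod]. apply Req_le. f_equal. simpl. unfold Im. ring.
Qed.

(** * The Moebius change of variable *)

(** [psi] lifts the circle map [z |-> (3 z - 2) / (3 - 2 z)]. *)
Definition psi (x : R) : R := x + 2 * atan (2 * sin x / (3 - 2 * cos x)).

Lemma den_pos x : 0 < 13 - 12 * cos x.
Proof. generalize (COS_bound x). lra. Qed.

Lemma sin_sqr x : sin x * sin x = 1 - cos x * cos x.
Proof. generalize (sin2_cos2 x). unfold Rsqr. lra. Qed.

Lemma tan_half_sqr x :
  1 + (2 * sin x / (3 - 2 * cos x)) ^ 2 =
  (13 - 12 * cos x) / ((3 - 2 * cos x) * (3 - 2 * cos x)).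
Proof.
  assert (Hc := COS_bound x).
  replace (13 - 12 * cos x) with
    ((3 - 2 * cos x) * (3 - 2 * cos x) + 4 * (sin x * sin x)) by (rewrite sin_sqr; ring).
  field. lra.
Qed.

(** The circle map is [e^{ix} (3 - 2 e^{-ix}) / (3 - 2 e^{ix})], so [psi x - x] is twice the
    argument of [3 - 2 e^{-ix}]. That number has positive real part, hence [atan] gives its
    argument, and double angle formulas make everything rational. *)
Lemma psi_cos_sin x :
  cos (psi x) = (13 * cos x - 12) / (13 - 12 * cos x) /\
  sin (psi x) = 5 * sin x / (13 - 12 * cos x).
Proof.
  unfold psi. assert (Ht := tan_half_sqr x).
  set (t := 2 * sin x / (3 - 2 * cos x)) in *.
  assert (Hc := COS_bound x). assert (Hd := den_pos x). assert (Hs := sin_sqr x).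
  assert (Hp : 0 < 1 + t ^ 2) by nra.
  assert (Hsq : sqrt (1 + t ^ 2) * sqrt (1 + t ^ 2) = 1 + t ^ 2) by (apply sqrt_sqrt; lra).
  assert (Hsp : 0 < sqrt (1 + t ^ 2)) by (apply sqrt_lt_R0, Hp).
  assert (C2 : cos (2 * atan t) = 2 / (1 + t ^ 2) - 1).
  { rewrite cos_2a_cos, cos_atan. replace (t²) with (t ^ 2) by (unfold Rsqr; ring).
    rewrite <- Hsq at 3. field. lra. }
  assert (S2 : sin (2 * atan t) = 2 * t / (1 + t ^ 2)).
  { rewrite sin_2a, cos_atan, sin_atan. replace (t²) with (t ^ 2) by (unfold Rsqr; ring).
    rewrite <- Hsq at 3. field. lra. }
  rewrite cos_plus, sin_plus, C2, S2, Ht. unfold t.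
  split.
  - replace (13 * cos x - 12) with
      (cos x * (2 * ((3 - 2 * cos x) * (3 - 2 * cos x)) - (13 - 12 * cos x))
       - 4 * (3 - 2 * cos x) * (sin x * sin x)) by (rewrite Hs; ring).
    field. lra.
  - field. lra.
Qed.

Lemma expi_psi x : (expi (psi x) * (3 - 2 * expi x) = 3 * expi x - 2)%C.
Proof.
  destruct (psi_cos_sin x) as [H1 H2]. assert (Hd := den_pos x). assert (Hs := sin_sqr x).
  unfold expi. rewrite H1, H2. apply C_eq; simpl.
  - replace (3 * cos x - 0 * sin x + - (2)) with
      (((13 * cos x - 12) * (3 - 2 * cos x) + 10 * (sin x * sin x)) / (13 - 12 * cos x))
      by (rewrite Hs; field; lra).
    field. lra.
  - field. lra.
Qed.

Lemma psi_opp x : psi (- x) = - psi x.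
Proof.
  unfold psi. rewrite sin_neg, cos_neg.
  replace (2 * - sin x / (3 - 2 * cos x)) with (- (2 * sin x / (3 - 2 * cos x)))
    by (unfold Rdiv; ring).
  rewrite atan_opp. ring.
Qed.

Lemma psi_2PI x (k : nat) : psi (x + 2 * INR k * PI) = psi x + 2 * PI * IZR (Z.of_nat k).
Proof.
  unfold psi. rewrite sin_period, cos_period, <- INR_IZR_INZ. ring.
Qed.

(** The derivative [5 / (13 - 12 cos x)] of [psi], rewritten in the image variable. There it is a
    trigonometric polynomial of degree one, and differentiation in [x] becomes a three-term
    convolution. *)
Definition Dsym (y : R) : R := (13 + 12 * cos y) / 5.

Lemma is_derive_psi x : is_derive psi x (Dsym (psi x)).
Proof.
  destruct (psi_cos_sin x) as [H1 _]. assert (Hd := den_pos x). assert (Hc := COS_bound x).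
  unfold Dsym. rewrite H1. assert (Hs := sin_sqr x). assert (Ht := tan_half_sqr x).
  assert (Hd1 : is_derive (fun t => 2 * sin t / (3 - 2 * cos t)) x
     ((6 * cos x - 4) / ((3 - 2 * cos x) * (3 - 2 * cos x)))).
  { auto_derive; [lra|].
    replace (6 * cos x - 4) with (2 * cos x * (3 - 2 * cos x) - 4 * (sin x * sin x))
      by (rewrite Hs; ring).
    field. lra. }
  assert (Hd2 : is_derive (fun t => atan (2 * sin t / (3 - 2 * cos t))) x
     ((6 * cos x - 4) / ((3 - 2 * cos x) * (3 - 2 * cos x)) *
      (/ (1 + (2 * sin x / (3 - 2 * cos x)) ^ 2)))).
  { apply (is_derive_comp atan (fun t => 2 * sin t / (3 - 2 * cos t)) x); [|exact Hd1].
    apply is_derive_Reals.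
    apply derivable_pt_lim_atan. }
  rewrite Ht in Hd2.
  replace ((13 + 12 * ((13 * cos x - 12) / (13 - 12 * cos x))) / 5)
    with (1 + 2 * ((6 * cos x - 4) / ((3 - 2 * cos x) * (3 - 2 * cos x)) *
      / ((13 - 12 * cos x) / ((3 - 2 * cos x) * (3 - 2 * cos x))))) by (field; lra).
  apply (is_derive_plus (K := R_AbsRing) (V := R_NormedModule) (fun t : R => t)
    (fun t => 2 * atan (2 * sin t / (3 - 2 * cos t))) x 1);
    [apply (is_derive_id (K := R_AbsRing))|].
  apply (is_derive_scal (fun t => atan (2 * sin t / (3 - 2 * cos t)))). exact Hd2.
Qed.

(** * Smooth functions on the circle *)

Definition is_derC (f : R -> C) (x : R) (l : C) : Prop :=
  is_derive (fun t => Re (f t)) x (Re l) /\ is_derive (fun t => Im (f t)) x (Im l).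

Lemma is_derC_unique f x l : is_derC f x l -> DeriveC f x = l.
Proof.
  intros [H1 H2]. apply C_eq; apply is_derive_unique; assumption.
Qed.

Lemma is_derC_ext f g x l : (forall t, f t = g t) -> is_derC f x l -> is_derC g x l.
Proof.
  intros H [H1 H2]. split; (eapply is_derive_ext; [|eassumption]);
  intros t; cbn beta; rewrite H; reflexivity.
Qed.

Lemma is_derC_plus f g x l m :
  is_derC f x l -> is_derC g x m -> is_derC (fun t => f t + g t)%C x (l + m)%C.
Proof.
  intros [H1 H2] [H3 H4]. split.
  - apply (is_derive_plus (K := R_AbsRing) (V := R_NormedModule) _ _ _ _ _ H1 H3).
  - apply (is_derive_plus (K := R_AbsRing) (V := R_NormedModule) _ _ _ _ _ H2 H4).
Qed.

Lemma is_derC_mult f g x l m :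
  is_derC f x l -> is_derC g x m ->
  is_derC (fun t => f t * g t)%C x (l * g x + f x * m)%C.
Proof.
  intros [H1 H2] [H3 H4].
  assert (M : forall (a b : R -> R) a' b', is_derive a x a' -> is_derive b x b' ->
             is_derive (fun t => a t * b t) x (a' * b x + a x * b')).
  { intros a b a' b' Ha Hb.
    apply (is_derive_mult (K := R_AbsRing) a b x a' b' Ha Hb). intros; apply Rmult_comm. }
  split.
  - replace (Re (l * g x + f x * m)%C) with
      ((Re l * Re (g x) + Re (f x) * Re m) - (Im l * Im (g x) + Im (f x) * Im m))
      by (simpl; unfold Re, Im; ring).
    apply (is_derive_minus (K := R_AbsRing) (V := R_NormedModule)
      (fun t => Re (f t) * Re (g t)) (fun t => Im (f t) * Im (g t)));
      [apply (M _ _ _ _ H1 H3)|apply (M _ _ _ _ H2 H4)].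
  - replace (Im (l * g x + f x * m)%C) with
      ((Re l * Im (g x) + Re (f x) * Im m) + (Im l * Re (g x) + Im (f x) * Re m))
      by (simpl; unfold Re, Im; ring).
    apply (is_derive_plus (K := R_AbsRing) (V := R_NormedModule)
      (fun t => Re (f t) * Im (g t)) (fun t => Im (f t) * Re (g t)));
      [apply (M _ _ _ _ H1 H4)|apply (M _ _ _ _ H2 H3)].
Qed.

Lemma is_derC_const c x : is_derC (fun _ => c) x (RtoC 0).
Proof. split; apply (is_derive_const (K := R_AbsRing) (V := R_NormedModule)). Qed.

Lemma is_derC_scal c f x l : is_derC f x l -> is_derC (fun t => c * f t)%C x (c * l)%C.
Proof.
  intros H. replace (c * l)%C with (RtoC 0 * f x + c * l)%C by ring.
  apply (is_derC_mult (fun _ => c) f); [apply is_derC_const|exact H].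
Qed.

Lemma is_derC_comp f (g : R -> R) (x : R) l (d : R) :
  is_derive g x d -> is_derC f (g x) l -> is_derC (fun t => f (g t)) x (RtoC d * l)%C.
Proof.
  intros Hg [H1 H2]. split.
  - replace (Re (RtoC d * l)%C) with (scal d (Re l)) by (simpl; unfold scal; simpl; unfold mult, Re; simpl; ring).
    apply (is_derive_comp (fun t => Re (f t)) g x _ _ H1 Hg).
  - replace (Im (RtoC d * l)%C) with (scal d (Im l)) by (simpl; unfold scal; simpl; unfold mult, Im; simpl; ring).
    apply (is_derive_comp (fun t => Im (f t)) g x _ _ H2 Hg).
Qed.

Lemma is_derC_RtoC (g : R -> R) (x d : R) : is_derive g x d -> is_derC (fun t => RtoC (g t)) x (RtoC d).
Proof.
  intros H. split; [exact H|].
  exact (is_derive_const (K := R_AbsRing) (V := R_NormedModule) 0 x).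
Qed.

Lemma is_derC_expi q x : is_derC (fun t => expi (q * t)) x (Ci * RtoC q * expi (q * x))%C.
Proof.
  split; simpl; auto_derive; try exact I; ring.
Qed.

Lemma is_derC_ser a y : geo a -> is_derC (ser a) y (ser (dk a) y).
Proof. intros H. split; [apply is_derive_ser_Re, H|apply is_derive_ser_Im, H]. Qed.

Definition Dseq (k : Z) : C :=
  match k with
  | Z0 => RtoC (13 / 5)
  | Zpos 1 => RtoC (6 / 5)
  | Zneg 1 => RtoC (6 / 5)
  | _ => RtoC 0
  end.

Lemma fin_Dseq : fin Dseq 1.
Proof. intros [|[p|p|]|[p|p|]] H; try reflexivity; simpl in H; lia. Qed.

Lemma ser_Dseq y : ser Dseq y = RtoC (Dsym y).
Proof.
  rewrite (ser_finite _ 1 y fin_Dseq), zsC_S, zsC_0. cbn [Z.of_nat Dseq Pos.of_succ_nat Z.opp].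
  unfold Dsym, expi. rewrite Rmult_0_l, cos_0, sin_0, Rmult_1_l.
  replace (-1 * y) with (- y) by ring. rewrite cos_neg, sin_neg.
  apply C_eq; simpl; field.
Qed.

(** This class is closed under differentiation, through [nxt], so smoothness of all orders follows
    by iteration. The wave has [q = 0], [p = 1]; the eigenfunction has [q = 1], [p = 3]. *)
Definition tw (q p : Z) (H : Z -> C) (x : R) : C :=
  (expi (IZR q * x) * ser H (psi (IZR p * x)))%C.

Definition nxt (q p : Z) (H : Z -> C) (k : Z) : C :=
  (Ci * RtoC (IZR q) * H k + RtoC (IZR p) * conv Dseq (dk H) k)%C.

Lemma geo_Dseq : geo Dseq.
Proof. apply (geo_fin _ 1), fin_Dseq. Qed.

Lemma geo_nxt q p H : geo H -> geo (nxt q p H).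
Proof.
  intros G. apply geo_plus; apply geo_scal; [exact G|].
  apply geo_conv; [apply geo_Dseq|apply geo_dk, G].
Qed.

Lemma is_derC_ser_psi H p x : geo H ->
  is_derC (fun t => ser H (psi (IZR p * t))) x
    (RtoC (IZR p) * ser (conv Dseq (dk H)) (psi (IZR p * x)))%C.
Proof.
  intros G.
  destruct (geo_asum _ (geo_dk _ G)) as [B HB].
  destruct (geo_asum _ geo_Dseq) as [A HA].
  rewrite (ser_conv Dseq (dk H) A B _ HA HB), ser_Dseq, Cmult_assoc, <- RtoC_mult.
  apply (is_derC_comp (ser H) (fun t => psi (IZR p * t))); [|apply is_derC_ser, G].
  apply (is_derive_comp psi (fun t => IZR p * t)); [apply is_derive_psi|].
  auto_derive; [exact I|ring].
Qed.

Lemma is_derC_tw q p H x : geo H -> is_derC (tw q p H) x (tw q p (nxt q p H) x).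
Proof.
  intros G.
  destruct (geo_asum _ G) as [B HB].
  destruct (geo_asum _ (geo_conv _ _ geo_Dseq (geo_dk _ G))) as [A HA].
  replace (tw q p (nxt q p H) x) with
    (Ci * RtoC (IZR q) * expi (IZR q * x) * ser H (psi (IZR p * x)) +
     expi (IZR q * x) * (RtoC (IZR p) * ser (conv Dseq (dk H)) (psi (IZR p * x))))%C.
  - apply (is_derC_mult (fun t => expi (IZR q * t)) (fun t => ser H (psi (IZR p * t))));
      [apply is_derC_expi|apply is_derC_ser_psi, G].
  - unfold tw, nxt.
    erewrite ser_plus; [|eapply nrm_asum with (tau := 0); [lra|apply nrm_scal, asum_nrm, HB]
                       |eapply nrm_asum with (tau := 0); [lra|apply nrm_scal, asum_nrm, HA]].
    rewrite (ser_scal _ H B _ HB), (ser_scal _ _ A _ HA). ring.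
Qed.

Fixpoint iter_nxt (q p : Z) (H : Z -> C) (n : nat) : Z -> C :=
  match n with O => H | S n => nxt q p (iter_nxt q p H n) end.

Lemma geo_iter_nxt q p H n : geo H -> geo (iter_nxt q p H n).
Proof. intros G. induction n as [|n IH]; [exact G|]. apply geo_nxt, IH. Qed.

Lemma Derive_n_tw q p H n x : geo H ->
  Derive_n (fun t => Re (tw q p H t)) n x = Re (tw q p (iter_nxt q p H n) x) /\
  Derive_n (fun t => Im (tw q p H t)) n x = Im (tw q p (iter_nxt q p H n) x).
Proof.
  intros G. revert x. induction n as [|n IH]; intros x; [split; reflexivity|].
  destruct (is_derC_tw q p _ x (geo_iter_nxt q p H n G)) as [H1 H2].
  split; cbn [Derive_n iter_nxt].
  - rewrite (Derive_ext _ (fun t => Re (tw q p (iter_nxt q p H n) t))) by (intros; apply IH).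
    apply is_derive_unique, H1.
  - rewrite (Derive_ext _ (fun t => Im (tw q p (iter_nxt q p H n) t))) by (intros; apply IH).
    apply is_derive_unique, H2.
Qed.

Lemma smoothC_tw q p H : geo H -> smoothC (tw q p H).
Proof.
  intros G. split; intros [|n] x; try exact I; simpl.
  - apply ex_derive_ext with (fun t => Re (tw q p (iter_nxt q p H n) t)).
    + intros t. symmetry. apply Derive_n_tw, G.
    + eexists. apply (is_derC_tw q p _ x (geo_iter_nxt q p H n G)).
  - apply ex_derive_ext with (fun t => Im (tw q p (iter_nxt q p H n) t)).
    + intros t. symmetry. apply Derive_n_tw, G.
    + eexists. apply (is_derC_tw q p _ x (geo_iter_nxt q p H n G)).
Qed.

Lemma tw_periodic q (p : nat) H : periodic (2 * PI) (tw q (Z.of_nat p) H).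
Proof.
  intros x. unfold tw.
  replace (IZR q * (x + 2 * PI)) with (IZR q * x + 2 * PI * IZR q) by ring.
  rewrite expi_2PI_Z, <- !INR_IZR_INZ.
  replace (INR p * (x + 2 * PI)) with (INR p * x + 2 * INR p * PI) by ring.
  rewrite psi_2PI. f_equal.
  apply tsum_ext. intros k. f_equal.
  replace (IZR k * (psi (INR p * x) + 2 * PI * IZR (Z.of_nat p)))
    with (IZR k * psi (INR p * x) + 2 * PI * IZR (k * Z.of_nat p)) by (rewrite mult_IZR; ring).
  apply expi_2PI_Z.
Qed.

(** * Fourier coefficients *)

Definition contC (f : R -> C) : Prop :=
  (forall x, continuous (fun t => Re (f t)) x) /\ (forall x, continuous (fun t => Im (f t)) x).

Lemma is_derC_contC f f' : (forall x, is_derC f x (f' x)) -> contC f.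
Proof.
  intros H. split; intros x; apply (ex_derive_continuous (K := R_AbsRing) (V := R_NormedModule));
  eexists; apply (H x).
Qed.

Lemma contC_tw q p H : geo H -> contC (tw q p H).
Proof. intros G. eapply is_derC_contC. intros x. apply is_derC_tw, G. Qed.

Lemma contC_continuous f : contC f -> forall x : R, continuous f x.
Proof.
  intros [H1 H2] x.
  apply (continuous_ext (fun t => (Re (f t), Im (f t)))).
  { intros t. symmetry. apply surjective_pairing. }
  apply (continuous_comp_2 (fun t => Re (f t)) (fun t => Im (f t))
    (fun a b => (a, b) : prod_UniformSpace R_UniformSpace R_UniformSpace)); [apply H1|apply H2|].
  apply (continuous_ext (fun z => z)); [intros [a b]; reflexivity|apply continuous_id].
Qed.

Lemma contC_mult f g : contC f -> contC g -> contC (fun x => f x * g x)%C.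
Proof.
  intros [F1 F2] [G1 G2]. split; intros x; simpl.
  - apply (continuous_minus (K := R_AbsRing) (V := R_NormedModule));
      apply (continuous_mult (K := R_AbsRing)); auto.
  - apply (continuous_plus (K := R_AbsRing) (V := R_NormedModule));
      apply (continuous_mult (K := R_AbsRing)); auto.
Qed.

Lemma contC_plus f g : contC f -> contC g -> contC (fun x => f x + g x)%C.
Proof.
  intros [F1 F2] [G1 G2]. split; intros x; simpl;
  apply (continuous_plus (K := R_AbsRing) (V := R_NormedModule)); auto.
Qed.

Lemma contC_const c : contC (fun _ => c).
Proof. split; intros x; apply continuous_const. Qed.

Lemma contC_expi q : contC (fun x => expi (q * x)).
Proof. eapply is_derC_contC. intros x. apply is_derC_expi. Qed.

Lemma contC_ext f g : (forall x, f x = g x) -> contC f -> contC g.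
Proof.
  intros H [H1 H2]. split; intros x.
  - apply (continuous_ext (fun t => Re (f t))); [intros t; rewrite H; reflexivity|apply H1].
  - apply (continuous_ext (fun t => Im (f t))); [intros t; rewrite H; reflexivity|apply H2].
Qed.

Definition is_cint (f : R -> C) (l : C) : Prop :=
  is_RInt (fun t => Re (f t)) (- PI) PI (Re l) /\ is_RInt (fun t => Im (f t)) (- PI) PI (Im l).

Lemma is_cint_unique f l : is_cint f l -> RIntC f (- PI) PI = l.
Proof.
  intros [H1 H2]. apply (is_RInt_unique (V := C_R_CompleteNormedModule)).
  destruct l as [l1 l2].
  exact (is_RInt_fct_extend_pair (U := R_NormedModule) (V := R_NormedModule) f _ _ _ _ H1 H2).
Qed.

Lemma contC_is_cint f : contC f -> is_cint f (RIntC f (- PI) PI).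
Proof.
  intros [H1 H2].
  assert (E : is_cint f (RInt (fun t => Re (f t)) (- PI) PI, RInt (fun t => Im (f t)) (- PI) PI)).
  { split; apply (RInt_correct (V := R_CompleteNormedModule));
    apply (ex_RInt_continuous (V := R_CompleteNormedModule)); intros; [apply H1|apply H2]. }
  rewrite (is_cint_unique _ _ E). exact E.
Qed.

Lemma is_cint_plus f g l m : is_cint f l -> is_cint g m -> is_cint (fun x => f x + g x)%C (l + m)%C.
Proof.
  intros [H1 H2] [H3 H4]. split.
  - apply (is_RInt_plus (V := R_NormedModule) _ _ _ _ _ _ H1 H3).
  - apply (is_RInt_plus (V := R_NormedModule) _ _ _ _ _ _ H2 H4).
Qed.

Lemma is_cint_scal c f l : is_cint f l -> is_cint (fun x => c * f x)%C (c * l)%C.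
Proof.
  intros [H1 H2]. split.
  - apply (is_RInt_minus (V := R_NormedModule) (fun t => Re c * Re (f t)) (fun t => Im c * Im (f t))).
    + apply (is_RInt_scal (V := R_NormedModule) _ _ _ (Re c) _ H1).
    + apply (is_RInt_scal (V := R_NormedModule) _ _ _ (Im c) _ H2).
  - apply (is_RInt_plus (V := R_NormedModule) (fun t => Re c * Im (f t)) (fun t => Im c * Re (f t))).
    + apply (is_RInt_scal (V := R_NormedModule) _ _ _ (Re c) _ H2).
    + apply (is_RInt_scal (V := R_NormedModule) _ _ _ (Im c) _ H1).
Qed.

Lemma is_cint_ext f g l : (forall x, f x = g x) -> is_cint f l -> is_cint g l.
Proof.
  intros H [H1 H2]. split; (eapply is_RInt_ext; [|eassumption]); intros; cbn beta; rewrite H; reflexivity.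
Qed.

Lemma is_cint_derC f f' : (forall x, is_derC f x (f' x)) -> contC f' ->
  is_cint f' (f PI - f (- PI)%R)%C.
Proof.
  intros H [H1 H2]. split.
  - apply (is_RInt_derive (V := R_CompleteNormedModule) (fun t => Re (f t)) (fun t => Re (f' t)));
      intros x _; [apply H|apply H1].
  - apply (is_RInt_derive (V := R_CompleteNormedModule) (fun t => Im (f t)) (fun t => Im (f' t)));
      intros x _; [apply H|apply H2].
Qed.

Definition is_fc (f : R -> C) (n : Z) (l : C) : Prop :=
  is_cint (fun x => f x * expi (- (IZR n * x)))%C (RtoC (2 * PI) * l)%C.

Lemma two_PI_neq : RtoC (2 * PI) <> RtoC 0.
Proof. intros H. apply RtoC_inj in H. generalize PI_RGT_0. lra. Qed.

Lemma RtoC_inv_2PI : RtoC (/ (2 * PI)) = (/ RtoC (2 * PI))%C.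
Proof. apply RtoC_inv. generalize PI_RGT_0. lra. Qed.

Lemma is_fc_fourier f n l : is_fc f n l -> fourier f n = l.
Proof.
  intros H. unfold fourier. rewrite (is_cint_unique _ _ H), RtoC_inv_2PI.
  rewrite Cmult_assoc, Cinv_l by apply two_PI_neq. ring.
Qed.

Lemma contC_fc_fun f n : contC f -> contC (fun x => f x * expi (- (IZR n * x)))%C.
Proof.
  intros H. apply contC_mult; [exact H|].
  apply (contC_ext (fun x => expi (- IZR n * x))); [|apply contC_expi].
  intros x. f_equal. ring.
Qed.

Lemma contC_is_fc f n : contC f -> is_fc f n (fourier f n).
Proof.
  intros H. unfold is_fc, fourier. rewrite RtoC_inv_2PI.
  replace (RtoC (2 * PI) * _)%C with (RIntC (fun x => f x * expi (- (IZR n * x)))%C (- PI) PI)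
    by (rewrite Cmult_assoc, Cinv_r by apply two_PI_neq; ring).
  apply contC_is_cint, contC_fc_fun, H.
Qed.

Lemma is_fc_plus f g n l m : is_fc f n l -> is_fc g n m -> is_fc (fun x => f x + g x)%C n (l + m)%C.
Proof.
  intros H1 H2. unfold is_fc. rewrite Cmult_plus_distr_l.
  eapply is_cint_ext; [|apply (is_cint_plus _ _ _ _ H1 H2)]. intros x. cbn beta. ring.
Qed.

Lemma is_fc_scal c f n l : is_fc f n l -> is_fc (fun x => c * f x)%C n (c * l)%C.
Proof.
  intros H. unfold is_fc.
  replace (RtoC (2 * PI) * (c * l))%C with (c * (RtoC (2 * PI) * l))%C by ring.
  eapply is_cint_ext; [|apply (is_cint_scal c _ _ H)]. intros x. cbn beta. ring.
Qed.

Lemma is_fc_ext f g n l : (forall x, f x = g x) -> is_fc f n l -> is_fc g n l.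
Proof. intros H. apply is_cint_ext. intros x. rewrite H. reflexivity. Qed.

Lemma is_fc_unique f n l m : is_fc f n l -> is_fc f n m -> l = m.
Proof. intros H1 H2. rewrite <- (is_fc_fourier _ _ _ H1). apply is_fc_fourier, H2. Qed.

Lemma is_fc_shift m f n l : is_fc f n l -> is_fc (fun x => expi (IZR m * x) * f x)%C (n + m) l.
Proof.
  apply is_cint_ext. intros x.
  replace (- (IZR (n + m) * x)) with (- (IZR n * x) + - (IZR m * x)) by (rewrite plus_IZR; ring).
  rewrite expi_plus.
  transitivity (f x * expi (- (IZR n * x)) * (expi (- (IZR m * x)) * expi (IZR m * x)))%C;
    [rewrite expi_opp_l; ring|ring].
Qed.

Lemma is_fc_one n : is_fc (fun _ => RtoC 1) n (if (n =? 0)%Z then RtoC 1 else RtoC 0).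
Proof.
  destruct (Z.eqb_spec n 0) as [->|Hn]; unfold is_fc.
  - apply (is_cint_ext (fun _ => RtoC 1)).
    + intros x. rewrite Rmult_0_l, Ropp_0, expi_0. ring.
    + split; simpl.
      * replace (2 * PI * 1 - 0 * 0) with (scal (PI - - PI) 1) by (unfold scal; simpl; unfold mult; simpl; ring).
        apply (is_RInt_const (V := R_NormedModule)).
      * replace (2 * PI * 0 + 0 * 1) with (scal (PI - - PI) 0) by (unfold scal; simpl; unfold mult; simpl; ring).
        apply (is_RInt_const (V := R_NormedModule)).
  - assert (Hz : (Ci * RtoC (- IZR n))%C <> RtoC 0).
    { intros H. apply (f_equal Im) in H. simpl in H.
      assert (IZR n = 0) by lra. apply eq_IZR_R0 in H0. contradiction. }
    (* For nonzero [n] the exponential has a primitive that is again periodic, so its values at [PI]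
       and [- PI] cancel. *)
    assert (E : (RtoC (2 * PI) * RtoC 0 = / (Ci * RtoC (- IZR n)) * expi (- IZR n * PI) -
                 / (Ci * RtoC (- IZR n)) * expi (- IZR n * - PI))%C).
    { replace (- IZR n * - PI) with (- IZR n * PI + 2 * PI * IZR n) by ring.
      rewrite expi_2PI_Z. ring. }
    rewrite E. apply (is_cint_ext (fun x => expi (- IZR n * x))).
    { intros x. replace (- IZR n * x) with (- (IZR n * x)) by ring. ring. }
    apply (is_cint_derC (fun x => / (Ci * RtoC (- IZR n)) * expi (- IZR n * x))%C);
      [|apply contC_expi].
    intros x. replace (expi (- IZR n * x)) with
      (/ (Ci * RtoC (- IZR n)) * (Ci * RtoC (- IZR n) * expi (- IZR n * x)))%C
      by (field; split; [|intros H; rewrite H in Hz; apply Hz; ring]; intros H; rewrite H in Hz; apply Hz; ring).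
    apply is_derC_scal, is_derC_expi.
Qed.

(** The factor 2 comes from bounding real and imaginary parts separately. The estimate serves only
    to force coefficients to vanish, so a sharp constant would bring nothing. *)
Lemma is_fc_bound f n l M : contC f -> (forall x, Cmod (f x) <= M) -> is_fc f n l ->
  Cmod l <= 2 * M.
Proof.
  intros Hc HM H.
  assert (Hb : forall g L, (forall x, continuous g x) -> (forall x, Rabs (g x) <= M) ->
             is_RInt g (- PI) PI L -> Rabs L <= 2 * PI * M).
  { intros g L Hg Hgm HL. generalize PI_RGT_0. intros Hp.
    rewrite <- (is_RInt_unique (V := R_CompleteNormedModule) _ _ _ _ HL).
    eapply Rle_trans; [apply (abs_RInt_le_const g (- PI) PI M)|].
    - lra.
    - exists L; exact HL.
    - intros t _. apply Hgm.
    - apply Req_le. ring. }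
  destruct (contC_fc_fun f n Hc) as [C1 C2]. destruct H as [H1 H2].
  assert (Hg : forall x, Cmod (f x * expi (- (IZR n * x)))%C <= M).
  { intros x. rewrite Cmod_mult, Cmod_expi, Rmult_1_r. apply HM. }
  assert (P := PI_RGT_0).
  pose proof (Hb _ _ C1 (fun x => Rle_trans _ _ _ (re_le_Cmod _) (Hg x)) H1) as B1.
  pose proof (Hb _ _ C2 (fun x => Rle_trans _ _ _ (im_le_Cmod _) (Hg x)) H2) as B2.
  replace (Re (RtoC (2 * PI) * l)%C) with (2 * PI * Re l) in B1 by (simpl; unfold Re; ring).
  replace (Im (RtoC (2 * PI) * l)%C) with (2 * PI * Im l) in B2 by (simpl; unfold Im; ring).
  rewrite Rabs_mult, (Rabs_pos_eq (2 * PI)) in B1, B2 by lra.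
  apply Rmult_le_reg_l in B1, B2; try lra.
  eapply Rle_trans; [apply Cmod_le_abs|]. lra.
Qed.

Lemma is_fc_conj f n l : is_fc f n l -> is_fc (fun x => Cconj (f x)) (- n) (Cconj l).
Proof.
  intros [H1 H2]. unfold is_fc.
  replace (RtoC (2 * PI) * Cconj l)%C with (Cconj (RtoC (2 * PI) * l))
    by (apply C_eq; simpl; ring).
  split.
  - eapply is_RInt_ext; [|exact H1]. intros x _. rewrite opp_IZR. unfold expi. simpl.
    replace (- (- IZR n * x)) with (- - (IZR n * x)) by ring.
    rewrite !cos_neg, !sin_neg. ring.
  - change (Im (Cconj (RtoC (2 * PI) * l))) with (opp (Im (RtoC (2 * PI) * l)%C)).
    eapply is_RInt_ext; [|apply (is_RInt_opp (V := R_NormedModule) _ _ _ _ H2)].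
    intros x _. rewrite opp_IZR. unfold expi. simpl. unfold opp; simpl.
    replace (- (- IZR n * x)) with (- - (IZR n * x)) by ring.
    rewrite !cos_neg, !sin_neg. ring.
Qed.

(** * Hardy spaces *)

(** Hardy spaces enter only through their missing Fourier modes, one mode at a time. *)
Definition FZ (n : Z) (f : R -> C) : Prop := is_fc f n (RtoC 0).

Lemma FZ_ext n f g : (forall x, f x = g x) -> FZ n f -> FZ n g.
Proof. apply is_fc_ext. Qed.

Lemma FZ_plus n f g : FZ n f -> FZ n g -> FZ n (fun x => f x + g x)%C.
Proof.
  intros H1 H2. unfold FZ. replace (RtoC 0) with (RtoC 0 + RtoC 0)%C by ring.
  apply is_fc_plus; assumption.
Qed.

Lemma FZ_scal n c f : FZ n f -> FZ n (fun x => c * f x)%C.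
Proof.
  intros H. unfold FZ. replace (RtoC 0) with (c * RtoC 0)%C by ring. apply is_fc_scal, H.
Qed.

Lemma FZ_zero n : FZ n (fun _ => RtoC 0).
Proof.
  apply (FZ_ext n (fun _ => RtoC 0 * RtoC 1)%C); [intros; ring|].
  pose proof (is_fc_scal (RtoC 0) _ n _ (is_fc_one n)) as H.
  rewrite Cmult_0_l in H. exact H.
Qed.

Lemma FZ_zsC n (F : Z -> R -> C) N : (forall k, FZ n (F k)) -> FZ n (fun x => zsC (fun k => F k x) N).
Proof.
  intros H. induction N as [|N IH].
  - apply (FZ_ext n (F 0%Z)); [intros; rewrite zsC_0; reflexivity|apply H].
  - apply (FZ_ext n (fun x => zsC (fun k => F k x) N +
      (F (Z.of_nat (S N)) x + F (- Z.of_nat (S N))%Z x))%C); [intros; rewrite zsC_S; reflexivity|].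
    apply FZ_plus; [exact IH|]. apply FZ_plus; apply H.
Qed.

Lemma FZ_expi q n : n <> q -> FZ n (fun x => expi (IZR q * x)).
Proof.
  intros H. apply (FZ_ext n (fun x => expi (IZR q * x) * RtoC 1)%C); [intros; ring|].
  replace n with (n - q + q)%Z by lia. apply is_fc_shift.
  generalize (is_fc_one (n - q)). destruct (Z.eqb_spec (n - q) 0); [lia|]. auto.
Qed.

(** A Fourier coefficient is continuous for uniform convergence, so the absence of a mode survives
    uniform approximation. *)
Lemma FZ_of_small f n : contC f -> (exists M, forall eps, 0 < eps -> exists g,
    contC g /\ FZ n (fun x => f x - g x)%C /\ forall x, Cmod (g x) <= M * eps) -> FZ n f.
Proof.
  intros Hf [M HM]. pose proof (contC_is_fc f n Hf) as H.
  assert (Hz : Cmod (fourier f n) <= 0).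
  { apply Rnot_lt_le. intros Hp.
    assert (HMp : 0 <= M).
    { destruct (HM 1) as (g & _ & _ & Hg); [lra|]. generalize (Cmod_ge_0 (g 0)) (Hg 0). lra. }
    assert (He : 0 < Cmod (fourier f n) / (4 * (M + 1))) by (apply Rdiv_lt_0_compat; lra).
    destruct (HM _ He) as (g & Hc & Hz & Hg).
    assert (Hfg : is_fc g n (fourier f n)).
    { apply (is_fc_ext (fun x => f x + (- (1)) * (f x - g x))%C); [intros; ring|].
      replace (fourier f n) with (fourier f n + (- (1)) * RtoC 0)%C at 1 by ring.
      apply is_fc_plus; [exact H|]. apply is_fc_scal, Hz. }
    generalize (is_fc_bound g n _ _ Hc Hg Hfg). intros Hb.
    assert (M * (Cmod (fourier f n) / (4 * (M + 1))) <= Cmod (fourier f n) / 4).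
    { apply Rle_trans with ((M + 1) * (Cmod (fourier f n) / (4 * (M + 1)))).
      - apply Rmult_le_compat_r; lra.
      - apply Req_le. field. lra. }
    lra. }
  unfold FZ. replace (RtoC 0) with (fourier f n); [exact H|].
  apply Cmod_eq_0. generalize (Cmod_ge_0 (fourier f n)). lra.
Qed.

Lemma contC_expi_psi q p : contC (fun x => expi (q * psi (IZR p * x))).
Proof.
  eapply is_derC_contC. intros x.
  apply (is_derC_comp (fun y => expi (q * y)) (fun t => psi (IZR p * t)));
    [|apply is_derC_expi].
  apply (is_derive_comp psi (fun t => IZR p * t)); [apply is_derive_psi|].
  auto_derive; [exact I|reflexivity].
Qed.

Lemma contC_minus f g : contC f -> contC g -> contC (fun x => f x - g x)%C.
Proof.
  intros Hf Hg. apply (contC_ext (fun x => f x + (- (1)) * g x)%C); [intros; ring|].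
  apply contC_plus; [exact Hf|]. apply contC_mult; [apply contC_const|exact Hg].
Qed.

Lemma contC_zsC (F : Z -> R -> C) N :
  (forall k, contC (F k)) -> contC (fun x => zsC (fun k => F k x) N).
Proof.
  intros H. induction N as [|N IH].
  - apply (contC_ext (F 0%Z)); [intros; rewrite zsC_0; reflexivity|apply H].
  - apply (contC_ext (fun x => zsC (fun k => F k x) N +
      (F (Z.of_nat (S N)) x + F (- Z.of_nat (S N))%Z x))%C); [intros; rewrite zsC_S; reflexivity|].
    apply contC_plus; [exact IH|]. apply contC_plus; apply H.
Qed.

(** The partial sums lack mode [n] by linearity, and the remaining tail is uniformly small. The
    alternative [G k = 0] allows one half of a series to be treated with information on that half
    alone. *)
Lemma FZ_ser pre M G p n :
  contC pre -> (forall x, Cmod (pre x) <= M) -> geo G ->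
  (forall k, G k = RtoC 0 \/ FZ n (fun x => pre x * expi (IZR k * psi (IZR p * x)))%C) ->
  FZ n (fun x => pre x * ser G (psi (IZR p * x)))%C.
Proof.
  intros Hpre HM HG Hk. destruct (geo_asum _ HG) as [A HA].
  assert (HM0 : 0 <= M) by (eapply Rle_trans; [apply Cmod_ge_0|apply (HM 0)]).
  assert (Hcs : contC (fun x => ser G (psi (IZR p * x)))).
  { eapply is_derC_contC. intros x. apply is_derC_ser_psi, HG. }
  apply FZ_of_small; [apply contC_mult; assumption|].
  exists M. intros eps He. destruct (asum_tail G A HA eps He) as [N HN].
  set (t := fun k => if (Z.abs k <=? Z.of_nat N)%Z then RtoC 0 else G k) in HN.
  set (u := fun k => if (Z.abs k <=? Z.of_nat N)%Z then G k else RtoC 0).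
  assert (Hu : asum u A) by (apply asum_trunc, HA).
  assert (Hf : fin u N).
  { intros k Hk'. unfold u. destruct (Z.leb_spec (Z.abs k) (Z.of_nat N)); [lia|reflexivity]. }
  assert (E1 : forall y, ser G y = (ser u y + ser t y)%C).
  { intros y. rewrite (ser_ext G (fun k => u k + t k)%C).
    - eapply ser_plus; eassumption.
    - intros k. unfold u, t. destruct (_ <=? _)%Z; ring. }
  set (fu := fun x => zsC (fun k => u k * (pre x * expi (IZR k * psi (IZR p * x))))%C N).
  assert (E2 : forall x, (pre x * ser G (psi (IZR p * x)) - pre x * ser t (psi (IZR p * x)))%C = fu x).
  { intros x. rewrite E1. unfold fu.
    rewrite (zsC_ext _ (fun k => pre x * (u k * expi (IZR k * psi (IZR p * x))))%C) by (intros; ring).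
    rewrite zsC_scal, <- (ser_finite u N _ Hf). ring. }
  exists (fun x => pre x * ser t (psi (IZR p * x)))%C. split; [|split].
  - apply (contC_ext (fun x => pre x * ser G (psi (IZR p * x)) - fu x)%C).
    + intros x. rewrite <- E2. ring.
    + apply contC_minus; [apply contC_mult; assumption|]. apply contC_zsC. intros k.
      apply contC_mult; [apply contC_const|]. apply contC_mult; [exact Hpre|apply contC_expi_psi].
  - apply (FZ_ext n fu); [intros; symmetry; apply E2|]. apply FZ_zsC. intros k.
    destruct (Hk k) as [H0|H0]; [|apply FZ_scal, H0].
    apply (FZ_ext n (fun _ => RtoC 0)); [|apply FZ_zero].
    intros x. unfold u. rewrite H0. destruct (_ <=? _)%Z; ring.
  - intros x. rewrite Cmod_mult. apply Rmult_le_compat; try apply Cmod_ge_0; [apply HM|].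
    apply ser_bound, HN.
Qed.

(** Multiplication by [1 / (3 - 2 e^{i p x})] and by [e^{i psi (p x)}] does not create Fourier
    modes below those already present. *)
Definition inv3 (p : Z) (x : R) : C :=
  ((3 - 2 * expi (- IZR p * x)) * RtoC (/ (13 - 12 * cos (IZR p * x))))%C.

Lemma inv3_spec p x : (inv3 p x * (3 - 2 * expi (IZR p * x)) = RtoC 1)%C.
Proof.
  unfold inv3. assert (Hd := den_pos (IZR p * x)). assert (Hs := sin_sqr (IZR p * x)).
  replace (- IZR p * x) with (- (IZR p * x)) by ring.
  unfold expi. rewrite cos_neg, sin_neg. set (c := cos (IZR p * x)) in *. set (s := sin (IZR p * x)) in *.
  apply C_eq; simpl.
  - apply Rmult_eq_reg_r with (13 - 12 * c); [|lra].
    replace (1 * (13 - 12 * c)) with (9 - 12 * c + 4 * (c * c) + 4 * (s * s)) by (rewrite Hs; ring).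
    field. lra.
  - field. lra.
Qed.

Lemma contC_inv3 p : contC (inv3 p).
Proof.
  apply contC_mult.
  - apply contC_minus; [apply contC_const|]. apply contC_mult; [apply contC_const|apply contC_expi].
  - split; intros x; [|apply continuous_const].
    apply (ex_derive_continuous (K := R_AbsRing) (V := R_NormedModule)
             (fun t => / (13 - 12 * cos (IZR p * t)))).
    assert (Hd := den_pos (IZR p * x)). auto_derive. lra.
Qed.

Lemma Cmod_inv3 p x : Cmod (inv3 p x) <= 1.
Proof.
  assert (H : Cmod (inv3 p x) * Cmod (3 - 2 * expi (IZR p * x))%C = 1).
  { rewrite <- Cmod_mult, inv3_spec, Cmod_R. apply Rabs_R1. }
  assert (H2 : 1 <= Cmod (3 - 2 * expi (IZR p * x))%C).
  { generalize (Cmod_triangle (3 - 2 * expi (IZR p * x)) (2 * expi (IZR p * x))).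
    replace (3 - 2 * expi (IZR p * x) + 2 * expi (IZR p * x))%C with (RtoC 3) by ring.
    rewrite Cmod_mult, Cmod_expi, !Cmod_R, (Rabs_pos_eq 3), (Rabs_pos_eq 2) by lra. lra. }
  generalize (Cmod_ge_0 (inv3 p x)). nra.
Qed.

(** The quotient [g] satisfies [3 g - 2 e^{ipx} g = phi], so below [n0] its coefficients obey
    [3 a_k = 2 a_{k-p}]. Going down, they grow like [(3/2)^j]; being bounded, they vanish. Here the
    pole 3/2 of the Moebius map lying outside the disc is what counts. *)
Lemma is_fc_div p phi M n0 : (0 < p)%Z -> contC phi -> (forall x, Cmod (phi x) <= M) ->
  (forall n, (n < n0)%Z -> FZ n phi) ->
  forall n, (n < n0)%Z -> FZ n (fun x => phi x * inv3 p x)%C.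
Proof.
  intros Hp Hc HM HZ n Hn.
  assert (HM0 : 0 <= M) by (eapply Rle_trans; [apply Cmod_ge_0|apply (HM 0)]).
  set (g := fun x => (phi x * inv3 p x)%C).
  assert (Hg : contC g) by (apply contC_mult; [exact Hc|apply contC_inv3]).
  assert (Hgb : forall x, Cmod (g x) <= M).
  { intros x. unfold g. rewrite Cmod_mult. generalize (HM x) (Cmod_inv3 p x) (Cmod_ge_0 (phi x)). nra. }
  set (a := fun k => fourier g k).
  assert (Ha : forall k, is_fc g k (a k)) by (intros; apply contC_is_fc, Hg).
  assert (Hab : forall k, Cmod (a k) <= 2 * M) by (intros k; apply (is_fc_bound g k); auto).
  assert (Hrec : forall k, (k < n0)%Z -> (3 * a k - 2 * a (k - p)%Z = 0)%C).
  { intros k Hk. apply (is_fc_unique phi k); [|apply HZ, Hk].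
    apply (is_fc_ext (fun x => 3 * g x + (- 2) * (expi (IZR p * x) * g x))%C).
    - intros x. unfold g.
      transitivity (phi x * (inv3 p x * (3 - 2 * expi (IZR p * x))))%C; [ring|].
      rewrite inv3_spec. ring.
    - replace (3 * a k - 2 * a (k - p)%Z)%C with (3 * a k + (- 2) * a (k - p)%Z)%C by ring.
      apply is_fc_plus; [apply is_fc_scal, Ha|]. apply is_fc_scal.
      replace k with (k - p + p)%Z at 1 by lia. apply is_fc_shift, Ha. }
  assert (Hpow : forall j, (a (n - p * Z.of_nat j)%Z = RtoC ((3 / 2) ^ j) * a n)%C).
  { induction j as [|j IH].
    - simpl. replace (n - p * 0)%Z with n by lia. ring.
    - specialize (Hrec (n - p * Z.of_nat j)%Z ltac:(nia)). rewrite IH in Hrec.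
      replace (n - p * Z.of_nat j - p)%Z with (n - p * Z.of_nat (S j))%Z in Hrec by lia.
      set (b := a (n - p * Z.of_nat (S j))%Z) in *.
      assert (Hb : (2 * b = 3 * (RtoC ((3 / 2) ^ j) * a n))%C).
      { replace (2 * b)%C with (3 * (RtoC ((3 / 2) ^ j) * a n) -
          (3 * (RtoC ((3 / 2) ^ j) * a n) - 2 * b))%C by ring. rewrite Hrec. ring. }
      replace b with (RtoC (/ 2) * (2 * b))%C.
      + rewrite Hb. simpl. rewrite !RtoC_mult. unfold Rdiv. rewrite RtoC_mult. ring.
      + rewrite Cmult_assoc, <- RtoC_mult. replace (/ 2 * 2) with 1 by field. ring. }
  assert (Hz : Cmod (a n) <= 0).
  { apply Rnot_lt_le. intros Hpos.
    destruct (Pow_x_infinity (3 / 2)) with (b := (2 * M + 1) / Cmod (a n)) as [j Hj].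
    { rewrite Rabs_pos_eq; lra. }
    specialize (Hj j (le_n j)). specialize (Hab (n - p * Z.of_nat j)%Z).
    rewrite Hpow, Cmod_mult, Cmod_R in Hab.
    apply Rge_le in Hj. apply Rmult_le_compat_r with (r := Cmod (a n)) in Hj; [|lra].
    replace ((2 * M + 1) / Cmod (a n) * Cmod (a n)) with (2 * M + 1) in Hj by (field; lra).
    lra. }
  unfold FZ. replace (RtoC 0) with (a n); [apply Ha|].
  apply Cmod_eq_0. generalize (Cmod_ge_0 (a n)). lra.
Qed.

(** Multiplication by [(3 e^{ipx} - 2) / (3 - 2 e^{ipx})] is a division covered by [is_fc_div]
    followed by a polynomial in [e^{ipx}]. *)
Lemma FZ_mul_E p phi M n0 : (0 < p)%Z -> contC phi -> (forall x, Cmod (phi x) <= M) ->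
  (forall n, (n < n0)%Z -> FZ n phi) ->
  forall n, (n < n0)%Z -> FZ n (fun x => expi (psi (IZR p * x)) * phi x)%C.
Proof.
  intros Hp Hc HM HZ n Hn. pose proof (is_fc_div p phi M n0 Hp Hc HM HZ) as Hd.
  apply (FZ_ext n (fun x => 3 * (expi (IZR p * x) * (phi x * inv3 p x)) +
                            (- 2) * (phi x * inv3 p x))%C).
  - intros x.
    transitivity ((3 * expi (IZR p * x) - 2) * (phi x * inv3 p x))%C; [ring|].
    rewrite <- expi_psi.
    transitivity (expi (psi (IZR p * x)) * phi x * (inv3 p x * (3 - 2 * expi (IZR p * x))))%C; [ring|].
    rewrite inv3_spec. ring.
  - apply FZ_plus; apply FZ_scal; [|apply Hd, Hn].
    replace n with (n - p + p)%Z by lia. apply is_fc_shift, Hd. lia.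
Qed.

Lemma FZ_mul_E_pow p phi M n0 (j : nat) : (0 < p)%Z -> contC phi -> (forall x, Cmod (phi x) <= M) ->
  (forall n, (n < n0)%Z -> FZ n phi) ->
  forall n, (n < n0)%Z -> FZ n (fun x => expi (INR j * psi (IZR p * x)) * phi x)%C.
Proof.
  intros Hp Hc HM HZ. induction j as [|j IH]; intros n Hn.
  - apply (FZ_ext n phi); [|apply HZ, Hn]. intros x. simpl. rewrite Rmult_0_l, expi_0. ring.
  - apply (FZ_ext n (fun x => expi (psi (IZR p * x)) * (expi (INR j * psi (IZR p * x)) * phi x))%C).
    + intros x. rewrite S_INR.
      replace ((INR j + 1) * psi (IZR p * x)) with (psi (IZR p * x) + INR j * psi (IZR p * x)) by ring.
      rewrite expi_plus. ring.
    + apply (FZ_mul_E p _ M n0 Hp); [| |exact IH|exact Hn].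
      * apply contC_mult; [|exact Hc]. apply contC_expi_psi.
      * intros x. rewrite Cmod_mult, Cmod_expi, Rmult_1_l. apply HM.
Qed.

Lemma FZ_conj n f : FZ n f -> FZ (- n) (fun x => Cconj (f x)).
Proof.
  intros H. unfold FZ. replace (RtoC 0) with (Cconj (RtoC 0)) by (apply C_eq; simpl; ring).
  apply is_fc_conj, H.
Qed.

Lemma Cconj_expi t : Cconj (expi t) = expi (- t).
Proof. unfold expi, Cconj. rewrite cos_neg, sin_neg. reflexivity. Qed.

Lemma FZ_epos k n : (0 <= k)%Z -> (n < 0)%Z -> FZ n (fun x => expi (IZR k * psi (IZR 1 * x))).
Proof.
  intros Hk Hn.
  apply (FZ_ext n (fun x => expi (INR (Z.to_nat k) * psi (IZR 1 * x)) * RtoC 1)%C).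
  - intros x. rewrite INR_IZR_INZ, Z2Nat.id by exact Hk. ring.
  - apply (FZ_mul_E_pow 1 (fun _ => RtoC 1) 1 0); [lia|apply contC_const| | |exact Hn].
    + intros x. rewrite Cmod_R, Rabs_R1. lra.
    + intros m Hm. generalize (is_fc_one m). destruct (Z.eqb_spec m 0); [lia|auto].
Qed.

Lemma FZ_eneg k n : (k <= 0)%Z -> (0 < n)%Z -> FZ n (fun x => expi (IZR k * psi (IZR 1 * x))).
Proof.
  intros Hk Hn.
  apply (FZ_ext n (fun x => Cconj (expi (IZR (- k) * psi (IZR 1 * x))))).
  - intros x. rewrite Cconj_expi, opp_IZR. f_equal. ring.
  - replace n with (- - n)%Z by lia. apply FZ_conj, FZ_epos; lia.
Qed.

(** The factor [1 + 2/3 E] vanishes where [E = -3/2], which is the image of the point at infinity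
    under the Moebius map in [e^{3ix}]. This zero gives the negative half three extra orders of
    decay in [e^{ix}], more than the factor [e^{ix}] takes away. *)
Definition pre3 (x : R) : C :=
  (expi (IZR 1 * x) * (1 + RtoC (2 / 3) * expi (IZR 1 * psi (IZR 3 * x))))%C.

Lemma contC_pre3 : contC pre3.
Proof.
  apply contC_mult; [apply contC_expi|]. apply contC_plus; [apply contC_const|].
  apply contC_mult; [apply contC_const|apply contC_expi_psi].
Qed.

Lemma Cmod_pre3 x : Cmod (pre3 x) <= 2.
Proof.
  unfold pre3. rewrite Cmod_mult, Cmod_expi, Rmult_1_l.
  eapply Rle_trans; [apply Cmod_triangle|].
  rewrite Cmod_mult, Cmod_expi, !Cmod_R, Rabs_R1, Rabs_pos_eq; lra.
Qed.

Lemma FZ_pre3_pos k n : (0 <= k)%Z -> (n < 1)%Z ->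
  FZ n (fun x => pre3 x * expi (IZR k * psi (IZR 3 * x)))%C.
Proof.
  intros Hk Hn.
  assert (H : forall j, FZ n (fun x => expi (INR j * psi (IZR 3 * x)) * expi (IZR 1 * x))%C).
  { intros j. apply (FZ_mul_E_pow 3 (fun x => expi (IZR 1 * x)) 1 1); [lia|apply contC_expi| | |exact Hn].
    - intros x. rewrite Cmod_expi. lra.
    - intros m Hm. apply FZ_expi. lia. }
  apply (FZ_ext n (fun x => expi (INR (Z.to_nat k) * psi (IZR 3 * x)) * expi (IZR 1 * x) +
    RtoC (2 / 3) * (expi (INR (S (Z.to_nat k)) * psi (IZR 3 * x)) * expi (IZR 1 * x)))%C).
  - intros x. unfold pre3. rewrite S_INR, INR_IZR_INZ, Z2Nat.id by exact Hk.
    replace ((IZR k + 1) * psi (IZR 3 * x)) with (IZR 1 * psi (IZR 3 * x) + IZR k * psi (IZR 3 * x)) by (simpl; ring).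
    rewrite expi_plus. ring.
  - apply FZ_plus; [|apply FZ_scal]; apply H.
Qed.

(** After complex conjugation the function is a nonnegative power of [E] times
    [e^{2ix} / (3 - 2 e^{3ix})], up to a constant, and this has no mode below 2. *)
Lemma FZ_pre3_neg k n : (k < 0)%Z -> (-2 < n)%Z ->
  FZ n (fun x => pre3 x * expi (IZR k * psi (IZR 3 * x)))%C.
Proof.
  intros Hk Hn.
  assert (H : forall j m, (m < 2)%Z -> FZ m (fun x => expi (INR j * psi (IZR 3 * x)) *
             (expi (IZR 2 * x) * inv3 3 x))%C).
  { intros j m Hm. apply (FZ_mul_E_pow 3 _ 1 2); [lia| | | |exact Hm].
    - apply contC_mult; [apply contC_expi|apply contC_inv3].
    - intros x. rewrite Cmod_mult, Cmod_expi, Rmult_1_l. apply Cmod_inv3.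
    - apply (is_fc_div 3 _ 1); [lia|apply contC_expi| |].
      + intros x. rewrite Cmod_expi. lra.
      + intros q Hq. apply FZ_expi. lia. }
  set (j := Z.to_nat (- k - 1)).
  apply (FZ_ext n (fun x => Cconj (RtoC (5 / 3) *
     (expi (INR j * psi (IZR 3 * x)) * (expi (IZR 2 * x) * inv3 3 x))))%C).
  - intros x.
    (* From the definition of the map, [E + 2/3 = (5/3) e^{3ix} / (3 - 2 e^{3ix})]; the numerator is
       the gain announced by the zero of the prefactor. *)
    assert (Hu : (RtoC (5 / 3) * (expi (IZR 2 * x) * inv3 3 x) =
      expi (- (IZR 1 * x)) * (expi (IZR 1 * psi (IZR 3 * x)) + RtoC (2 / 3)))%C).
    { replace (IZR 1 * psi (IZR 3 * x)) with (psi (IZR 3 * x)) by (simpl; ring).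
      assert (He : ((expi (psi (IZR 3 * x)) + RtoC (2 / 3)) * (3 - 2 * expi (IZR 3 * x)) =
                RtoC (5 / 3) * expi (IZR 3 * x))%C).
      { rewrite Cmult_plus_distr_r, expi_psi. apply C_eq; simpl; field. }
      transitivity (expi (- (IZR 1 * x)) * ((expi (psi (IZR 3 * x)) + RtoC (2 / 3)) *
        (inv3 3 x * (3 - 2 * expi (IZR 3 * x)))))%C; [|rewrite inv3_spec; ring].
      transitivity (expi (- (IZR 1 * x)) * inv3 3 x * ((expi (psi (IZR 3 * x)) + RtoC (2 / 3)) *
        (3 - 2 * expi (IZR 3 * x))))%C; [|ring].
      rewrite He. replace (IZR 2 * x) with (- (IZR 1 * x) + IZR 3 * x) by (simpl; ring).
      rewrite expi_plus. ring. }
    transitivity (Cconj (expi (INR j * psi (IZR 3 * x)) *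
      (expi (- (IZR 1 * x)) * (expi (IZR 1 * psi (IZR 3 * x)) + RtoC (2 / 3)))))%C.
    { rewrite <- Hu. f_equal. ring. }
    rewrite !Cmult_conj, Cplus_conj, !Cconj_expi, Ropp_involutive.
    replace (Cconj (RtoC (2 / 3))) with (RtoC (2 / 3)) by (apply C_eq; simpl; ring).
    unfold pre3, j. rewrite INR_IZR_INZ, Z2Nat.id by lia.
    replace (IZR k * psi (IZR 3 * x)) with
      (- (IZR (- k - 1) * psi (IZR 3 * x)) + - (IZR 1 * psi (IZR 3 * x)))
      by (rewrite minus_IZR, opp_IZR; simpl; ring).
    rewrite expi_plus.
    set (e := expi (IZR 1 * psi (IZR 3 * x))). set (f := expi (- (IZR 1 * psi (IZR 3 * x)))).
    assert (Hef : (f * e = RtoC 1)%C) by apply expi_opp_l.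
    transitivity (expi (- (IZR (- k - 1) * psi (IZR 3 * x))) * expi (IZR 1 * x) *
      (f + RtoC (2 / 3) * (f * e)))%C; [rewrite Hef; ring|ring].
  - replace n with (- - n)%Z by lia. apply FZ_conj, FZ_scal, H. lia.
Qed.

(** On each side of 0 only one of the two halves contributes, so the multiplier can be read off.
    Mode 0 is a separate hypothesis because neither half has to have zero mean by itself, while the
    symbol vanishes there. *)
Lemma fourier_split f0 f1 f2 n : contC f0 -> contC f1 -> contC f2 ->
  ((0 < n)%Z -> FZ n f0 /\ FZ n f2) -> ((n < 0)%Z -> FZ n f0 /\ FZ n f1) ->
  (n = 0%Z -> FZ n (fun x => - Ci * f1 x + Ci * f2 x)%C) ->
  fourier (fun x => - Ci * f1 x + Ci * f2 x)%C n =
  (- Ci * RtoC (IZR (Z.sgn n)) * fourier (fun x => f0 x + (f1 x + f2 x)) n)%C.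
Proof.
  intros C0 C1 C2 Hp Hn Hz.
  pose proof (contC_is_fc f1 n C1) as F1. pose proof (contC_is_fc f2 n C2) as F2.
  destruct (Z.lt_trichotomy n 0) as [H|[H|H]].
  - destruct (Hn H) as [Z0 Z1]. rewrite (is_fc_unique f1 n _ _ F1 Z1) in F1.
    rewrite (is_fc_fourier _ _ _ (is_fc_plus _ _ _ _ _ Z0 (is_fc_plus _ _ _ _ _ F1 F2))).
    rewrite (is_fc_fourier _ _ _ (is_fc_plus _ _ _ _ _ (is_fc_scal (- Ci) _ _ _ F1) (is_fc_scal Ci _ _ _ F2))).
    rewrite Z.sgn_neg by exact H. apply C_eq; simpl; ring.
  - rewrite (is_fc_fourier _ _ _ (Hz H)). subst n. simpl. ring.
  - destruct (Hp H) as [Z0 Z2]. rewrite (is_fc_unique f2 n _ _ F2 Z2) in F2.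
    rewrite (is_fc_fourier _ _ _ (is_fc_plus _ _ _ _ _ Z0 (is_fc_plus _ _ _ _ _ F1 F2))).
    rewrite (is_fc_fourier _ _ _ (is_fc_plus _ _ _ _ _ (is_fc_scal (- Ci) _ _ _ F1) (is_fc_scal Ci _ _ _ F2))).
    rewrite Z.sgn_pos by exact H. apply C_eq; simpl; ring.
Qed.

Lemma fourier_ext f g n : (forall x, f x = g x) -> contC f -> fourier g n = fourier f n.
Proof.
  intros H Hf. apply is_fc_fourier, (is_fc_ext f); [exact H|]. apply contC_is_fc, Hf.
Qed.

(** * The travelling wave *)

Lemma ser_even_real a A y : asum a A -> (forall k, a (- k)%Z = a k) -> (forall k, Im (a k) = 0) ->
  Im (ser a y) = 0.
Proof.
  intros HA He Hr. unfold ser, tsum. cbn [Im snd].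
  rewrite (Lim_seq_ext _ (fun _ => 0)); [rewrite Lim_seq_const; reflexivity|].
  intros n. set (g := fun k => Im (a k * expi (IZR k * y))%C).
  assert (H : zs g n = - 1 * zs g n).
  { rewrite <- zs_scal, <- (zs_flip g). apply zs_ext. intros k _. unfold g.
    rewrite He, opp_IZR. unfold expi. simpl.
    replace (- IZR k * y) with (- (IZR k * y)) by ring. rewrite cos_neg, sin_neg.
    generalize (Hr k). unfold Im. intros ->. ring. }
  fold g. lra.
Qed.

Lemma ser_even a A y : asum a A -> (forall k, a (- k)%Z = a k) -> ser a (- y) = ser a y.
Proof.
  intros HA He. apply is_tsum_unique.
  pose proof (is_tsum_flip _ _ (is_ser a A y HA)) as H.
  eapply is_tsum_ext; [|exact H]. intros k. cbn beta. rewrite He, opp_IZR.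
  do 2 f_equal. ring.
Qed.

Lemma is_fc_derC f f' n l : (forall x, is_derC f x (f' x)) -> contC f' -> periodic (2 * PI) f ->
  is_fc f n l -> is_fc f' n (Ci * RtoC (IZR n) * l)%C.
Proof.
  intros Hd Hc Hp Hf. unfold is_fc in *.
  set (e := fun x => expi (- IZR n * x)).
  assert (He : forall x, is_derC (fun x => f x * e x)%C x
                (f' x * e x + f x * (Ci * RtoC (- IZR n) * e x))%C).
  { intros x. apply is_derC_mult; [apply Hd|]. apply is_derC_expi. }
  assert (Hce : contC e) by apply contC_expi.
  pose proof (is_cint_derC _ _ He) as H.
  assert (Hcf : contC (fun x => f' x * e x + f x * (Ci * RtoC (- IZR n) * e x))%C).
  { apply contC_plus; [apply contC_mult; assumption|]. apply contC_mult.
    - apply is_derC_contC with f'. exact Hd.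
    - apply contC_mult; [apply contC_const|exact Hce]. }
  specialize (H Hcf).
  assert (H0 : (f PI * e PI - f (- PI)%R * e (- PI)%R)%C = RtoC 0).
  { replace (f PI) with (f (- PI)%R).
    - replace (e PI) with (e (- PI)%R); [ring|]. unfold e.
      rewrite <- (expi_2PI_Z (- IZR n * PI) n). f_equal. ring.
    - rewrite <- (Hp (- PI)). f_equal. ring. }
  cbn beta in H. rewrite H0 in H.
  pose proof (is_cint_plus _ _ _ _ H (is_cint_scal (Ci * RtoC (IZR n))%C _ _ Hf)) as H2.
  replace (RtoC (2 * PI) * (Ci * RtoC (IZR n) * l))%C with
    (0 + Ci * RtoC (IZR n) * (RtoC (2 * PI) * l))%C by ring.
  eapply is_cint_ext; [|exact H2]. intros x. cbn beta.
  replace (- (IZR n * x)) with (- IZR n * x) by ring. fold (e x).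
  rewrite RtoC_opp. ring.
Qed.

(** Both Fourier coefficients are multiplied by [i n], so the Hilbert transform commutes with
    differentiation. This yields the transform of [f'] from that of [f]. *)
Lemma is_hilbert_derC f f' h h' : (forall x, is_derC f x (f' x)) -> contC f' -> periodic (2 * PI) f ->
  (forall x, is_derC h x (h' x)) -> contC h' -> is_hilbert f h -> is_hilbert f' h'.
Proof.
  intros Hf Cf Pf Hh Ch (Ph & _ & Hk). split; [|split].
  - intros x. rewrite <- (is_derC_unique _ _ _ (Hh x)). symmetry. apply is_derC_unique.
    apply (is_derC_ext (fun t => h (t + 2 * PI)%R)); [intros t; apply Ph|].
    replace (h' (x + 2 * PI)) with (RtoC 1 * h' (x + 2 * PI)%R)%C by ring.
    apply (is_derC_comp h (fun t => t + 2 * PI)); [auto_derive; [exact I|ring]|apply Hh].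
  - apply contC_continuous, Ch.
  - intros n.
    pose proof (contC_is_fc f n (is_derC_contC _ _ Hf)) as F1.
    pose proof (contC_is_fc h n (is_derC_contC _ _ Hh)) as F2.
    rewrite (is_fc_fourier _ _ _ (is_fc_derC _ _ n _ Hf Cf Pf F1)).
    rewrite (is_fc_fourier _ _ _ (is_fc_derC _ _ n _ Hh Ch Ph F2)).
    rewrite Hk. ring.
Qed.

Lemma is_hilbert_ext f g h : (forall x, f x = g x) -> contC f -> is_hilbert f h -> is_hilbert g h.
Proof.
  intros H C (P1 & P2 & P3). split; [exact P1|]. split; [exact P2|]. intros k.
  rewrite P3, (fourier_ext f g k H C). reflexivity.
Qed.

Definition posp (a : Z -> C) (k : Z) : C := if (0 <? k)%Z then a k else RtoC 0.
Definition negp (a : Z -> C) (k : Z) : C := if (k <? 0)%Z then a k else RtoC 0.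
Definition sgp (a : Z -> C) (k : Z) : C := (RtoC (IZR (Z.sgn k)) * a k)%C.

Lemma geo_posp a : geo a -> geo (posp a).
Proof.
  apply geo_dom. intros k. unfold posp. destruct (_ <? _)%Z; [lra|].
  rewrite Cmod_0. apply Cmod_ge_0.
Qed.

Lemma geo_negp a : geo a -> geo (negp a).
Proof.
  apply geo_dom. intros k. unfold negp. destruct (_ <? _)%Z; [lra|].
  rewrite Cmod_0. apply Cmod_ge_0.
Qed.

Lemma geo_sgp a : geo a -> geo (sgp a).
Proof.
  apply geo_dom. intros k. unfold sgp. rewrite Cmod_mult, Cmod_R, <- abs_IZR.
  assert (IZR (Z.abs (Z.sgn k)) <= 1) by (apply IZR_le; lia).
  generalize (Cmod_ge_0 (a k)). nra.
Qed.

Definition cst (c : R) (k : Z) : C := if (k =? 0)%Z then RtoC c else RtoC 0.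

Lemma fin_cst c : fin (cst c) 0.
Proof. intros k Hk. unfold cst. destruct (Z.eqb_spec k 0); [lia|reflexivity]. Qed.

Lemma ser_cst c y : ser (cst c) y = RtoC c.
Proof.
  rewrite (ser_finite _ 0 y (fin_cst c)), zsC_0. unfold cst. simpl.
  rewrite Rmult_0_l, expi_0. ring.
Qed.

Lemma conv_Dseq a k : conv Dseq a k =
  (RtoC (13 / 5) * a k + RtoC (6 / 5) * (a (k - 1)%Z + a (k + 1)%Z))%C.
Proof.
  rewrite (conv_finite_l _ _ 1 k fin_Dseq), zsC_S, zsC_0. simpl Dseq.
  replace (k - 0)%Z with k by lia.
  replace (k - Z.of_nat 1)%Z with (k - 1)%Z by lia.
  replace (k - - Z.of_nat 1)%Z with (k + 1)%Z by lia.
  cbn [Z.of_nat Pos.of_succ_nat Z.opp Dseq]. ring.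
Qed.

Section Wave.

Variables (c : R) (Y : Z -> C).
Hypothesis Ygeo : geo Y.
Hypothesis Yeven : forall k, Y (- k)%Z = Y k.
Hypothesis Yreal : forall k, Im (Y k) = 0.
Hypothesis Y_0 : Y 0%Z = RtoC 0.

Definition Wseq (k : Z) : C := (cst c k + conv Dseq Y k)%C.

Hypothesis Weq : forall k, (RtoC (IZR (Z.abs k)) * conv Wseq Wseq k = 2 * Y k)%C.

Lemma Vgeo : geo (conv Dseq Y).
Proof. apply geo_conv; [apply geo_Dseq|exact Ygeo]. Qed.

Lemma Veven k : conv Dseq Y (- k) = conv Dseq Y k.
Proof.
  rewrite !conv_Dseq.
  replace (- k - 1)%Z with (- (k + 1))%Z by lia. replace (- k + 1)%Z with (- (k - 1))%Z by lia.
  rewrite !Yeven. ring.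
Qed.

Lemma Vreal k : Im (conv Dseq Y k) = 0.
Proof.
  apply conv_real; [|exact Yreal]. intros m. unfold Dseq.
  destruct m as [|p|p]; try reflexivity; destruct p; reflexivity.
Qed.

Lemma Wgeo : geo Wseq.
Proof. apply geo_plus; [apply (geo_fin _ 0), fin_cst|apply Vgeo]. Qed.

Definition wave (x : R) : R := Re (tw 0 1 (conv Dseq Y) x).

Lemma tw01 H x : tw 0 1 H x = ser H (psi (IZR 1 * x)).
Proof. unfold tw. rewrite Rmult_0_l, expi_0. ring. Qed.

Lemma wave_ser x : RtoC (wave x) = ser (conv Dseq Y) (psi (IZR 1 * x)).
Proof.
  destruct (geo_asum _ Vgeo) as [A HA]. unfold wave. rewrite tw01.
  apply C_eq; [reflexivity|].
  change (0 = Im (ser (conv Dseq Y) (psi (IZR 1 * x)))). symmetry.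
  apply (ser_even_real _ A); [exact HA|apply Veven|apply Vreal].
Qed.

Lemma ser_Wseq y : ser Wseq y = (RtoC c + ser (conv Dseq Y) y)%C.
Proof.
  destruct (geo_asum _ Vgeo) as [A HA].
  destruct (geo_asum _ (geo_fin _ 0 (fin_cst c))) as [A' HA'].
  unfold Wseq. rewrite (ser_plus _ _ _ _ y HA' HA), ser_cst. reflexivity.
Qed.

Lemma wave_W x : RtoC (c + wave x) = ser Wseq (psi (IZR 1 * x)).
Proof. rewrite ser_Wseq, RtoC_plus, wave_ser. reflexivity. Qed.

Lemma wave_smooth : smooth wave.
Proof. exact (proj1 (smoothC_tw 0 1 _ Vgeo)). Qed.

Lemma wave_periodic : periodic (2 * PI) wave.
Proof. intros x. unfold wave. f_equal. exact (tw_periodic 0 1 _ x). Qed.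

Lemma wave_even x : wave (- x) = wave x.
Proof.
  destruct (geo_asum _ Vgeo) as [A HA]. unfold wave. rewrite !tw01. f_equal.
  replace (IZR 1 * - x) with (- (IZR 1 * x)) by ring. rewrite psi_opp.
  apply (ser_even _ A); [exact HA|apply Veven].
Qed.

(** As [Y 0 = 0], the sequence [Y] has a primitive [U]; then [v = psi' (ser Y o psi)] is the
    derivative of the periodic function [ser U o psi]. *)
Lemma wave_mean : RInt wave (- PI) PI = 0.
Proof.
  set (U := fun k => if (k =? 0)%Z then RtoC 0 else (- Ci * RtoC (/ IZR k) * Y k)%C).
  assert (GU : geo U).
  { apply geo_dom with Y; [|exact Ygeo]. intros k. unfold U. destruct (Z.eqb_spec k 0) as [->|Hk].
    - rewrite Cmod_0. apply Cmod_ge_0.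
    - rewrite !Cmod_mult, Cmod_opp, Cmod_Ci, Cmod_R, Rmult_1_l, Rabs_inv, <- abs_IZR.
      assert (1 <= IZR (Z.abs k)) by (apply IZR_le; lia).
      assert (/ IZR (Z.abs k) <= 1) by (rewrite <- Rinv_1; apply Rinv_le_contravar; lra).
      generalize (Cmod_ge_0 (Y k)). nra. }
  assert (DU : forall k, dk U k = Y k).
  { intros k. unfold dk, U. destruct (Z.eqb_spec k 0) as [->|Hk]; [rewrite Y_0; ring|].
    assert (HR : (RtoC (IZR k) * RtoC (/ IZR k))%C = RtoC 1).
    { rewrite <- RtoC_mult, Rinv_r; [reflexivity|]. apply not_0_IZR, Hk. }
    transitivity (- (Ci * Ci) * (RtoC (IZR k) * RtoC (/ IZR k)) * Y k)%C; [ring|].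
    rewrite HR. replace (- (Ci * Ci))%C with (RtoC 1) by (apply C_eq; simpl; ring). ring. }
  assert (H : forall x, is_derC (fun t => ser U (psi (IZR 1 * t))) x (RtoC (wave x))).
  { intros x. rewrite wave_ser.
    rewrite (ser_ext _ (conv Dseq (dk U))) by (intros k; apply conv_ext; [reflexivity|intros; symmetry; apply DU]).
    replace (ser (conv Dseq (dk U)) (psi (IZR 1 * x))) with
      (RtoC (IZR 1) * ser (conv Dseq (dk U)) (psi (IZR 1 * x)))%C by (simpl; ring).
    apply is_derC_ser_psi, GU. }
  assert (Hc : contC (fun x => RtoC (wave x))).
  { apply (contC_ext (tw 0 1 (conv Dseq Y))); [|apply contC_tw, Vgeo].
    intros x. rewrite wave_ser. apply tw01. }
  destruct (is_cint_derC _ _ H Hc) as [H1 _].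
  apply (is_RInt_unique (V := R_CompleteNormedModule)) in H1.
  transitivity (Re (ser U (psi (IZR 1 * PI)) - ser U (psi (IZR 1 * - PI)))%C); [exact H1|].
  rewrite <- !tw01. replace PI with (- PI + 2 * PI) at 1 by ring.
  pose proof (tw_periodic 0 1 U (- PI)) as E. change (Z.of_nat 1) with 1%Z in E.
  rewrite E. simpl. ring.
Qed.

Definition wave_square (x : R) : C := ser (conv Wseq Wseq) (psi (IZR 1 * x)).

Lemma wave_square_eq x : wave_square x = RtoC ((c + wave x) * (c + wave x)).
Proof.
  destruct (geo_asum _ Wgeo) as [A HA]. unfold wave_square.
  rewrite (ser_conv _ _ _ _ _ HA HA), <- wave_W, RtoC_mult. reflexivity.
Qed.

Lemma dk_square k : dk (conv Wseq Wseq) k = (Ci * 2 * sgp Y k)%C.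
Proof.
  unfold dk, sgp. replace (IZR k) with (IZR (Z.sgn k) * IZR (Z.abs k)).
  - rewrite RtoC_mult. transitivity (Ci * (RtoC (IZR (Z.sgn k)) *
      (RtoC (IZR (Z.abs k)) * conv Wseq Wseq k)))%C; [ring|]. rewrite Weq. ring.
  - rewrite <- mult_IZR. f_equal. lia.
Qed.

(** For [|k| >= 2] the three indices share one sign; at 1 and -1 the neighbour 0 contributes nothing
    since [Y 0 = 0]; at 0 the two neighbours cancel by evenness. The constant [c] in [Wseq] is
    removed by the sign of 0. *)
Lemma conv_Dseq_sgp k : conv Dseq (sgp Y) k = sgp Wseq k.
Proof.
  unfold sgp, Wseq, cst. rewrite !conv_Dseq.
  destruct (Z.eq_dec k 0) as [->|H0].
  - change (0 - 1)%Z with (- (1))%Z. change (0 + 1)%Z with 1%Z. rewrite Yeven. simpl. ring.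
  - destruct (Z.eqb_spec k 0); [lia|].
    destruct (Z.eq_dec k 1) as [->|H1]; [change (1 - 1)%Z with 0%Z; rewrite Y_0; simpl; ring|].
    destruct (Z.eq_dec k (-1)) as [->|H2]; [change (-1 + 1)%Z with 0%Z; rewrite Y_0; simpl; ring|].
    replace (Z.sgn (k - 1)) with (Z.sgn k) by lia. replace (Z.sgn (k + 1)) with (Z.sgn k) by lia.
    ring.
Qed.

Definition wave_hilbert (x : R) : C := (- Ci * ser (sgp Wseq) (psi (IZR 1 * x)))%C.

(** This is the wave equation in integrated form: with [w = c + v] it says that the derivative of
    [w^2] is [- 2 H v], once [wave_hilbert] is known to be the Hilbert transform. *)
Lemma is_derC_wave_square x : is_derC wave_square x (- 2 * wave_hilbert x)%C.
Proof.
  assert (Gs : geo (conv Wseq Wseq)) by (apply geo_conv; apply Wgeo).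
  pose proof (is_derC_ser_psi (conv Wseq Wseq) 1 x Gs) as H.
  replace (- 2 * wave_hilbert x)%C with
    (RtoC (IZR 1) * ser (conv Dseq (dk (conv Wseq Wseq))) (psi (IZR 1 * x)))%C; [exact H|].
  destruct (geo_asum _ geo_Dseq) as [A HA].
  destruct (geo_asum _ (geo_sgp _ Ygeo)) as [B HB].
  destruct (geo_asum _ (geo_sgp _ Wgeo)) as [B' HB'].
  rewrite (ser_ext _ (fun k => Ci * 2 * sgp Wseq k)%C).
  - rewrite (ser_scal _ _ _ _ HB'). unfold wave_hilbert. simpl. ring.
  - intros k. rewrite (conv_ext Dseq Dseq _ (fun k => Ci * 2 * sgp Y k)%C k (fun _ => eq_refl) dk_square).
    rewrite (conv_scal_r _ _ _ _ _ k HA HB), conv_Dseq_sgp. reflexivity.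
Qed.

Lemma contC_wave_hilbert : contC wave_hilbert.
Proof.
  apply contC_mult; [apply contC_const|].
  apply (contC_ext (tw 0 1 (sgp Wseq))); [intros; apply tw01|apply contC_tw, geo_sgp, Wgeo].
Qed.

Lemma wave_hilbert_split x : wave_hilbert x =
  (- Ci * (RtoC 1 * ser (posp Wseq) (psi (IZR 1 * x))) +
     Ci * (RtoC 1 * ser (negp Wseq) (psi (IZR 1 * x))))%C.
Proof.
  destruct (geo_asum _ (geo_posp _ Wgeo)) as [A HA].
  destruct (geo_asum _ (geo_negp _ Wgeo)) as [A' HA'].
  unfold wave_hilbert.
  rewrite (ser_ext (sgp Wseq) (fun k => posp Wseq k - negp Wseq k)%C).
  - rewrite (ser_minus _ _ _ _ _ HA HA'). ring.
  - intros k. unfold sgp, posp, negp. destruct (Z.ltb_spec 0 k), (Z.ltb_spec k 0); try lia.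
    + rewrite Z.sgn_pos by lia. ring.
    + rewrite Z.sgn_neg by lia. replace (RtoC (-1)) with (- RtoC 1)%C by (apply C_eq; simpl; ring). ring.
    + replace k with 0%Z by lia. simpl. ring.
Qed.

Lemma wave_split x : RtoC (wave x) =
  ((Wseq 0%Z - RtoC c) * RtoC 1 + (RtoC 1 * ser (posp Wseq) (psi (IZR 1 * x)) +
                  RtoC 1 * ser (negp Wseq) (psi (IZR 1 * x))))%C.
Proof.
  destruct (geo_asum _ (geo_posp _ Wgeo)) as [A HA].
  destruct (geo_asum _ (geo_negp _ Wgeo)) as [A' HA'].
  set (z := fun k => if (k =? 0)%Z then Wseq 0 else RtoC 0).
  assert (Fz : fin z 0).
  { intros k Hk. unfold z. destruct (Z.eqb_spec k 0); [lia|reflexivity]. }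
  destruct (geo_asum _ (geo_fin _ 0 Fz)) as [B HB].
  assert (E : ser Wseq (psi (IZR 1 * x)) = (ser z (psi (IZR 1 * x)) +
     (ser (posp Wseq) (psi (IZR 1 * x)) + ser (negp Wseq) (psi (IZR 1 * x))))%C).
  { rewrite <- (ser_plus _ _ _ _ _ HA HA').
    destruct (geo_asum _ (geo_plus _ _ (geo_posp _ Wgeo) (geo_negp _ Wgeo))) as [A2 HA2].
    rewrite <- (ser_plus _ _ _ _ _ HB HA2). apply ser_ext. intros k. unfold z, posp, negp.
    destruct (Z.eqb_spec k 0) as [Hk|Hk], (Z.ltb_spec 0 k), (Z.ltb_spec k 0); try lia; try rewrite Hk; ring. }
  rewrite (ser_finite z 0 _ Fz), zsC_0 in E. unfold z in E. simpl in E. rewrite Rmult_0_l, expi_0 in E.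
  transitivity (RtoC (c + wave x) - RtoC c)%C; [rewrite RtoC_plus; ring|].
  rewrite wave_W, E. ring.
Qed.

Lemma wave_is_hilbert : is_hilbert (fun x => RtoC (wave x)) wave_hilbert.
Proof.
  split; [|split].
  - intros x. unfold wave_hilbert. f_equal. rewrite <- !tw01. apply (tw_periodic 0 1).
  - apply contC_continuous, contC_wave_hilbert.
  - intros n.
    set (f1 := fun x => (RtoC 1 * ser (posp Wseq) (psi (IZR 1 * x)))%C).
    set (f2 := fun x => (RtoC 1 * ser (negp Wseq) (psi (IZR 1 * x)))%C).
    set (f0 := fun x : R => ((Wseq 0%Z - RtoC c) * RtoC 1)%C).
    assert (C0 : contC f0) by (apply contC_const).
    assert (C1 : contC f1).
    { apply contC_mult; [apply contC_const|].
      apply (contC_ext (tw 0 1 (posp Wseq))); [intros; apply tw01|apply contC_tw, geo_posp, Wgeo]. }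
    assert (C2 : contC f2).
    { apply contC_mult; [apply contC_const|].
      apply (contC_ext (tw 0 1 (negp Wseq))); [intros; apply tw01|apply contC_tw, geo_negp, Wgeo]. }
    assert (M1 : forall x : R, Cmod (RtoC 1) <= 1) by (intros; rewrite Cmod_R, Rabs_R1; lra).
    assert (Z0 : n <> 0%Z -> FZ n f0).
    { intros Hn. unfold FZ, f0.
      pose proof (is_fc_scal (Wseq 0%Z - RtoC c)%C _ n _ (is_fc_one n)) as H.
      destruct (Z.eqb_spec n 0); [lia|]. rewrite Cmult_0_r in H. exact H. }
    rewrite (fourier_ext (fun x => - Ci * f1 x + Ci * f2 x)%C) by
      (try (intros; symmetry; apply wave_hilbert_split);
       apply contC_plus; (apply contC_mult; [apply contC_const|assumption])).
    rewrite (fourier_ext (fun x => f0 x + (f1 x + f2 x))%C (fun x => RtoC (wave x))) by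
      (try (intros; symmetry; apply wave_split); repeat (apply contC_plus; try assumption)).
    apply fourier_split; try assumption.
    + intros Hn. split; [apply Z0; lia|].
      apply (FZ_ser (fun _ => RtoC 1) 1); [apply contC_const|exact M1|apply geo_negp, Wgeo|].
      intros k. unfold negp. destruct (Z.ltb_spec k 0); [right|left; reflexivity].
      apply (FZ_ext n (fun x => expi (IZR k * psi (IZR 1 * x)))); [intros; ring|].
      apply FZ_eneg; lia.
    + intros Hn. split; [apply Z0; lia|].
      apply (FZ_ser (fun _ => RtoC 1) 1); [apply contC_const|exact M1|apply geo_posp, Wgeo|].
      intros k. unfold posp. destruct (Z.ltb_spec 0 k); [right|left; reflexivity].
      apply (FZ_ext n (fun x => expi (IZR k * psi (IZR 1 * x)))); [intros; ring|].
      apply FZ_epos; lia.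
    (* Mode 0: a positive power of [e^{i psi}] may have a nonzero mean, so the halves are not
       treated separately. Their combination is a multiple of the derivative of the periodic
       [wave_square], hence of zero mean. *)
    + intros ->. apply (FZ_ext 0 (fun x => RtoC (- / 2) * (- 2 * wave_hilbert x))%C).
      { intros x. rewrite wave_hilbert_split. fold (f1 x) (f2 x).
        rewrite Cmult_assoc. replace (RtoC (- / 2) * - 2)%C with (RtoC 1) by (apply C_eq; simpl; field).
        ring. }
      apply FZ_scal. unfold FZ.
      replace (RtoC 0) with (Ci * RtoC (IZR 0) * fourier wave_square 0)%C by (simpl; ring).
      apply (is_fc_derC wave_square (fun x => (- 2 * wave_hilbert x)%C)).
      * apply is_derC_wave_square.
      * apply contC_mult; [apply contC_const|apply contC_wave_hilbert].
      * intros x. unfold wave_square. rewrite <- !tw01. apply (tw_periodic 0 1).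
      * apply contC_is_fc. eapply is_derC_contC. apply is_derC_wave_square.
Qed.

Lemma wave_travelling : travelling_wave c wave.
Proof.
  exists wave_hilbert. split; [apply wave_is_hilbert|]. intros x.
  assert (Hd : is_derive wave x (Derive wave x)).
  { apply Derive_correct. apply (wave_smooth 1%nat x). }
  assert (H1 : is_derC wave_square x (RtoC (2 * (c + wave x) * Derive wave x))).
  { apply (is_derC_ext (fun x => RtoC ((c + wave x) * (c + wave x)))).
    - intros; symmetry; apply wave_square_eq.
    - apply is_derC_RtoC.
      apply (is_derive_ext (fun t => (c + wave t) * (c + wave t))); [reflexivity|].
      auto_derive; [repeat split; exists (Derive wave x); exact Hd|].
      change (fun t : R => wave t) with wave. ring. }
  pose proof (is_derC_unique _ _ _ H1) as E1.
  rewrite (is_derC_unique _ _ _ (is_derC_wave_square x)) in E1.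
  assert (E2 : wave_hilbert x = (RtoC (- / 2) * (- 2 * wave_hilbert x))%C).
  { rewrite Cmult_assoc. replace (RtoC (- / 2) * - 2)%C with (RtoC 1) by (apply C_eq; simpl; field).
    ring. }
  rewrite E2, E1. apply C_eq; simpl; field.
Qed.

(** * Absence of smaller periods *)

Lemma expi_diff k a b : Cmod (expi (IZR k * a) - expi (IZR k * b))%C <=
  IZR (Z.abs k) * Cmod (expi a - expi b)%C.
Proof.
  assert (Hn : forall n a b, Cmod (expi (INR n * a) - expi (INR n * b))%C <= INR n * Cmod (expi a - expi b)%C).
  { clear. intros n a b. induction n as [|n IH].
    - simpl. rewrite !Rmult_0_l. replace (expi 0 - expi 0)%C with (RtoC 0) by ring. rewrite Cmod_0. lra.
    - rewrite S_INR, !Rmult_plus_distr_r, !Rmult_1_l, !expi_plus.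
      replace (expi (INR n * a) * expi a - expi (INR n * b) * expi b)%C with
        ((expi (INR n * a) - expi (INR n * b)) * expi a + expi (INR n * b) * (expi a - expi b))%C by ring.
      eapply Rle_trans; [apply Cmod_triangle|]. rewrite !Cmod_mult, !Cmod_expi. lra. }
  destruct (Z.le_ge_cases 0 k) as [Hk|Hk].
  - rewrite Z.abs_eq by exact Hk. specialize (Hn (Z.to_nat k) a b).
    rewrite INR_IZR_INZ, Z2Nat.id in Hn by exact Hk. exact Hn.
  - rewrite Z.abs_neq by exact Hk. specialize (Hn (Z.to_nat (- k)) (- a) (- b)).
    rewrite INR_IZR_INZ, Z2Nat.id, opp_IZR in Hn by lia.
    replace (- IZR k * - a) with (IZR k * a) in Hn by ring.
    replace (- IZR k * - b) with (IZR k * b) in Hn by ring.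
    rewrite <- (Cconj_expi a), <- (Cconj_expi b) in Hn.
    rewrite <- (Cmod_conj (expi a - expi b)), Cminus_conj, opp_IZR. exact Hn.
Qed.

(** The squared distance is [2 (1 + cos x) / (13 - 12 cos x)], increasing in [cos x]; at
    [cos x = -1/2] it equals 1/19, just below [0.23^2]. *)
Lemma expi_psi_plus_one x : cos x <= - / 2 -> Cmod (expi (psi x) - expi PI)%C <= 23 / 100.
Proof.
  intros Hx. destruct (psi_cos_sin x) as [H1 H2]. assert (Hd := den_pos x). assert (Hs := sin_sqr x).
  apply Rsqr_incr_0_var; [|lra]. unfold Cmod. rewrite Rsqr_sqrt by nra. unfold expi.
  simpl. rewrite H1, H2, cos_PI, sin_PI. generalize (COS_bound x). intros Hb.
  set (s := sin x) in *. set (k := cos x) in *.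
  replace (((13 * k - 12) / (13 - 12 * k) + - -1) * (((13 * k - 12) / (13 - 12 * k) + - -1) * 1) +
    (5 * s / (13 - 12 * k) + - 0) * ((5 * s / (13 - 12 * k) + - 0) * 1)) with
    (((1 + k) * (1 + k) + 25 * (s * s)) / ((13 - 12 * k) * (13 - 12 * k))) by (field; lra).
  rewrite Hs. replace ((1 + k) * (1 + k) + 25 * (1 - k * k)) with (2 * (1 + k) * (13 - 12 * k)) by ring.
  replace (2 * (1 + k) * (13 - 12 * k) / ((13 - 12 * k) * (13 - 12 * k))) with
    (2 * (1 + k) / (13 - 12 * k)) by (field; lra).
  unfold Rsqr. apply Rmult_le_reg_r with (13 - 12 * k); [lra|].
  unfold Rdiv at 1. rewrite Rmult_assoc, Rinv_l by lra. lra.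
Qed.

Lemma ser_diff a y z S : geo a -> asum (fun k => RtoC (IZR k) * a k)%C S ->
  Cmod (ser a y - ser a z)%C <= S * Cmod (expi y - expi z)%C.
Proof.
  intros G HS. destruct (geo_asum _ G) as [A HA].
  eapply is_tsum_bound; [apply is_tsum_minus; eapply is_ser; exact HA|].
  intros n. eapply Rle_trans; [|apply Rmult_le_compat_r; [apply Cmod_ge_0|apply (HS n)]].
  rewrite Rmult_comm, <- zs_scal. apply zs_le. intros k _.
  replace (a k * expi (IZR k * y) - a k * expi (IZR k * z))%C with
    (a k * (expi (IZR k * y) - expi (IZR k * z)))%C by ring.
  rewrite !Cmod_mult, Cmod_R, <- abs_IZR. generalize (expi_diff k y z) (Cmod_ge_0 (a k)). nra.
Qed.

Lemma psi_0 : psi 0 = 0.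
Proof. generalize (psi_opp 0). rewrite Ropp_0. lra. Qed.

Lemma wave_iter n T x : periodic T wave -> wave (x + INR n * T) = wave x.
Proof.
  intros H. induction n as [|n IH].
  - simpl. f_equal. ring.
  - rewrite S_INR. replace (x + (INR n + 1) * T) with (x + INR n * T + T) by ring. rewrite H. exact IH.
Qed.

(** Since [n <= 2 j + 1] and [j >= 1] for [j = n / 2], the ratio [2 j / n] is at least 2/3, with
    equality at [n = 3]. *)
Lemma half_period n : (2 <= n)%nat -> cos (INR (n / 2) * (2 * PI / INR n)) <= - / 2.
Proof.
  intros Hn. assert (HP := PI_RGT_0).
  assert (Hc : cos (PI - PI / 3) = - / 2).
  { rewrite cos_minus, cos_PI, sin_PI, cos_PI3. lra. }
  rewrite <- Hc.
  assert (H1 : (1 <= n / 2)%nat) by (apply Nat.div_le_lower_bound; lia).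
  assert (H2 : (2 * (n / 2) <= n <= 2 * (n / 2) + 1)%nat).
  { generalize (Nat.div_mod_eq n 2) (Nat.mod_upper_bound n 2). lia. }
  set (j := (n / 2)%nat) in *. apply le_INR in H1. destruct H2 as [H2 H3].
  apply le_INR in H2, H3. rewrite plus_INR in H3. rewrite mult_INR in H2, H3. simpl in H1, H2, H3.
  assert (E : INR j * (2 * PI / INR n) = PI * (2 * INR j / INR n)) by (field; lra).
  assert (B : 2 / 3 <= 2 * INR j / INR n <= 1).
  { split; apply Rmult_le_reg_r with (INR n); try lra;
    unfold Rdiv; rewrite ?Rmult_assoc, ?Rinv_l; lra. }
  (* The available monotonicity of the cosine is strict, and equality does occur for [n = 3]. *)
  rewrite E. destruct (Req_dec (PI * (2 * INR j / INR n)) (PI - PI / 3)) as [->|Hne]; [lra|].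
  left. apply cos_decreasing_1; try nra.
Qed.

Section Aperiodic.

Variables (a b S : R).
Hypothesis W0 : Re (ser Wseq 0) <= a.
Hypothesis Wpi : b <= Re (ser Wseq PI).
Hypothesis WS : asum (fun k => RtoC (IZR k) * Wseq k)%C S.
Hypothesis gap : a + S * (23 / 100) < b.

Lemma wave_gap x : cos x <= - / 2 -> wave 0 < wave x.
Proof.
  intros Hx.
  assert (E0 : c + wave 0 <= a).
  { change (c + wave 0) with (Re (RtoC (c + wave 0))). rewrite wave_W, Rmult_0_r, psi_0. exact W0. }
  assert (E1 : b - S * (23 / 100) <= c + wave x).
  { change (c + wave x) with (Re (RtoC (c + wave x))). rewrite wave_W, Rmult_1_l.
    generalize (ser_diff Wseq (psi x) PI S Wgeo WS) (expi_psi_plus_one x Hx) (asum_nonneg _ _ WS).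
    generalize (re_le_Cmod (ser Wseq (psi x) - ser Wseq PI)%C). intros H1 H2 H3 H4.
    change (Re (ser Wseq (psi x) - ser Wseq PI)%C) with (Re (ser Wseq (psi x)) - Re (ser Wseq PI)) in H1.
    assert (S * Cmod (expi (psi x) - expi PI)%C <= S * (23 / 100)) by (apply Rmult_le_compat_l; assumption).
    apply Rabs_le_between in H1. lra. }
  lra.
Qed.

Lemma wave_aperiodic n : (2 <= n)%nat -> ~ periodic (2 * PI / INR n) wave.
Proof.
  intros Hn Hp. pose proof (wave_iter (n / 2) _ 0 Hp) as E.
  pose proof (wave_gap _ (half_period n Hn)) as G. rewrite Rplus_0_l in E. lra.
Qed.

Lemma wave_nonzero : exists x, wave x <> 0.
Proof.
  destruct (Req_dec (wave 0) 0) as [H|H]; [|exists 0; exact H].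
  exists PI. generalize (wave_gap PI). rewrite cos_PI. lra.
Qed.

End Aperiodic.

End Wave.

(** * The eigenfunction *)

(** Unlike the sign function this is 1 at 0: the prefactor [e^{ix}] moves the term of index 0 to the
    modes at least 1, so it belongs to the positive half. *)
Definition sig (k : Z) : R := if (k <? 0)%Z then -1 else 1.

(** The symbol of [f |-> f' / (3 i)] once [pre3] is divided out: [D] acting on [k G_k], plus
    multiplication by [17/15 + 6/5 E], where 17/15 is 1/3 from [e^{ix}] and 4/5 from the other
    factor. The indices -1 and 0 are not coupled in either direction, so the two halves are
    preserved. *)
Definition gam (G : Z -> C) (k : Z) : C :=
  (RtoC ((39 * IZR k + 17) / 15) * G k + RtoC (18 * IZR k / 15) * G (k - 1)%Z
   + RtoC (18 * (IZR k + 1) / 15) * G (k + 1)%Z)%C.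

Definition up3 (G : Z -> C) (k : Z) : C := (G k + RtoC (2 / 3) * G (k - 1)%Z)%C.

Definition shf (j : Z) (a : Z -> C) (k : Z) : C := a (k - j)%Z.

Lemma geo_shf j a : geo a -> geo (shf j a).
Proof.
  intros (t & A & Ht & H). exists t, (wt t j * A). split; [exact Ht|]. intros n.
  eapply Rle_trans; [|apply Rmult_le_compat_l; [apply Rlt_le, wt_pos|apply (H (n + Z.abs_nat j)%nat)]].
  eapply Rle_trans; [|apply Rmult_le_compat_l; [apply Rlt_le, wt_pos|
    apply (zs_shift_le (fun k => wt t k * Cmod (a k)) n j), wt_Cmod_pos]].
  rewrite <- zs_scal. apply zs_le. intros k _. unfold shf.
  rewrite <- Rmult_assoc. apply Rmult_le_compat_r; [apply Cmod_ge_0|]. apply wt_sub. lra.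
Qed.

Lemma ser_shf j a A y : asum a A -> ser (shf j a) y = (expi (IZR j * y) * ser a y)%C.
Proof.
  intros HA. apply is_tsum_unique.
  pose proof (is_tsum_shift _ _ _ j (asum_ser a A y HA) (is_ser a A y HA)) as H.
  apply (is_tsum_scal (expi (IZR j * y))) in H.
  eapply is_tsum_ext; [|exact H]. intros k. cbn beta. unfold shf.
  replace (IZR k * y) with (IZR j * y + IZR (k - j) * y) by (rewrite minus_IZR; ring).
  rewrite expi_plus. ring.
Qed.

Lemma geo_up3 a : geo a -> geo (up3 a).
Proof. intros H. apply geo_plus; [exact H|]. apply geo_scal. apply (geo_shf 1 a H). Qed.

Lemma tw_up3 a x : geo a -> tw 1 3 (up3 a) x = (pre3 x * ser a (psi (IZR 3 * x)))%C.
Proof.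
  intros H. destruct (geo_asum _ H) as [A HA]. destruct (geo_asum _ (geo_shf 1 a H)) as [B HB].
  destruct (geo_asum _ (geo_scal (RtoC (2 / 3)) _ (geo_shf 1 a H))) as [B' HB'].
  unfold tw. rewrite (ser_ext (up3 a) (fun k => a k + RtoC (2 / 3) * shf 1 a k)%C) by reflexivity.
  rewrite (ser_plus _ _ _ _ _ HA HB'), (ser_scal _ _ _ _ HB), (ser_shf 1 a A _ HA).
  unfold pre3. ring.
Qed.

Lemma nxt_up3 G k : nxt 1 3 (up3 G) k = (3 * Ci * up3 (gam G) k)%C.
Proof.
  unfold nxt. rewrite conv_Dseq. unfold dk, up3, gam.
  replace (k + 1 - 1)%Z with k by lia. replace (k - 1 + 1)%Z with k by lia.
  rewrite !minus_IZR, !plus_IZR. simpl (IZR 1). 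
  set (g0 := G k). set (g1 := G (k - 1)%Z). set (g2 := G (k - 1 - 1)%Z). set (g3 := G (k + 1)%Z).
  apply C_eq; simpl; unfold Re, Im; field.
Qed.

Lemma geo_gam G : geo G -> geo (gam G).
Proof.
  intros H.
  assert (Hk : forall q a, geo a -> geo (fun k => RtoC (q * IZR k) * a k)%C).
  { intros q a Ha. apply (geo_ext (fun k => RtoC q * (RtoC (IZR k) * a k))%C).
    - intros k. rewrite RtoC_mult. ring.
    - apply geo_scal, geo_mul_k, Ha. }
  apply (geo_ext (fun k => (RtoC (39 / 15 * IZR k) * G k + RtoC (17 / 15) * G k) +
     (RtoC (18 / 15 * IZR k) * shf 1 G k) + ((RtoC (18 / 15 * IZR k) * shf (-1) G k) +
      RtoC (18 / 15) * shf (-1) G k))%C).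
  - intros k. unfold gam, shf. replace (k - -1)%Z with (k + 1)%Z by lia.
    replace ((39 * IZR k + 17) / 15) with (39 / 15 * IZR k + 17 / 15) by field.
    replace (18 * IZR k / 15) with (18 / 15 * IZR k) by field.
    replace (18 * (IZR k + 1) / 15) with (18 / 15 * IZR k + 18 / 15) by field.
    rewrite !RtoC_plus. ring.
  - assert (S1 := geo_shf 1 G H). assert (S2 := geo_shf (-1) G H).
    repeat apply geo_plus; try (apply Hk; assumption); apply geo_scal; assumption.
Qed.

Definition nonneg (a : Z -> C) (k : Z) : C := if (k <? 0)%Z then RtoC 0 else a k.

Lemma geo_nonneg a : geo a -> geo (nonneg a).
Proof.
  apply geo_dom. intros k. unfold nonneg. destruct (_ <? _)%Z; [|lra].
  rewrite Cmod_0. apply Cmod_ge_0.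
Qed.

Section Eigen.

Variables (c : R) (Y : Z -> C) (G : Z -> C) (nu : C).
Hypothesis Ygeo : geo Y.
Hypothesis Yeven : forall k, Y (- k)%Z = Y k.
Hypothesis Yreal : forall k, Im (Y k) = 0.
Hypothesis Ggeo : geo G.
Hypothesis Geq : forall k, conv (Wseq c Y) (gam G) k = ((RtoC (sig k) + nu) * G k)%C.
Hypothesis Gnz : ser (fun k => (RtoC (sig k) + nu) * G k)%C 0 <> RtoC 0.

Definition eigf : R -> C := tw 1 3 (up3 G).
Definition eigg : R -> C := tw 1 3 (nxt 1 3 (up3 G)).
Definition eigHf : R -> C := tw 1 3 (up3 (fun k => - Ci * RtoC (sig k) * G k)%C).
Definition eigHg : R -> C := tw 1 3 (nxt 1 3 (up3 (fun k => - Ci * RtoC (sig k) * G k)%C)).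

Lemma geo_sig : geo (fun k => - Ci * RtoC (sig k) * G k)%C.
Proof.
  apply geo_dom with G; [|exact Ggeo]. intros k.
  rewrite !Cmod_mult, Cmod_opp, Cmod_Ci, Cmod_R. apply Req_le. unfold sig.
  destruct (_ <? _)%Z; [rewrite Rabs_left by lra|rewrite Rabs_pos_eq by lra]; ring.
Qed.

Lemma eigf_der x : is_derC eigf x (eigg x).
Proof. apply is_derC_tw, geo_up3, Ggeo. Qed.

Lemma eigHf_der x : is_derC eigHf x (eigHg x).
Proof. apply is_derC_tw, geo_up3, geo_sig. Qed.

Lemma contC_eigg : contC eigg.
Proof. apply contC_tw, geo_nxt, geo_up3, Ggeo. Qed.

Lemma contC_eigHg : contC eigHg.
Proof. apply contC_tw, geo_nxt, geo_up3, geo_sig. Qed.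

(** The factor [3 Ci pre3] comes out because [r E D / (1 + r E) = (r E + r^2) / (1 - r^2)] for [r = 2/3]. *)
Lemma eigg_ser x : eigg x = (3 * Ci * pre3 x * ser (gam G) (psi (IZR 3 * x)))%C.
Proof.
  destruct (geo_asum _ (geo_up3 _ (geo_gam _ Ggeo))) as [A HA].
  unfold eigg, tw. rewrite (ser_ext _ (fun k => 3 * Ci * up3 (gam G) k)%C) by apply nxt_up3.
  rewrite (ser_scal _ _ _ _ HA).
  transitivity (3 * Ci * tw 1 3 (up3 (gam G)) x)%C; [unfold tw; ring|].
  rewrite (tw_up3 _ _ (geo_gam _ Ggeo)). ring.
Qed.

Lemma eigHf_split x : eigHf x =
  (- Ci * (pre3 x * ser (nonneg G) (psi (IZR 3 * x))) + Ci * (pre3 x * ser (negp G) (psi (IZR 3 * x))))%C.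
Proof.
  destruct (geo_asum _ (geo_nonneg _ Ggeo)) as [A HA].
  destruct (geo_asum _ (geo_negp _ Ggeo)) as [B HB].
  destruct (geo_asum _ (geo_scal (- Ci) _ (geo_nonneg _ Ggeo))) as [A' HA'].
  destruct (geo_asum _ (geo_scal Ci _ (geo_negp _ Ggeo))) as [B' HB'].
  unfold eigHf. rewrite (tw_up3 _ _ geo_sig).
  rewrite (ser_ext _ (fun k => - Ci * nonneg G k + Ci * negp G k)%C).
  - rewrite (ser_plus _ _ _ _ _ HA' HB'), (ser_scal _ _ _ _ HA), (ser_scal _ _ _ _ HB). ring.
  - intros k. unfold sig, nonneg, negp. destruct (Z.ltb_spec k 0).
    + replace (RtoC (-1)) with (- RtoC 1)%C by (apply C_eq; simpl; ring). ring.
    + ring.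
Qed.

Lemma eigf_split x : eigf x =
  (RtoC 0 + (pre3 x * ser (nonneg G) (psi (IZR 3 * x)) + pre3 x * ser (negp G) (psi (IZR 3 * x))))%C.
Proof.
  destruct (geo_asum _ (geo_nonneg _ Ggeo)) as [A HA].
  destruct (geo_asum _ (geo_negp _ Ggeo)) as [B HB].
  unfold eigf. rewrite (tw_up3 _ _ Ggeo).
  rewrite (ser_ext G (fun k => nonneg G k + negp G k)%C).
  - rewrite (ser_plus _ _ _ _ _ HA HB). ring.
  - intros k. unfold nonneg, negp. destruct (Z.ltb_spec k 0); ring.
Qed.

Lemma FZ_eigpos n : (n < 1)%Z -> FZ n (fun x => pre3 x * ser (nonneg G) (psi (IZR 3 * x)))%C.
Proof.
  intros Hn. apply (FZ_ser pre3 2); [apply contC_pre3|apply Cmod_pre3|apply geo_nonneg, Ggeo|].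
  intros k. unfold nonneg. destruct (Z.ltb_spec k 0); [left; reflexivity|right].
  apply FZ_pre3_pos; lia.
Qed.

Lemma FZ_eigneg n : (-2 < n)%Z -> FZ n (fun x => pre3 x * ser (negp G) (psi (IZR 3 * x)))%C.
Proof.
  intros Hn. apply (FZ_ser pre3 2); [apply contC_pre3|apply Cmod_pre3|apply geo_negp, Ggeo|].
  intros k. unfold negp. destruct (Z.ltb_spec k 0); [right|left; reflexivity].
  apply FZ_pre3_neg; lia.
Qed.

Lemma eigf_periodic : periodic (2 * PI) eigf.
Proof. intros x. exact (tw_periodic 1 3 _ x). Qed.

Lemma eigHf_periodic : periodic (2 * PI) eigHf.
Proof. intros x. exact (tw_periodic 1 3 _ x). Qed.

Lemma eigf_hilbert : is_hilbert eigf eigHf.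
Proof.
  split; [apply eigHf_periodic|]. split; [apply contC_continuous, contC_tw, geo_up3, geo_sig|].
  intros n.
  set (f1 := fun x => (pre3 x * ser (nonneg G) (psi (IZR 3 * x)))%C).
  set (f2 := fun x => (pre3 x * ser (negp G) (psi (IZR 3 * x)))%C).
  assert (C1 : contC f1).
  { apply (contC_ext (tw 1 3 (up3 (nonneg G)))); [intros; apply tw_up3, geo_nonneg, Ggeo|].
    apply contC_tw, geo_up3, geo_nonneg, Ggeo. }
  assert (C2 : contC f2).
  { apply (contC_ext (tw 1 3 (up3 (negp G)))); [intros; apply tw_up3, geo_negp, Ggeo|].
    apply contC_tw, geo_up3, geo_negp, Ggeo. }
  assert (C0 : contC (fun _ => RtoC 0)) by apply contC_const.
  rewrite (fourier_ext (fun x => - Ci * f1 x + Ci * f2 x)%C eigHf) by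
    (try (intros; symmetry; apply eigHf_split);
     apply contC_plus; (apply contC_mult; [apply contC_const|assumption])).
  rewrite (fourier_ext (fun x => RtoC 0 + (f1 x + f2 x))%C eigf) by
    (try (intros; symmetry; apply eigf_split); repeat (apply contC_plus; try assumption)).
  apply (fourier_split (fun _ => RtoC 0)); try assumption.
  - intros Hn. split; [apply FZ_zero|apply FZ_eigneg; lia].
  - intros Hn. split; [apply FZ_zero|apply FZ_eigpos; lia].
  - intros ->. apply FZ_plus; apply FZ_scal; [apply FZ_eigpos|apply FZ_eigneg]; lia.
Qed.

Lemma is_cint_of_FZ f : FZ 0 f -> is_cint f (RtoC 0).
Proof.
  intros H. unfold FZ, is_fc in H. rewrite Cmult_0_r in H.
  eapply is_cint_ext; [|exact H]. intros x. cbn beta. rewrite Rmult_0_l, Ropp_0, expi_0. ring.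
Qed.

(** The positive half has only modes at least 1 and the negative half only modes at most -2, so 0
    falls in the gap between them. *)
Lemma eigf_int : is_cint eigf (RtoC 0).
Proof.
  apply is_cint_of_FZ. eapply FZ_ext; [intros; symmetry; apply eigf_split|].
  apply FZ_plus; [apply FZ_zero|]. apply FZ_plus; [apply FZ_eigpos|apply FZ_eigneg]; lia.
Qed.

Lemma eigHf_int : is_cint eigHf (RtoC 0).
Proof.
  apply is_cint_of_FZ. eapply FZ_ext; [intros; symmetry; apply eigHf_split|].
  apply FZ_plus; apply FZ_scal; [apply FZ_eigpos|apply FZ_eigneg]; lia.
Qed.

Lemma eigg_int : is_cint eigg (RtoC 0).
Proof.
  pose proof (is_cint_derC _ _ eigf_der contC_eigg) as H.
  replace (RtoC 0) with (eigf PI - eigf (- PI)%R)%C; [exact H|].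
  rewrite <- (eigf_periodic (- PI)). replace (- PI + 2 * PI) with PI by ring. ring.
Qed.

Lemma wave3_W x : RtoC (c / 3 + rescale3 (wave Y) x) =
  (RtoC (/ 3) * ser (Wseq c Y) (psi (IZR 3 * x)))%C.
Proof.
  pose proof (wave_W c Y Ygeo Yeven Yreal (3 * x)) as H. rewrite Rmult_1_l in H.
  rewrite <- H, <- RtoC_mult. f_equal. unfold rescale3. field.
Qed.

(** The 1/3 of the rescaled wave cancels the 3 produced by differentiating in [3 x]. What is left,
    divided by [pre3], is [i] times [W * gam G - sig G], which [Geq] identifies. *)
Lemma eig_pointwise x :
  (RtoC (c / 3 + rescale3 (wave Y) x) * eigg x + eigHf x)%C = (Ci * nu * eigf x)%C.
Proof.
  destruct (geo_asum _ (Wgeo c Y Ygeo)) as [A HA].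
  destruct (geo_asum _ (geo_gam _ Ggeo)) as [B HB].
  destruct (geo_asum _ geo_sig) as [S HS].
  destruct (geo_asum _ Ggeo) as [S2 HS2].
  destruct (geo_asum _ (geo_scal (Ci * nu) _ Ggeo)) as [S3 HS3].
  rewrite wave3_W, eigg_ser. unfold eigHf, eigf. rewrite (tw_up3 _ _ geo_sig), (tw_up3 _ _ Ggeo).
  transitivity (pre3 x * (RtoC (/ 3) * 3) * (Ci * (ser (Wseq c Y) (psi (IZR 3 * x)) *
     ser (gam G) (psi (IZR 3 * x)))) +
     pre3 x * ser (fun k => - Ci * RtoC (sig k) * G k) (psi (IZR 3 * x)))%C; [ring|].
  rewrite <- (ser_conv _ _ _ _ _ HA HB).
  rewrite <- RtoC_mult. replace (/ 3 * 3) with 1 by field.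
  rewrite (ser_ext (conv (Wseq c Y) (gam G)) (fun k => Ci * (- Ci * RtoC (sig k) * G k) +
      - Ci * (Ci * nu * G k))%C).
  - destruct (geo_asum _ (geo_scal Ci _ geo_sig)) as [S4 HS4].
    destruct (geo_asum _ (geo_scal (- Ci) _ (geo_scal (Ci * nu) _ Ggeo))) as [S5 HS5].
    rewrite (ser_plus _ _ _ _ _ HS4 HS5), (ser_scal _ _ _ _ HS), (ser_scal _ _ _ _ HS3),
      (ser_scal _ _ _ _ HS2).
    set (s1 := ser _ _). set (s2 := ser G _).
    transitivity (pre3 x * ((Ci * Ci + 1) * s1 + - (Ci * Ci) * (Ci * nu) * s2))%C; [ring|].
    replace (Ci * Ci)%C with (- RtoC 1)%C by (apply C_eq; simpl; ring). ring.
  - intros k. rewrite Geq.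
    transitivity (- (Ci * Ci) * ((RtoC (sig k) + nu) * G k))%C; [|ring].
    replace (Ci * Ci)%C with (- RtoC 1)%C by (apply C_eq; simpl; ring). ring.
Qed.

(** At 0 the sequence equation equates [Gnz] with the product of the values of [W] and [gam G], so
    the latter cannot vanish, and [pre3 0 = 5/3]. Testing the right-hand side avoids the factor [k]
    in [gam]. One value of [f'] settles the nontriviality of both eigenfunctions. *)
Lemma eigg_0 : eigg 0 <> RtoC 0.
Proof.
  intros E. apply Gnz.
  destruct (geo_asum _ (Wgeo c Y Ygeo)) as [A HA].
  destruct (geo_asum _ (geo_gam _ Ggeo)) as [B HB].
  rewrite (ser_ext _ (conv (Wseq c Y) (gam G))) by (intros; symmetry; apply Geq).
  rewrite (ser_conv _ _ _ _ _ HA HB).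
  rewrite eigg_ser, Rmult_0_r, psi_0 in E.
  assert (Hp : pre3 0 = RtoC (5 / 3)).
  { unfold pre3. rewrite !Rmult_0_r, psi_0, Rmult_0_r, expi_0. apply C_eq; simpl; field. }
  rewrite Hp in E.
  assert (Hc : (3 * Ci * RtoC (5 / 3))%C <> RtoC 0).
  { intros H. apply (f_equal Im) in H. simpl in H. lra. }
  destruct (Ceq_dec (ser (gam G) 0) (RtoC 0)) as [->|Hn]; [ring|].
  exfalso. exact (Cmult_neq_0 _ _ Hc Hn E).
Qed.

Lemma eigf_nonzero : exists x, eigf x <> RtoC 0.
Proof.
  apply Classical_Pred_Type.not_all_ex_not. intros H. apply eigg_0.
  rewrite <- (is_derC_unique _ _ _ (eigf_der 0)). apply is_derC_unique.
  apply (is_derC_ext (fun _ => RtoC 0)); [intros; symmetry; apply H|apply is_derC_const].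
Qed.

Lemma DeriveC_eigf x : DeriveC eigf x = eigg x.
Proof. apply is_derC_unique, eigf_der. Qed.

(** The pointwise identity expresses [v^3 f'] through [f], [H f] and [f'], and each of these
    integrates to 0. *)
Lemma eig_mean : RIntC (fun y => RtoC (rescale3 (wave Y) y) * DeriveC eigf y)%C (- PI) PI = RtoC 0.
Proof.
  apply is_cint_unique.
  pose proof (is_cint_plus _ _ _ _ (is_cint_scal (Ci * nu)%C _ _ eigf_int)
    (is_cint_plus _ _ _ _ (is_cint_scal (- (1))%C _ _ eigHf_int)
       (is_cint_scal (- RtoC (c / 3))%C _ _ eigg_int))) as H.
  replace (RtoC 0) with (Ci * nu * 0 + (- (1) * 0 + - RtoC (c / 3) * 0))%C by ring.
  eapply is_cint_ext; [|exact H]. intros x. cbn beta. rewrite DeriveC_eigf, <- eig_pointwise, RtoC_plus.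
  ring.
Qed.

Lemma eigenpair_L : eigenpair (opL c (rescale3 (wave Y))) (Ci * nu)%C eigf.
Proof.
  split; [|split].
  - split; [apply smoothC_tw, geo_up3, Ggeo|apply eigf_periodic].
  - apply eigf_nonzero.
  - exists eigHf. split; [apply eigf_hilbert|]. intros x.
    rewrite eig_mean, DeriveC_eigf, <- eig_pointwise. ring.
Qed.

Lemma smoothC_ext f g : (forall x, f x = g x) -> smoothC f -> smoothC g.
Proof.
  intros H [S1 S2]. split; intros n x.
  - apply (ex_derive_n_ext (fun x => Re (f x))); [intros t; rewrite H; reflexivity|apply S1].
  - apply (ex_derive_n_ext (fun x => Im (f x))); [intros t; rewrite H; reflexivity|apply S2].
Qed.

Lemma eigenpair_A : eigenpair (opA c (rescale3 (wave Y))) (Ci * nu)%C (DeriveC eigf).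
Proof.
  split; [|split].
  - split.
    + apply (smoothC_ext eigg); [intros; symmetry; apply DeriveC_eigf|].
      apply smoothC_tw, geo_nxt, geo_up3, Ggeo.
    + intros x. rewrite !DeriveC_eigf. exact (tw_periodic 1 3 _ x).
  - exists 0. rewrite DeriveC_eigf. apply eigg_0.
  - exists eigHg. split.
    + apply (is_hilbert_ext eigg); [intros; symmetry; apply DeriveC_eigf|apply contC_eigg|].
      apply (is_hilbert_derC eigf _ eigHf); [apply eigf_der|apply contC_eigg|apply eigf_periodic|
        apply eigHf_der|apply contC_eigHg|apply eigf_hilbert].
    + intros x. rewrite DeriveC_eigf.
      assert (Hg : is_derC eigg x (DeriveC eigg x)).
      { pose proof (is_derC_tw 1 3 _ x (geo_nxt 1 3 _ (geo_up3 _ Ggeo))) as H.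
        rewrite (is_derC_unique eigg x _ H). exact H. }
      assert (H1 : is_derC (DeriveC eigf) x (DeriveC eigg x)).
      { apply (is_derC_ext eigg); [intros; symmetry; apply DeriveC_eigf|exact Hg]. }
      (* Rather than differentiating the product, the pointwise identity is solved for [v^3 f'] and
         its right-hand side is differentiated; the eigenvalue relation for [f'] is then
         immediate. *)
      assert (H2 : is_derC (fun y => RtoC (rescale3 (wave Y) y) * DeriveC eigf y)%C x
         (Ci * nu * eigg x + (- (1) * eigHg x + - RtoC (c / 3) * DeriveC eigg x))%C).
      { apply (is_derC_ext (fun x => Ci * nu * eigf x + (- (1) * eigHf x + - RtoC (c / 3) * eigg x))%C).
        - intros t. rewrite DeriveC_eigf, <- eig_pointwise, RtoC_plus. ring.
        - apply is_derC_plus; [apply is_derC_scal, eigf_der|].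
          apply is_derC_plus; apply is_derC_scal; [apply eigHf_der|exact Hg]. }
      rewrite (is_derC_unique _ _ _ H1), (is_derC_unique _ _ _ H2). ring.
Qed.

End Eigen.

(** * Linear bound for the preconditioned operator *)

(** In a weighted summable space an operator is bounded by its largest weighted column sum; this is
    why the certificates below inspect columns. *)
Lemma col_bound tau (N : Z -> Z -> C) x y kap B : 0 <= tau -> 0 <= kap ->
  (forall i, is_tsum (fun j => N i j * x j)%C (y i)) ->
  (forall j n, zs (fun i => wt tau i * Cmod (N i j)) n <= kap * wt tau j) ->
  nrm tau x B -> nrm tau y (kap * B).
Proof.
  intros Ht Hk HN Hc Hx n.
  assert (Hl : is_lim_seq (fun M => zs (fun i => wt tau i * Cmod (zsC (fun j => N i j * x j)%C M)) n)
                 (zs (fun i => wt tau i * Cmod (y i)) n)).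
  { apply (zs_lim (fun M i => wt tau i * Cmod (zsC (fun j => N i j * x j)%C M))). intros i.
    apply (is_lim_seq_scal_l _ (wt tau i) (Cmod (y i))). destruct (HN i) as [H1 H2].
    apply Cmod_lim; assumption. }
  refine (is_lim_seq_le _ (fun _ => kap * B) _ (kap * B) _ Hl (is_lim_seq_const _)).
  intros M. eapply Rle_trans.
  - apply zs_le. intros i _. apply Rmult_le_compat_l; [apply Rlt_le, wt_pos|]. apply Cmod_zsC.
  - rewrite (zs_ext _ (fun i => zs (fun j => wt tau i * Cmod (N i j * x j)%C) M))
      by (intros; rewrite zs_scal; reflexivity).
    rewrite zs_swap. eapply Rle_trans; [|apply Rmult_le_compat_l; [exact Hk|apply (Hx M)]].
    rewrite <- zs_scal. apply zs_le. intros j _.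
    rewrite (zs_ext _ (fun i => Cmod (x j) * (wt tau i * Cmod (N i j)))).
    + rewrite zs_scal. generalize (Hc j n) (Cmod_ge_0 (x j)). nra.
    + intros i _. rewrite Cmod_mult. ring.
Qed.

Lemma is_tsum_delta c p : is_tsum (fun j => if (j =? p)%Z then c else RtoC 0) c.
Proof.
  pose proof (is_tsum_finite (fun j => if (j =? p)%Z then c else RtoC 0) (Z.abs_nat p)) as H.
  rewrite zsC_delta in H by lia. apply H.
  intros j Hj. destruct (Z.eqb_spec j p); [lia|reflexivity].
Qed.

Definition low (m : nat) (k : Z) : bool := (Z.abs k <=? Z.of_nat m)%Z.

Definition Aop (m : nat) (S : Z -> Z -> C) (x : Z -> C) (k : Z) : C :=
  if low m k then zsC (fun j => S k j * x j)%C m else x k.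

Lemma Aop_nrm tau m S x al w B : 0 <= tau -> exp (tau * INR m) <= w -> 1 <= al ->
  (forall j, zs (fun k => Cmod (S k j)) m <= al) ->
  nrm tau x B -> nrm tau (Aop m S x) (w * al * B).
Proof.
  intros Ht Hw Hal HS Hx.
  assert (Hw1 : 1 <= w).
  { eapply Rle_trans; [|exact Hw]. rewrite <- exp_0 at 1. apply exp_le_mono.
    apply Rmult_le_pos; [exact Ht|apply pos_INR]. }
  apply (col_bound tau (fun i j => if low m i then (if low m j then S i j else RtoC 0)
     else (if (j =? i)%Z then RtoC 1 else RtoC 0)) x); [exact Ht|nra| | |exact Hx].
  - intros i. unfold Aop. destruct (low m i) eqn:Ei.
    + rewrite (zsC_ext _ (fun j => (if low m j then S i j else RtoC 0) * x j)%C).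
      * apply is_tsum_finite. intros j Hj. unfold low. destruct (Z.leb_spec (Z.abs j) (Z.of_nat m)); [lia|ring].
      * intros j Hj. unfold low. destruct (Z.leb_spec (Z.abs j) (Z.of_nat m)); [ring|lia].
    + apply (is_tsum_ext (fun j => if (j =? i)%Z then x i else RtoC 0)).
      * intros j. destruct (Z.eqb_spec j i) as [->|]; ring.
      * apply is_tsum_delta.
  - intros j n. destruct (low m j) eqn:Ej.
    + apply Rle_trans with (w * zs (fun k => Cmod (S k j)) m).
      2:{ generalize (wt_ge_1 tau j Ht) (HS j) (zs_pos (fun k => Cmod (S k j)) m (fun _ => Cmod_ge_0 _)).
          intros H1 H2 H3. assert (w * zs (fun k => Cmod (S k j)) m <= w * al) by nra. assert (0 <= w * al) by nra. nra. }
      rewrite <- zs_scal.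
      assert (Hb : forall i, wt tau i * Cmod (if low m i then S i j else if (j =? i)%Z then RtoC 1 else RtoC 0)
                 <= if low m i then w * Cmod (S i j) else 0).
      { intros i. destruct (low m i) eqn:Ei.
        - apply Rmult_le_compat_r; [apply Cmod_ge_0|]. eapply Rle_trans; [|exact Hw].
          unfold wt. rewrite INR_IZR_INZ. apply exp_le_of; [exact Ht|]. apply Z.leb_le, Ei.
        - destruct (Z.eqb_spec j i) as [->|]; [rewrite Ei in Ej; discriminate|].
          rewrite Cmod_0, Rmult_0_r. lra. }
      eapply Rle_trans; [apply zs_le; intros i _; apply Hb|].
      eapply Rle_trans; [apply (zs_mono _ n (n + m)); [|lia]|].
      * intros i. destruct (low m i); [|lra]. apply Rmult_le_pos; [lra|apply Cmod_ge_0].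
      * rewrite (zs_finite _ m (n + m)).
        -- apply zs_le. intros i Hi. unfold low. destruct (Z.leb_spec (Z.abs i) (Z.of_nat m)); [lra|lia].
        -- intros i Hi. unfold low. destruct (Z.leb_spec (Z.abs i) (Z.of_nat m)); [lia|reflexivity].
        -- lia.
    + rewrite (zs_ext _ (fun i => if (i =? j)%Z then wt tau j else 0)).
      * apply Rle_trans with (zs (fun i => if (i =? j)%Z then wt tau j else 0) (n + Z.abs_nat j)).
        -- apply zs_mono; [|lia]. intros i. destruct (Z.eqb_spec i j); [apply Rlt_le, wt_pos|lra].
        -- rewrite zs_delta by lia. generalize (wt_pos tau j). intros Hp.
           assert (1 <= w * al) by nra. nra.
      * intros i _. destruct (Z.eqb_spec i j) as [->|Hij].
        -- rewrite Ej, Z.eqb_refl, Cmod_R, Rabs_R1. ring.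
        -- destruct (low m i) eqn:Ei; [|destruct (Z.eqb_spec j i); [congruence|]]; rewrite Cmod_0; ring.
Qed.

Section Precond.

Variables (m NB na NC : nat) (p : Z) (s a cc u t o : Z -> C).

(** Common form of both problems: the linearization is the identity minus [Kop], up to defects
    handled as perturbations. The factor [t], of size about [1 / |k|], makes it small on high modes.
    The rank-one column [p] carries the eigenvalue, or the mean condition of the wave, and [o] can
    mask this entry elsewhere. *)
Definition Kop (d : Z -> C) (i : Z) : C :=
  (u i * conv s (fun k => o k * d k) i
   - conv a (fun k => t k * conv s (fun j => o j * d j) k) i + cc i * d p)%C.

Definition Kmat (i j : Z) : C :=
  (o j * (u i * s (i - j)%Z - zsC (fun n => a n * (t (i - n)%Z * s (i - n - j)%Z)) na)
   + if (j =? p)%Z then cc i else RtoC 0)%C.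

Hypothesis s_fin : fin s NB.
Hypothesis a_fin : fin a na.
Hypothesis o_le : forall k, Cmod (o k) <= 1.

Lemma fin_asum b N : fin b N -> asum b (zs (fun k => Cmod (b k)) N).
Proof.
  intros H n. eapply Rle_trans; [apply (zs_mono _ n (n + N)); [intros; apply Cmod_ge_0|lia]|].
  rewrite (zs_finite _ N (n + N)); [lra| |lia]. intros k Hk. rewrite (H k Hk). apply Cmod_0.
Qed.

Lemma Kop_tsum d D i : asum d D -> is_tsum (fun j => Kmat i j * d j)%C (Kop d i).
Proof.
  intros Hd. set (e := fun k => (o k * d k)%C).
  assert (He : asum e D).
  { intros n. eapply Rle_trans; [|apply (Hd n)]. apply zs_le. intros k _. unfold e.
    rewrite Cmod_mult. generalize (o_le k) (Cmod_ge_0 (d k)). nra. }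
  assert (Hs := fin_asum s NB s_fin).
  assert (Hc : forall i, is_tsum (fun j => e j * s (i - j)%Z)%C (conv s e i)).
  { intros k. rewrite (conv_comm _ _ _ _ k Hs He). eapply is_conv; eassumption. }
  unfold Kop. fold e. rewrite (conv_finite_l a _ na i a_fin).
  pose proof (is_tsum_minus _ _ _ _ (is_tsum_scal (u i) _ _ (Hc i))
    (is_tsum_zsC (fun n j => (a n * (t (i - n)%Z * (e j * s (i - n - j)%Z)))%C) _ na
      (fun n => is_tsum_scal (a n) _ _ (is_tsum_scal (t (i - n)%Z) _ _ (Hc (i - n)%Z))))) as H.
  assert (Hp : is_tsum (fun j => if (j =? p)%Z then (cc i * d p)%C else RtoC 0) (cc i * d p)%C) by apply is_tsum_delta.
  eapply is_tsum_ext; [|apply (is_tsum_plus _ _ _ _ H Hp)]. intros j. cbn beta. unfold Kmat, e.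
  rewrite (zsC_ext (fun n => a n * (t (i - n)%Z * (o j * d j * s (i - n - j)%Z)))%C
    (fun n => (o j * d j) * (a n * (t (i - n)%Z * s (i - n - j)%Z)))%C) by (intros; ring).
  rewrite zsC_scal. destruct (Z.eqb_spec j p) as [->|]; ring.
Qed.

Variables (Phi anorm k2 : R).
Hypothesis u_le : forall k, Cmod (u k) <= Phi * Cmod (t k).
Hypothesis a_le : zs (fun k => Cmod (a k)) na <= anorm.

Definition Kabs (i j : Z) : R :=
  Phi * (Cmod (t i) * Cmod (s (i - j)%Z)) +
  zs (fun n => Cmod (a n) * (Cmod (t (i - n)%Z) * Cmod (s (i - n - j)%Z))) na.

Lemma Kmat_abs i j : Cmod (Kmat i j) <= Cmod (o j) * Kabs i j + if (j =? p)%Z then Cmod (cc i) else 0.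
Proof.
  unfold Kmat. eapply Rle_trans; [apply Cmod_triangle|].
  apply Rplus_le_compat; [|destruct (_ =? _)%Z; [|rewrite Cmod_0]; lra].
  rewrite Cmod_mult. apply Rmult_le_compat_l; [apply Cmod_ge_0|].
  unfold Cminus. eapply Rle_trans; [apply Cmod_triangle|]. unfold Kabs. apply Rplus_le_compat.
  - rewrite Cmod_mult, <- Rmult_assoc. apply Rmult_le_compat_r; [apply Cmod_ge_0|apply u_le].
  - rewrite Cmod_opp. eapply Rle_trans; [apply Cmod_zsC|]. apply zs_le. intros n _.
    rewrite !Cmod_mult. lra.
Qed.

Lemma Phi_t_nonneg k : 0 <= Phi * Cmod (t k).
Proof. eapply Rle_trans; [apply Cmod_ge_0|apply u_le]. Qed.

(** Row sums are regrouped by the index at which [t] is evaluated, so that one window of [s] around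
    the column remains. The weight [chi] is 1 for a full column sum and [high] for the part that
    leaks out of the low block. *)
Lemma Kabs_sum (chi : Z -> R) j n : (forall k, 0 <= chi k) ->
  zs (fun i => chi i * Kabs i j) n <=
  zs (fun l => (Phi * chi l + zs (fun q => Cmod (a q) * chi (l + q)%Z) na) *
               (Cmod (t l) * Cmod (s (l - j)%Z))) (n + na).
Proof.
  intros Hc.
  assert (P1 : forall l, 0 <= Cmod (t l) * Cmod (s (l - j)%Z)).
  { intros l. apply Rmult_le_pos; apply Cmod_ge_0. }
  assert (P2 : forall l, 0 <= Phi * (Cmod (t l) * Cmod (s (l - j)%Z))).
  { intros l. rewrite <- Rmult_assoc. apply Rmult_le_pos; [apply Phi_t_nonneg|apply Cmod_ge_0]. }
  unfold Kabs.
  rewrite (zs_ext _ (fun i => chi i * (Phi * (Cmod (t i) * Cmod (s (i - j)%Z))) +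
    zs (fun q => Cmod (a q) * (chi i * (Cmod (t (i - q)%Z) * Cmod (s (i - q - j)%Z)))) na)).
  2:{ intros i _. rewrite Rmult_plus_distr_l. f_equal. rewrite <- zs_scal. apply zs_ext. intros; ring. }
  rewrite zs_plus, zs_swap.
  assert (E : zs (fun l => (Phi * chi l + zs (fun q => Cmod (a q) * chi (l + q)%Z) na) *
               (Cmod (t l) * Cmod (s (l - j)%Z))) (n + na) =
    zs (fun l => chi l * (Phi * (Cmod (t l) * Cmod (s (l - j)%Z))) +
      zs (fun q => Cmod (a q) * (chi (l + q)%Z * (Cmod (t l) * Cmod (s (l - j)%Z)))) na) (n + na)).
  { apply zs_ext. intros l _. rewrite Rmult_plus_distr_r. f_equal; [ring|].
    rewrite Rmult_comm, <- zs_scal. apply zs_ext. intros; ring. }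
  rewrite E. clear E.
  rewrite zs_plus. apply Rplus_le_compat.
  - apply (zs_mono _ n (n + na)); [|lia]. intros l. apply Rmult_le_pos; auto.
  - rewrite (zs_swap _ (n + na)%nat). apply zs_le. intros q Hq. rewrite !zs_scal.
    apply Rmult_le_compat_l; [apply Cmod_ge_0|].
    set (g := fun l => chi (l + q)%Z * (Cmod (t l) * Cmod (s (l - j)%Z))).
    rewrite (zs_ext _ (fun i => g (i - q)%Z)).
    + assert (Hg : forall l, 0 <= g l) by (intros; apply Rmult_le_pos; auto).
      eapply Rle_trans; [apply (zs_shift_le g n q Hg)|]. apply zs_mono; [exact Hg|lia].
    + intros i _. unfold g. replace (i - q + q)%Z with i by lia. reflexivity.
Qed.

Lemma Kabs_far i j : (Z.of_nat (NB + na) < Z.abs (i - j))%Z -> Kabs i j = 0.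
Proof.
  intros H. unfold Kabs. rewrite (s_fin (i - j)%Z) by lia. rewrite Cmod_0.
  rewrite (zs_ext _ (fun _ => 0)); [rewrite zs_zero; ring|].
  intros q Hq. rewrite (s_fin (i - q - j)%Z) by lia. rewrite Cmod_0. ring.
Qed.

Lemma Kabs_nonneg i j : 0 <= Kabs i j.
Proof.
  unfold Kabs. apply Rplus_le_le_0_compat.
  - rewrite <- Rmult_assoc. apply Rmult_le_pos; [apply Phi_t_nonneg|apply Cmod_ge_0].
  - apply zs_pos. intros q. repeat apply Rmult_le_pos; apply Cmod_ge_0.
Qed.

Variables (tau w kap : R) (S : Z -> Z -> C) (h : Z -> R) (R' : Z -> Z -> C) (P : (Z -> C) -> Prop).
Hypothesis tau_pos : 0 <= tau.
Hypothesis p_low : (Z.abs p <= Z.of_nat m)%Z.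
Hypothesis cc_fin : fin cc NC.
Hypothesis w_exp : exp (tau * INR (m + NB + na + NC)) <= w.
Hypothesis k2_le : forall j, (Z.of_nat m < Z.abs j)%Z ->
  zs (fun n => Cmod (t (j + n)%Z) * Cmod (s n)) NB <= k2.
Hypothesis kapH : (Phi + anorm) * k2 <= kap.
Hypothesis Phi_pos : 0 <= Phi.

Definition high (k : Z) : R := if low m k then 0 else 1.

Hypothesis h_le : forall k, (Z.abs k <= Z.of_nat m)%Z ->
  Cmod (o k) * zs (fun n => (Phi * high (k + n) + zs (fun q => Cmod (a q) * high (k + n + q)) na) *
     (Cmod (t (k + n)%Z) * Cmod (s n))) NB +
  (if (k =? p)%Z then zs (fun i => high i * Cmod (cc i)) NC else 0) <= h k.

(** The low block of the identity minus [A] plus [Kop A], where [A] denotes [Aop m S]. *)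
Definition Resid (i j : Z) : C :=
  ((if (i =? j)%Z then RtoC 1 else RtoC 0) - S i j + zsC (fun k => Kmat i k * S k j) m)%C.

(** The residual block may be replaced by one with the same action on the sequences satisfying [P];
    this is the entry point of evenness. *)
Hypothesis R'_eq : forall x i, P x -> (Z.abs i <= Z.of_nat m)%Z ->
  zsC (fun j => Resid i j * x j)%C m = zsC (fun j => R' i j * x j)%C m.
Hypothesis kapL : forall j, (Z.abs j <= Z.of_nat m)%Z ->
  zs (fun k => h k * Cmod (S k j)) m + zs (fun i => Cmod (R' i j)) m <= kap.

Lemma high_nonneg k : 0 <= high k.
Proof. unfold high. destruct (low m k); lra. Qed.

Lemma zs_recentre (f : Z -> R) j n : (forall k, 0 <= f k) ->
  (forall l, (Z.of_nat NB < Z.abs (l - j))%Z -> f l = 0) ->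
  zs f n <= zs (fun q => f (j + q)%Z) NB.
Proof.
  intros Hf H0. set (g := fun q => f (j + q)%Z).
  rewrite (zs_ext f (fun l => g (l - j)%Z)) by (intros; unfold g; f_equal; lia).
  eapply Rle_trans; [apply (zs_shift_le g); intros; apply Hf|].
  eapply Rle_trans; [apply (zs_mono g _ (n + Z.abs_nat j + NB)); [intros; apply Hf|lia]|].
  rewrite (zs_finite g NB); [lra| |lia]. intros k Hk. apply H0. lia.
Qed.

Lemma s_mod_far (b : Z -> R) j l : (Z.of_nat NB < Z.abs (l - j))%Z ->
  b l * (Cmod (t l) * Cmod (s (l - j)%Z)) = 0.
Proof. intros H. rewrite (s_fin _ H), Cmod_0. ring. Qed.

Lemma Kcol_high k n : (Z.abs k <= Z.of_nat m)%Z ->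
  zs (fun i => high i * Cmod (Kmat i k)) n <= h k.
Proof.
  intros Hk. eapply Rle_trans; [|apply (h_le k Hk)].
  apply Rle_trans with (zs (fun i => Cmod (o k) * (high i * Kabs i k) +
     (if (k =? p)%Z then high i * Cmod (cc i) else 0)) n).
  { apply zs_le. intros i _. generalize (Kmat_abs i k) (high_nonneg i). intros H1 H2.
    eapply Rle_trans; [apply Rmult_le_compat_l; [exact H2|exact H1]|].
    destruct (_ =? _)%Z; apply Req_le; ring. }
  rewrite zs_plus, zs_scal. apply Rplus_le_compat.
  - apply Rmult_le_compat_l; [apply Cmod_ge_0|].
    eapply Rle_trans; [apply (Kabs_sum high k n), high_nonneg|].
    eapply Rle_trans; [apply (zs_recentre _ k)|].
    + intros l. apply Rmult_le_pos.
      * apply Rplus_le_le_0_compat; [apply Rmult_le_pos; [exact Phi_pos|apply high_nonneg]|].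
        apply zs_pos. intros q. apply Rmult_le_pos; [apply Cmod_ge_0|apply high_nonneg].
      * apply Rmult_le_pos; apply Cmod_ge_0.
    + intros l Hl. apply (s_mod_far (fun l => Phi * high l + _) k l Hl).
    + apply Req_le, zs_ext. intros q _. replace (k + q - k)%Z with q by lia. reflexivity.
  - destruct (_ =? _)%Z; [|rewrite zs_zero; lra].
    eapply Rle_trans; [apply (zs_mono _ n (n + NC)); [|lia]|].
    + intros i. apply Rmult_le_pos; [apply high_nonneg|apply Cmod_ge_0].
    + rewrite (zs_finite _ NC (n + NC)); [lra| |lia]. intros i Hi. rewrite (cc_fin i Hi), Cmod_0. ring.
Qed.

Lemma Kcol_all j n : (Z.of_nat m < Z.abs j)%Z -> zs (fun i => Cmod (Kmat i j)) n <= kap.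
Proof.
  intros Hj. eapply Rle_trans; [|exact kapH].
  assert (Hn : 0 <= anorm).
  { eapply Rle_trans; [|exact a_le]. apply zs_pos. intros; apply Cmod_ge_0. }
  eapply Rle_trans; [|apply Rmult_le_compat_l; [lra|apply (k2_le j Hj)]].
  apply Rle_trans with (zs (fun i => 1 * Kabs i j) n).
  { apply zs_le. intros i _. eapply Rle_trans; [apply Kmat_abs|].
    destruct (Z.eqb_spec j p); [lia|]. generalize (o_le j) (Kabs_nonneg i j). nra. }
  eapply Rle_trans; [apply (Kabs_sum (fun _ => 1)); intros; lra|].
  eapply Rle_trans; [apply (zs_recentre _ j)|].
  - intros l. apply Rmult_le_pos.
    + rewrite Rmult_1_r. apply Rplus_le_le_0_compat; [exact Phi_pos|].
      apply zs_pos. intros q. rewrite Rmult_1_r. apply Cmod_ge_0.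
    + apply Rmult_le_pos; apply Cmod_ge_0.
  - intros l Hl. apply (s_mod_far (fun l => Phi * 1 + _) j l Hl).
  - rewrite <- zs_scal. apply zs_le. intros q _. replace (j + q - j)%Z with q by lia.
    apply Rmult_le_compat_r; [apply Rmult_le_pos; apply Cmod_ge_0|].
    rewrite Rmult_1_r. apply Rplus_le_compat_l. eapply Rle_trans; [|exact a_le].
    apply zs_le. intros; lra.
Qed.

(** A low column has the residual in its low rows and the leak of [Kop] times [S], estimated by [h],
    in its high rows. On a high column [A] is the identity, so only [Kop] is left. All entries lie
    within bounded distance of the low block or of the diagonal, and the exponential weight costs no
    more than the factor [w]. *)
Lemma precond_bound x B : P x -> nrm tau x B ->
  nrm tau (fun k => x k - Aop m S x k + Kop (Aop m S x) k)%C (w * kap * B).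
Proof.
  intros HP Hx.
  assert (Hw1 : 1 <= w).
  { eapply Rle_trans; [|exact w_exp]. rewrite <- exp_0 at 1. apply exp_le_mono.
    apply Rmult_le_pos; [exact tau_pos|apply pos_INR]. }
  assert (Hkap : 0 <= kap).
  { eapply Rle_trans; [|apply (Kcol_all (Z.of_nat m + 1) 0); lia]. apply zs_pos. intros; apply Cmod_ge_0. }
  set (d := Aop m S x).
  (* Only finiteness matters here, to justify the matrix form of [Kop]; the size of [A] does not
     enter the final constant. *)
  assert (Hd : exists D, asum d D).
  { set (al := 1 + zs (fun j => zs (fun k => Cmod (S k j)) m) m).
    pose (S0 := fun k j => if low m j then S k j else RtoC 0).
    exists (exp (tau * INR m) * al * B). apply (nrm_asum tau); [exact tau_pos|].
    apply (nrm_ext tau (Aop m S0 x)).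
    - intros k. unfold d, Aop. destruct (low m k); [|reflexivity]. apply zsC_ext. intros j Hj.
      unfold S0, low. destruct (Z.leb_spec (Z.abs j) (Z.of_nat m)); [reflexivity|lia].
    - apply Aop_nrm; [exact tau_pos|lra| | |exact Hx].
      + unfold al. generalize (zs_pos (fun j => zs (fun k => Cmod (S k j)) m) m
          (fun _ => zs_pos _ _ (fun _ => Cmod_ge_0 _))). lra.
      + intros j. unfold S0. destruct (low m j) eqn:Ej.
        * assert (zs (fun k => Cmod (S k j)) m <= zs (fun j => zs (fun k => Cmod (S k j)) m) m).
          { apply (zs_term (fun j => zs (fun k => Cmod (S k j)) m)).
            - intros; apply zs_pos; intros; apply Cmod_ge_0.
            - apply Z.leb_le, Ej. }
          unfold al. lra.
        * rewrite (zs_ext _ (fun _ => 0)) by (intros; apply Cmod_0). rewrite zs_zero.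
          unfold al. generalize (zs_pos (fun j => zs (fun k => Cmod (S k j)) m) m
          (fun _ => zs_pos _ _ (fun _ => Cmod_ge_0 _))). lra. }
  destruct Hd as [D Hd].
  (* The composite matrix acting on [x], with the low block already replaced by [R']. *)
  set (N := fun i j => if low m j then (if low m i then R' i j else zsC (fun k => Kmat i k * S k j)%C m)
                       else Kmat i j).
  apply (col_bound tau N x); [exact tau_pos|nra| | |exact Hx].
  - intros i. pose proof (Kop_tsum d D i Hd) as H1.
    assert (H2 : is_tsum (fun j => if low m j then (Kmat i j * d j)%C else RtoC 0)
                   (zsC (fun j => Kmat i j * d j)%C m)).
    { rewrite (zsC_ext _ (fun j => if low m j then (Kmat i j * d j)%C else RtoC 0)).
      - apply is_tsum_finite. intros j Hj. unfold low. destruct (Z.leb_spec (Z.abs j) (Z.of_nat m)); [lia|reflexivity].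
      - intros j Hj. unfold low. destruct (Z.leb_spec (Z.abs j) (Z.of_nat m)); [reflexivity|lia]. }
    assert (H3 : is_tsum (fun j => if low m j then (N i j * x j)%C else RtoC 0)
                   (zsC (fun j => N i j * x j)%C m)).
    { rewrite (zsC_ext _ (fun j => if low m j then (N i j * x j)%C else RtoC 0)).
      - apply is_tsum_finite. intros j Hj. unfold low. destruct (Z.leb_spec (Z.abs j) (Z.of_nat m)); [lia|reflexivity].
      - intros j Hj. unfold low. destruct (Z.leb_spec (Z.abs j) (Z.of_nat m)); [reflexivity|lia]. }
    replace (x i - d i + Kop d i)%C with (Kop d i - zsC (fun j => Kmat i j * d j)%C m +
        zsC (fun j => N i j * x j)%C m)%C.
    + eapply is_tsum_ext; [|apply (is_tsum_plus _ _ _ _ (is_tsum_minus _ _ _ _ H1 H2) H3)].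
      intros j. cbn beta. unfold N, d, Aop. destruct (low m j); ring.
    + assert (E1 : zsC (fun j => zsC (fun k => Kmat i k * S k j)%C m * x j)%C m =
                   zsC (fun j => Kmat i j * d j)%C m).
      { rewrite (zsC_ext _ (fun j => zsC (fun k => Kmat i k * (S k j * x j))%C m)).
        - rewrite zsC_swap. apply zsC_ext. intros k Hk. rewrite zsC_scal. unfold d, Aop, low.
          destruct (Z.leb_spec (Z.abs k) (Z.of_nat m)); [reflexivity|lia].
        - intros j _. rewrite <- zsC_scal_r. apply zsC_ext. intros; ring. }
      assert (E2 : zsC (fun j => N i j * x j)%C m = (x i - d i + zsC (fun j => Kmat i j * d j)%C m)%C).
      { destruct (low m i) eqn:Ei.
        - assert (Hi : (Z.abs i <= Z.of_nat m)%Z) by (apply Z.leb_le, Ei).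
          rewrite (zsC_ext _ (fun j => R' i j * x j)%C).
          + rewrite <- (R'_eq x i HP Hi). unfold Resid.
            rewrite (zsC_ext _ (fun j => ((if (j =? i)%Z then x i else RtoC 0) - S i j * x j) +
               zsC (fun k => Kmat i k * S k j)%C m * x j)%C).
            * rewrite zsC_plus, zsC_minus, zsC_delta, E1 by exact Hi.
              replace (d i) with (zsC (fun j => S i j * x j)%C m); [ring|].
              unfold d, Aop. rewrite Ei. reflexivity.
            * intros j _. rewrite (Z.eqb_sym i j). destruct (Z.eqb_spec j i) as [->|]; ring.
          + intros j Hj. unfold N, low at 1. rewrite Ei.
            destruct (Z.leb_spec (Z.abs j) (Z.of_nat m)); [reflexivity|lia].
        - rewrite (zsC_ext _ (fun j => zsC (fun k => Kmat i k * S k j)%C m * x j)%C).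
          + rewrite E1. unfold d at 2, Aop. rewrite Ei. ring.
          + intros j Hj. unfold N, low at 1. rewrite Ei.
            destruct (Z.leb_spec (Z.abs j) (Z.of_nat m)); [reflexivity|lia]. }
      rewrite E2. ring.
  - intros j n. destruct (low m j) eqn:Ej.
    + assert (Hj : (Z.abs j <= Z.of_nat m)%Z) by (apply Z.leb_le, Ej).
      apply Rle_trans with (w * kap); [|generalize (wt_ge_1 tau j tau_pos); intros; assert (0 <= w * kap) by nra; nra].
      (* From a low column the band reaches at most [NB + na] further, and the rank-one column stops
         at [NC]; the sum of these lengths is the exponent in [w_exp]. *)
      assert (Hfar : forall i k, (Z.abs k <= Z.of_nat m)%Z -> (Z.of_nat (m + NB + na + NC) < Z.abs i)%Z ->
                Kmat i k = RtoC 0).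
      { intros i k Hk Hi. apply Cmod_eq_0. apply Rle_antisym; [|apply Cmod_ge_0].
        eapply Rle_trans; [apply Kmat_abs|]. rewrite Kabs_far by lia.
        destruct (_ =? _)%Z; [rewrite (cc_fin i) by lia; rewrite Cmod_0|]; lra. }
      assert (Hterm : forall i, wt tau i * Cmod (N i j) <= w * ((if low m i then Cmod (R' i j) else 0) +
         zs (fun k => Cmod (S k j) * (high i * Cmod (Kmat i k))) m)).
      { intros i. destruct (Z.le_gt_cases (Z.abs i) (Z.of_nat (m + NB + na + NC))) as [Hi|Hi].
        - apply Rmult_le_compat; [apply Rlt_le, wt_pos|apply Cmod_ge_0| |].
          + eapply Rle_trans; [|exact w_exp]. unfold wt. rewrite (INR_IZR_INZ (m + NB + na + NC)).
            apply exp_le_of; assumption.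
          + unfold N, high. rewrite Ej. destruct (low m i).
            * rewrite (zs_ext _ (fun _ => 0)) by (intros; ring). rewrite zs_zero. lra.
            * rewrite Rplus_0_l. eapply Rle_trans; [apply Cmod_zsC|]. apply zs_le. intros k _.
              rewrite Cmod_mult. lra.
        - replace (Cmod (N i j)) with 0.
          + rewrite Rmult_0_r. apply Rmult_le_pos; [lra|]. apply Rplus_le_le_0_compat.
            * destruct (low m i); [apply Cmod_ge_0|lra].
            * apply zs_pos. intros k. repeat apply Rmult_le_pos; try apply Cmod_ge_0. apply high_nonneg.
          + symmetry. unfold N. rewrite Ej. unfold low at 1.
            destruct (Z.leb_spec (Z.abs i) (Z.of_nat m)); [lia|].
            rewrite (zsC_ext _ (fun _ => RtoC 0)); [rewrite zsC_zero; apply Cmod_0|].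
            intros k Hk. rewrite (Hfar i k Hk Hi). ring. }
      eapply Rle_trans; [apply zs_le; intros i _; apply Hterm|].
      rewrite zs_scal. apply Rmult_le_compat_l; [lra|]. rewrite zs_plus, zs_swap.
      eapply Rle_trans; [|apply (kapL j Hj)]. rewrite Rplus_comm. apply Rplus_le_compat.
      * apply zs_le. intros k Hk. rewrite zs_scal, Rmult_comm.
        apply Rmult_le_compat_r; [apply Cmod_ge_0|apply Kcol_high, Hk].
      * eapply Rle_trans; [apply (zs_mono _ n (n + m)); [|lia]|].
        -- intros i. destruct (low m i); [apply Cmod_ge_0|lra].
        -- rewrite (zs_finite _ m (n + m)).
           ++ apply zs_le. intros i _. destruct (low m i); [lra|apply Cmod_ge_0].
           ++ intros i Hi. unfold low. destruct (Z.leb_spec (Z.abs i) (Z.of_nat m)); [lia|reflexivity].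
           ++ lia.
    + assert (Hj : (Z.of_nat m < Z.abs j)%Z) by (apply Z.leb_gt, Ej).
      apply Rle_trans with (zs (fun i => w * wt tau j * Cmod (Kmat i j)) n).
      * apply zs_le. intros i _. unfold N. rewrite Ej.
        destruct (Z.le_gt_cases (Z.abs (i - j)) (Z.of_nat (NB + na))) as [Hi|Hi].
        -- apply Rmult_le_compat_r; [apply Cmod_ge_0|].
           eapply Rle_trans; [apply (wt_near tau i j (NB + na) tau_pos Hi)|].
           apply Rmult_le_compat_r; [apply Rlt_le, wt_pos|]. eapply Rle_trans; [|exact w_exp].
           rewrite !INR_IZR_INZ. apply exp_le_of; [exact tau_pos|lia].
        -- assert (Hz : Cmod (Kmat i j) <= 0).
           { eapply Rle_trans; [apply Kmat_abs|]. rewrite (Kabs_far i j Hi).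
             destruct (Z.eqb_spec j p); [lia|lra]. }
           assert (Hz2 := Cmod_ge_0 (Kmat i j)). replace (Cmod (Kmat i j)) with 0 by lra. lra.
      * rewrite zs_scal. generalize (Kcol_all j n Hj) (wt_pos tau j). intros H1 H2.
        assert (0 <= w * wt tau j) by nra.
        replace (w * kap * wt tau j) with (w * wt tau j * kap) by ring.
        apply Rmult_le_compat_l; assumption.
Qed.

End Precond.

Lemma nrm_geo tau x B : 0 < tau -> nrm tau x B -> geo x.
Proof. intros H Hx. exists tau, B. auto. Qed.

Lemma geo_bmul c M a : (forall k, Cmod (c k) <= M) -> geo a -> geo (fun k => c k * a k)%C.
Proof.
  intros Hc Ha. assert (HM : 0 <= M) by (eapply Rle_trans; [apply Cmod_ge_0|apply (Hc 0%Z)]).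
  apply geo_dom with (fun k => RtoC M * a k)%C; [|apply geo_scal, Ha].
  intros k. rewrite !Cmod_mult, Cmod_R, Rabs_pos_eq by exact HM.
  apply Rmult_le_compat_r; [apply Cmod_ge_0|apply Hc].
Qed.

Lemma nrm_bmul tau c M a B : (forall k, Cmod (c k) <= M) -> nrm tau a B ->
  nrm tau (fun k => c k * a k)%C (M * B).
Proof.
  intros Hc Ha. assert (HM : 0 <= M) by (eapply Rle_trans; [apply Cmod_ge_0|apply (Hc 0%Z)]).
  replace M with (Cmod (RtoC M)) by (rewrite Cmod_R; apply Rabs_pos_eq, HM).
  apply nrm_dom with (fun k => RtoC M * a k)%C; [|apply nrm_scal, Ha].
  intros k. rewrite !Cmod_mult, Cmod_R, Rabs_pos_eq by exact HM.
  apply Rmult_le_compat_r; [apply Cmod_ge_0|apply Hc].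
Qed.

Lemma conv_add_l a a' b k : geo a -> geo a' -> geo b ->
  conv (fun m => a m + a' m)%C b k = (conv a b k + conv a' b k)%C.
Proof.
  intros H1 H2 H3. destruct (geo_asum _ H1), (geo_asum _ H2), (geo_asum _ H3).
  eapply conv_plus_l; eassumption.
Qed.

Lemma conv_add_r a b b' k : geo a -> geo b -> geo b' ->
  conv a (fun m => b m + b' m)%C k = (conv a b k + conv a b' k)%C.
Proof.
  intros H1 H2 H3. destruct (geo_asum _ H1), (geo_asum _ H2), (geo_asum _ H3).
  eapply conv_plus_r; eassumption.
Qed.

Lemma conv_sub_l a a' b k : geo a -> geo a' -> geo b ->
  conv (fun m => a m - a' m)%C b k = (conv a b k - conv a' b k)%C.
Proof.
  intros H1 H2 H3. destruct (geo_asum _ H1), (geo_asum _ H2), (geo_asum _ H3).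
  eapply conv_minus_l; eassumption.
Qed.

Lemma conv_sub_r a b b' k : geo a -> geo b -> geo b' ->
  conv a (fun m => b m - b' m)%C k = (conv a b k - conv a b' k)%C.
Proof.
  intros H1 H2 H3. destruct (geo_asum _ H1), (geo_asum _ H2), (geo_asum _ H3).
  eapply conv_minus_r; eassumption.
Qed.

Lemma conv_sym a b k : geo a -> geo b -> conv a b k = conv b a k.
Proof.
  intros H1 H2. destruct (geo_asum _ H1), (geo_asum _ H2). eapply conv_comm; eassumption.
Qed.

Lemma conv_one d k : conv (cst 1) d k = d k.
Proof.
  rewrite (conv_finite_l _ _ 0 k (fin_cst 1)), zsC_0. unfold cst. simpl.
  replace (k - 0)%Z with k by lia. ring.
Qed.

Lemma Aop_minus m S x y k : (Aop m S (fun j => x j - y j) k = Aop m S x k - Aop m S y k)%C.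
Proof.
  unfold Aop. destruct (low m k); [|reflexivity].
  rewrite <- zsC_minus. apply zsC_ext. intros; ring.
Qed.

(** * The wave equation in sequence space *)

Definition even_real (x : Z -> C) : Prop := (forall k, x (- k)%Z = x k) /\ forall k, Im (x k) = 0.

Lemma even_real_zero : even_real (fun _ => RtoC 0).
Proof. split; reflexivity. Qed.

Lemma even_real_plus a b : even_real a -> even_real b -> even_real (fun k => a k + b k)%C.
Proof.
  intros [H1 H2] [H3 H4]. split; intros k; [rewrite H1, H3; reflexivity|].
  simpl. generalize (H2 k) (H4 k). unfold Im. lra.
Qed.

Lemma even_real_conv a b : even_real a -> even_real b -> even_real (conv a b).
Proof.
  intros [H1 H2] [H3 H4]. split; intros k; [|apply conv_real; assumption].
  rewrite <- conv_flip. apply conv_ext; intros; [apply H1|apply H3].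
Qed.

Lemma even_real_cst c : even_real (cst c).
Proof.
  split; intros k; unfold cst.
  - replace (- k =? 0)%Z with (k =? 0)%Z; [reflexivity|].
    destruct (Z.eqb_spec k 0), (Z.eqb_spec (- k) 0); lia.
  - destruct (_ =? _)%Z; reflexivity.
Qed.

Lemma even_real_Dseq : even_real Dseq.
Proof.
  split; intros [|p|p]; try reflexivity; destruct p; reflexivity.
Qed.

Lemma even_real_closed (u : nat -> Z -> C) x : (forall n, even_real (u n)) ->
  (forall k, is_lim_seq (fun n => Re (u n k)) (Re (x k)) /\
             is_lim_seq (fun n => Im (u n k)) (Im (x k))) -> even_real x.
Proof.
  intros Hu Hl. split; intros k.
  - assert (U : forall (f : nat -> R) (a b : R), is_lim_seq f a -> is_lim_seq f b -> a = b).
    { intros f a b Ha Hb. apply is_lim_seq_unique in Ha, Hb. rewrite Ha in Hb. congruence. }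
    apply C_eq.
    + apply (U (fun n => Re (u n k))); [|apply Hl].
      eapply is_lim_seq_ext; [|apply (Hl (- k)%Z)]. intros n. cbn beta. rewrite (proj1 (Hu n)). reflexivity.
    + apply (U (fun n => Im (u n k))); [|apply Hl].
      eapply is_lim_seq_ext; [|apply (Hl (- k)%Z)]. intros n. cbn beta. rewrite (proj1 (Hu n)). reflexivity.
  - destruct (Hl k) as [_ H].
    apply (is_lim_seq_ext _ (fun _ => 0)) in H; [|intros n; apply (Hu n)].
    apply is_lim_seq_unique in H. rewrite Lim_seq_const in H. injection H. auto.
Qed.

Section WaveEquation.

Variables (c : R) (m NY NB : nat) (yb s t : Z -> C) (S : Z -> Z -> C).
Variables (tau al eps ns nDs dt res kap0 r : R).
Hypothesis tau_pos : 0 < tau.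
Hypothesis yb_fin : fin yb NY.
Hypothesis s_fin : fin s NB.
Hypothesis yb_er : even_real yb.
Hypothesis s_er : even_real s.
Hypothesis yb_0 : yb 0%Z = RtoC 0.
Hypothesis S_even : forall i j, S (- i)%Z (- j)%Z = S i j.
Hypothesis S_real : forall i j, Im (S i j) = 0.
Hypothesis A_le : forall x B, nrm tau x B -> nrm tau (Aop m S x) (al * B).
Hypothesis t_0 : t 0%Z = RtoC (-1).

(** The value -1 at 0 is a convention: there [d_0 - K1 d] becomes [(s * d)_0], so the mean condition
    fits the same pattern as the other equations. *)
Definition tau1 (k : Z) : C := RtoC (if (k =? 0)%Z then -1 else / IZR (Z.abs k)).

Definition one (_ : Z) : C := RtoC 1.
Definition zero (_ : Z) : C := RtoC 0.

Definition K1 : (Z -> C) -> Z -> C := Kop 0 s zero (cst 1) t t one.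

Hypothesis lin_le : forall x B, even_real x -> nrm tau x B ->
  nrm tau (fun k => x k - Aop m S x k + K1 (Aop m S x) k)%C (kap0 * B).
Hypothesis t_le : forall k, Cmod (tau1 k - t k)%C <= dt.

Definition Wb : Z -> C := Wseq c yb.
Definition err1 (k : Z) : C := (cst 1 k - conv Wb (conv Dseq s) k)%C.
Definition res1 (k : Z) : C := (RtoC (/ 2) * conv Wb Wb k - tau1 k * yb k)%C.

Hypothesis err_le : nrm tau err1 eps.
Hypothesis s_le : nrm tau s ns.
Hypothesis Ds_le : nrm tau (conv Dseq s) nDs.
Hypothesis res_le : nrm tau (fun k => if (k =? 0)%Z then RtoC 0 else res1 k) res.
Hypothesis kap_lt : 0 <= kap0 + al * (eps + dt * ns) + nDs * al * (nDs * al) * r < 1.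
Hypothesis r_ge : res <= (1 - (kap0 + al * (eps + dt * ns) + nDs * al * (nDs * al) * r)) * r.

Definition Y1 (d : Z -> C) (k : Z) : C := (yb k + conv s d k)%C.

(** Multiplied by [|k|], the wave equation at [k = 0] only says [Y 0 = 0], the condition for zero
    mean; as [yb 0 = 0], this is the vanishing of [(s * d)_0]. *)
Definition F1 (d : Z -> C) (k : Z) : C :=
  if (k =? 0)%Z then conv s d 0%Z
  else (RtoC (/ 2) * conv (Wseq c (Y1 d)) (Wseq c (Y1 d)) k - tau1 k * Y1 d k)%C.

Definition T1 (x : Z -> C) (k : Z) : C := (x k - F1 (Aop m S x) k)%C.

Definition off0 (x : Z -> C) (k : Z) : C := if (k =? 0)%Z then RtoC 0 else x k.

Lemma geo_s : geo s. Proof. exact (geo_fin _ _ s_fin). Qed.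
Lemma geo_yb : geo yb. Proof. exact (geo_fin _ _ yb_fin). Qed.
Lemma geo_Wb : geo Wb. Proof. apply Wgeo, geo_yb. Qed.

Lemma fin_Wb : fin Wb (NY + 1).
Proof.
  intros k Hk. unfold Wb, Wseq. rewrite (fin_cst c k) by lia.
  rewrite (fin_conv Dseq yb 1 NY fin_Dseq yb_fin k) by lia. ring.
Qed.

(** [W] is affine in [d] with increment [q = (D * s) * d]. The cross term [Wb * q] is [d] up to
    [err1], because [s] approximately inverts [Wb * D], and the square of [q] is the only nonlinear
    term. *)
Lemma F1_expand d k : geo d -> k <> 0%Z ->
  F1 d k = (res1 k + d k - conv err1 d k - tau1 k * conv s d k +
    RtoC (/ 2) * conv (conv (conv Dseq s) d) (conv (conv Dseq s) d) k)%C.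
Proof.
  intros Hd Hk. unfold F1. destruct (Z.eqb_spec k 0); [lia|].
  assert (Gs := geo_s). assert (GW := geo_Wb). assert (GD := geo_Dseq).
  set (q := conv (conv Dseq s) d).
  assert (Gq : geo q) by (apply geo_conv; [apply geo_conv; assumption|exact Hd]).
  assert (EW : forall j, Wseq c (Y1 d) j = (Wb j + q j)%C).
  { intros j. unfold Wb, Wseq, Y1. rewrite conv_add_r; [|exact GD|apply geo_yb|apply geo_conv; assumption].
    unfold q. rewrite (conv_fin_assoc Dseq s d 1 NB j fin_Dseq s_fin). ring. }
  rewrite (conv_ext _ (fun j => Wb j + q j)%C _ (fun j => Wb j + q j)%C k EW EW).
  rewrite conv_add_l by (first [assumption | apply geo_plus; assumption]).
  rewrite !conv_add_r by assumption. rewrite (conv_sym q Wb) by assumption.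
  assert (E : conv Wb q k = (d k - conv err1 d k)%C).
  { unfold q. rewrite (conv_fin_assoc Wb (conv Dseq s) d (NY + 1) (1 + NB) k fin_Wb);
      [|apply fin_conv; [apply fin_Dseq|exact s_fin]].
    unfold err1. rewrite conv_sub_l, conv_one;
      [ring|apply (geo_fin _ 0), fin_cst|repeat apply geo_conv; assumption|exact Hd]. }
  rewrite E. unfold res1, Y1.
  transitivity (RtoC (/ 2) * conv Wb Wb k + (RtoC (/ 2) * 2) * (d k - conv err1 d k) +
    RtoC (/ 2) * conv q q k - tau1 k * (yb k + conv s d k))%C; [ring|].
  rewrite <- RtoC_mult. replace (/ 2 * 2) with 1 by field. ring.
Qed.

Lemma K1_eq d k : K1 d k = (t k * conv s d k + cst 1 k * d 0%Z)%C.
Proof.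
  unfold K1, Kop.
  rewrite (conv_ext s s (fun j => one j * d j)%C d k) by (intros; unfold one; ring).
  rewrite (conv_finite_l zero _ 0 k) by (intros ? ?; reflexivity).
  rewrite zsC_0. unfold zero. ring.
Qed.

Lemma T1_expand x k : geo x -> geo (Aop m S x) ->
  T1 x k = ((x k - Aop m S x k + K1 (Aop m S x) k) +
    off0 (fun k => conv err1 (Aop m S x) k + (tau1 k - t k) * conv s (Aop m S x) k
      - RtoC (/ 2) * conv (conv (conv Dseq s) (Aop m S x)) (conv (conv Dseq s) (Aop m S x)) k - res1 k)%C k)%C.
Proof.
  intros Hx Hd. unfold T1, off0. rewrite K1_eq. set (d := Aop m S x) in *.
  destruct (Z.eqb_spec k 0) as [->|Hk].
  - unfold F1, cst. simpl. rewrite t_0. replace (RtoC (-1)) with (- RtoC 1)%C by (apply C_eq; simpl; ring).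
    ring.
  - rewrite (F1_expand d k Hd Hk). unfold cst. destruct (Z.eqb_spec k 0); [lia|]. ring.
Qed.

Lemma off0_nrm x B : nrm tau x B -> nrm tau (off0 x) B.
Proof.
  apply nrm_dom. intros k. unfold off0. destruct (_ =? _)%Z; [rewrite Cmod_0; apply Cmod_ge_0|lra].
Qed.

Lemma Aop_er x : even_real x -> even_real (Aop m S x).
Proof.
  intros [H1 H2]. split; intros k; unfold Aop, low.
  - rewrite Z.abs_opp. destruct (_ <=? _)%Z; [|apply H1].
    rewrite <- zsC_flip. apply zsC_ext. intros j _. rewrite S_even, H1. reflexivity.
  - destruct (_ <=? _)%Z; [|apply H2]. unfold zsC. cbn [Im snd].
    rewrite (zs_ext _ (fun _ => 0)); [apply zs_zero|]. intros j _. simpl.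
    generalize (S_real k j) (H2 j). unfold Im. intros -> ->. ring.
Qed.

Lemma tau1_even k : tau1 (- k) = tau1 k.
Proof.
  unfold tau1. rewrite Z.abs_opp. replace (- k =? 0)%Z with (k =? 0)%Z; [reflexivity|].
  destruct (Z.eqb_spec k 0), (Z.eqb_spec (- k) 0); lia.
Qed.

Lemma Y1_er d : even_real d -> even_real (Y1 d).
Proof. intros H. apply even_real_plus; [exact yb_er|apply even_real_conv; assumption]. Qed.

Lemma T1_er x : even_real x -> even_real (T1 x).
Proof.
  intros Hx. assert (Hd := Aop_er x Hx). set (d := Aop m S x) in *.
  assert (HY := Y1_er d Hd).
  assert (HW : even_real (Wseq c (Y1 d))).
  { apply even_real_plus; [apply even_real_cst|]. apply even_real_conv; [apply even_real_Dseq|exact HY]. }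
  assert (HWW := even_real_conv _ _ HW HW). assert (Hs := even_real_conv _ _ s_er Hd).
  split; intros k; unfold T1, F1; fold d.
  - replace (- k =? 0)%Z with (k =? 0)%Z
      by (destruct (Z.eqb_spec k 0), (Z.eqb_spec (- k) 0); lia).
    rewrite (proj1 Hx), tau1_even, (proj1 HY), (proj1 HWW). reflexivity.
  - destruct (_ =? _)%Z.
    + change (Im (x k) - Im (conv s d 0%Z) = 0). rewrite (proj2 Hx), (proj2 Hs). ring.
    + generalize (proj2 Hx k) (proj2 HWW k) (proj2 HY k).
      set (ww := conv _ _ k). set (yy := Y1 d k). unfold tau1. simpl. unfold Im. intros -> -> ->. ring.
Qed.

Lemma F1_zero : exists d, nrm tau d (al * r) /\ even_real d /\ forall k, F1 d k = RtoC 0.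
Proof.
  set (kap := kap0 + al * (eps + dt * ns) + nDs * al * (nDs * al) * r) in *.
  assert (Hsq : 0 <= tau) by lra.
  destruct (contraction tau r kap T1 even_real) as (x & Px & Hx & HT); try assumption.
  - apply even_real_zero.
  - intros x Px _. apply T1_er, Px.
  - apply even_real_closed.
  - intros x y B Px Py Hx Hy Hxy.
    assert (HAx := A_le _ _ Hx). assert (HAy := A_le _ _ Hy). assert (HAd := A_le _ _ Hxy).
    set (z := fun k => (x k - y k)%C) in *.
    assert (Ez : forall k, Aop m S z k = (Aop m S x k - Aop m S y k)%C) by (intros; apply Aop_minus).
    assert (Pz : even_real z).
    { split; intros k; unfold z; [rewrite (proj1 Px), (proj1 Py); reflexivity|].
      generalize (proj2 Px k) (proj2 Py k). simpl. unfold Im. intros -> ->. ring. }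
    set (dx := Aop m S x) in *. set (dy := Aop m S y) in *. set (dz := Aop m S z) in *.
    assert (Gx := nrm_geo _ _ _ tau_pos HAx). assert (Gy := nrm_geo _ _ _ tau_pos HAy).
    assert (Gz := nrm_geo _ _ _ tau_pos HAd).
    assert (Ge := nrm_geo _ _ _ tau_pos err_le). assert (Gs := geo_s).
    set (Ds := conv Dseq s) in *. assert (GDs := nrm_geo _ _ _ tau_pos Ds_le).
    assert (L1 : forall a k, geo a -> conv a dz k = (conv a dx k - conv a dy k)%C).
    { intros a k Ha. rewrite <- conv_sub_r by assumption. apply conv_ext; [reflexivity|exact Ez]. }
    (* The quadratic parts are factored as a difference of squares, [(q_x + q_y) * q_z]; the sum
       doubles the radius and the coefficient 1/2 compensates. *)
    assert (N : nrm tau (fun k => (z k - dz k + K1 dz k) +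
       off0 (fun k => conv err1 dz k + (tau1 k - t k) * conv s dz k
       - RtoC (/ 2) * conv (fun j => conv Ds dx j + conv Ds dy j) (conv Ds dz) k)%C k)%C
       (kap0 * B + (eps * (al * B) + dt * (ns * (al * B)) +
         / 2 * ((nDs * (al * r) + nDs * (al * r)) * (nDs * (al * B)))))).
    { apply nrm_plus; [apply lin_le; assumption|]. apply off0_nrm. apply nrm_minus; [apply nrm_plus|].
      - apply conv_nrm; assumption.
      - apply (nrm_bmul tau (fun k => tau1 k - t k)%C); [exact t_le|]. apply conv_nrm; assumption.
      - apply (nrm_bmul tau (fun _ => RtoC (/ 2))).
        { intros _. rewrite Cmod_R, Rabs_pos_eq; lra. }
        apply conv_nrm; [exact Hsq| |apply conv_nrm; assumption].
        apply nrm_plus; apply conv_nrm; assumption. }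
    replace (kap * B) with (kap0 * B + (eps * (al * B) + dt * (ns * (al * B)) +
         / 2 * ((nDs * (al * r) + nDs * (al * r)) * (nDs * (al * B))))) by (unfold kap; field).
    eapply nrm_ext; [|exact N]. intros k. cbn beta.
    rewrite (T1_expand x k), (T1_expand y k) by (try assumption; eapply nrm_geo; eassumption).
    fold dx dy Ds. rewrite !K1_eq.
    assert (G1 : geo (conv Ds dx)) by (apply geo_conv; assumption).
    assert (G2 : geo (conv Ds dy)) by (apply geo_conv; assumption).
    assert (Eq : conv (fun j => conv Ds dx j + conv Ds dy j)%C (conv Ds dz) k =
      (conv (conv Ds dx) (conv Ds dx) k - conv (conv Ds dy) (conv Ds dy) k)%C).
    { rewrite (conv_ext _ (fun j => conv Ds dx j + conv Ds dy j)%C _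
        (fun j => conv Ds dx j - conv Ds dy j)%C) by (intros; first [reflexivity|apply L1; exact GDs]).
      rewrite conv_add_l, !conv_sub_r, (conv_sym (conv Ds dy) (conv Ds dx))
        by (first [assumption | apply geo_minus; assumption]). ring. }
    unfold off0. rewrite Eq, !L1 by assumption. rewrite (Ez 0%Z). unfold z. rewrite (Ez k).
    destruct (Z.eqb_spec k 0); ring.
  - assert (E0 : forall k, Aop m S (fun _ => RtoC 0) k = RtoC 0).
    { intros k. unfold Aop. destruct (low m k); [|reflexivity].
      rewrite (zsC_ext _ (fun _ => RtoC 0)) by (intros; ring). apply zsC_zero. }
    eapply nrm_le; [exact r_ge|]. apply (nrm_dom tau _ (off0 res1)); [|exact res_le].
    intros k. apply Req_le.
    assert (G0 : geo (fun _ => RtoC 0)) by (apply (geo_fin _ 0); intros ? ?; reflexivity).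
    assert (C0 : forall a j, conv a (Aop m S (fun _ => RtoC 0)) j = RtoC 0).
    { intros a j. unfold conv. rewrite (tsum_ext _ (fun _ => RtoC 0)) by (intros; rewrite E0; ring).
      rewrite (tsum_finite _ 0) by reflexivity. apply zsC_zero. }
    assert (C1 : forall a j, conv a (conv (conv Dseq s) (Aop m S (fun _ => RtoC 0))) j = RtoC 0).
    { intros a j. unfold conv at 1. rewrite (tsum_ext _ (fun _ => RtoC 0)) by (intros; rewrite C0; ring).
      rewrite (tsum_finite _ 0) by reflexivity. apply zsC_zero. }
    assert (GA : geo (Aop m S (fun _ => RtoC 0))) by (apply (geo_ext (fun _ => RtoC 0)); [intros; symmetry; apply E0|exact G0]).
    rewrite (T1_expand _ k G0 GA), K1_eq. unfold off0. rewrite C1, !C0, !E0.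
    rewrite <- (Cmod_opp (if (k =? 0)%Z then RtoC 0 else res1 k)). f_equal.
    destruct (_ =? _)%Z; ring.
  - exists (Aop m S x). split; [apply A_le, Hx|]. split; [apply Aop_er, Px|]. intros k.
    specialize (HT k). unfold T1 in HT.
    replace (F1 (Aop m S x) k) with (x k - (x k - F1 (Aop m S x) k))%C by ring. rewrite HT. ring.
Qed.

Theorem wave_equation_solution : exists d, nrm tau d (al * r) /\ geo (Y1 d) /\ even_real (Y1 d) /\
  Y1 d 0%Z = RtoC 0 /\
  (forall k, RtoC (IZR (Z.abs k)) * conv (Wseq c (Y1 d)) (Wseq c (Y1 d)) k = 2 * Y1 d k)%C /\
  forall k, Wseq c (Y1 d) k = (Wb k + conv Dseq (conv s d) k)%C.
Proof.
  destruct F1_zero as (d & Hd & Ed & HF). exists d.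
  assert (Gd := nrm_geo _ _ _ tau_pos Hd). assert (Gs := geo_s).
  assert (Y0 : Y1 d 0%Z = RtoC 0).
  { unfold Y1. rewrite yb_0. specialize (HF 0%Z). unfold F1 in HF. simpl in HF. rewrite HF. ring. }
  split; [exact Hd|]. split; [apply geo_plus; [apply geo_yb|apply geo_conv; assumption]|].
  split; [apply Y1_er, Ed|]. split; [exact Y0|]. split.
  - intros k. destruct (Z.eq_dec k 0) as [->|Hk]; [rewrite Y0; simpl; ring|].
    specialize (HF k). unfold F1, tau1 in HF. destruct (Z.eqb_spec k 0); [lia|].
    set (ww := conv _ _ k) in *. set (y := Y1 d k) in *.
    assert (Hk' : (RtoC (IZR (Z.abs k)) * RtoC (/ IZR (Z.abs k)))%C = RtoC 1).
    { rewrite <- RtoC_mult, Rinv_r; [reflexivity|]. apply not_0_IZR. lia. }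
    assert (H2 : (2 * RtoC (/ 2))%C = RtoC 1) by (rewrite <- RtoC_mult; f_equal; field).
    transitivity (2 * RtoC (IZR (Z.abs k)) * (RtoC (/ 2) * ww - RtoC (/ IZR (Z.abs k)) * y) +
      2 * y * (RtoC (IZR (Z.abs k)) * RtoC (/ IZR (Z.abs k))) +
      RtoC (IZR (Z.abs k)) * ww * (1 - 2 * RtoC (/ 2)))%C; [ring|].
    rewrite HF, Hk', H2. ring.
  - intros k. unfold Wseq, Y1, Wb. rewrite conv_add_r; [unfold Wseq; ring|apply geo_Dseq|apply geo_yb|].
    apply geo_conv; assumption.
Qed.

End WaveEquation.

(** * The eigenvalue equation in sequence space *)

(** The order-zero part of [gam], left after extracting [D] acting on [(k + 1/2) G_k]. *)
Definition Bseq (k : Z) : C :=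
  match k with
  | Z0 => RtoC (- (1 / 6))
  | Zpos 1 => RtoC (3 / 5)
  | Zneg 1 => RtoC (- (3 / 5))
  | _ => RtoC 0
  end.

Lemma fin_Bseq : fin Bseq 1.
Proof.
  intros [|p|p] Hk; [simpl in Hk; lia| |]; destruct p; try reflexivity; simpl in Hk; lia.
Qed.

Lemma conv_Bseq a k : conv Bseq a k =
  (RtoC (- (1 / 6)) * a k + RtoC (3 / 5) * a (k - 1)%Z + RtoC (- (3 / 5)) * a (k + 1)%Z)%C.
Proof.
  rewrite (conv_finite_l _ _ 1 k fin_Bseq), zsC_S, zsC_0. cbn [Z.of_nat Pos.of_succ_nat Z.opp Bseq].
  replace (k - 0)%Z with k by lia. replace (k - -1)%Z with (k + 1)%Z by lia. ring.
Qed.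

(** The shift by 1/2 keeps the divisor away from 0 and makes it odd under [k |-> -1 - k], the
    reflection that exchanges the two halves. *)
Definition tau2 (k : Z) : C := RtoC (/ (IZR k + / 2)).

Lemma tau2_inv k : (RtoC (IZR k + / 2) * tau2 k)%C = RtoC 1.
Proof.
  unfold tau2. rewrite <- RtoC_mult, Rinv_r; [reflexivity|].
  intros H. assert (H2 : IZR (2 * k + 1) = 0) by (rewrite plus_IZR, mult_IZR; lra).
  apply eq_IZR in H2. lia.
Qed.

Lemma tau2_le k : Cmod (tau2 k) <= 2.
Proof.
  unfold tau2. rewrite Cmod_R, Rabs_inv.
  assert (H : / 2 <= Rabs (IZR k + / 2)).
  { destruct (Z.le_gt_cases 0 k) as [Hk|Hk].
    - apply IZR_le in Hk. rewrite Rabs_pos_eq; lra.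
    - assert (Hk' : (k <= -1)%Z) by lia. apply IZR_le in Hk'. rewrite Rabs_left; lra. }
  apply Rle_trans with (/ / 2); [apply Rinv_le_contravar; lra|rewrite Rinv_inv; lra].
Qed.

Lemma gam_decomp G k : gam G k =
  (conv Dseq (fun j => RtoC (IZR j + / 2) * G j) k + conv Bseq G k)%C.
Proof.
  rewrite conv_Dseq, conv_Bseq. unfold gam. rewrite minus_IZR, plus_IZR.
  set (g := G k). set (g1 := G (k - 1)%Z). set (g2 := G (k + 1)%Z).
  apply C_eq; simpl; unfold Re, Im; field.
Qed.

Section EigenEquation.

Variables (m NW NB Lg na : nat) (p : Z) (Wb dW s Gb a t : Z -> C) (a0 nub : C) (S : Z -> Z -> C).
Variables (tau al eps ns nDs nW nB nG dt phim anorm da res rowp kap0 r : R).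
Hypothesis tau_pos : 0 < tau.
Hypothesis Wb_fin : fin Wb NW.
Hypothesis s_fin : fin s NB.
Hypothesis Gb_fin : fin Gb Lg.
Hypothesis a_fin : fin a na.
Hypothesis A_le : forall x B, nrm tau x B -> nrm tau (Aop m S x) (al * B).

(** The entry [d p] of the unknown is the correction of the eigenvalue; the other entries give the
    correction [tau2 (s * d)] of [Gb]. *)
Definition sl (k : Z) : C := if (k =? p)%Z then RtoC 0 else RtoC 1.
Definition phi2 (k : Z) : C := (RtoC (sig k) + nub - a0)%C.
Definition cc2 (k : Z) : C := ((if (k =? p)%Z then RtoC 1 else RtoC 0) + Gb k)%C.

Definition K2 : (Z -> C) -> Z -> C := Kop p s a cc2 (fun k => phi2 k * t k)%C t sl.

Hypothesis lin_le : forall x B, nrm tau x B ->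
  nrm tau (fun k => x k - Aop m S x k + K2 (Aop m S x) k)%C (kap0 * B).
(** The eigenvalue entry has its own, much sharper bound (0.42 against 37 for [al]): it is a factor
    of the only quadratic term, and it localizes [nu]. *)
Hypothesis row_le : forall x B, nrm tau x B -> Cmod (Aop m S x p) <= rowp * B.
Hypothesis t_le : forall k, Cmod (tau2 k - t k)%C <= dt.

Definition err2 (k : Z) : C := (cst 1 k - conv Wb (conv Dseq s) k)%C.
Definition res2 (k : Z) : C := (conv Wb (gam Gb) k - (RtoC (sig k) + nub) * Gb k)%C.
Definition rho2 (k : Z) : C := (conv Wb Bseq k - a k - a0 * cst 1 k)%C.

Hypothesis err_le : nrm tau err2 eps.
Hypothesis s_le : nrm tau s ns.
Hypothesis Ds_le : nrm tau (conv Dseq s) nDs.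
Hypothesis B_le : nrm tau Bseq nB.
Hypothesis a_le : nrm tau a anorm.
Hypothesis rho_le : nrm tau rho2 da.
Hypothesis dW_le : nrm tau dW nW.
Hypothesis Gam_le : nrm tau (gam Gb) nG.
Hypothesis res_le : nrm tau res2 res.
Hypothesis phi_le : forall k, Cmod (phi2 k) <= phim.

Definition del2 : R := eps + nW * nDs + nW * (nB * (2 * ns)) + da * (2 * ns) + anorm * (dt * ns) + phim * (dt * ns).
(** In the last term, one factor 2 bounds [tau2] and the other comes from differencing a product of
    two unknowns. *)
Definition kap2 : R := kap0 + al * del2 + 4 * rowp * al * ns * r.

Hypothesis kap_lt : 0 <= kap2 < 1.
Hypothesis r_ge : res + nW * nG <= (1 - kap2) * r.

Definition W2 (k : Z) : C := (Wb k + dW k)%C.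
Definition eta2 (d : Z -> C) : Z -> C := conv s (fun k => sl k * d k)%C.
Definition G2 (d : Z -> C) (k : Z) : C := (Gb k + tau2 k * eta2 d k)%C.
Definition F2 (d : Z -> C) (k : Z) : C :=
  (conv W2 (gam (G2 d)) k - (RtoC (sig k) + (nub + d p)) * G2 d k)%C.
Definition T2 (x : Z -> C) (k : Z) : C := (x k - F2 (Aop m S x) k)%C.

(** The defects separating the true linearization from the certified one: the inexact inverse, the
    perturbation [dW] of the wave, and the roundings of [Wb * Bseq] and of [tau2]. *)
Definition Del2 (d : Z -> C) (k : Z) : C :=
  (- conv err2 (fun j => sl j * d j) k + conv dW (conv (conv Dseq s) (fun j => sl j * d j)) k
   + conv dW (conv Bseq (fun j => tau2 j * eta2 d j)) k + conv rho2 (fun j => tau2 j * eta2 d j) k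
   + conv a (fun j => (tau2 j - t j) * eta2 d j) k - phi2 k * ((tau2 k - t k) * eta2 d k))%C.

Lemma sl_le k : Cmod (sl k) <= 1.
Proof. unfold sl. destruct (_ =? _)%Z; rewrite Cmod_R, ?Rabs_R0, ?Rabs_R1; lra. Qed.

Lemma geo_s2 : geo s. Proof. exact (geo_fin _ _ s_fin). Qed.
Lemma geo_Wb2 : geo Wb. Proof. exact (geo_fin _ _ Wb_fin). Qed.
Lemma geo_Gb2 : geo Gb. Proof. exact (geo_fin _ _ Gb_fin). Qed.
Lemma geo_a2 : geo a. Proof. exact (geo_fin _ _ a_fin). Qed.
Lemma geo_B2 : geo Bseq. Proof. exact (geo_fin _ _ fin_Bseq). Qed.

Lemma geo_sl d : geo d -> geo (fun j => sl j * d j)%C.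
Proof. apply (geo_bmul sl 1), sl_le. Qed.

Lemma geo_eta d : geo d -> geo (eta2 d).
Proof. intros H. apply geo_conv; [apply geo_s2|apply geo_sl, H]. Qed.

Lemma geo_taueta d : geo d -> geo (fun j => tau2 j * eta2 d j)%C.
Proof. intros H. apply (geo_bmul tau2 2); [apply tau2_le|apply geo_eta, H]. Qed.

Lemma geo_tdeta d : geo d -> geo (fun j => (tau2 j - t j) * eta2 d j)%C.
Proof.
  intros H. apply (geo_bmul (fun j => tau2 j - t j)%C dt); [apply t_le|apply geo_eta, H].
Qed.

Lemma geo_G2 d : geo d -> geo (G2 d).
Proof. intros H. apply geo_plus; [apply geo_Gb2|apply geo_taueta, H]. Qed.

Lemma gam_G2 d k : geo d -> gam (G2 d) k =
  (gam Gb k + (conv (conv Dseq s) (fun j => sl j * d j) k + conv Bseq (fun j => tau2 j * eta2 d j) k))%C.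
Proof.
  intros H. rewrite !gam_decomp. unfold G2.
  rewrite (conv_add_r Bseq) by (first [apply geo_B2|apply geo_Gb2|apply geo_taueta, H]).
  assert (E : conv Dseq (fun j => RtoC (IZR j + / 2) * (Gb j + tau2 j * eta2 d j))%C k =
    (conv Dseq (fun j => RtoC (IZR j + / 2) * Gb j)%C k + conv Dseq (eta2 d) k)%C).
  { rewrite <- conv_add_r.
    - apply conv_ext; [reflexivity|]. intros j. rewrite Cmult_plus_distr_l, Cmult_assoc, tau2_inv. ring.
    - apply geo_Dseq.
    - apply (geo_fin _ Lg). intros j Hj. rewrite (Gb_fin j Hj). ring.
    - apply geo_eta, H. }
  rewrite E. unfold eta2 at 1.
  rewrite (conv_fin_assoc Dseq s _ 1 NB k fin_Dseq s_fin). ring.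
Qed.

Lemma cv_one_r b k : conv (fun j => a0 * cst 1 j)%C b k = (a0 * b k)%C.
Proof.
  rewrite (conv_finite_l _ _ 0 k).
  - rewrite zsC_0. unfold cst. simpl. replace (k - 0)%Z with k by lia. ring.
  - intros j Hj. rewrite (fin_cst 1 j Hj). ring.
Qed.

(** [W2] is split so that only the finite part [Wb] is reassociated with [Dseq], [s] and [Bseq];
    products with the infinite [dW] are left as they stand and merely estimated. *)
Lemma F2_expand d k : geo d -> geo dW ->
  F2 d k = (res2 k + conv dW (gam Gb) k + d k - K2 d k + Del2 d k - d p * (tau2 k * eta2 d k))%C.
Proof.
  intros Hd HW. unfold F2.
  assert (Gs := geo_s2). assert (GW := geo_Wb2). assert (GD := geo_Dseq). assert (GB := geo_B2).
  assert (Ga := geo_a2). assert (GG := geo_gam _ geo_Gb2).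
  set (od := fun j => (sl j * d j)%C).
  assert (God : geo od) by (apply geo_sl, Hd).
  set (te := fun j => (tau2 j * eta2 d j)%C). assert (Gte : geo te) by (apply geo_taueta, Hd).
  set (q := conv (conv Dseq s) od).
  assert (Gq : geo q) by (apply geo_conv; [apply geo_conv; assumption|exact God]).
  set (b := conv Bseq te). assert (Gb' : geo b) by (apply geo_conv; assumption).
  rewrite (conv_ext W2 W2 _ (fun k => gam Gb k + (q k + b k))%C k (fun _ => eq_refl)
     (fun j => gam_G2 d j Hd)).
  assert (Gqb : geo (fun k => q k + b k)%C) by (apply geo_plus; assumption).
  assert (Gall : geo (fun k => gam Gb k + (q k + b k))%C) by (apply geo_plus; assumption).
  unfold W2. rewrite conv_add_l by assumption. rewrite !conv_add_r by assumption.
  assert (E1 : conv Wb q k = (od k - conv err2 od k)%C).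
  { unfold q. rewrite (conv_fin_assoc Wb (conv Dseq s) od NW (1 + NB) k Wb_fin);
      [|apply fin_conv; [apply fin_Dseq|exact s_fin]].
    unfold err2. rewrite conv_sub_l, conv_one;
      [ring|apply (geo_fin _ 0), fin_cst|repeat apply geo_conv; assumption|exact God]. }
  assert (Ea0 : geo (fun j => a0 * cst 1 j)%C) by (apply geo_scal, (geo_fin _ 0), fin_cst).
  assert (E2 : conv Wb b k = (conv rho2 te k + conv a te k + a0 * te k)%C).
  { unfold b. rewrite (conv_fin_assoc Wb Bseq te NW 1 k Wb_fin fin_Bseq).
    rewrite <- cv_one_r. unfold rho2.
    assert (GWB : geo (conv Wb Bseq)) by (apply geo_conv; assumption).
    assert (GWBa : geo (fun k => conv Wb Bseq k - a k)%C) by (apply geo_minus; assumption).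
    rewrite conv_sub_l by assumption. rewrite conv_sub_l by assumption. ring. }
  rewrite E1, E2. unfold K2, Kop, Del2. fold (eta2 d) te od q b.
  change (conv s od) with (eta2 d).
  assert (Gtd := geo_tdeta d Hd).
  assert (E3 : conv a (fun j => (tau2 j - t j) * eta2 d j)%C k =
    (conv a te k - conv a (fun j => t j * eta2 d j)%C k)%C).
  { assert (Gt : geo (fun j => t j * eta2 d j)%C).
    { apply (geo_ext (fun j => te j - (tau2 j - t j) * eta2 d j)%C).
      - intros j. unfold te. ring.
      - apply geo_minus; assumption. }
    rewrite <- conv_sub_r by assumption. apply conv_ext; [reflexivity|]. intros j. unfold te. ring. }
  rewrite E3. unfold res2, cc2, phi2, G2.
  assert (E4 : od k = (d k - (if (k =? p)%Z then RtoC 1 else RtoC 0) * d p)%C).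
  { unfold od, sl. destruct (Z.eqb_spec k p) as [->|]; ring. }
  assert (E5 : te k = (tau2 k * eta2 d k)%C) by reflexivity.
  rewrite E4, E5. ring.
Qed.

Lemma sl_nrm x B : nrm tau x B -> nrm tau (fun k => sl k * x k)%C B.
Proof.
  intros H. rewrite <- (Rmult_1_l B). apply (nrm_bmul tau sl); [apply sl_le|exact H].
Qed.

Lemma eta_nrm x B : nrm tau x B -> nrm tau (eta2 x) (ns * B).
Proof. intros H. apply conv_nrm; [lra|exact s_le|apply sl_nrm, H]. Qed.

Lemma taueta_nrm x B : nrm tau x B -> nrm tau (fun j => tau2 j * eta2 x j)%C (2 * (ns * B)).
Proof. intros H. apply (nrm_bmul tau tau2); [apply tau2_le|apply eta_nrm, H]. Qed.

Lemma Del2_nrm x B : nrm tau x B -> nrm tau (Del2 x) (del2 * B).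
Proof.
  intros H. assert (Ht : 0 <= tau) by lra.
  assert (H1 := sl_nrm _ _ H). assert (H2 := taueta_nrm _ _ H).
  assert (H3 : nrm tau (fun j => (tau2 j - t j) * eta2 x j)%C (dt * (ns * B))).
  { apply (nrm_bmul tau (fun j => tau2 j - t j)%C); [apply t_le|apply eta_nrm, H]. }
  replace (del2 * B) with (eps * B + nW * (nDs * B) + nW * (nB * (2 * (ns * B))) + da * (2 * (ns * B))
     + anorm * (dt * (ns * B)) + phim * (dt * (ns * B))) by (unfold del2; ring).
  unfold Del2. apply nrm_minus; [|apply (nrm_bmul tau phi2); [apply phi_le|exact H3]].
  apply nrm_plus; [|apply conv_nrm; assumption]. apply nrm_plus; [|apply conv_nrm; assumption].
  apply nrm_plus; [|repeat apply conv_nrm; assumption].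
  apply nrm_plus; [|repeat apply conv_nrm; assumption].
  apply nrm_opp, conv_nrm; assumption.
Qed.

Lemma eta_minus x y k : geo x -> geo y ->
  eta2 (fun j => x j - y j)%C k = (eta2 x k - eta2 y k)%C.
Proof.
  intros Hx Hy. unfold eta2. rewrite <- conv_sub_r by (first [apply geo_s2|apply geo_sl; assumption]).
  apply conv_ext; [reflexivity|]. intros j. ring.
Qed.

Lemma Del2_minus x y k : geo x -> geo y -> geo dW ->
  Del2 (fun j => x j - y j)%C k = (Del2 x k - Del2 y k)%C.
Proof.
  intros Hx Hy HW. unfold Del2.
  assert (Gs := geo_s2). assert (GW := geo_Wb2). assert (GD := geo_Dseq). assert (GB := geo_B2).
  assert (Ga := geo_a2).
  assert (Ge : geo err2) by (apply (nrm_geo tau _ eps); assumption).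
  assert (Gr : geo rho2) by (apply (nrm_geo tau _ da); assumption).
  assert (Sx := geo_sl x Hx). assert (Sy := geo_sl y Hy).
  assert (Tx := geo_taueta x Hx). assert (Ty := geo_taueta y Hy).
  assert (Dx := geo_tdeta x Hx). assert (Dy := geo_tdeta y Hy).
  assert (GDs : geo (conv Dseq s)) by (apply geo_conv; assumption).
  assert (E1 : forall b k, geo b -> conv b (fun j => sl j * (x j - y j))%C k =
     (conv b (fun j => sl j * x j) k - conv b (fun j => sl j * y j) k)%C).
  { intros b j Hb. rewrite <- conv_sub_r by assumption. apply conv_ext; [reflexivity|]. intros; ring. }
  assert (E2 : forall b k, geo b -> conv b (fun j => tau2 j * eta2 (fun j => x j - y j) j)%C k =
     (conv b (fun j => tau2 j * eta2 x j) k - conv b (fun j => tau2 j * eta2 y j) k)%C).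
  { intros b j Hb. rewrite <- conv_sub_r by assumption. apply conv_ext; [reflexivity|]. intros i.
    rewrite eta_minus by assumption. ring. }
  assert (E3 : conv a (fun j => (tau2 j - t j) * eta2 (fun j => x j - y j) j)%C k =
     (conv a (fun j => (tau2 j - t j) * eta2 x j) k - conv a (fun j => (tau2 j - t j) * eta2 y j) k)%C).
  { rewrite <- conv_sub_r by assumption. apply conv_ext; [reflexivity|]. intros i.
    rewrite eta_minus by assumption. ring. }
  assert (E4 : conv dW (conv (conv Dseq s) (fun j => sl j * (x j - y j))%C) k =
    (conv dW (conv (conv Dseq s) (fun j => sl j * x j)%C) k - conv dW (conv (conv Dseq s) (fun j => sl j * y j)%C) k)%C).
  { rewrite <- conv_sub_r by (first [assumption|apply geo_conv; assumption]).
    apply conv_ext; [reflexivity|]. intros i. apply E1, GDs. }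
  assert (E5 : conv dW (conv Bseq (fun j => tau2 j * eta2 (fun j => x j - y j) j)%C) k =
    (conv dW (conv Bseq (fun j => tau2 j * eta2 x j)%C) k - conv dW (conv Bseq (fun j => tau2 j * eta2 y j)%C) k)%C).
  { rewrite <- conv_sub_r by (first [assumption|apply geo_conv; assumption]).
    apply conv_ext; [reflexivity|]. intros i. apply E2, GB. }
  rewrite E4, E5, E1, E2, E3, eta_minus by assumption. ring.
Qed.

Lemma K2_minus x y k : geo x -> geo y ->
  K2 (fun j => x j - y j)%C k = (K2 x k - K2 y k)%C.
Proof.
  intros Hx Hy. unfold K2, Kop. fold (eta2 x) (eta2 y) (eta2 (fun j => x j - y j)%C).
  assert (Ga := geo_a2).
  assert (Gt : forall d, geo d -> geo (fun j => t j * eta2 d j)%C).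
  { intros d Hd. apply (geo_ext (fun j => tau2 j * eta2 d j - (tau2 j - t j) * eta2 d j)%C).
    - intros j. ring.
    - apply geo_minus; [apply geo_taueta|apply geo_tdeta]; exact Hd. }
  assert (E : conv a (fun j => t j * eta2 (fun j => x j - y j) j)%C k =
     (conv a (fun j => t j * eta2 x j) k - conv a (fun j => t j * eta2 y j) k)%C).
  { rewrite <- conv_sub_r by (first [assumption|apply Gt; assumption]).
    apply conv_ext; [reflexivity|]. intros i. rewrite eta_minus by assumption. ring. }
  rewrite E, eta_minus by assumption. ring.
Qed.

Lemma T2_expand x k : geo x -> geo (Aop m S x) -> geo dW ->
  T2 x k = ((x k - Aop m S x k + K2 (Aop m S x) k) - Del2 (Aop m S x) k +
     Aop m S x p * (tau2 k * eta2 (Aop m S x) k) - (res2 k + conv dW (gam Gb) k))%C.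
Proof. intros Hx Hd HW. unfold T2. rewrite (F2_expand _ k Hd HW). ring. Qed.

Lemma F2_zero : exists d, nrm tau d (al * r) /\ Cmod (d p) <= rowp * r /\
  forall k, F2 d k = RtoC 0.
Proof.
  assert (Ht : 0 <= tau) by lra.
  assert (GW : geo dW) by (eapply nrm_geo; eassumption).
  destruct (contraction tau r kap2 T2 (fun _ => True)) as (x & _ & Hx & HT); try assumption; auto.
  - intros x y B _ _ Hx Hy Hxy.
    assert (HAx := A_le _ _ Hx). assert (HAy := A_le _ _ Hy). assert (HAd := A_le _ _ Hxy).
    set (z := fun k => (x k - y k)%C) in *.
    assert (Gx0 := nrm_geo _ _ _ tau_pos Hx). assert (Gy0 := nrm_geo _ _ _ tau_pos Hy).
    assert (Gx := nrm_geo _ _ _ tau_pos HAx). assert (Gy := nrm_geo _ _ _ tau_pos HAy).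
    set (dx := Aop m S x) in *. set (dy := Aop m S y) in *.
    assert (HAd' : nrm tau (fun k => dx k - dy k)%C (al * B)).
    { eapply nrm_ext; [|exact HAd]. intros k. apply Aop_minus. }
    (* The product of eigenvalue and eigenvector corrections is differenced as
       [z_p eta_x + y_p eta_z]. *)
    assert (N : nrm tau (fun k => (z k - Aop m S z k + K2 (Aop m S z) k) - Del2 (fun k => dx k - dy k) k +
       (Aop m S z p * (tau2 k * eta2 dx k) + dy p * (tau2 k * eta2 (fun k => dx k - dy k) k)))%C
       (kap0 * B + del2 * (al * B) + (rowp * B * (2 * (ns * (al * r))) + rowp * r * (2 * (ns * (al * B)))))).
    { apply nrm_plus; [apply nrm_minus; [apply lin_le; assumption|apply Del2_nrm, HAd']|].
      apply nrm_plus.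
      - apply (nrm_bmul tau (fun _ => Aop m S z p)); [intros _; apply row_le, Hxy|apply taueta_nrm, HAx].
      - apply (nrm_bmul tau (fun _ => dy p)); [intros _; apply row_le, Hy|apply taueta_nrm, HAd']. }
    replace (kap2 * B) with (kap0 * B + del2 * (al * B) +
      (rowp * B * (2 * (ns * (al * r))) + rowp * r * (2 * (ns * (al * B))))) by (unfold kap2; ring).
    eapply nrm_ext; [|exact N]. intros k. cbn beta.
    rewrite (T2_expand x k), (T2_expand y k) by assumption. fold dx dy.
    rewrite Del2_minus, eta_minus by assumption.
    assert (EA : forall j, Aop m S z j = (dx j - dy j)%C) by (intros; apply Aop_minus).
    assert (EK : K2 (Aop m S z) k = (K2 dx k - K2 dy k)%C).
    { rewrite <- K2_minus by assumption. unfold K2, Kop.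
      assert (EC : forall j, conv s (fun i => sl i * Aop m S z i)%C j = conv s (fun i => sl i * (dx i - dy i))%C j).
      { intros j. apply conv_ext; [reflexivity|]. intros i. rewrite EA. reflexivity. }
      rewrite EC, EA. do 2 f_equal.
      apply conv_ext; [reflexivity|]. intros j. rewrite EC. reflexivity. }
    rewrite EK, !EA. unfold z. ring.
  - eapply nrm_le; [exact r_ge|].
    apply (nrm_ext tau (fun k => - (res2 k + conv dW (gam Gb) k))%C).
    + assert (E0 : forall k, Aop m S (fun _ => RtoC 0) k = RtoC 0).
      { intros k. unfold Aop. destruct (low m k); [|reflexivity].
        rewrite (zsC_ext _ (fun _ => RtoC 0)) by (intros; ring). apply zsC_zero. }
      assert (G0 : geo (fun _ => RtoC 0)) by (apply (geo_fin _ 0); intros ? ?; reflexivity).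
      assert (GA : geo (Aop m S (fun _ => RtoC 0))) by (apply (geo_ext (fun _ => RtoC 0)); [intros; symmetry; apply E0|exact G0]).
      set (z := Aop m S (fun _ => RtoC 0)) in *.
      assert (EZ : forall b j, (forall i, b i = RtoC 0) -> forall g, conv g b j = RtoC 0).
      { intros b j Hb g. unfold conv. rewrite (tsum_ext _ (fun _ => RtoC 0)) by (intros; rewrite Hb; ring).
        rewrite (tsum_finite _ 0) by reflexivity. apply zsC_zero. }
      assert (Eeta : forall i, eta2 z i = RtoC 0).
      { intros i. apply EZ. intros j. rewrite E0. ring. }
      intros k. rewrite (T2_expand _ k G0 GA GW). fold z.
      assert (ED : Del2 z k = RtoC 0).
      { unfold Del2. rewrite !EZ; try (intros; rewrite ?Eeta, ?E0; ring); rewrite ?Eeta; try ring.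
        all: intros; apply EZ; intros; rewrite ?Eeta, ?E0; ring. }
      assert (EK : K2 z k = RtoC 0).
      { unfold K2, Kop. fold (eta2 z). rewrite EZ by (intros; rewrite Eeta; ring).
        rewrite Eeta, E0. ring. }
      rewrite ED, EK, Eeta, !E0. ring.
    + apply nrm_opp, nrm_plus; [exact res_le|]. apply conv_nrm; assumption.
  - exists (Aop m S x). split; [apply A_le, Hx|]. split; [apply row_le, Hx|]. intros k.
    specialize (HT k). unfold T2 in HT.
    replace (F2 (Aop m S x) k) with (x k - (x k - F2 (Aop m S x) k))%C by ring. rewrite HT. ring.
Qed.

Hypothesis nonvanishing : rowp * r * zs (fun k => Cmod (Gb k)) Lg +
    (1 + (Cmod nub + rowp * r)) * (2 * (ns * (al * r))) <
  Cmod (zsC (fun k => (RtoC (sig k) + nub) * Gb k)%C Lg).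

Lemma fin_sum_ser b N : fin b N -> ser b 0 = zsC b N.
Proof.
  intros H. rewrite (ser_finite b N 0 H). apply zsC_ext. intros k _.
  rewrite Rmult_0_r, expi_0. ring.
Qed.

Theorem eigen_equation_solution : exists G nu, geo G /\ Cmod (nu - nub)%C <= rowp * r /\
  (forall k, conv W2 (gam G) k = ((RtoC (sig k) + nu) * G k)%C) /\
  ser (fun k => (RtoC (sig k) + nu) * G k)%C 0 <> RtoC 0.
Proof.
  destruct F2_zero as (d & Hd & Hp & HF).
  assert (Gd := nrm_geo _ _ _ tau_pos Hd). assert (Ht : 0 <= tau) by lra.
  exists (G2 d), (nub + d p)%C. split; [apply geo_G2, Gd|]. split; [|split].
  - replace (nub + d p - nub)%C with (d p) by ring. exact Hp.
  - intros k. specialize (HF k). unfold F2 in HF.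
    replace (conv W2 (gam (G2 d)) k) with
      (conv W2 (gam (G2 d)) k - (RtoC (sig k) + (nub + d p)) * G2 d k +
       (RtoC (sig k) + (nub + d p)) * G2 d k)%C by ring.
    rewrite HF. ring.
  (* The series is split into the numerical part [b], the change [b'] due to the eigenvalue and the
     change [b''] due to the eigenvector; the margin in [nonvanishing] covers the last two. *)
  - set (b := fun k => ((RtoC (sig k) + nub) * Gb k)%C) in *.
    assert (Fb : fin b Lg) by (intros k Hk; unfold b; rewrite (Gb_fin k Hk); ring).
    destruct (geo_asum _ (geo_fin _ _ Fb)) as [A1 HA1].
    set (b' := fun k => (d p * Gb k)%C).
    assert (HG : asum Gb (zs (fun k => Cmod (Gb k)) Lg)) by (apply fin_asum, Gb_fin).
    assert (HA2 : asum b' (rowp * r * zs (fun k => Cmod (Gb k)) Lg)).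
    { apply (nrm_asum 0); [lra|]. apply (nrm_bmul 0 (fun _ => d p)); [intros _; exact Hp|].
      apply asum_nrm, HG. }
    set (b'' := fun k => ((RtoC (sig k) + (nub + d p)) * (tau2 k * eta2 d k))%C).
    assert (HA3 : asum b'' ((1 + (Cmod nub + rowp * r)) * (2 * (ns * (al * r))))).
    { apply (nrm_asum tau); [exact Ht|].
      apply (nrm_bmul tau (fun k => RtoC (sig k) + (nub + d p))%C); [|apply taueta_nrm, Hd].
      intros k. eapply Rle_trans; [apply Cmod_triangle|]. apply Rplus_le_compat.
      - rewrite Cmod_R. unfold sig. destruct (_ <? _)%Z; [rewrite Rabs_left by lra|rewrite Rabs_pos_eq by lra]; lra.
      - eapply Rle_trans; [apply Cmod_triangle|]. lra. }
    assert (HA23 : asum (fun k => b' k + b'' k)%C (rowp * r * zs (fun k => Cmod (Gb k)) Lg +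
       (1 + (Cmod nub + rowp * r)) * (2 * (ns * (al * r))))).
    { apply (nrm_asum 0); [lra|]. apply nrm_plus; apply asum_nrm; assumption. }
    rewrite (ser_ext _ (fun k => b k + (b' k + b'' k))%C) by (intros k; unfold b, b', b'', G2; ring).
    rewrite (ser_plus _ _ _ _ _ HA1 HA23), (fin_sum_ser b Lg Fb).
    intros E. generalize (ser_bound _ _ 0 HA23). set (z := ser _ _) in *.
    replace z with (- zsC b Lg)%C.
    + rewrite Cmod_opp. lra.
    + replace z with (zsC b Lg + z - zsC b Lg)%C by ring. rewrite E. ring.
Qed.

End EigenEquation.

(** * Integer certificates *)

(** The executable counterpart of [zs], with an integer index and an accumulator. *)
Fixpoint zsa (f : Z -> Z) (n : nat) (i acc : Z) : Z :=
  match n with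
  | O => acc
  | S n => zsa f n (i + 1)%Z (acc + (f i + f (- i)))%Z
  end.

Definition zsZ (f : Z -> Z) (n : nat) : Z := zsa f n 1%Z (f 0%Z).

Lemma zsa_spec f n k acc : IZR acc = zs (fun j => IZR (f j)) k ->
  IZR (zsa f n (Z.of_nat (S k)) acc) = zs (fun j => IZR (f j)) (n + k).
Proof.
  revert k acc. induction n as [|n IH]; intros k acc H; [exact H|].
  cbn [zsa]. replace (Z.of_nat (S k) + 1)%Z with (Z.of_nat (S (S k))) by lia.
  rewrite IH; [f_equal; lia|]. cbn [zs]. rewrite !plus_IZR, H. reflexivity.
Qed.

Lemma IZR_zsZ f n : IZR (zsZ f n) = zs (fun j => IZR (f j)) n.
Proof.
  unfold zsZ. change 1%Z with (Z.of_nat 1). rewrite (zsa_spec f n 0); [f_equal; lia|reflexivity].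
Qed.

(** Nested conditionals stop at the first failure even under call by value. *)
Fixpoint alla (b : Z -> bool) (n : nat) (i : Z) : bool :=
  match n with
  | O => true
  | S n => if b i then if b (- i)%Z then alla b n (i + 1)%Z else false else false
  end.

Definition allz (b : Z -> bool) (n : nat) : bool := if b 0%Z then alla b n 1%Z else false.

Lemma allz_spec b n : allz b n = true -> forall k, (Z.abs k <= Z.of_nat n)%Z -> b k = true.
Proof.
  assert (H : forall n i, alla b n i = true -> forall k, (i <= Z.abs k < i + Z.of_nat n)%Z -> b k = true).
  { clear. induction n as [|n IH]; intros i H k Hk; [lia|]. cbn [alla] in H.
    destruct (b i) eqn:E1; [|discriminate]. destruct (b (- i)%Z) eqn:E2; [|discriminate].
    destruct (Z.eq_dec k i) as [->|]; [exact E1|].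
    destruct (Z.eq_dec k (- i)%Z) as [->|]; [exact E2|].
    destruct (Z.eq_dec (Z.abs k) i); [lia|]. apply (IH _ H). lia. }
  unfold allz. destruct (b 0%Z) eqn:E0; [|discriminate]. intros Ha k Hk.
  destruct (Z.eq_dec k 0) as [->|]; [exact E0|]. apply (H n 1%Z Ha). lia.
Qed.

(** Binary tries indexed by positive numbers, so that a table lookup costs only the length of the
    index. *)
Inductive tree (A : Type) : Type := Lf | Nd (l : tree A) (x : A) (r : tree A).
Arguments Lf {A}.
Arguments Nd {A} l x r.

Fixpoint tget {A} (d : A) (t : tree A) (q : positive) : A :=
  match t with
  | Lf => d
  | Nd l x r => match q with xH => x | xO q => tget d l q | xI q => tget d r q end
  end.

Fixpoint tset {A} (d : A) (t : tree A) (q : positive) (v : A) : tree A :=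
  let '(l, x, r) := match t with Lf => (Lf, d, Lf) | Nd l x r => (l, x, r) end in
  match q with xH => Nd l v r | xO q => Nd (tset d l q v) x r | xI q => Nd l x (tset d r q v) end.

Definition key (k : Z) : positive :=
  match k with Z0 => xH | Zpos q => xO q | Zneg q => xI q end.

Fixpoint fill {A} (d : A) (f : Z -> A) (n : nat) : tree A :=
  match n with
  | O => tset d Lf xH (f 0%Z)
  | S n' => let k := Z.of_nat n in
    tset d (tset d (fill d f n') (key k) (f k)) (key (- k)) (f (- k)%Z)
  end.

(** No property of [fill] is ever needed: a table is read through [look], which fixes its support,
    and its entries are compared with their intended values by the boolean checks. *)
Definition look {A} (d : A) (t : tree A) (n : nat) (k : Z) : A :=
  if (Z.abs k <=? Z.of_nat n)%Z then tget d t (key k) else d.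

Definition listed (l : list Z) (n : nat) : tree Z :=
  fill 0%Z (fun k => List.nth (Z.to_nat (k + Z.of_nat n)) l 0%Z) n.

Definition rz (sc : R) (f : Z -> Z) (k : Z) : C := RtoC (IZR (f k) / sc).
Definition cq (sc : R) (x y : Z) : C := (IZR x / sc, IZR y / sc).
Definition cz (sc : R) (f g : Z -> Z) (k : Z) : C := (IZR (f k) / sc, IZR (g k) / sc).

Definition finZ (f : Z -> Z) (n : nat) : Prop := forall k, (Z.of_nat n < Z.abs k)%Z -> f k = 0%Z.

Lemma look_fin t n : finZ (look 0%Z t n) n.
Proof.
  intros k Hk. unfold look. destruct (Z.leb_spec (Z.abs k) (Z.of_nat n)); [lia|reflexivity].
Qed.

Lemma rz_fin sc f n : finZ f n -> fin (rz sc f) n.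
Proof. intros H k Hk. unfold rz. rewrite (H k Hk). unfold Rdiv. rewrite Rmult_0_l. reflexivity. Qed.

Lemma cz_fin sc f g n : finZ f n -> finZ g n -> fin (cz sc f g) n.
Proof.
  intros H H' k Hk. unfold cz. rewrite (H k Hk), (H' k Hk). unfold Rdiv. rewrite Rmult_0_l. reflexivity.
Qed.

Lemma Cmod_pair x y : Cmod (x, y) <= Rabs x + Rabs y.
Proof. apply (Cmod_le_abs (x, y)). Qed.

Lemma Cmod_rz sc f k : 0 < sc -> Cmod (rz sc f k) = IZR (Z.abs (f k)) / sc.
Proof.
  intros H. unfold rz. rewrite Cmod_R. unfold Rdiv. rewrite Rabs_mult, Rabs_inv, (Rabs_pos_eq sc) by lra.
  rewrite abs_IZR. reflexivity.
Qed.

Lemma Cmod_cz sc f g k : 0 < sc -> Cmod (cz sc f g k) <= IZR (Z.abs (f k) + Z.abs (g k)) / sc.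
Proof.
  intros H. unfold cz. eapply Rle_trans; [apply Cmod_pair|]. unfold Rdiv.
  rewrite !Rabs_mult, Rabs_inv, (Rabs_pos_eq sc) by lra. rewrite plus_IZR, !abs_IZR. lra.
Qed.

Lemma zs_div f n sc : zs (fun k => f k / sc) n = zs f n / sc.
Proof.
  unfold Rdiv. rewrite Rmult_comm, <- zs_scal. apply zs_ext. intros; ring.
Qed.

Lemma zs_rz sc f n b : 0 < sc -> (zsZ (fun k => Z.abs (f k)) n <=? b)%Z = true ->
  zs (fun k => Cmod (rz sc f k)) n <= IZR b / sc.
Proof.
  intros H Hb. apply Z.leb_le, IZR_le in Hb. rewrite IZR_zsZ in Hb.
  rewrite (zs_ext _ (fun k => IZR (Z.abs (f k)) / sc)) by (intros; apply Cmod_rz, H).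
  rewrite zs_div. apply Rmult_le_compat_r; [apply Rlt_le, Rinv_0_lt_compat, H|exact Hb].
Qed.

Lemma zs_cz sc f g n b : 0 < sc -> (zsZ (fun k => Z.abs (f k) + Z.abs (g k)) n <=? b)%Z = true ->
  zs (fun k => Cmod (cz sc f g k)) n <= IZR b / sc.
Proof.
  intros H Hb. apply Z.leb_le, IZR_le in Hb. rewrite IZR_zsZ in Hb.
  eapply Rle_trans; [apply zs_le; intros k _; apply (Cmod_cz _ _ _ _ H)|].
  rewrite zs_div. apply Rmult_le_compat_r; [apply Rlt_le, Rinv_0_lt_compat, H|exact Hb].
Qed.

Lemma C_pair_eq (a b a' b' : R) : a = a' -> b = b' -> (a, b) = (a', b') :> C.
Proof. intros -> ->. reflexivity. Qed.

Lemma zsC_cz sc f g n : zsC (cz sc f g) n = (IZR (zsZ f n) / sc, IZR (zsZ g n) / sc).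
Proof.
  unfold zsC, cz. apply C_pair_eq; cbn [Re Im fst snd]; rewrite zs_div, IZR_zsZ; reflexivity.
Qed.

Definition convZ (f g : Z -> Z) (n : nat) (k : Z) : Z := zsZ (fun j => (f j * g (k - j))%Z) n.

Lemma conv_rz_cz s1 s2 f g h n k : finZ f n -> s1 <> 0 -> s2 <> 0 ->
  conv (rz s1 f) (cz s2 g h) k = cz (s1 * s2) (convZ f g n) (convZ f h n) k.
Proof.
  intros Hf H1 H2. rewrite (conv_finite_l _ _ n k (rz_fin _ _ _ Hf)).
  rewrite (zsC_ext _ (cz (s1 * s2) (fun j => f j * g (k - j))%Z (fun j => f j * h (k - j))%Z)).
  - apply zsC_cz.
  - intros j _. unfold rz, cz. apply C_eq; simpl; rewrite mult_IZR; field; auto.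
Qed.

Lemma rz_cz sc f k : rz sc f k = cz sc f (fun _ => 0%Z) k.
Proof. unfold rz, cz, RtoC. apply C_pair_eq; [reflexivity|]. unfold Rdiv. ring. Qed.

Lemma zsZ_0 n : zsZ (fun _ => 0%Z) n = 0%Z.
Proof. apply eq_IZR. rewrite IZR_zsZ. apply zs_zero. Qed.

Lemma conv_rz s1 s2 f g n k : finZ f n -> s1 <> 0 -> s2 <> 0 ->
  conv (rz s1 f) (rz s2 g) k = rz (s1 * s2) (convZ f g n) k.
Proof.
  intros Hf H1 H2. rewrite (conv_ext _ (rz s1 f) _ (cz s2 g (fun _ => 0%Z)) k (fun _ => eq_refl) (rz_cz s2 g)).
  rewrite (conv_rz_cz _ _ _ _ _ n) by assumption. rewrite rz_cz. unfold cz. f_equal. f_equal. f_equal.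
  apply eq_IZR. unfold convZ. rewrite IZR_zsZ.
  rewrite (zs_ext _ (fun _ => 0)); [apply zs_zero|]. intros j _. rewrite Z.mul_0_r. reflexivity.
Qed.

Section Certificate.

Variables (m NB na NC : nat) (p : Z) (sym : bool).
Variables (tz sz az phr phi ccr cci oz rhoT hT : Z -> Z) (Sr Si Mr Mi V : Z -> Z -> Z).
Variables (Phiz natz k2z alz kz rowz : Z) (tau : R).

(** Fixed-point scales: [t] 2^16, [s] 2^18, [a] and [ph] 2^24, [cc] 2^30, [S] 2^14, [M] (the rounded
    matrix of [Kop]) 2^20; hence 2^58 for [Kr], 2^34 for [Rr] and 2^35 for [Qr].  When [sym] holds only
    even sequences matter (on odd ones the linearization is singular, by translation invariance), and
    the residual matrix may be symmetrized. *)
Definition hi (k : Z) : Z := if low m k then 0%Z else 1%Z.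

Definition Kr (i j : Z) : Z :=
  (oz j * (phr i * V i j - zsZ (fun n => az n * V (i - n) j) na)
   + if (j =? p)%Z then ccr i * 268435456 else 0)%Z.
Definition Ki (i j : Z) : Z :=
  (oz j * (phi i * V i j) + if (j =? p)%Z then cci i * 268435456 else 0)%Z.

(** [V] caches the products [t_l s_(l-j)], which the convolution with [a] would otherwise recompute
    for every entry. *)
Definition check_V : bool :=
  allz (fun l => allz (fun j => (V l j =? tz l * sz (l - j))%Z) m) (m + na).
(** One unit of [M] is [2^38] at the scale of [Kr]; the tolerance [2^37] is rounding to the nearest
    integer. *)
Definition check_M : bool :=
  allz (fun i => allz (fun j => if (Z.abs (Kr i j - Mr i j * 274877906944) <=? 137438953472)%Z
    then (Z.abs (Ki i j - Mi i j * 274877906944) <=? 137438953472)%Z else false) m) m.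
Definition check_rho : bool :=
  allz (fun l => (Phiz * hi l + zsZ (fun q => Z.abs (az q) * hi (l + q)) na <=? rhoT l)%Z) (m + NB).
Definition check_h : bool :=
  allz (fun k => (oz k * zsZ (fun n => rhoT (k + n) * (Z.abs (tz (k + n)) * Z.abs (sz n))) NB +
    (if k =? p then 268435456 * zsZ (fun i => hi i * (Z.abs (ccr i) + Z.abs (cci i))) NC else 0)
     <=? hT k * 274877906944)%Z) m.
Definition check_k2 : bool :=
  allz (fun j => if low m j then true else
    (zsZ (fun n => Z.abs (tz (j + n)) * Z.abs (sz n)) NB <=? k2z)%Z) (S NB).
Definition check_al : bool :=
  allz (fun j => (zsZ (fun k => Z.abs (Sr k j) + Z.abs (Si k j)) m <=? alz)%Z) m.

Definition Rr (i j : Z) : Z :=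
  ((if i =? j then 17179869184 else 0) - Sr i j * 1048576 +
   zsZ (fun k => Mr i k * Sr k j - Mi i k * Si k j) m)%Z.
Definition Ri (i j : Z) : Z :=
  (- Si i j * 1048576 + zsZ (fun k => Mr i k * Si k j + Mi i k * Sr k j) m)%Z.

Definition Qr (i j : Z) : Z := if sym then (Rr i j + Rr i (- j))%Z else (2 * Rr i j)%Z.
Definition Qi (i j : Z) : Z := if sym then (Ri i j + Ri i (- j))%Z else (2 * Ri i j)%Z.

Definition check_col (j : Z) : bool :=
  (2 * zsZ (fun k => hT k * (Z.abs (Sr k j) + Z.abs (Si k j))) m +
   zsZ (fun i => Z.abs (Qr i j) + Z.abs (Qi i j)) m <=? kz)%Z.
Definition check_cols : bool := allz check_col m.

Definition check_row : bool :=
  allz (fun j => (Z.abs (Sr p j) + Z.abs (Si p j) <=? rowz)%Z) m.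

Definition s_ := rz 262144 sz.
Definition t_ := rz 65536 tz.
Definition a_ := rz 16777216 az.
Definition ph_ := cz 16777216 phr phi.
Definition u_ (k : Z) : C := (ph_ k * t_ k)%C.
Definition cc_ := cz 1073741824 ccr cci.
Definition o_ (k : Z) : C := RtoC (IZR (oz k)).
Definition S_ (k j : Z) : C := cz 16384 (fun k => Sr k j) (fun k => Si k j) k.

Hypothesis sz_fin : finZ sz NB.
Hypothesis az_fin : finZ az na.
Hypothesis ccr_fin : finZ ccr NC.
Hypothesis cci_fin : finZ cci NC.
Hypothesis oz_01 : forall k, (0 <= oz k <= 1)%Z.
Hypothesis p_low : (Z.abs p <= Z.of_nat m)%Z.
Hypothesis m_NB : (m <= NB)%nat.
Hypothesis t_mono : forall k k0, (0 < k0 <= k)%Z \/ (k <= k0 < 0)%Z -> (Z.abs (tz k) <= Z.abs (tz k0))%Z.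
Hypothesis S_out : forall k j, (Z.of_nat m < Z.abs j)%Z -> Sr k j = 0%Z /\ Si k j = 0%Z.
Hypothesis HV : check_V = true.
Hypothesis HM : check_M = true.
Hypothesis Hrho : check_rho = true.
Hypothesis Hh : check_h = true.
Hypothesis Hk2 : check_k2 = true.
Hypothesis Hal : check_al = true.
Hypothesis Hcol : check_cols = true.
Hypothesis Hrow : check_row = true.
Hypothesis Hph : forall k, (0 <= Phiz)%Z /\ (phr k * phr k + phi k * phi k <= Phiz * Phiz)%Z.
Hypothesis Hna : (zsZ (fun n => Z.abs (az n)) na <=? natz)%Z = true.
Hypothesis alz_ge : (16384 <= alz)%Z.
Hypothesis tau_pos : 0 <= tau.
Hypothesis w_exp : exp (tau * INR (m + NB + na + NC)) <= 1001 / 1000.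

(** The second summand pays for rounding [Kop] to [M]: an entry of the residual moves by at most the
    column sum of [S] times [2^-20], and a column has [2 m + 1] entries. *)
Definition kapL : R := IZR kz / 34359738368 + INR (2 * m + 1) * (IZR alz / 16384) / 1048576.
Definition kapH : R := (IZR Phiz / 16777216 + IZR natz / 16777216) * (IZR k2z / 17179869184).

Variable kap : R.
Hypothesis kapL_le : kapL <= kap.
Hypothesis kapH_le : kapH <= kap.

Lemma V_eq l j : (Z.abs l <= Z.of_nat (m + na))%Z -> (Z.abs j <= Z.of_nat m)%Z ->
  V l j = (tz l * sz (l - j))%Z.
Proof.
  intros Hl Hj. apply Z.eqb_eq.
  apply (allz_spec _ _ (allz_spec _ _ HV l Hl) j Hj).
Qed.

Notation K := (Kmat na p s_ a_ cc_ u_ t_ o_).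

Lemma K_eq i j : (Z.abs i <= Z.of_nat m)%Z -> (Z.abs j <= Z.of_nat m)%Z ->
  K i j = cq 288230376151711744 (Kr i j) (Ki i j).
Proof.
  intros Hi Hj. unfold Kmat, Kr, Ki.
  rewrite (zsC_ext _ (cz 288230376151711744 (fun n => az n * V (i - n) j)%Z (fun _ => 0%Z))).
  - rewrite zsC_cz, zsZ_0. unfold o_, u_, ph_, t_, s_, cz, rz, cc_. rewrite (V_eq i j) by lia.
    apply C_eq; destruct (_ =? _)%Z; simpl; unfold cz; simpl;
    rewrite ?plus_IZR, ?minus_IZR, ?mult_IZR, ?minus_IZR, ?mult_IZR; field.
  - intros n Hn. unfold a_, t_, s_, rz, cz. rewrite V_eq by lia. apply C_eq; simpl; rewrite ?mult_IZR; field.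
Qed.

Lemma K_M i j : (Z.abs i <= Z.of_nat m)%Z -> (Z.abs j <= Z.of_nat m)%Z ->
  Cmod (K i j - cq 1048576 (Mr i j) (Mi i j))%C <= / 1048576.
Proof.
  intros Hi Hj. rewrite (K_eq i j Hi Hj).
  pose proof (allz_spec _ _ HM i Hi) as H0. cbn beta in H0.
  pose proof (allz_spec _ _ H0 j Hj) as H. cbn beta in H.
  destruct (Z.leb_spec (Z.abs (Kr i j - Mr i j * 274877906944)) 137438953472) as [H1|]; [|discriminate].
  apply Z.leb_le in H. apply IZR_le in H, H1. rewrite abs_IZR, minus_IZR, mult_IZR in H, H1.
  eapply Rle_trans; [apply Cmod_le_abs|]. unfold cq. simpl.
  set (x := IZR (Kr i j)) in *. set (y := IZR (Ki i j)) in *.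
  set (x' := IZR (Mr i j)) in *. set (y' := IZR (Mi i j)) in *.
  replace (x / 288230376151711744 + - (x' / 1048576)) with
    ((x - x' * 274877906944) * / 288230376151711744) by field.
  replace (y / 288230376151711744 + - (y' / 1048576)) with
    ((y - y' * 274877906944) * / 288230376151711744) by field.
  rewrite !Rabs_mult, (Rabs_pos_eq (/ 288230376151711744)) by lra. lra.
Qed.

Lemma S_col j : zs (fun k => Cmod (S_ k j)) m <= IZR alz / 16384.
Proof.
  destruct (Z.le_gt_cases (Z.abs j) (Z.of_nat m)) as [Hj|Hj].
  - apply (zs_cz 16384 (fun k => Sr k j) (fun k => Si k j)); [lra|]. apply (allz_spec _ _ Hal j Hj).
  - rewrite (zs_ext _ (fun _ => 0)).
    + rewrite zs_zero. apply IZR_le in alz_ge. lra.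
    + intros k _. unfold S_, cz, cq. destruct (S_out k j Hj) as [-> ->].
      unfold Rdiv. rewrite Rmult_0_l. apply Cmod_0.
Qed.

Lemma check_A_le x B : nrm tau x B -> nrm tau (Aop m S_ x) (1001 / 1000 * (IZR alz / 16384) * B).
Proof.
  apply Aop_nrm; [exact tau_pos| | |exact S_col].
  - eapply Rle_trans; [|exact w_exp]. apply exp_le_mono. apply Rmult_le_compat_l; [exact tau_pos|].
    apply le_INR. lia.
  - apply IZR_le in alz_ge. lra.
Qed.

Lemma check_row_le x B : nrm tau x B -> Cmod (Aop m S_ x p) <= IZR rowz / 16384 * B.
Proof.
  intros Hx. unfold Aop, low. destruct (Z.leb_spec (Z.abs p) (Z.of_nat m)); [|lia].
  apply (nrm_asum tau x B tau_pos) in Hx.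
  eapply Rle_trans; [apply Cmod_zsC|].
  assert (H0 : 0 <= IZR rowz / 16384).
  { assert (Hr := allz_spec _ _ Hrow 0%Z ltac:(lia)). cbn beta in Hr. apply Z.leb_le in Hr.
    assert (H1 : (0 <= rowz)%Z) by lia. apply IZR_le in H1. lra. }
  eapply Rle_trans; [|apply Rmult_le_compat_l; [exact H0|apply (Hx m)]].
  rewrite <- zs_scal. apply zs_le. intros j Hj. rewrite Cmod_mult.
  apply Rmult_le_compat_r; [apply Cmod_ge_0|].
  eapply Rle_trans; [apply Cmod_cz; lra|].
  assert (Hr := allz_spec _ _ Hrow j Hj). cbn beta in Hr. apply Z.leb_le, IZR_le in Hr.
  apply Rmult_le_compat_r; [lra|exact Hr].
Qed.

(** Beyond [NB + 1] the entries of [t] met by the window are monotone. *)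
Lemma check_k2_le j : (Z.of_nat m < Z.abs j)%Z ->
  zs (fun n => Cmod (t_ (j + n)%Z) * Cmod (s_ n)) NB <= IZR k2z / 17179869184.
Proof.
  intros Hj.
  assert (H0 : forall j, (Z.of_nat m < Z.abs j <= Z.of_nat (S NB))%Z ->
     zs (fun n => Cmod (t_ (j + n)%Z) * Cmod (s_ n)) NB <= IZR k2z / 17179869184).
  { clear j Hj. intros j Hj. assert (H := allz_spec _ _ Hk2 j ltac:(lia)). cbn beta in H.
    unfold low in H. destruct (Z.leb_spec (Z.abs j) (Z.of_nat m)); [lia|].
    apply Z.leb_le, IZR_le in H. rewrite IZR_zsZ in H.
    rewrite (zs_ext _ (fun n => IZR (Z.abs (tz (j + n)) * Z.abs (sz n)) / 17179869184)).
    - rewrite zs_div. lra.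
    - intros n _. unfold t_, s_. rewrite !Cmod_rz, mult_IZR by lra. field. }
  destruct (Z.le_gt_cases (Z.abs j) (Z.of_nat (S NB))) as [Hj'|Hj']; [apply H0; lia|].
  set (j0 := if (0 <? j)%Z then Z.of_nat (S NB) else (- Z.of_nat (S NB))%Z).
  eapply Rle_trans; [|apply (H0 j0)].
  - apply zs_le. intros n Hn. apply Rmult_le_compat_r; [apply Cmod_ge_0|].
    unfold t_. rewrite !Cmod_rz by lra. apply Rmult_le_compat_r; [lra|]. apply IZR_le, t_mono.
    unfold j0. destruct (Z.ltb_spec 0 j); lia.
  - unfold j0. destruct (_ <? _)%Z; lia.
Qed.

Lemma u_le_ k : Cmod (u_ k) <= IZR Phiz / 16777216 * Cmod (t_ k).
Proof.
  unfold u_. rewrite Cmod_mult. apply Rmult_le_compat_r; [apply Cmod_ge_0|].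
  destruct (Hph k) as [H0 H]. apply IZR_le in H0, H. rewrite plus_IZR, !mult_IZR in H.
  apply Rsqr_incr_0_var; [|lra]. unfold Cmod, ph_, cz. cbn [fst snd].
  rewrite Rsqr_sqrt by nra. unfold Rsqr. nra.
Qed.

Lemma hi_high k : high m k = IZR (hi k).
Proof. unfold high, hi. destruct (low m k); reflexivity. Qed.

Lemma Cmod_o k : Cmod (o_ k) = IZR (oz k).
Proof. unfold o_. rewrite Cmod_R, Rabs_pos_eq; [reflexivity|]. apply IZR_le, oz_01. Qed.

Lemma h_le_ k : (Z.abs k <= Z.of_nat m)%Z ->
  Cmod (o_ k) * zs (fun n => (IZR Phiz / 16777216 * high m (k + n) +
      zs (fun q => Cmod (a_ q) * high m (k + n + q)) na) * (Cmod (t_ (k + n)%Z) * Cmod (s_ n))) NB +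
  (if (k =? p)%Z then zs (fun i => high m i * Cmod (cc_ i)) NC else 0) <= IZR (hT k) / 1048576.
Proof.
  intros Hk. assert (H := allz_spec _ _ Hh k Hk). cbn beta in H. apply Z.leb_le, IZR_le in H.
  rewrite plus_IZR, !mult_IZR, IZR_zsZ in H. rewrite Cmod_o.
  assert (Hz : forall l, (Z.abs l <= Z.of_nat (m + NB))%Z ->
    IZR Phiz / 16777216 * high m l + zs (fun q => Cmod (a_ q) * high m (l + q)) na <=
    IZR (rhoT l) / 16777216).
  { intros l Hl. assert (Hr := allz_spec _ _ Hrho l Hl). cbn beta in Hr. apply Z.leb_le, IZR_le in Hr.
    rewrite plus_IZR, mult_IZR, IZR_zsZ in Hr.
    rewrite hi_high, (zs_ext (fun q => Cmod (a_ q) * high m (l + q))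
      (fun q => IZR (Z.abs (az q) * hi (l + q)) / 16777216)).
    - rewrite zs_div. lra.
    - intros q _. rewrite hi_high, mult_IZR. unfold a_. rewrite Cmod_rz by lra. field. }
  assert (H1 : zs (fun n => (IZR Phiz / 16777216 * high m (k + n) +
      zs (fun q => Cmod (a_ q) * high m (k + n + q)) na) * (Cmod (t_ (k + n)%Z) * Cmod (s_ n))) NB <=
    zs (fun j => IZR (rhoT (k + j) * (Z.abs (tz (k + j)) * Z.abs (sz j)))) NB / 288230376151711744).
  { rewrite <- zs_div. apply zs_le. intros n Hn.
    eapply Rle_trans; [apply Rmult_le_compat_r; [apply Rmult_le_pos; apply Cmod_ge_0|apply Hz; lia]|].
    unfold t_, s_. rewrite !Cmod_rz, !mult_IZR by lra. apply Req_le. field. }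
  assert (Ho : 0 <= IZR (oz k)) by (apply IZR_le, oz_01).
  apply (Rmult_le_compat_l _ _ _ Ho) in H1.
  destruct (k =? p)%Z.
  - assert (H2 : zs (fun i => high m i * Cmod (cc_ i)) NC <=
      IZR (zsZ (fun i => hi i * (Z.abs (ccr i) + Z.abs (cci i)))%Z NC) / 1073741824).
    { rewrite IZR_zsZ, <- zs_div. apply zs_le. intros i _. rewrite hi_high, mult_IZR.
      unfold Rdiv. rewrite Rmult_assoc. apply Rmult_le_compat_l.
      - unfold hi. destruct (low m i); lra.
      - apply Cmod_cz. lra. }
    rewrite mult_IZR in H. lra.
  - lra.
Qed.

Notation Res := (Resid m na p s_ a_ cc_ u_ t_ o_ S_).

Lemma Res_R i j : (Z.abs i <= Z.of_nat m)%Z -> (Z.abs j <= Z.of_nat m)%Z ->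
  Cmod (Res i j - cq 17179869184 (Rr i j) (Ri i j))%C <=
  IZR alz / 16384 / 1048576.
Proof.
  intros Hi Hj.
  assert (E : (Res i j - cq 17179869184 (Rr i j) (Ri i j))%C =
    zsC (fun k => (K i k - cq 1048576 (Mr i k) (Mi i k)) * S_ k j)%C m).
  { rewrite (zsC_ext (fun k => (K i k - _) * S_ k j)%C
      (fun k => K i k * S_ k j - cq 1048576 (Mr i k) (Mi i k) * S_ k j)%C) by (intros; ring).
    rewrite zsC_minus. unfold Resid. set (z := zsC (fun k => K i k * S_ k j)%C m).
    rewrite (zsC_ext (fun k => cq 1048576 (Mr i k) (Mi i k) * S_ k j)%C
      (cz 17179869184 (fun k => Mr i k * Sr k j - Mi i k * Si k j)%Z
         (fun k => Mr i k * Si k j + Mi i k * Sr k j)%Z)).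
    - rewrite zsC_cz. unfold cq, Rr, Ri. rewrite !plus_IZR, !minus_IZR, !mult_IZR, opp_IZR.
      unfold S_, cz, cq. destruct (_ =? _)%Z; apply C_eq; simpl; unfold Re, Im; field.
    - intros k _. unfold S_, cz, cq. rewrite minus_IZR, plus_IZR, !mult_IZR.
      apply C_eq; simpl; field. }
  rewrite E. eapply Rle_trans; [apply Cmod_zsC|].
  apply Rle_trans with (zs (fun k => / 1048576 * Cmod (S_ k j)) m).
  - apply zs_le. intros k Hk. rewrite Cmod_mult. apply Rmult_le_compat_r; [apply Cmod_ge_0|].
    apply K_M; assumption.
  - rewrite zs_scal. generalize (S_col j). lra.
Qed.

(** Averaging the columns [j] and [-j] leaves the action on even sequences unchanged. For the wave
    the average is what is small, since [S] is an approximate inverse on even sequences only. *)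
Definition R_ (i j : Z) : C :=
  if sym then (RtoC (/ 2) * (Res i j + Res i (- j)%Z))%C else Res i j.

Lemma R_bound i j : (Z.abs i <= Z.of_nat m)%Z -> (Z.abs j <= Z.of_nat m)%Z ->
  Cmod (R_ i j) <= IZR (Z.abs (Qr i j) + Z.abs (Qi i j)) / 34359738368 + IZR alz / 16384 / 1048576.
Proof.
  intros Hi Hj. generalize (Res_R i j Hi Hj) (Res_R i (- j) Hi ltac:(lia)).
  set (e1 := (Res i j - _)%C). set (e2 := (Res i (- j)%Z - _)%C). intros H1 H2.
  assert (E : exists e, R_ i j = (cz 34359738368 (fun j => Qr i j) (fun j => Qi i j) j + e)%C /\
      Cmod e <= IZR alz / 16384 / 1048576).
  { unfold R_, Qr, Qi, cz. destruct sym.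
    - exists (RtoC (/ 2) * (e1 + e2))%C. split.
      + unfold e1, e2, cq. rewrite !plus_IZR. apply C_eq; simpl; unfold Re, Im; field.
      + rewrite Cmod_mult, Cmod_R, Rabs_pos_eq by lra. generalize (Cmod_triangle e1 e2). lra.
    - exists e1. split; [|exact H1]. unfold e1, cq. rewrite !mult_IZR. apply C_eq; simpl; unfold Re, Im; field. }
  destruct E as (e & -> & He). eapply Rle_trans; [apply Cmod_triangle|].
  apply Rplus_le_compat; [|exact He].
  apply (Cmod_cz 34359738368 (fun j => Qr i j) (fun j => Qi i j)). lra.
Qed.

Lemma zs_const c n : zs (fun _ => c) n = INR (2 * n + 1) * c.
Proof.
  induction n as [|n IH]; [simpl; ring|]. cbn [zs]. rewrite IH.
  replace (2 * S n + 1)%nat with (S (S (2 * n + 1))) by lia. rewrite !S_INR. ring.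
Qed.

Lemma kapL_col j : (Z.abs j <= Z.of_nat m)%Z ->
  zs (fun k => IZR (hT k) / 1048576 * Cmod (S_ k j)) m + zs (fun i => Cmod (R_ i j)) m <= kap.
Proof.
  intros Hj. eapply Rle_trans; [|exact kapL_le]. unfold kapL.
  assert (H := allz_spec _ _ Hcol j Hj). unfold check_col in H. apply Z.leb_le, IZR_le in H.
  rewrite plus_IZR, mult_IZR, !IZR_zsZ in H.
  assert (Hpos : forall k, (Z.abs k <= Z.of_nat m)%Z -> 0 <= IZR (hT k) / 1048576).
  { intros k Hk. eapply Rle_trans; [|apply (h_le_ k Hk)]. apply Rplus_le_le_0_compat.
    - apply Rmult_le_pos; [apply Cmod_ge_0|]. apply zs_pos. intros n.
      apply Rmult_le_pos; [|apply Rmult_le_pos; apply Cmod_ge_0]. apply Rplus_le_le_0_compat.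
      + apply Rmult_le_pos; [|apply high_nonneg].
        destruct (Hph 0%Z) as [H0 _]. apply IZR_le in H0. lra.
      + apply zs_pos. intros q. apply Rmult_le_pos; [apply Cmod_ge_0|apply high_nonneg].
    - destruct (_ =? _)%Z; [|lra]. apply zs_pos. intros i.
      apply Rmult_le_pos; [apply high_nonneg|apply Cmod_ge_0]. }
  assert (H1 : zs (fun k => IZR (hT k) / 1048576 * Cmod (S_ k j)) m <=
    zs (fun k => IZR (hT k * (Z.abs (Sr k j) + Z.abs (Si k j)))) m / 17179869184).
  { rewrite <- zs_div. apply zs_le. intros k Hk.
    eapply Rle_trans; [apply Rmult_le_compat_l; [apply Hpos, Hk|apply Cmod_cz; lra]|].
    rewrite mult_IZR. apply Req_le. field. }
  assert (H2 : zs (fun i => Cmod (R_ i j)) m <=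
    zs (fun i => IZR (Z.abs (Qr i j) + Z.abs (Qi i j))) m / 34359738368 +
    INR (2 * m + 1) * (IZR alz / 16384 / 1048576)).
  { rewrite <- zs_div, <- zs_const, <- zs_plus. apply zs_le. intros i Hi. apply R_bound; assumption. }
  lra.
Qed.

Lemma check_lin x B : (sym = true -> forall k, x (- k)%Z = x k) -> nrm tau x B ->
  nrm tau (fun k => x k - Aop m S_ x k + Kop p s_ a_ cc_ u_ t_ o_ (Aop m S_ x) k)%C
    (1001 / 1000 * kap * B).
Proof.
  intros Hs Hx.
  apply (precond_bound m NB na NC p s_ a_ cc_ u_ t_ o_ (rz_fin _ _ _ sz_fin) (rz_fin _ _ _ az_fin))
    with (Phi := IZR Phiz / 16777216) (anorm := IZR natz / 16777216) (k2 := IZR k2z / 17179869184)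
      (h := fun k => IZR (hT k) / 1048576) (R' := R_)
      (P := fun x => sym = true -> forall k, x (- k)%Z = x k); try assumption.
  - intros k. rewrite Cmod_o. apply IZR_le, oz_01.
  - apply u_le_.
  - apply zs_rz; [lra|exact Hna].
  - apply cz_fin; assumption.
  - apply check_k2_le.
  - destruct (Hph 0%Z) as [H0 _]. apply IZR_le in H0. lra.
  - apply h_le_.
  - clear x B Hs Hx. intros x i Hs _. unfold R_. destruct sym; [|reflexivity].
    specialize (Hs eq_refl).
    rewrite (zsC_ext (fun j => RtoC (/ 2) * (Res i j + Res i (- j)%Z) * x j)%C
      (fun j => RtoC (/ 2) * (Res i j * x j) + RtoC (/ 2) * (Res i (- j)%Z * x (- j)%Z))%C)
      by (intros; rewrite Hs; ring).
    rewrite zsC_plus, !zsC_scal, (zsC_flip (fun j => Res i j * x j)%C).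
    set (z := zsC _ m). apply C_eq; simpl; field.
  - apply kapL_col.
Qed.

End Certificate.

(** * Numerical data *)

(** [n_list]: the approximate [Y] in units of 5e-15; [s_list]: the approximate inverse [s];
    [gr_list] and [gi_list]: the approximate [G], which, like [nur] and [nui] below, comes from a numerical
    eigenvector; [S1_list], [S2r_list], [S2i_list]: numerical inverses of [1 - M] on low modes (for
    [S1_list], of its restriction to even sequences). *)
Definition n_list : list Z := [0; -40729976860955; 39820880724436; -34929784811067; 26909360278799;
-20564876871368; 14880659781345; -10859627847758; 7633595541321; -5453205467608; 3766524882780;
-2661921093448; 1814759064760; -1276654365690; 860245409491; -605250548040; 402800468545; -284797058994;
186681436593; -133424773412; 85687312603; -62416751224; 38922390488; -29249423844; 17452106252; -13785125259;
7683281034; -6568478002; 3286545373; -3186516824; 1336752887; -1587911355; 491278308; -821196170; 138147204;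
-445155438; 631779; -254751678; -45129829; -154202890; -53778970; -98340159; -48883556; -65536006; -40228604;
-45196148; -31594943; -31962327; -24223733; -23009061; -18336945; -16770099; -13789325; -12328781; -10337007;
-9119294; -7740097; -6775492; -5795528; -5051130; -4342229; -3775667; -3256525; -2828437; -2445055; -2122753;
-1837966; -1595659; -1383213; -1201083; -1042089; -905110; -785803; -682664; -592924; -515133; -447474;
-388651; -337510; -292842; -254083; -219882; -190448; -163782; -141491; -119772; -103286; -83593; -72731;
-49926; -46994]%Z.
Definition s_list : list Z := [366552; -29485; 126190; 4266; 61368; 12545; 34111; 12899; 20777; 10987; 13538;
8729; 9259; 6727; 6550; 5115; 4742; 3868; 3488; 2920; 2593; 2206; 1943; 1670; 1464; 1266; 1108; 962; 841; 732;
640; 558; 488; 426; 373; 326; 285; 249; 218; 190; 166; 145; 126; 109; 95; 81; 70; 57; 50; 35; 33]%Z.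
Definition gr_list : list Z := [7; 8; 11; 13; 16; 19; 22; 26; 30; 35; 40; 47; 54; 62; 71; 82; 94; 109; 125;
143; 165; 190; 218; 251; 289; 332; 383; 440; 507; 584; 673; 776; 895; 1032; 1191; 1375; 1588; 1835; 2120;
2451; 2836; 3281; 3800; 4401; 5102; 5915; 6865; 7966; 9258; 10754; 12520; 14555; 16979; 19750; 23100; 26876;
31544; 36679; 43261; 50200; 59635; 68889; 82728; 94738; 115696; 130412; 163532; 179301; 234492; 245200;
342941; 330955; 515305; 434249; 803004; 536025; 1311459; 570242; 2266882; 346740; 4173677; -643700; 8193584;
-3722351; 17080609; -12280289; 37551970; -35043305; 86533339; -94789945; 208590917; -252660227; 529801135;
-679622597; 1464842280; -1792170861; -727394444; -2039772488; 1080040946; -1115927632; 610268081; -542823134;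
291370048; -256376886; 131163176; -120420159; 56720227; -56939636; 23443579; -27366219; 9019012; -13497396;
2987658; -6898391; 602492; -3685924; -244622; -2071472; -471211; -1226435; -466947; -762518; -391407; -494485;
-305924; -331712; -231141; -228356; -171681; -160254; -126465; -114062; -92839; -82035; -68106; -59466;
-50005; -43369; -36775; -31782; -27102; -23384; -20019; -17263; -14820; -12781; -10996; -9488; -8176; -7060;
-6092; -5264; -4548; -3933; -3401; -2943; -2548; -2207; -1912; -1657; -1437; -1246; -1081; -938; -814; -707;
-614; -534; -464; -403; -351; -305; -265; -231; -201; -175; -152; -132; -115; -100; -87; -75; -65; -57; -49;
-42; -36; -31; -26; -21; -18; -13; -12]%Z.
Definition gi_list : list Z := [-16; -17; -25; -29; -36; -42; -50; -58; -67; -78; -90; -104; -119; -137; -158;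
-182; -209; -240; -276; -318; -365; -420; -483; -555; -639; -735; -847; -975; -1123; -1294; -1491; -1719;
-1983; -2288; -2640; -3048; -3521; -4069; -4704; -5439; -6294; -7286; -8439; -9777; -11338; -13148; -15266;
-17721; -20606; -23942; -27888; -32429; -37855; -44044; -51556; -59990; -70485; -81950; -96793; -112274;
-133633; -154235; -185712; -212335; -260259; -292613; -368749; -402767; -530187; -551519; -777597; -745764;
-1171430; -981790; -1828202; -1221456; -2983402; -1331137; -5132791; -929946; -9355724; 981255; -18066778;
6917549; -36789281; 23065266; -78404434; 64397197; -173507414; 166428630; -396163533; 408842469; -929342589;
920226241; -2228560753; 531929473; -371036913; 1126798923; -469104556; 475797898; -210070562; 205943929;
-86661733; 91475331; -33979694; 41846288; -12331896; 19838728; -3758063; 9823002; -562062; 5117832; 484802;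
2819280; 713931; 1642707; 661500; 1007965; 534827; 646304; 407926; 429202; 302601; 292754; 221506; 203699;
161223; 143839; 117164; 102694; 85208; 73937; 62089; 53585; 45358; 39043; 33228; 28573; 24412; 20991; 17984;
15471; 13284; 11437; 9837; 8477; 7302; 6298; 5432; 4690; 4049; 3499; 3024; 2616; 2263; 1959; 1696; 1469; 1273;
1103; 957; 830; 720; 625; 543; 471; 410; 356; 309; 269; 234; 203; 177; 154; 134; 116; 101; 88; 76; 66; 58; 50;
43; 37; 32; 28; 24; 20; 17; 14; 12; 8; 8]%Z.
Definition S1_list : list (list Z) := [[2971; -784; -21486; -290; -13022; -1544; -7759; -1967; -4757; -1834;
-3008]; [784; -5826; 477; -10424; -479; -6232; -1085; -3741; -1199; -2289; -1076]; [10743; 239; 27941; -1861;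
10784; -10; 6155; 832; 3637; 1017; 2225]; [97; -3475; -1240; 12142; -1546; 1480; -750; 670; -344; 305; -149];
[3256; -120; 5392; -1159; 15041; -738; 3349; 6; 1859; 274; 1081]; [309; -1246; -4; 888; -590; 11293; -558;
1272; -158; 636; 8]; [1293; -181; 2051; -375; 2233; -465; 11487; -307; 1478; 28; 792]; [281; -534; 238; 287;
4; 908; -264; 10359; -247; 868; -14]; [595; -150; 909; -129; 929; -99; 1108; -217; 10222; -171; 839]; [204;
-254; 226; 102; 122; 353; 19; 675; -152; 9769; -140]; [301; -108; 445; -45; 432; 4; 475; -10; 671; -126;
9628]]%Z.
Definition S2r_list : list (list Z) := [[17607; -353; 688; -122; 365; -28; 210; 7; 127; 15; 76; 11; 41; -1; 9;
-18; -30; -41; -102; -24; -55; -111; -38; -57; -28; -34; -21; -22; -15; -15; -11; -10; -8; -7; -6; -5; -4; -4;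
-3; -3; -2]; [302; 17680; -358; 740; -118; 403; -18; 242; 22; 158; 36; 111; 37; 82; 33; 63; 24; 44; 7; -37;
10; 13; 15; 12; 12; 10; 9; 8; 7; 6; 5; 4; 4; 3; 3; 3; 2; 2; 2; 1; 1]; [277; 305; 17761; -398; 785; -148; 419;
-46; 239; -12; 136; -9; 68; -23; 9; -51; -61; -88; -192; -34; -106; -211; -76; -110; -57; -66; -42; -43; -31;
-29; -22; -20; -16; -15; -12; -11; -9; -8; -7; -6; -5]; [243; 307; 347; 17871; -403; 869; -134; 489; -17; 307;
33; 213; 53; 162; 60; 134; 62; 109; 66; -60; 49; 84; 49; 53; 38; 36; 28; 26; 21; 19; 16; 14; 12; 10; 9; 8; 7;
6; 5; 4; 4]; [176; 235; 315; 340; 17949; -475; 900; -203; 476; -98; 256; -71; 117; -87; 3; -131; -130; -194;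
-374; -47; -212; -418; -156; -220; -116; -133; -86; -87; -63; -60; -46; -42; -34; -30; -25; -22; -19; -16;
-14; -12; -10]; [201; 218; 294; 384; 414; 18126; -452; 1057; -143; 629; 0; 429; 71; 333; 113; 289; 152; 258;
222; -101; 151; 270; 134; 159; 102; 104; 76; 72; 56; 51; 42; 37; 31; 27; 23; 20; 18; 15; 13; 11; 10]; [124;
166; 189; 251; 349; 357; 18173; -617; 1024; -331; 510; -238; 213; -247; -18; -322; -281; -433; -756; -59;
-441; -860; -329; -458; -247; -279; -182; -184; -134; -126; -99; -90; -73; -65; -54; -47; -40; -35; -30; -25;
-23]; [187; 204; 267; 303; 384; 514; 532; 18510; -486; 1374; -111; 904; 87; 706; 220; 636; 358; 606; 608;
-180; 403; 734; 339; 418; 256; 268; 190; 183; 141; 129; 104; 93; 78; 68; 58; 50; 43; 37; 33; 28; 24]; [70; 94;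
104; 144; 168; 219; 342; 306; 18409; -920; 1104; -657; 418; -638; -72; -768; -612; -977; -1576; -61; -944;
-1825; -714; -978; -535; -600; -396; -397; -292; -274; -215; -195; -159; -141; -118; -103; -88; -76; -66; -56;
-49]; [211; 236; 293; 332; 410; 483; 578; 784; 787; 19175; -421; 2006; 87; 1543; 444; 1421; 826; 1409; 1516;
-344; 1006; 1844; 820; 1034; 617; 656; 458; 443; 338; 311; 250; 224; 186; 164; 138; 121; 103; 89; 78; 66; 58];
[-19; -15; -21; -11; -15; 1; 17; 25; 169; 28; 18529; -1659; 918; -1558; -191; -1799; -1337; -2213; -3345; -23;
-2066; -3958; -1571; -2132; -1178; -1314; -873; -870; -644; -602; -475; -429; -351; -311; -261; -228; -194;
-168; -145; -123; -109]; [301; 340; 410; 470; 560; 652; 773; 929; 1069; 1438; 1444; 20527; 39; 3479; 914;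
3202; 1867; 3251; 3577; -708; 2417; 4426; 1928; 2460; 1448; 1551; 1072; 1044; 792; 731; 585; 525; 434; 382;
323; 282; 241; 208; 181; 153; 136]; [-199; -222; -264; -298; -349; -393; -453; -516; -565; -685; -579; -976;
18039; -3655; -366; -4137; -2887; -5002; -7132; 145; -4577; -8686; -3478; -4692; -2610; -2898; -1933; -1923;
-1426; -1333; -1053; -950; -779; -689; -579; -505; -431; -372; -323; -273; -242]; [520; 589; 702; 808; 950;
1102; 1292; 1516; 1771; 2131; 2440; 3173; 3324; 23695; 1918; 7266; 4110; 7428; 8022; -1572; 5639; 10251; 4412;
5664; 3305; 3557; 2446; 2388; 1805; 1668; 1333; 1195; 988; 871; 734; 641; 548; 473; 411; 348; 309]; [-580;
-653; -777; -888; -1041; -1195; -1398; -1606; -1879; -2167; -2514; -2953; -3240; -4162; 15144; -9233; -5977;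
-11154; -14964; 684; -10137; -19036; -7654; -10292; -5741; -6365; -4254; -4227; -3139; -2932; -2317; -2090;
-1715; -1517; -1274; -1113; -950; -821; -711; -602; -534]; [980; 1109; 1319; 1515; 1779; 2056; 2411; 2797;
3292; 3837; 4539; 5354; 6335; 7776; 8896; 31551; 8602; 16604; 16602; -3784; 12632; 22556; 9656; 12407; 7209;
7770; 5327; 5206; 3927; 3632; 2899; 2600; 2147; 1893; 1596; 1392; 1190; 1027; 891; 755; 670]; [-1340; -1510;
-1799; -2057; -2420; -2776; -3269; -3743; -4446; -5059; -6106; -6866; -8490; -9372; -11888; -12963; 3702;
-23528; -29123; 2179; -21722; -40291; -16162; -21749; -12113; -13443; -8976; -8926; -6625; -6190; -4891;
-4413; -3621; -3203; -2690; -2351; -2006; -1733; -1501; -1272; -1128]; [1657; 1871; 2228; 2553; 3003; 3455;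
4066; 4677; 5548; 6360; 7661; 8714; 10766; 12079; 15511; 17165; 23033; 47133; 26282; -9891; 24933; 42219;
18189; 23097; 13456; 14431; 9905; 9654; 7286; 6729; 5371; 4814; 3974; 3502; 2952; 2573; 2201; 1899; 1648;
1395; 1238]; [-2052; -2312; -2759; -3148; -3717; -4246; -5032; -5716; -6873; -7700; -9519; -10370; -13468;
-13895; -19692; -18248; -30140; -22222; -23825; 3901; -32841; -62434; -24058; -33372; -18140; -20504; -13493;
-13562; -9979; -9382; -7376; -6679; -5464; -4843; -4061; -3552; -3028; -2618; -2266; -1921; -1703]; [79; 89;
106; 121; 142; 162; 191; 218; 258; 294; 355; 396; 496; 532; 716; 695; 1098; 789; 1923; -643; 2651; 4804; 1703;
2572; 1294; 1563; 974; 1022; 726; 701; 539; 496; 400; 358; 298; 262; 222; 192; 166; 140; 124]; [-41; -52; -54;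
-73; -68; -105; -83; -161; -90; -264; -64; -475; 66; -952; 511; -2147; 1943; -5513; 6854; -2983; 7410; 16735;
-9666; 5916; -4054; 2188; -1779; 786; -829; 248; -416; 46; -226; -24; -134; -43; -86; -42; -58; -35; -41];
[-1548; -1757; -2080; -2405; -2797; -3271; -3773; -4465; -5109; -6161; -6949; -8653; -9491; -12516; -12959;
-19035; -17386; -31655; -20617; -12604; -2969; -13179; -3854; -20558; -6055; -12244; -5696; -7805; -4695;
-5255; -3675; -3678; -2813; -2642; -2131; -1928; -1609; -1418; -1213; -1040; -916]; [1511; 1715; 2030; 2345;
2728; 3186; 3676; 4343; 4974; 5980; 6760; 8373; 9225; 12054; 12594; 18180; 16932; 29771; 20407; 14561; -2837;
27392; 38502; 19554; 11929; 12519; 8613; 8427; 6325; 5882; 4669; 4209; 3460; 3062; 2574; 2250; 1921; 1660;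
1439; 1219; 1082]; [-1461; -1660; -1963; -2271; -2638; -3087; -3554; -4215; -4805; -5816; -6520; -8175; -8868;
-11843; -12014; -18057; -15851; -30096; -17849; -11759; -3238; -28399; -19711; 7435; -10893; -9149; -7644;
-6605; -5510; -4777; -4027; -3488; -2969; -2569; -2204; -1902; -1644; -1411; -1231; -1039; -926]; [1050; 1192;
1410; 1630; 1893; 2214; 2549; 3018; 3443; 4157; 4668; 5827; 6344; 8407; 8590; 12730; 11344; 20956; 12906;
8420; 607; 20733; 16640; 7520; 32407; 7652; 8148; 5684; 5436; 4184; 3812; 3085; 2743; 2282; 2006; 1692; 1482;
1255; 1103; 924; 826]; [-824; -936; -1107; -1281; -1487; -1741; -2003; -2377; -2707; -3281; -3671; -4612;
-4987; -6684; -6741; -10195; -8849; -16986; -9806; -6180; -2398; -17116; -11629; -4961; -10693; 16340; -5212;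
-2607; -3398; -2223; -2349; -1744; -1679; -1332; -1224; -1007; -905; -755; -674; -560; -506]; [562; 638; 754;
872; 1013; 1184; 1363; 1615; 1840; 2224; 2493; 3117; 3382; 4497; 4568; 6811; 6000; 11210; 6714; 4175; 780;
11495; 8821; 4174; 8968; 1114; 25075; 2706; 3934; 2236; 2528; 1735; 1736; 1316; 1236; 989; 899; 738; 662; 545;
493]; [-418; -475; -561; -649; -754; -883; -1015; -1205; -1372; -1664; -1860; -2340; -2525; -3392; -3410;
-5177; -4466; -8627; -4910; -2994; -1444; -8981; -5961; -2736; -5497; 204; -5073; 18592; -1989; -356; -1204;
-528; -797; -484; -557; -397; -402; -311; -297; -236; -221]; [278; 316; 373; 431; 501; 586; 674; 798; 909;
1099; 1231; 1540; 1669; 2220; 2250; 3360; 2948; 5521; 3275; 1970; 479; 5784; 4373; 2138; 4408; 596; 4571;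
-579; 21416; 978; 1935; 905; 1187; 733; 795; 567; 558; 429; 402; 319; 295]; [-203; -230; -272; -315; -366;
-428; -493; -585; -666; -808; -903; -1137; -1226; -1650; -1654; -2520; -2164; -4204; -2367; -1409; -803;
-4470; -2893; -1379; -2650; 50; -2441; 1282; -2598; 18897; -675; 320; -339; 40; -197; -39; -128; -57; -89;
-54; -64]; [133; 150; 178; 206; 239; 279; 321; 380; 433; 523; 585; 732; 793; 1055; 1068; 1594; 1397; 2612;
1546; 907; 237; 2774; 2100; 1053; 2123; 324; 2184; -233; 2613; -927; 19713; 386; 1081; 412; 628; 347; 407;
272; 280; 205; 200]; [-96; -109; -129; -150; -174; -203; -234; -278; -316; -384; -429; -541; -582; -786; -786;
-1202; -1028; -2009; -1120; -654; -433; -2171; -1364; -666; -1233; 29; -1123; 603; -1188; 1369; -1547; 18697;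
-188; 472; -32; 200; 11; 97; 20; 51; 19]; [62; 70; 83; 96; 111; 130; 149; 177; 201; 243; 272; 340; 369; 489;
496; 737; 647; 1203; 716; 410; 100; 1289; 992; 507; 1013; 179; 1047; -72; 1236; -387; 1730; -909; 18862; 184;
705; 226; 390; 196; 245; 153; 165]; [-45; -51; -61; -70; -81; -95; -110; -131; -148; -181; -201; -255; -274;
-370; -370; -568; -483; -953; -525; -303; -233; -1043; -631; -313; -558; 25; -497; 301; -518; 648; -674; 1230;
-1070; 18411; -14; 465; 68; 224; 74; 125; 64]; [28; 32; 38; 44; 51; 60; 69; 81; 92; 111; 125; 155; 168; 223;
226; 334; 295; 542; 326; 183; 33; 584; 465; 241; 483; 100; 505; -7; 597; -144; 816; -374; 1290; -808; 18381;
113; 522; 152; 279; 131; 171]; [-21; -24; -28; -33; -38; -45; -51; -61; -69; -84; -94; -119; -128; -174; -173;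
-268; -226; -452; -245; -140; -126; -501; -287; -144; -246; 22; -211; 157; -213; 322; -277; 582; -447; 1066;
-826; 18150; 45; 416; 95; 207; 89]; [13; 15; 17; 20; 23; 27; 31; 37; 42; 50; 56; 70; 76; 99; 102; 148; 132;
238; 146; 81; 4; 257; 217; 114; 231; 58; 247; 15; 294; -41; 399; -139; 609; -326; 1040; -705; 18073; 86; 419;
117; 219]; [-10; -11; -13; -15; -18; -21; -24; -28; -32; -39; -44; -56; -60; -82; -81; -127; -106; -215; -114;
-65; -70; -242; -129; -65; -104; 18; -84; 86; -80; 166; -102; 289; -173; 503; -334; 921; -681; 17931; 64; 360;
99]; [6; 7; 8; 9; 10; 12; 14; 16; 18; 22; 25; 31; 33; 44; 45; 64; 58; 101; 65; 35; -7; 108; 101; 54; 112; 34;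
123; 19; 149; -1; 201; -40; 300; -119; 490; -280; 877; -617; 17853; 74; 351]; [-5; -5; -6; -7; -8; -10; -11;
-13; -15; -18; -21; -26; -28; -39; -38; -60; -50; -104; -54; -31; -40; -118; -56; -29; -42; 14; -29; 49; -24;
89; -30; 148; -57; 248; -123; 431; -269; 799; -583; 17746; 74]; [3; 3; 3; 4; 5; 5; 6; 7; 8; 10; 11; 13; 14;
18; 19; 27; 25; 41; 28; 14; -9; 43; 48; 26; 56; 21; 63; 17; 78; 11; 104; -2; 153; -33; 241; -99; 411; -241;
758; -545; 17680]]%Z.
Definition S2i_list : list (list Z) := [[-202; 19; -91; 0; -56; -8; -40; -12; -31; -14; -28; -16; -29; -15;
-36; -11; -55; 7; -115; -8; -23; -77; -25; -43; -21; -27; -16; -18; -12; -12; -9; -9; -7; -6; -5; -5; -4; -3;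
-3; -3; -2]; [8; -214; 21; -98; 2; -60; -7; -42; -11; -32; -13; -27; -13; -24; -14; -23; -15; -21; -18; -1;
-2; -6; -4; -4; -3; -3; -2; -2; -2; -2; -1; -1; -1; -1; -1; -1; -1; -1; 0; 0; 0]; [-89; 7; -237; 20; -113; -2;
-74; -13; -56; -19; -50; -22; -51; -22; -63; -15; -99; 19; -209; -15; -42; -141; -44; -79; -38; -49; -29; -32;
-22; -22; -17; -16; -13; -11; -9; -8; -7; -6; -5; -5; -4]; [-14; -93; 9; -251; 25; -120; 3; -77; -7; -55; -11;
-44; -11; -39; -9; -39; 0; -44; 26; 2; 9; 29; 6; 14; 5; 8; 4; 5; 3; 3; 2; 2; 2; 2; 1; 1; 1; 1; 1; 1; 0]; [-59;
-20; -111; 2; -283; 18; -147; -9; -105; -23; -90; -31; -93; -32; -116; -18; -185; 48; -399; -28; -81; -271;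
-85; -152; -72; -94; -56; -62; -43; -42; -32; -30; -24; -22; -18; -16; -14; -12; -10; -9; -8]; [-20; -57; -16;
-113; 10; -297; 33; -148; 10; -98; 2; -74; 3; -64; 15; -67; 51; -95; 160; 12; 39; 129; 35; 69; 29; 41; 23; 26;
17; 18; 13; 12; 10; 9; 7; 6; 5; 5; 4; 3; 3]; [-50; -34; -81; -35; -146; -12; -355; 9; -208; -24; -171; -42;
-175; -46; -224; -18; -363; 114; -798; -56; -162; -547; -170; -306; -143; -188; -112; -123; -86; -85; -64;
-60; -48; -44; -36; -32; -27; -23; -20; -17; -15]; [-20; -39; -22; -69; -16; -135; 19; -357; 57; -186; 40;
-129; 47; -107; 86; -121; 191; -209; 514; 37; 116; 388; 110; 211; 93; 127; 73; 82; 56; 56; 42; 39; 31; 28; 23;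
21; 17; 15; 13; 11; 10]; [-55; -50; -80; -63; -125; -69; -216; -45; -488; -19; -343; -58; -347; -67; -449; -8;
-743; 267; -1660; -117; -339; -1143; -352; -637; -297; -391; -233; -257; -178; -177; -134; -125; -100; -90;
-75; -66; -56; -49; -42; -35; -31]; [-13; -24; -15; -41; -14; -75; 2; -155; 58; -431; 138; -235; 165; -186;
270; -225; 548; -462; 1397; 98; 304; 1023; 297; 560; 251; 340; 197; 221; 150; 151; 113; 106; 84; 76; 63; 56;
47; 41; 35; 30; 26]; [-76; -79; -106; -104; -152; -132; -230; -152; -379; -134; -783; -92; -717; -107; -936;
20; -1576; 613; -3563; -248; -729; -2457; -754; -1368; -635; -839; -499; -550; -380; -378; -286; -268; -214;
-193; -160; -141; -120; -104; -90; -76; -67]; [7; 3; 11; -2; 19; -15; 39; -51; 88; -151; 217; -522; 444; -333;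
714; -431; 1409; -1020; 3514; 242; 748; 2526; 744; 1389; 627; 844; 493; 550; 376; 376; 282; 266; 211; 191;
158; 140; 118; 102; 88; 74; 66]; [-130; -141; -177; -189; -245; -247; -349; -313; -520; -370; -837; -355;
-1605; -212; -2004; 77; -3418; 1376; -7808; -536; -1591; -5375; -1646; -2990; -1386; -1832; -1089; -1202;
-829; -825; -624; -584; -467; -422; -349; -309; -261; -227; -195; -165; -147]; [58; 61; 79; 77; 111; 93; 163;
100; 255; 72; 439; -73; 854; -696; 1721; -834; 3395; -2230; 8407; 562; 1757; 5964; 1771; 3287; 1493; 2001;
1173; 1306; 894; 894; 672; 631; 503; 455; 376; 332; 281; 244; 210; 177; 157]; [-252; -279; -341; -374; -467;
-494; -651; -642; -937; -805; -1418; -925; -2332; -788; -4448; 110; -7496; 2986; -17256; -1154; -3487; -11811;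
-3619; -6569; -3047; -4025; -2391; -2639; -1822; -1811; -1370; -1283; -1025; -926; -766; -677; -573; -497;
-429; -363; -322]; [175; 191; 236; 252; 323; 325; 455; 408; 668; 476; 1043; 449; 1787; 62; 3469; -1700; 7611;
-4708; 18992; 1197; 3893; 13316; 3973; 7348; 3351; 4479; 2633; 2925; 2006; 2003; 1508; 1415; 1128; 1021; 843;
746; 630; 547; 472; 398; 353]; [-521; -579; -702; -777; -956; -1032; -1324; -1353; -1881; -1731; -2790; -2086;
-4429; -2110; -7805; -708; -16244; 5898; -37328; -2344; -7440; -25247; -7764; -14048; -6532; -8611; -5124;
-5647; -3902; -3878; -2934; -2746; -2195; -1984; -1641; -1450; -1227; -1065; -919; -777; -689]; [377; 417;
508; 555; 693; 729; 964; 941; 1385; 1167; 2094; 1311; 3423; 1033; 6267; -809; 13439; -8763; 36204; 1820; 7239;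
25159; 7502; 13878; 6335; 8461; 4979; 5529; 3794; 3787; 2853; 2677; 2134; 1931; 1595; 1411; 1192; 1035; 892;
754; 669]; [-868; -969; -1168; -1304; -1587; -1738; -2187; -2295; -3083; -2978; -4511; -3705; -7010; -4101;
-11980; -2764; -23729; 5842; -60848; -2787; -12230; -40028; -12544; -22334; -10493; -13716; -8212; -9007;
-6246; -6191; -4693; -4386; -3511; -3170; -2624; -2318; -1962; -1703; -1470; -1242; -1102]; [-163; -183; -219;
-251; -296; -340; -403; -460; -553; -624; -771; -850; -1102; -1160; -1643; -1569; -2639; -2027; -4922; -1544;
-655; -1947; -1101; -1156; -835; -769; -609; -537; -444; -386; -325; -281; -240; -207; -179; -154; -133; -114;
-100; -85; -75]; [341; 381; 460; 516; 624; 691; 856; 917; 1196; 1200; 1723; 1519; 2614; 1761; 4317; 1467;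
8173; -1305; 19686; -2208; 7168; 13086; 2177; 7130; 2110; 4166; 1853; 2612; 1503; 1732; 1170; 1197; 893; 852;
676; 617; 509; 451; 383; 329; 289]; [-301; -333; -405; -443; -555; -584; -775; -758; -1119; -951; -1700;
-1095; -2786; -961; -5079; 201; -10707; 4907; -28034; -6711; -4382; -14310; -3984; -9229; -3621; -5735; -3016;
-3739; -2381; -2547; -1830; -1791; -1388; -1289; -1046; -940; -786; -689; -590; -501; -443]; [255; 283; 342;
376; 466; 496; 648; 646; 928; 816; 1392; 961; 2245; 915; 4012; 132; 8274; -3203; 21173; 6262; 2620; 13184;
8898; 8109; 5808; 5403; 4105; 3729; 2966; 2641; 2167; 1905; 1596; 1392; 1182; 1024; 880; 754; 657; 550; 491];
[-194; -215; -261; -284; -357; -373; -499; -481; -724; -599; -1107; -678; -1830; -563; -3369; 245; -7158;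
3336; -18738; -6348; -1455; -11937; -6475; -5160; -4701; -3811; -3281; -2731; -2341; -1977; -1697; -1445;
-1244; -1064; -919; -787; -683; -581; -509; -425; -381]; [127; 141; 170; 185; 231; 243; 322; 314; 465; 392;
705; 448; 1154; 388; 2100; -89; 4408; -1935; 11389; 4121; 726; 8232; 5772; 4047; 5176; 2841; 3199; 2138; 2157;
1597; 1511; 1189; 1084; 885; 790; 658; 582; 488; 432; 357; 322]; [-92; -102; -123; -134; -169; -175; -237;
-225; -344; -278; -529; -311; -880; -243; -1633; 169; -3493; 1691; -9166; -3426; -461; -6552; -3891; -2739;
-3227; -1085; -2155; -1113; -1417; -906; -974; -704; -690; -536; -499; -404; -367; -302; -271; -222; -202];
[58; 65; 78; 85; 106; 110; 147; 142; 213; 176; 324; 198; 534; 163; 979; -72; 2067; -949; 5352; 2113; 203;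
4270; 3094; 1961; 2745; 1128; 2425; 913; 1414; 768; 926; 608; 638; 468; 453; 354; 329; 265; 241; 195; 179];
[-42; -47; -56; -61; -77; -80; -108; -102; -158; -125; -243; -138; -407; -103; -760; 96; -1633; 812; -4294;
-1694; -152; -3297; -2012; -1320; -1707; -533; -1311; 39; -848; -230; -527; -244; -349; -211; -241; -169;
-172; -131; -126; -98; -93]; [26; 29; 35; 38; 47; 49; 66; 63; 95; 77; 145; 87; 239; 69; 439; -40; 928; -436;
2403; 1005; 51; 2073; 1550; 920; 1389; 504; 1188; 289; 1187; 278; 638; 273; 402; 231; 271; 183; 190; 141; 136;
105; 99]; [-19; -21; -25; -28; -35; -36; -49; -46; -72; -56; -111; -61; -186; -44; -350; 51; -756; 385; -1992;
-813; -53; -1602; -980; -617; -839; -229; -655; 10; -522; 310; -328; 37; -184; -26; -112; -40; -73; -38; -50;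
-32; -36]; [11; 13; 15; 16; 21; 21; 29; 27; 41; 34; 63; 37; 104; 29; 192; -19; 406; -192; 1047; 460; 8; 970;
753; 425; 682; 229; 588; 124; 553; 44; 669; 70; 325; 99; 194; 92; 126; 76; 86; 59; 61]; [-9; -10; -12; -12;
-16; -16; -22; -21; -33; -25; -51; -27; -86; -19; -162; 26; -351; 182; -928; -386; -20; -767; -461; -285;
-396; -94; -310; 22; -250; 132; -223; 342; -135; 105; -60; 39; -29; 13; -15; 3; -8]; [5; 6; 7; 7; 9; 9; 12;
12; 18; 14; 27; 16; 45; 13; 82; -8; 172; -81; 442; 204; -3; 442; 361; 194; 330; 106; 289; 59; 274; 20; 299;
-24; 442; 4; 195; 37; 110; 41; 69; 35; 45]; [-4; -4; -5; -6; -7; -7; -10; -9; -15; -11; -23; -12; -40; -8;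
-76; 14; -165; 87; -437; -183; -8; -366; -211; -130; -181; -36; -140; 21; -113; 74; -102; 145; -110; 312; -64;
112; -18; 52; -1; 26; 4]; [2; 2; 3; 3; 4; 4; 5; 5; 7; 6; 11; 7; 18; 5; 34; -3; 70; -32; 179; 88; -4; 197; 172;
88; 159; 51; 142; 30; 137; 13; 149; -7; 191; -38; 331; -15; 136; 15; 73; 21; 44]; [-2; -2; -2; -3; -3; -3; -5;
-4; -7; -5; -11; -5; -19; -3; -36; 7; -79; 43; -211; -88; -4; -175; -95; -59; -80; -12; -61; 16; -47; 43; -42;
76; -46; 130; -64; 273; -36; 101; -3; 49; 7]; [1; 1; 1; 1; 2; 2; 2; 2; 3; 3; 5; 3; 7; 2; 13; -1; 27; -12; 67;
36; -4; 85; 82; 40; 77; 25; 70; 17; 69; 10; 76; 1; 96; -12; 138; -37; 267; -19; 105; 7; 54]; [-1; -1; -1; -1;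
-2; -2; -2; -2; -3; -2; -5; -3; -9; -1; -18; 4; -39; 22; -104; -43; -2; -85; -41; -27; -34; -3; -25; 12; -18;
25; -15; 42; -16; 66; -24; 111; -43; 236; -25; 87; 2]; [0; 0; 0; 1; 1; 1; 1; 1; 1; 1; 2; 1; 3; 1; 4; 0; 9; -3;
21; 13; -3; 35; 39; 18; 38; 13; 35; 10; 36; 8; 40; 5; 50; -1; 69; -12; 109; -33; 226; -18; 85]; [0; 0; -1; -1;
-1; -1; -1; -1; -2; -1; -3; -1; -4; 0; -9; 2; -20; 12; -53; -22; -1; -41; -17; -12; -13; 0; -9; 8; -5; 15; -3;
23; -3; 35; -6; 55; -14; 93; -32; 203; -17]; [0; 0; 0; 0; 0; 0; 0; 0; 0; 0; 0; 0; 1; 0; 1; 0; 2; 0; 3; 4; -2;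
13; 19; 8; 19; 7; 18; 7; 19; 6; 21; 5; 27; 4; 36; 0; 54; -9; 88; -27; 193]]%Z.

Definition look2 (t : tree (tree Z)) (n m : nat) (i j : Z) : Z := look 0%Z (look Lf t n i) m j.

Lemma look2_out t n m i j : (Z.of_nat n < Z.abs i)%Z \/ (Z.of_nat m < Z.abs j)%Z ->
  look2 t n m i j = 0%Z.
Proof.
  intros H. unfold look2, look.
  destruct (Z.leb_spec (Z.abs j) (Z.of_nat m)); [|reflexivity].
  destruct (Z.leb_spec (Z.abs i) (Z.of_nat n)); [lia|reflexivity].
Qed.

Definition fill2 (f : Z -> Z -> Z) (n m : nat) : tree (tree Z) :=
  fill Lf (fun i => fill 0%Z (fun j => f i j) m) n.

Definition entry (l : list (list Z)) (i j : Z) : Z := nth (Z.to_nat j) (nth (Z.to_nat i) l []) 0%Z.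

(** The tables are evaluated at definition time, so later checks read literals. *)
Definition n_tree := Eval vm_compute in fill 0%Z (fun k => nth (Z.abs_nat k) n_list 0%Z) 90.
Definition nz : Z -> Z := look 0%Z n_tree 90.
Definition s_tree := Eval vm_compute in fill 0%Z (fun k => nth (Z.abs_nat k) s_list 0%Z) 50.
Definition sz : Z -> Z := look 0%Z s_tree 50.

(** [W] in units of 1e-15: the unit 5e-15 of [n_list] absorbs the denominator 5 of [Dseq]. *)
Definition wZ (k : Z) : Z :=
  ((if k =? 0 then 1109643839000099 else 0) + (13 * nz k + 6 * (nz (k - 1) + nz (k + 1))))%Z.
Definition w_tree := Eval vm_compute in fill 0%Z wZ 91.
Definition wz : Z -> Z := look 0%Z w_tree 91.
Definition dZ (k : Z) : Z := (13 * sz k + 6 * (sz (k - 1) + sz (k + 1)))%Z.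
Definition d_tree := Eval vm_compute in fill 0%Z dZ 51.
Definition dz : Z -> Z := look 0%Z d_tree 51.
(** [vz] is [wz] rounded to the scale 2^30; the difference is absorbed in the perturbation of [W]. *)
Definition v_tree := Eval vm_compute in
  fill 0%Z (fun k => (wz k * 2147483648 + 1000000000000000) / 2000000000000000)%Z 91.
Definition vz : Z -> Z := look 0%Z v_tree 91.

Lemma check_wz : allz (fun k => wz k =? wZ k)%Z 91 = true.
Proof. vm_cast_no_check (eq_refl true). Qed.
Lemma check_dz : allz (fun k => dz k =? dZ k)%Z 51 = true.
Proof. vm_cast_no_check (eq_refl true). Qed.

(** Even sequences are summed over positive indices and the result is doubled, which halves the
    costly convolutions. *)
Definition psZ (f : Z -> Z) (k : Z) : Z := if (k <=? 0)%Z then 0%Z else f k.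

(** Over the denominator [2e30], with the division by [k] performed in integers; adding 1 makes the
    floor an upper bound. *)
Definition res1Z (k : Z) : Z :=
  (Z.abs (k * convZ wz wz 91 k - 10000000000000000 * nz k) / k + 1)%Z.
Definition err1Z (k : Z) : Z :=
  ((if k =? 0 then 1310720000000000000000 else 0) - convZ dz wz 51 k)%Z.

(** Rounding down keeps [|t1z|] and [|t2z|] monotone. *)
Definition t1z (k : Z) : Z := if (k =? 0)%Z then (-65536)%Z else (65536 / Z.abs k)%Z.
Definition t2z (k : Z) : Z :=
  if (k <? 0)%Z then (- (131072 / (- (2 * k) - 1)))%Z else (131072 / (2 * k + 1))%Z.

Definition zeroZ (_ : Z) : Z := 0%Z.
Definition oneZ (_ : Z) : Z := 1%Z.
Definition ph1 (_ : Z) : Z := 16777216%Z.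
Definition cc1 (k : Z) : Z := if (k =? 0)%Z then 1073741824%Z else 0%Z.

(** Reading rows and columns through absolute values makes the matrix commute with the reflection,
    so it preserves even sequences. *)
Definition S1_tree := Eval vm_compute in
  fill2 (fun i j => entry S1_list (Z.abs i) (Z.abs j)) 10 10.
Definition S1z : Z -> Z -> Z := look2 S1_tree 10 10.
Definition zero2 (_ _ : Z) : Z := 0%Z.
Definition V1_tree := Eval vm_compute in fill2 (fun l j => t1z l * sz (l - j))%Z 10 10.
Definition V1z : Z -> Z -> Z := look2 V1_tree 10 10.
Definition M1_tree := Eval vm_compute in
  fill2 (fun i j => (Kr 0 0 zeroZ ph1 cc1 oneZ V1z i j + 137438953472) / 274877906944)%Z 10 10.
Definition M1z : Z -> Z -> Z := look2 M1_tree 10 10.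
Definition rho1_tree := Eval vm_compute in fill 0%Z (fun l => 16777216 * hi 10 l)%Z 60.
Definition rho1z : Z -> Z := look 0%Z rho1_tree 60.
Definition hsum (NB NC m : nat) (p : Z) (tz ccr cci oz rho : Z -> Z) (k : Z) : Z :=
  (oz k * zsZ (fun n => rho (k + n) * (Z.abs (tz (k + n)) * Z.abs (sz n))) NB +
    (if k =? p then 268435456 * zsZ (fun i => hi m i * (Z.abs (ccr i) + Z.abs (cci i))) NC else 0))%Z.
Definition h1_tree := Eval vm_compute in
  fill 0%Z (fun k => (hsum 50 0 10 0 t1z cc1 zeroZ oneZ rho1z k + 274877906943) / 274877906944)%Z 10.
Definition h1z : Z -> Z := look 0%Z h1_tree 10.

Definition gr_tree := Eval vm_compute in listed gr_list 96.
Definition grz : Z -> Z := look 0%Z gr_tree 96.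
Definition gi_tree := Eval vm_compute in listed gi_list 96.
Definition giz : Z -> Z := look 0%Z gi_tree 96.
Definition gamZ (g : Z -> Z) (k : Z) : Z :=
  ((39 * k + 17) * g k + 18 * k * g (k - 1) + 18 * (k + 1) * g (k + 1))%Z.
Definition gamr_tree := Eval vm_compute in fill 0%Z (gamZ grz) 97.
Definition gamr : Z -> Z := look 0%Z gamr_tree 97.
Definition gami_tree := Eval vm_compute in fill 0%Z (gamZ giz) 97.
Definition gami : Z -> Z := look 0%Z gami_tree 97.

Lemma check_gam : allz (fun k => if gamr k =? gamZ grz k then gami k =? gamZ giz k else false)%Z 97 = true.
Proof. vm_cast_no_check (eq_refl true). Qed.

(** [aZ] is [Wv * Bseq]; its central entry [a0] is moved into the diagonal [phi2]. *)
Definition aZ (k : Z) : Z := (-5 * vz k + 18 * vz (k - 1) - 18 * vz (k + 1))%Z.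
Definition a0z : Z := Eval vm_compute in ((aZ 0 + 960) / 1920)%Z.
Definition a_tree := Eval vm_compute in
  fill 0%Z (fun k => if k =? 0 then 0 else (aZ k + 960) / 1920)%Z 32.
Definition az : Z -> Z := look 0%Z a_tree 32.

Definition sgz (k : Z) : Z := if (k <? 0)%Z then (-1)%Z else 1%Z.
(** At scale [2^24], [nub] is about -0.0708 + 0.1421 i. *)
Definition nur : Z := (-1187806)%Z.
Definition nui : Z := 2384525%Z.
Definition ph2r (k : Z) : Z := (sgz k * 16777216 + nur - a0z)%Z.
Definition ph2i (_ : Z) : Z := nui.
Definition cc2r (k : Z) : Z := ((if k =? -1 then 1073741824 else 0) + grz k)%Z.
Definition o2z (k : Z) : Z := if (k =? -1)%Z then 0%Z else 1%Z.

Definition S2r_tree := Eval vm_compute in fill2 (fun i j => entry S2r_list (i + 20) (j + 20)) 20 20.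
Definition S2r : Z -> Z -> Z := look2 S2r_tree 20 20.
Definition S2i_tree := Eval vm_compute in fill2 (fun i j => entry S2i_list (i + 20) (j + 20)) 20 20.
Definition S2i : Z -> Z -> Z := look2 S2i_tree 20 20.
Definition V2_tree := Eval vm_compute in fill2 (fun l j => t2z l * sz (l - j))%Z 52 20.
Definition V2z : Z -> Z -> Z := look2 V2_tree 52 20.
Definition M2r_tree := Eval vm_compute in
  fill2 (fun i j => (Kr 32 (-1) az ph2r cc2r o2z V2z i j + 137438953472) / 274877906944)%Z 20 20.
Definition M2r : Z -> Z -> Z := look2 M2r_tree 20 20.
Definition M2i_tree := Eval vm_compute in
  fill2 (fun i j => (Ki (-1) ph2i giz o2z V2z i j + 137438953472) / 274877906944)%Z 20 20.
Definition M2i : Z -> Z -> Z := look2 M2i_tree 20 20.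
(** [phi2] takes only two values, one for each sign of [sig]; adding 1 makes the integer square root
    an upper bound of both moduli. *)
Definition Phi2 : Z := Eval vm_compute in
  (Z.sqrt (Z.max (ph2r 0 * ph2r 0) (ph2r (-1) * ph2r (-1)) + nui * nui) + 1)%Z.
Definition rho2_tree := Eval vm_compute in
  fill 0%Z (fun l => Phi2 * hi 20 l + zsZ (fun q => Z.abs (az q) * hi 20 (l + q)) 32)%Z 70.
Definition rho2z : Z -> Z := look 0%Z rho2_tree 70.
Definition h2_tree := Eval vm_compute in
  fill 0%Z (fun k => (hsum 50 96 20 (-1) t2z cc2r giz o2z rho2z k + 274877906943) / 274877906944)%Z 20.
Definition h2z : Z -> Z := look 0%Z h2_tree 20.

Definition res2r (k : Z) : Z :=
  (convZ vz gamr 91 k * 16777216 - 16106127360 * ((sgz k * 16777216 + nur) * grz k - nui * giz k))%Z.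
Definition res2i (k : Z) : Z :=
  (convZ vz gami 91 k * 16777216 - 16106127360 * ((sgz k * 16777216 + nur) * giz k + nui * grz k))%Z.

(** * Verified integer inequalities *)

Ltac by_computation := vm_cast_no_check (eq_refl true).

Lemma sum_res1 : (zsZ (psZ res1Z) 182 <=? 1435000000000000000000)%Z = true.
Proof. by_computation. Qed.
Lemma sum_err1 : (zsZ (psZ (fun k => Z.abs (err1Z k))) 142 <=? 595400000000000000)%Z = true.
Proof. by_computation. Qed.
Lemma err1_0 : (Z.abs (err1Z 0) <=? 2100000000000000)%Z = true.
Proof. by_computation. Qed.
Lemma sum_s : (zsZ (fun k => Z.abs (sz k)) 50 <=? 1160690)%Z = true.
Proof. by_computation. Qed.
Lemma sum_d : (zsZ (fun k => Z.abs (dz k)) 51 <=? 26068750)%Z = true.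
Proof. by_computation. Qed.
Lemma sum_a : (zsZ (fun k => Z.abs (az k)) 32 <=? 18357781)%Z = true.
Proof. by_computation. Qed.
Lemma V1_ok : check_V 10 0 t1z sz V1z = true.
Proof. by_computation. Qed.
Lemma V2_ok : check_V 20 32 t2z sz V2z = true.
Proof. by_computation. Qed.
Lemma M1_ok : check_M 10 0 0 zeroZ ph1 zeroZ cc1 zeroZ oneZ M1z zero2 V1z = true.
Proof. by_computation. Qed.
Lemma M2_ok : check_M 20 32 (-1) az ph2r ph2i cc2r giz o2z M2r M2i V2z = true.
Proof. by_computation. Qed.
Lemma rho1_ok : check_rho 10 50 0 zeroZ rho1z 16777216 = true.
Proof. by_computation. Qed.
Lemma rho2_ok : check_rho 20 50 32 az rho2z Phi2 = true.
Proof. by_computation. Qed.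
Lemma h1_ok : check_h 10 50 0 0 t1z sz cc1 zeroZ oneZ rho1z h1z = true.
Proof. by_computation. Qed.
Lemma h2_ok : check_h 20 50 96 (-1) t2z sz cc2r giz o2z rho2z h2z = true.
Proof. by_computation. Qed.
Lemma k2_1 : check_k2 10 50 t1z sz 9919509665 = true.
Proof. by_computation. Qed.
Lemma k2_2 : check_k2 20 50 t2z sz 5050503777 = true.
Proof. by_computation. Qed.
Lemma al_1 : check_al 10 S1z zero2 99332 = true.
Proof. by_computation. Qed.
Lemma al_2 : check_al 20 S2r S2i 607748 = true.
Proof. by_computation. Qed.
Lemma cols_1 : check_cols 10 true h1z S1z zero2 M1z zero2 8071124084 = true.
Proof. by_computation. Qed.
Lemma cols_2 : check_cols 20 false h2z S2r S2i M2r M2i 18813892492 = true.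
Proof. by_computation. Qed.
Lemma row_2 : check_row 20 (-1) S2r S2i 6845 = true.
Proof. by_computation. Qed.
Lemma sum_res2 : (zsZ (fun k => Z.abs (res2r k) + Z.abs (res2i k)) 188 <=? 4905000000000000000000)%Z = true.
Proof. by_computation. Qed.
Lemma sum_gam : (zsZ (fun k => Z.abs (gamr k) + Z.abs (gami k)) 97 <=? 1227479978189)%Z = true.
Proof. by_computation. Qed.
Lemma sum_G : (zsZ (fun k => Z.abs (grz k) + Z.abs (giz k)) 96 <=? 21551666041)%Z = true.
Proof. by_computation. Qed.
Lemma sum_v : (zsZ (fun k => Z.abs (vz k * 1000000000000000 - wz k * 1073741824)) 91 <=? 40077047193927680)%Z = true.
Proof. by_computation. Qed.
Lemma sum_rho : (zsZ (fun k => Z.abs (aZ k - az k * 1920 - if k =? 0 then a0z * 1920 else 0)) 92 <=? 609626)%Z = true.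
Proof. by_computation. Qed.
(** The scale is [2^54], so the left-hand side stands for about 2.03. *)
Lemma nv_ok : (36574818070767920 <=?
  zsZ (fun k => (sgz k * 16777216 + nur) * giz k + nui * grz k) 96)%Z = true.
Proof. by_computation. Qed.
Lemma W_0 : (zsZ wz 91 <=? 50237372558349)%Z = true.
Proof. by_computation. Qed.
(** The alternating signs are the values of [e^{ik PI}]. *)
Lemma W_pi : (1537740853320329 <=? zsZ (fun k => if Z.even k then wz k else - wz k) 91)%Z = true.
Proof. by_computation. Qed.
Lemma W_k : (zsZ (fun k => Z.abs (k * wz k)) 91 <=? 1763663396390790)%Z = true.
Proof. by_computation. Qed.

(** * Existence of the coefficients *)

Lemma zs_half f n : (forall k, f (- k)%Z = f k) ->
  zs f n = f 0%Z + 2 * zs (fun k => if (k <=? 0)%Z then 0 else f k) n.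
Proof.
  intros He. induction n as [|n IH]; cbn [zs]; [rewrite Z.leb_refl; ring|].
  rewrite IH, He. destruct (Z.leb_spec (Z.of_nat (S n)) 0); [lia|].
  destruct (Z.leb_spec (- Z.of_nat (S n)) 0); [|lia]. ring.
Qed.

Lemma floor_inv_error (q N : Z) : (0 < q)%Z -> (0 < N)%Z ->
  0 <= / IZR q - IZR (N / q) / IZR N <= / IZR N.
Proof.
  intros Hq HN.
  assert (H1 := Z.mul_div_le N q Hq). assert (H2 := Z.mul_succ_div_gt N q Hq).
  apply IZR_lt in Hq, HN. apply IZR_le in H1. apply IZR_lt in H2.
  unfold Z.succ in H2. rewrite mult_IZR in H1, H2. rewrite plus_IZR in H2.
  set (x := IZR (N / q)) in *. set (a := IZR q) in *. set (b := IZR N) in *.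
  replace (/ a - x / b) with ((b - a * x) * / (a * b)) by (field; lra).
  assert (Hi : 0 < / (a * b)) by (apply Rinv_0_lt_compat; nra).
  split; [apply Rmult_le_pos; lra|].
  replace (/ b) with (a * / (a * b)) by (field; lra). apply Rmult_le_compat_r; lra.
Qed.

(** So small that a sequence supported in [|k| <= 900] has weighted norm within 0.1 percent of its
    plain sum of moduli: the weight costs a factor 1001/1000, yet any positive rate already gives
    smoothness. *)
Definition tau : R := 1 / 1000000.

Lemma tau_gt : 0 < tau.
Proof. unfold tau. lra. Qed.

Lemma wt_bound n : (n <= 900)%nat -> exp (tau * INR n) <= 1001 / 1000.
Proof.
  intros Hn. apply le_INR in Hn. replace (INR 900) with 900 in Hn by (rewrite INR_IZR_INZ; reflexivity).
  assert (H0 := pos_INR n). set (x := tau * INR n).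
  assert (Hx : 0 <= x <= 9 / 10000) by (unfold x, tau; lra).
  assert (H := exp_ineq1_le (- x)). rewrite exp_Ropp in H.
  assert (Hp := exp_pos x). apply Rmult_le_compat_r with (r := exp x) in H; [|lra].
  rewrite Rinv_l in H by lra. nra.
Qed.

Lemma nrm_finite a n b : (n <= 900)%nat -> fin a n -> zs (fun k => Cmod (a k)) n <= b ->
  nrm tau a (1001 / 1000 * b).
Proof.
  intros Hn Ha Hb. eapply nrm_le; [|apply (nrm_fin tau a n b)]; try assumption.
  - apply Rmult_le_compat_r; [|apply wt_bound, Hn].
    eapply Rle_trans; [|exact Hb]. apply zs_pos. intros; apply Cmod_ge_0.
  - apply Rlt_le, tau_gt.
Qed.

Lemma Kop_ext p s s' a a' cc cc' u u' t t' o o' d k :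
  (forall i, s i = s' i) -> (forall i, a i = a' i) -> (forall i, cc i = cc' i) ->
  (forall i, u i = u' i) -> (forall i, t i = t' i) -> (forall i, o i = o' i) ->
  Kop p s a cc u t o d k = Kop p s' a' cc' u' t' o' d k.
Proof.
  intros Hs Ha Hc Hu Ht Ho. unfold Kop.
  assert (E : forall j, conv s (fun i => o i * d i)%C j = conv s' (fun i => o' i * d i)%C j).
  { intros j. apply conv_ext; [exact Hs|]. intros i. rewrite Ho. reflexivity. }
  rewrite Hu, Hc, E. do 2 f_equal. apply conv_ext; [exact Ha|].
  intros i. rewrite Ht, E. reflexivity.
Qed.

(** * The approximate wave, its defects and the exact wave *)

Definition c0 : R := 1109643839000099 / 1000000000000000.
Definition yb : Z -> C := rz 200000000000000 nz.
Definition sq : Z -> C := s_ sz.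

Lemma nz_fin : finZ nz 90. Proof. apply look_fin. Qed.
Lemma sz_fin : finZ sz 50. Proof. apply look_fin. Qed.
Lemma wz_fin : finZ wz 91. Proof. apply look_fin. Qed.
Lemma dz_fin : finZ dz 51. Proof. apply look_fin. Qed.
Lemma vz_fin : finZ vz 91. Proof. apply look_fin. Qed.
Lemma az_fin : finZ az 32. Proof. apply look_fin. Qed.
Lemma gr_fin : finZ grz 96. Proof. apply look_fin. Qed.
Lemma gi_fin : finZ giz 96. Proof. apply look_fin. Qed.
Lemma gamr_fin : finZ gamr 97. Proof. apply look_fin. Qed.
Lemma gami_fin : finZ gami 97. Proof. apply look_fin. Qed.

Lemma wz_eq k : wz k = wZ k.
Proof.
  destruct (Z.le_gt_cases (Z.abs k) 91) as [H|H].
  - apply Z.eqb_eq, (allz_spec _ _ check_wz k H).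
  - rewrite wz_fin by exact H. unfold wZ. rewrite !nz_fin by lia.
    destruct (Z.eqb_spec k 0); [lia|reflexivity].
Qed.

Lemma dz_eq k : dz k = dZ k.
Proof.
  destruct (Z.le_gt_cases (Z.abs k) 51) as [H|H].
  - apply Z.eqb_eq, (allz_spec _ _ check_dz k H).
  - rewrite dz_fin by exact H. unfold dZ. rewrite !sz_fin by lia. reflexivity.
Qed.

Lemma gam_eq k : gamr k = gamZ grz k /\ gami k = gamZ giz k.
Proof.
  destruct (Z.le_gt_cases (Z.abs k) 97) as [H|H].
  - pose proof (allz_spec _ _ check_gam k H) as E. cbn beta in E.
    destruct (Z.eqb_spec (gamr k) (gamZ grz k)); [|discriminate].
    split; [assumption|]. apply Z.eqb_eq, E.
  - rewrite gamr_fin, gami_fin by exact H. unfold gamZ. rewrite !gr_fin, !gi_fin by lia. lia.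
Qed.

Lemma Wb_eq k : Wb c0 yb k = rz 1000000000000000 wz k.
Proof.
  unfold Wb, Wseq. rewrite conv_Dseq. unfold yb, rz, cst. rewrite wz_eq. unfold wZ, c0.
  rewrite !plus_IZR, !mult_IZR, plus_IZR.
  destruct (_ =? _)%Z; apply C_eq; simpl; field.
Qed.

Lemma Ds_eq k : conv Dseq sq k = rz 1310720 dz k.
Proof.
  rewrite conv_Dseq. unfold sq, s_, rz. rewrite dz_eq. unfold dZ.
  rewrite plus_IZR, !mult_IZR, plus_IZR. apply C_eq; simpl; field.
Qed.

Lemma sq_fin : fin sq 50. Proof. apply rz_fin, sz_fin. Qed.
Lemma yb_fin : fin yb 90. Proof. apply rz_fin, nz_fin. Qed.
Lemma Ds_fin : fin (conv Dseq sq) 51.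
Proof. exact (fin_conv _ _ 1 50 fin_Dseq sq_fin). Qed.
Lemma Wb_fin : fin (Wb c0 yb) 91.
Proof. intros k Hk. rewrite Wb_eq. apply (rz_fin _ wz 91 wz_fin k Hk). Qed.

Lemma even_table : allz (fun k => if nz (- k) =? nz k then sz (- k) =? sz k else false)%Z 90 = true.
Proof. by_computation. Qed.

Lemma nz_sz_even k : nz (- k) = nz k /\ sz (- k) = sz k.
Proof.
  destruct (Z.le_gt_cases (Z.abs k) 90) as [H|H].
  - pose proof (allz_spec _ _ even_table k H) as E. cbn beta in E.
    destruct (Z.eqb_spec (nz (- k)) (nz k)); [|discriminate]. split; [assumption|]. apply Z.eqb_eq, E.
  - rewrite !nz_fin, !sz_fin by lia. auto.
Qed.

Lemma even_real_rz sc f : (forall k, f (- k)%Z = f k) -> even_real (rz sc f).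
Proof. intros H. split; intros k; unfold rz; [rewrite H|]; reflexivity. Qed.

Lemma yb_er : even_real yb.
Proof. apply even_real_rz. intros k. apply nz_sz_even. Qed.
Lemma sq_er : even_real sq.
Proof. apply even_real_rz. intros k. apply nz_sz_even. Qed.
Lemma Wb_er : even_real (Wb c0 yb).
Proof.
  apply even_real_plus; [apply even_real_cst|]. apply even_real_conv; [apply even_real_Dseq|apply yb_er].
Qed.

(** The numerator is twice the bound of [sum_err1] plus that of [err1_0]. *)
Definition eps1 : R := 1001 / 1000 * (1192900000000000000 / 1310720000000000000000).
Definition ns : R := 1001 / 1000 * (1160690 / 262144).
Definition nDs : R := 1001 / 1000 * (26068750 / 1310720).
Definition al1 : R := 1001 / 1000 * (99332 / 16384).
(** The residual 1.44e-9 divided by one minus the contraction rate, about 0.416, gives 3.46e-9; the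
    radius lies slightly above. *)
Definition r1 : R := 35 / 10000000000.

Lemma s_le : nrm tau sq ns.
Proof.
  apply (nrm_finite sq 50); [lia|apply sq_fin|].
  apply zs_rz; [lra|exact sum_s].
Qed.

Lemma Ds_le : nrm tau (conv Dseq sq) nDs.
Proof.
  apply (nrm_finite _ 51); [lia|apply Ds_fin|].
  rewrite (zs_ext _ (fun k => Cmod (rz 1310720 dz k))) by (intros; rewrite Ds_eq; reflexivity).
  apply zs_rz; [lra|exact sum_d].
Qed.

Lemma geo_Wb0 : geo (Wb c0 yb). Proof. exact (geo_fin _ _ Wb_fin). Qed.
Lemma geo_Ds0 : geo (conv Dseq sq). Proof. exact (geo_fin _ _ Ds_fin). Qed.

Lemma err1_alg (X : Z -> Z) k : (cst 1 k - rz (1310720 * 1000000000000000) X k)%C =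
  rz 1310720000000000000000 (fun k => ((if k =? 0 then 1310720000000000000000 else 0) - X k)%Z) k.
Proof.
  unfold rz, cst. rewrite minus_IZR. destruct (_ =? _)%Z; rewrite <- RtoC_minus; f_equal; field.
Qed.

Lemma err1_eq k : err1 c0 yb sq k = rz 1310720000000000000000 err1Z k.
Proof.
  unfold err1. rewrite (conv_sym _ _ k geo_Wb0 geo_Ds0).
  rewrite (conv_ext _ _ _ _ k Ds_eq Wb_eq), (conv_rz _ _ dz wz 51) by (try apply dz_fin; lra).
  exact (err1_alg (convZ dz wz 51) k).
Qed.

Lemma err1_le : nrm tau (err1 c0 yb sq) eps1.
Proof.
  apply (nrm_finite _ 142); [lia| |].
  - intros k Hk. unfold err1. rewrite (fin_cst 1 k) by lia.
    rewrite (fin_conv _ _ 91 51 Wb_fin Ds_fin k) by lia. ring.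
  - assert (Ee : even_real (err1 c0 yb sq)).
    { assert (E := even_real_conv _ _ Wb_er (even_real_conv _ _ even_real_Dseq sq_er)).
      split; intros k; unfold err1.
      - rewrite (proj1 (even_real_cst 1)), (proj1 E). reflexivity.
      - generalize (proj2 (even_real_cst 1) k) (proj2 E k). set (z := conv _ _ k).
        simpl. unfold Im. intros -> ->. ring. }
    rewrite zs_half by (intros k; rewrite (proj1 Ee); reflexivity).
    assert (H0 := err1_0). assert (H1 := sum_err1). apply Z.leb_le, IZR_le in H0, H1.
    rewrite IZR_zsZ in H1.
    rewrite (zs_ext _ (fun j => IZR (psZ (fun k => Z.abs (err1Z k)) j) / 1310720000000000000000)).
    + rewrite zs_div, err1_eq, Cmod_rz by lra. lra.
    + intros k _. unfold psZ. destruct (_ <=? _)%Z; [lra|]. rewrite err1_eq, Cmod_rz by lra. reflexivity.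
Qed.

Lemma res1_sum (X n : Z -> Z) N :
  zs (fun k => if (k <=? 0)%Z then 0 else
    Cmod (RtoC (/ 2) * rz (1000000000000000 * 1000000000000000) X k - tau1 k * rz 200000000000000 n k)%C) N <=
  zs (fun k => IZR (psZ (fun k => Z.abs (k * X k - 10000000000000000 * n k) / k + 1)%Z k)) N /
    2000000000000000000000000000000.
Proof.
  rewrite <- zs_div. apply zs_le. intros k _. unfold psZ. destruct (Z.leb_spec k 0); [lra|].
  set (a := (k * X k - 10000000000000000 * n k)%Z).
  assert (Hk : 0 < IZR k) by (apply IZR_lt; assumption).
  assert (Ha : IZR (Z.abs a) / IZR k <= IZR (Z.abs a / k + 1)).
  { assert (Hd := Z.mul_succ_div_gt (Z.abs a) k ltac:(assumption)). apply IZR_lt in Hd.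
    unfold Z.succ in Hd. rewrite mult_IZR in Hd.
    apply Rmult_le_reg_r with (IZR k); [exact Hk|]. unfold Rdiv. rewrite Rmult_assoc, Rinv_l by lra. lra. }
  replace (RtoC (/ 2) * rz (1000000000000000 * 1000000000000000) X k - tau1 k * rz 200000000000000 n k)%C
    with (RtoC (IZR a * / IZR k * / 2000000000000000000000000000000)).
  - rewrite Cmod_R, !Rabs_mult, <- abs_IZR, (Rabs_pos_eq (/ IZR k)), (Rabs_pos_eq (/ 2000000000000000000000000000000));
      try (apply Rlt_le, Rinv_0_lt_compat; lra).
    unfold Rdiv in *. apply Rmult_le_compat_r; [lra|exact Ha].
  - unfold rz, tau1. destruct (Z.eqb_spec k 0); [lia|].
    rewrite (Z.abs_eq k) by lia. unfold a. rewrite minus_IZR, !mult_IZR.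
    rewrite <- !RtoC_mult, <- RtoC_minus. f_equal. field. lra.
Qed.

Lemma res1_le : nrm tau (fun k => if (k =? 0)%Z then RtoC 0 else res1 c0 yb k)
  (1001 / 1000 * (2870000000000000000000 / 2000000000000000000000000000000)).
Proof.
  assert (Ee : even_real (conv (Wb c0 yb) (Wb c0 yb))) by (apply even_real_conv; apply Wb_er).
  apply (nrm_finite _ 182); [lia| |].
  - intros k Hk. destruct (Z.eqb_spec k 0); [reflexivity|]. unfold res1.
    rewrite (fin_conv _ _ 91 91 Wb_fin Wb_fin k), yb_fin by lia. ring.
  - rewrite zs_half.
    + rewrite Z.eqb_refl, Cmod_0.
      assert (H1 := sum_res1). apply Z.leb_le, IZR_le in H1. rewrite IZR_zsZ in H1.
      apply Rle_trans with (0 + 2 * (zs (fun k => IZR (psZ res1Z k)) 182 / 2000000000000000000000000000000));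
        [|lra].
      apply Rplus_le_compat_l, Rmult_le_compat_l; [lra|].
      eapply Rle_trans; [|exact (res1_sum (convZ wz wz 91) nz 182)]. apply Req_le, zs_ext.
      intros k _. destruct (Z.leb_spec k 0); [reflexivity|]. destruct (Z.eqb_spec k 0); [lia|].
      unfold res1. rewrite (conv_ext _ _ _ _ k Wb_eq Wb_eq), (conv_rz _ _ wz wz 91) by (try apply wz_fin; lra).
      reflexivity.
    + intros k. replace (- k =? 0)%Z with (k =? 0)%Z
        by (destruct (Z.eqb_spec k 0), (Z.eqb_spec (- k) 0); lia).
      destruct (_ =? _)%Z; [reflexivity|]. unfold res1.
      rewrite (proj1 Ee), tau1_even, (proj1 yb_er). reflexivity.
Qed.

Definition S1 : Z -> Z -> C := S_ S1z zero2.
Definition t1 : Z -> C := t_ t1z.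

Lemma S1_table : allz (fun i => allz (fun j => S1z (- i) (- j) =? S1z i j)%Z 10) 10 = true.
Proof. by_computation. Qed.

Lemma S1z_even i j : S1z (- i) (- j) = S1z i j.
Proof.
  destruct (Z.le_gt_cases (Z.abs i) 10) as [Hi|Hi].
  - destruct (Z.le_gt_cases (Z.abs j) 10) as [Hj|Hj].
    + pose proof (allz_spec _ _ S1_table i Hi) as H. cbn beta in H.
      apply Z.eqb_eq, (allz_spec _ _ H j Hj).
    + unfold S1z. rewrite !look2_out by lia. reflexivity.
  - unfold S1z. rewrite !look2_out by lia. reflexivity.
Qed.

Lemma t1_mono k k0 : (0 < k0 <= k)%Z \/ (k <= k0 < 0)%Z -> (Z.abs (t1z k) <= Z.abs (t1z k0))%Z.
Proof.
  intros H. unfold t1z. destruct (Z.eqb_spec k 0), (Z.eqb_spec k0 0); try lia.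
  rewrite (Z.abs_eq (65536 / Z.abs k)), (Z.abs_eq (65536 / Z.abs k0)) by (apply Z.div_pos; lia).
  apply Z.div_le_compat_l; lia.
Qed.

Lemma t1_le k : Cmod (tau1 k - t1 k)%C <= / 65536.
Proof.
  unfold t1, t_, rz, tau1, t1z. rewrite <- RtoC_minus, Cmod_R.
  destruct (Z.eqb_spec k 0).
  - replace (-1 - -65536 / 65536) with 0 by field. rewrite Rabs_R0. lra.
  - generalize (floor_inv_error (Z.abs k) 65536 ltac:(lia) ltac:(lia)). intros H.
    rewrite Rabs_pos_eq; lra.
Qed.

Lemma out2 (t : tree (tree Z)) n m k j : (Z.of_nat m < Z.abs j)%Z -> look2 t n m k j = 0%Z.
Proof. intros H. apply look2_out. right. exact H. Qed.

(** The constant is set by the columns beyond mode 10: [9919509665 / 2^34] is just below 0.5775,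
    while the low columns stay near 0.24. *)
Lemma wave_linear_bound x B : even_real x -> nrm tau x B ->
  nrm tau (fun k => x k - Aop 10 S1 x k + K1 sq t1 (Aop 10 S1 x) k)%C
    (1001 / 1000 * (5775 / 10000) * B).
Proof.
  intros Hx HB.
  assert (H : nrm tau (fun k => x k - Aop 10 S1 x k +
    Kop 0 (s_ sz) (a_ zeroZ) (cc_ cc1 zeroZ) (u_ t1z ph1 zeroZ) (t_ t1z) (o_ oneZ) (Aop 10 S1 x) k)%C
    (1001 / 1000 * (5775 / 10000) * B)).
  { refine (check_lin 10 50 0 0 0 true t1z sz zeroZ ph1 zeroZ cc1 zeroZ oneZ rho1z h1z S1z zero2
      M1z zero2 V1z 16777216 0 9919509665 99332 8071124084 tau sz_fin _ _ _ _ _ _ t1_mono _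
      V1_ok M1_ok rho1_ok h1_ok k2_1 al_1 cols_1 _ _ _ _ _ (5775 / 10000) _ _ x B _ HB).
    - intros k _. reflexivity.
    - intros k Hk. unfold cc1. destruct (Z.eqb_spec k 0); [lia|reflexivity].
    - intros k _. reflexivity.
    - intros k. unfold oneZ. lia.
    - lia.
    - lia.
    - intros k j Hj. split; [apply out2, Hj|reflexivity].
    - intros k. unfold ph1, zeroZ. lia.
    - reflexivity.
    - lia.
    - apply Rlt_le, tau_gt.
    - apply wt_bound. lia.
    - unfold kapL. rewrite INR_IZR_INZ. simpl. lra.
    - unfold kapH. lra.
    - intros _. apply Hx. }
  eapply nrm_ext; [|exact H]. intros k. cbn beta. f_equal. unfold K1. apply Kop_ext; intros i.
  - reflexivity.
  - unfold a_, rz, zeroZ, zero. f_equal. lra.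
  - unfold cc_, cz, cc1, zeroZ, cst. destruct (_ =? _)%Z; apply C_eq; simpl; field.
  - unfold u_, ph_, cz, ph1, zeroZ, t1. apply C_eq; simpl; unfold Re, Im; field.
  - reflexivity.
  - reflexivity.
Qed.

Theorem wave_coefficients : exists Y dV, geo Y /\ even_real Y /\ Y 0%Z = RtoC 0 /\
  (forall k, RtoC (IZR (Z.abs k)) * conv (Wseq c0 Y) (Wseq c0 Y) k = 2 * Y k)%C /\
  nrm tau dV (425 / 1000000000) /\
  forall k, Wseq c0 Y k = (Wb c0 yb k + dV k)%C.
Proof.
  destruct (wave_equation_solution c0 10 90 50 yb sq t1 S1 tau al1 eps1 ns nDs (/ 65536)
    (1001 / 1000 * (2870000000000000000000 / 2000000000000000000000000000000))
    (1001 / 1000 * (5775 / 10000)) r1) as (d & Hd & G1 & E1 & Z1 & W1 & V1).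
  - apply tau_gt.
  - apply yb_fin.
  - apply sq_fin.
  - apply yb_er.
  - apply sq_er.
  - unfold yb, rz. replace (nz 0) with 0%Z by reflexivity. f_equal. lra.
  - intros i j. unfold S1, S_, cz. rewrite S1z_even. reflexivity.
  - intros i j. unfold S1, S_, cz, zero2. simpl. lra.
  - apply (check_A_le 10 50 0 0 0 S1z zero2 99332 tau); try lia.
    + intros k j Hj. split; [apply out2, Hj|reflexivity].
    + exact al_1.
    + apply Rlt_le, tau_gt.
    + apply wt_bound. lia.
  - unfold t1, t_, rz, t1z. simpl. f_equal. lra.
  - apply wave_linear_bound.
  - apply t1_le.
  - apply err1_le.
  - apply s_le.
  - apply Ds_le.
  - apply res1_le.
  - unfold al1, eps1, ns, nDs, r1. split; lra.
  - unfold al1, eps1, ns, nDs, r1. lra.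
  - exists (Y1 yb sq d), (conv Dseq (conv sq d)). split; [exact G1|]. split; [exact E1|].
    split; [exact Z1|]. split; [exact W1|]. split; [|exact V1].
    apply (nrm_ext tau (conv (conv Dseq sq) d)).
    + intros k. symmetry. apply (conv_fin_assoc _ _ _ 1 50); [apply fin_Dseq|apply sq_fin].
    (* The product of [nDs], [al1] and [r1], about 19.91, 6.07 and 3.5e-9, is below 4.25e-7. *)
    + eapply nrm_le; [|apply conv_nrm; [apply Rlt_le, tau_gt|apply Ds_le|exact Hd]].
      unfold nDs, al1, r1. lra.
Qed.

(** * The approximate eigenpair, its defects and the exact eigenpair *)

Definition Wv : Z -> C := rz 1073741824 vz.
Definition Gb : Z -> C := cz 1073741824 grz giz.
Definition S2 : Z -> Z -> C := S_ S2r S2i.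
Definition t2 : Z -> C := t_ t2z.
Definition aq : Z -> C := a_ az.
Definition a0 : C := RtoC (IZR a0z / 16777216).
Definition nub : C := cq 16777216 nur nui.

Lemma Wv_fin : fin Wv 91. Proof. apply rz_fin, vz_fin. Qed.
Lemma Gb_fin : fin Gb 96. Proof. apply cz_fin; [apply gr_fin|apply gi_fin]. Qed.
Lemma aq_fin : fin aq 32. Proof. apply rz_fin, az_fin. Qed.

Lemma W_diff_le : nrm tau (fun k => Wb c0 yb k - Wv k)%C
  (1001 / 1000 * (40077047193927680 / (1000000000000000 * 1073741824))).
Proof.
  apply (nrm_finite _ 91); [lia| |].
  - intros k Hk. rewrite (Wb_fin k Hk), (Wv_fin k Hk). ring.
  - rewrite (zs_ext _ (fun k => Cmod (rz (1000000000000000 * 1073741824)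
      (fun k => vz k * 1000000000000000 - wz k * 1073741824)%Z k))).
    + apply zs_rz; [lra|exact sum_v].
    + intros k _. rewrite Wb_eq, <- Cmod_opp. f_equal. unfold Wv, rz.
      rewrite minus_IZR, !mult_IZR, <- RtoC_minus, <- RtoC_opp. f_equal. field.
Qed.

Lemma t2_mono k k0 : (0 < k0 <= k)%Z \/ (k <= k0 < 0)%Z -> (Z.abs (t2z k) <= Z.abs (t2z k0))%Z.
Proof.
  intros H. unfold t2z. destruct (Z.ltb_spec k 0), (Z.ltb_spec k0 0); try lia.
  - rewrite !Z.abs_opp.
    rewrite (Z.abs_eq (131072 / (- (2 * k) - 1))), (Z.abs_eq (131072 / (- (2 * k0) - 1)))
      by (apply Z.div_pos; lia). apply Z.div_le_compat_l; lia.
  - rewrite (Z.abs_eq (131072 / (2 * k + 1))), (Z.abs_eq (131072 / (2 * k0 + 1)))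
      by (apply Z.div_pos; lia). apply Z.div_le_compat_l; lia.
Qed.

Lemma t2_le k : Cmod (tau2 k - t2 k)%C <= / 65536.
Proof.
  unfold t2, t_, rz, tau2, t2z. rewrite <- RtoC_minus, Cmod_R.
  destruct (Z.ltb_spec k 0).
  - assert (Hq : 0 < IZR (- (2 * k) - 1)) by (apply IZR_lt; lia).
    generalize (floor_inv_error (- (2 * k) - 1) 131072 ltac:(lia) ltac:(lia)).
    rewrite opp_IZR. set (x := IZR (131072 / (- (2 * k) - 1))).
    rewrite minus_IZR, opp_IZR, mult_IZR in Hq |- *. intros H1.
    assert (E : / (IZR k + / 2) = - (2 * / (- (2 * IZR k) - 1))) by (field; lra).
    rewrite E. apply Rabs_le. lra.
  - assert (Hq : 0 < IZR (2 * k + 1)) by (apply IZR_lt; lia).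
    generalize (floor_inv_error (2 * k + 1) 131072 ltac:(lia) ltac:(lia)).
    set (x := IZR (131072 / (2 * k + 1))).
    rewrite plus_IZR, mult_IZR in Hq |- *. intros H1.
    assert (E : / (IZR k + / 2) = 2 * / (2 * IZR k + 1)) by (field; lra).
    rewrite E. apply Rabs_le. lra.
Qed.

Lemma sgz_sig k : IZR (sgz k) = sig k.
Proof. unfold sgz, sig. destruct (_ <? _)%Z; reflexivity. Qed.

Lemma phi2_eq k : phi2 a0 nub k = cz 16777216 ph2r ph2i k.
Proof.
  unfold phi2, a0, nub, cq, cz, ph2r, ph2i. rewrite <- sgz_sig, minus_IZR, plus_IZR, mult_IZR.
  set (x := IZR nur). set (y := IZR nui). set (z := IZR a0z). set (w := IZR (sgz k)).
  apply C_eq; simpl; field.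
Qed.

Lemma ph2_le k : (0 <= Phi2)%Z /\ (ph2r k * ph2r k + ph2i k * ph2i k <= Phi2 * Phi2)%Z.
Proof.
  split; [unfold Phi2; lia|]. unfold ph2r, ph2i, sgz, nur, nui, a0z, Phi2.
  destruct (k <? 0)%Z; lia.
Qed.

(** Here too the high columns decide: the sum of the bounds of [phi2] and [a], about 1.04 and 1.09,
    times 0.294 gives 0.628; the low columns stay near 0.55. *)
Lemma eigen_linear_bound x B : nrm tau x B ->
  nrm tau (fun k => x k - Aop 20 S2 x k + K2 (-1) sq Gb aq t2 a0 nub (Aop 20 S2 x) k)%C
    (1001 / 1000 * (6283 / 10000) * B).
Proof.
  intros HB.
  assert (H : nrm tau (fun k => x k - Aop 20 S2 x k +
    Kop (-1) (s_ sz) (a_ az) (cc_ cc2r giz) (u_ t2z ph2r ph2i) (t_ t2z) (o_ o2z) (Aop 20 S2 x) k)%C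
    (1001 / 1000 * (6283 / 10000) * B)).
  { refine (check_lin 20 50 32 96 (-1) false t2z sz az ph2r ph2i cc2r giz o2z rho2z h2z S2r S2i
      M2r M2i V2z Phi2 18357781 5050503777 607748 18813892492 tau sz_fin az_fin _ gi_fin _ _ _ t2_mono _
      V2_ok M2_ok rho2_ok h2_ok k2_2 al_2 cols_2 ph2_le sum_a _ _ _ (6283 / 10000) _ _ x B _ HB).
    - intros k Hk. unfold cc2r. rewrite (gr_fin k Hk). destruct (Z.eqb_spec k (-1)); [lia|reflexivity].
    - intros k. unfold o2z. destruct (_ =? _)%Z; lia.
    - lia.
    - lia.
    - intros k j Hj. split; apply out2, Hj.
    - lia.
    - apply Rlt_le, tau_gt.
    - apply wt_bound. lia.
    - unfold kapL. rewrite INR_IZR_INZ. simpl. lra.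
    - unfold kapH, Phi2. lra.
    - discriminate. }
  eapply nrm_ext; [|exact H]. intros k. cbn beta. f_equal. unfold K2. apply Kop_ext; intros i.
  - reflexivity.
  - reflexivity.
  - unfold cc_, cz, cc2r, cc2, Gb, cz. rewrite plus_IZR.
    destruct (_ =? _)%Z; apply C_eq; simpl; field.
  - rewrite phi2_eq. reflexivity.
  - reflexivity.
  - unfold o_, o2z, sl. destruct (_ =? _)%Z; reflexivity.
Qed.

Definition eps2 : R := eps1 + 1001 / 1000 * (40077047193927680 / (1000000000000000 * 1073741824)) * nDs.

Lemma err2_le : nrm tau (err2 Wv sq) eps2.
Proof.
  apply (nrm_ext tau (fun k => err1 c0 yb sq k + conv (fun j => Wb c0 yb j - Wv j) (conv Dseq sq) k)%C).
  - intros k. unfold err1, err2.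
    rewrite conv_sub_l; [ring|apply geo_Wb0|exact (geo_fin _ _ Wv_fin)|apply geo_Ds0].
  - apply nrm_plus; [apply err1_le|].
    apply conv_nrm; [apply Rlt_le, tau_gt|apply W_diff_le|apply Ds_le].
Qed.

Lemma rho2_alg (v a : Z -> Z) (b : Z) k :
  ((RtoC (- (1 / 6)) * rz 1073741824 v k + RtoC (3 / 5) * rz 1073741824 v (k - 1)%Z +
    RtoC (- (3 / 5)) * rz 1073741824 v (k + 1)%Z) - rz 16777216 a k
    - RtoC (IZR b / 16777216) * cst 1 k)%C =
  rz 32212254720 (fun k => (-5 * v k + 18 * v (k - 1) - 18 * v (k + 1)) - a k * 1920 -
     if k =? 0 then b * 1920 else 0)%Z k.
Proof.
  unfold rz, cst. rewrite !minus_IZR, plus_IZR, !mult_IZR.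
  destruct (_ =? _)%Z; rewrite ?mult_IZR; apply C_eq; simpl; field.
Qed.

Lemma rho2_eq k : rho2 Wv aq a0 k =
  rz 32212254720 (fun k => aZ k - az k * 1920 - if k =? 0 then a0z * 1920 else 0)%Z k.
Proof.
  unfold rho2. rewrite (conv_sym Wv Bseq) by
    (first [exact (geo_fin _ _ Wv_fin)|exact (geo_fin _ _ fin_Bseq)]).
  rewrite conv_Bseq. exact (rho2_alg vz az a0z k).
Qed.

Lemma rho2_le : nrm tau (rho2 Wv aq a0) (1001 / 1000 * (609626 / 32212254720)).
Proof.
  apply (nrm_finite _ 92); [lia| |].
  - intros k Hk. unfold rho2. rewrite (fin_cst 1 k), (aq_fin k) by lia.
    rewrite (fin_conv _ _ 91 1 Wv_fin fin_Bseq k) by lia. ring.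
  - rewrite (zs_ext _ (fun k => Cmod (rz 32212254720
      (fun k => aZ k - az k * 1920 - if k =? 0 then a0z * 1920 else 0)%Z k)))
      by (intros; rewrite rho2_eq; reflexivity).
    apply zs_rz; [lra|exact sum_rho].
Qed.

Lemma Bseq_le : nrm tau Bseq (1001 / 1000 * (41 / 30)).
Proof.
  apply (nrm_finite _ 1); [lia|apply fin_Bseq|]. cbn [zs Bseq Z.of_nat Pos.of_succ_nat Z.opp].
  rewrite !Cmod_R, (Rabs_left (- (1 / 6))), (Rabs_pos_eq (3 / 5)), (Rabs_left (- (3 / 5))) by lra. lra.
Qed.

Lemma aq_le : nrm tau aq (1001 / 1000 * (18357781 / 16777216)).
Proof. apply (nrm_finite _ 32); [lia|apply aq_fin|]. apply zs_rz; [lra|exact sum_a]. Qed.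

Lemma gam_alg (f g : Z -> Z) k : gam (cz 1073741824 f g) k = cz 16106127360 (gamZ f) (gamZ g) k.
Proof.
  unfold gam, cz, gamZ. rewrite !plus_IZR, !mult_IZR, !plus_IZR, !mult_IZR.
  apply C_eq; simpl; field.
Qed.

Lemma gam_Gb k : gam Gb k = cz 16106127360 gamr gami k.
Proof.
  unfold Gb. rewrite gam_alg. unfold cz. destruct (gam_eq k) as [-> ->]. reflexivity.
Qed.

Lemma gam_fin : fin (gam Gb) 97.
Proof. intros k Hk. rewrite gam_Gb. apply (cz_fin _ _ _ 97 gamr_fin gami_fin k Hk). Qed.

Lemma gam_le : nrm tau (gam Gb) (1001 / 1000 * (1227479978189 / 16106127360)).
Proof.
  apply (nrm_finite _ 97); [lia|apply gam_fin|].
  rewrite (zs_ext _ (fun k => Cmod (cz 16106127360 gamr gami k))) by (intros; rewrite gam_Gb; reflexivity).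
  apply zs_cz; [lra|exact sum_gam].
Qed.

Lemma nu_alg (f g : Z -> Z) k : ((RtoC (sig k) + nub) * cz 1073741824 f g k)%C =
  cz (16777216 * 1073741824) (fun k => (sgz k * 16777216 + nur) * f k - nui * g k)%Z
    (fun k => (sgz k * 16777216 + nur) * g k + nui * f k)%Z k.
Proof.
  unfold nub, cq, cz. rewrite <- sgz_sig, minus_IZR, plus_IZR, !mult_IZR, plus_IZR, mult_IZR.
  set (x := IZR nur). set (y := IZR nui). apply C_eq; simpl; field.
Qed.

Lemma res2_alg (X X' f g : Z -> Z) k :
  (cz (1073741824 * 16106127360) X X' k - (RtoC (sig k) + nub) * cz 1073741824 f g k)%C =
  cz 290142196707511001929482240
    (fun k => X k * 16777216 - 16106127360 * ((sgz k * 16777216 + nur) * f k - nui * g k))%Z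
    (fun k => X' k * 16777216 - 16106127360 * ((sgz k * 16777216 + nur) * g k + nui * f k))%Z k.
Proof.
  rewrite nu_alg. unfold cz. rewrite !minus_IZR, plus_IZR, !mult_IZR, minus_IZR, !plus_IZR, !mult_IZR, plus_IZR, mult_IZR.
  set (x := IZR nur). set (y := IZR nui). apply C_eq; simpl; field.
Qed.

Lemma res2_eq k : res2 Wv Gb nub k = cz 290142196707511001929482240 res2r res2i k.
Proof.
  unfold res2. rewrite (conv_ext Wv Wv _ _ k (fun _ => eq_refl) gam_Gb).
  unfold Wv at 1. rewrite (conv_rz_cz _ _ vz gamr gami 91) by (try apply vz_fin; lra).
  exact (res2_alg (convZ vz gamr 91) (convZ vz gami 91) grz giz k).
Qed.

Lemma res2_le : nrm tau (res2 Wv Gb nub)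
  (1001 / 1000 * (4905000000000000000000 / 290142196707511001929482240)).
Proof.
  apply (nrm_finite _ 188); [lia| |].
  - intros k Hk. unfold res2. rewrite (fin_conv _ _ 91 97 Wv_fin gam_fin k), (Gb_fin k) by lia. ring.
  - rewrite (zs_ext _ (fun k => Cmod (cz 290142196707511001929482240 res2r res2i k)))
      by (intros; rewrite res2_eq; reflexivity).
    apply zs_cz; [lra|exact sum_res2].
Qed.

Lemma Cmod_phi2 k : Cmod (phi2 a0 nub k) <= IZR Phi2 / 16777216.
Proof.
  rewrite phi2_eq. destruct (ph2_le k) as [H0 H]. apply IZR_le in H0, H.
  rewrite plus_IZR, !mult_IZR in H.
  apply Rsqr_incr_0_var; [|lra]. unfold Cmod, cz. cbn [fst snd].
  set (x := IZR (ph2r k)) in *. set (y := IZR (ph2i k)) in *. set (z := IZR Phi2) in *.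
  rewrite Rsqr_sqrt by nra. unfold Rsqr. nra.
Qed.

Lemma Gb_sum : zs (fun k => Cmod (Gb k)) 96 <= 21551666041 / 1073741824.
Proof. apply zs_cz; [lra|exact sum_G]. Qed.

Lemma nonvanishing : 2 <= Cmod (zsC (fun k => (RtoC (sig k) + nub) * Gb k)%C 96).
Proof.
  unfold Gb. rewrite (zsC_ext _ _ _ (fun k _ => nu_alg grz giz k)), zsC_cz.
  eapply Rle_trans; [|apply im_le_Cmod]. cbn [Im snd].
  assert (H := nv_ok). apply Z.leb_le, IZR_le in H.
  eapply Rle_trans; [|apply Rle_abs]. lra.
Qed.

Lemma Cmod_nub : Cmod nub <= 1.
Proof. unfold nub, cq, nur, nui. eapply Rle_trans; [apply Cmod_pair|]. rewrite Rabs_left, Rabs_pos_eq by lra. lra. Qed.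

Theorem eigen_coefficients W dV : nrm tau dV (425 / 1000000000) ->
  (forall k, W k = (Wb c0 yb k + dV k)%C) ->
  exists G nu, geo G /\ 0 < Im nu /\
    (forall k, conv W (gam G) k = ((RtoC (sig k) + nu) * G k)%C) /\
    ser (fun k => (RtoC (sig k) + nu) * G k)%C 0 <> RtoC 0.
Proof.
  intros HV HW.
  set (dW := fun k => (Wb c0 yb k - Wv k + dV k)%C).
  (* About 3.74e-8 for rounding the approximate wave to [Wv], plus 4.25e-7 for its distance to the
     exact wave. *)
  set (nW := 463 / 1000000000).
  set (al := 1001 / 1000 * (607748 / 16384)).
  (* With this radius the rate is about 0.744, so [(1 - kap2) * r] is near 6.4e-5, above the
     residual 5.3e-5. Most of that residual comes from the uncertainty of the wave. *)
  set (r := 25 / 100000).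
  destruct (eigen_equation_solution 20 91 50 96 32 (-1) Wv dW sq Gb aq t2 a0 nub S2 tau al eps2 ns nDs nW
    (1001 / 1000 * (41 / 30)) (1001 / 1000 * (1227479978189 / 16106127360)) (/ 65536) (IZR Phi2 / 16777216)
    (1001 / 1000 * (18357781 / 16777216)) (1001 / 1000 * (609626 / 32212254720))
    (1001 / 1000 * (4905000000000000000000 / 290142196707511001929482240)) (6845 / 16384)
    (1001 / 1000 * (6283 / 10000)) r) as (G & nu & HG & Hnu & Heq & Hnz).
  - apply tau_gt.
  - apply Wv_fin.
  - apply sq_fin.
  - apply Gb_fin.
  - apply aq_fin.
  - apply (check_A_le 20 50 0 0 (-1) S2r S2i 607748 tau); try lia.
    + intros k j Hj. split; apply out2, Hj.
    + exact al_2.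
    + apply Rlt_le, tau_gt.
    + apply wt_bound. lia.
  - apply eigen_linear_bound.
  - apply (check_row_le 20 50 (-1) S2r S2i 6845 tau); [lia|lia|exact row_2|apply Rlt_le, tau_gt].
  - apply t2_le.
  - apply err2_le.
  - apply s_le.
  - apply Ds_le.
  - apply Bseq_le.
  - apply aq_le.
  - apply rho2_le.
  - eapply nrm_le; [|apply nrm_plus; [apply W_diff_le|exact HV]]. unfold nW. lra.
  - apply gam_le.
  - apply res2_le.
  - apply Cmod_phi2.
  - unfold kap2, del2, eps2, eps1, ns, nDs, nW, al, r, Phi2. split; lra.
  - unfold kap2, del2, eps2, eps1, ns, nDs, nW, al, r, Phi2. lra.
  - eapply Rlt_le_trans; [|apply nonvanishing].
    assert (H1 := Gb_sum). assert (H2 := Cmod_nub).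
    apply Rle_lt_trans with (6845 / 16384 * r * (21551666041 / 1073741824) +
      (1 + (1 + 6845 / 16384 * r)) * (2 * (ns * (al * r)))).
    + apply Rplus_le_compat; [apply Rmult_le_compat_l; [unfold r; lra|exact H1]|].
      apply Rmult_le_compat_r; [unfold ns, al, r; lra|]. lra.
    + unfold ns, al, r. lra.
  - exists G, nu. split; [exact HG|]. split; [|split].
    + generalize (im_le_Cmod (nu - nub)%C). intros H.
      assert (H3 : Rabs (Im (nu - nub)%C) <= 6845 / 16384 * r) by lra.
      apply Rabs_le_between in H3. unfold nub, cq, nur, nui, r in H3. simpl in H3. unfold Im in *. lra.
    + intros k. rewrite <- Heq. apply conv_ext; [|reflexivity]. intros j. rewrite HW. unfold W2, dW. ring.
    + exact Hnz.
Qed.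

(** * Values and slope of the exact wave *)

Lemma sum_pi_alg (f : Z -> Z) n : Re (zsC (fun k => rz 1000000000000000 f k * expi (IZR k * PI))%C n) =
  IZR (zsZ (fun k => if Z.even k then f k else (- f k)%Z) n) / 1000000000000000.
Proof.
  rewrite IZR_zsZ, <- zs_div. unfold zsC. cbn [Re fst]. apply zs_ext. intros k _.
  assert (Hs : sin (IZR k * PI) = 0) by (apply sin_eq_0_1; exists k; reflexivity).
  assert (Hc : cos (IZR k * PI) = if Z.even k then 1 else -1).
  { destruct (Z.even k) eqn:E.
    - apply Z.even_spec in E. destruct E as [j ->].
      replace (IZR (2 * j) * PI) with (0 + 2 * PI * IZR j) by (rewrite mult_IZR; ring).
      generalize (expi_2PI_Z 0 j). unfold expi. intros H. injection H as H _. rewrite H. apply cos_0.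
    - assert (O : Z.odd k = true) by (rewrite <- Z.negb_even, E; reflexivity).
      apply Z.odd_spec in O. destruct O as [j ->].
      replace (IZR (2 * j + 1) * PI) with (PI + 2 * PI * IZR j) by (rewrite plus_IZR, mult_IZR; ring).
      generalize (expi_2PI_Z PI j). unfold expi. intros H. injection H as H _. rewrite H. apply cos_PI. }
  unfold expi, rz. simpl. rewrite Hs, Hc. destruct (Z.even k); rewrite ?opp_IZR; field.
Qed.

Section Values.

Variables (Y dV : Z -> C).
Hypothesis Yg : geo Y.
Hypothesis dV_le : nrm tau dV (425 / 1000000000).
Hypothesis Y_W : forall k, Wseq c0 Y k = (Wb c0 yb k + dV k)%C.

Lemma W_value y : Cmod (ser (Wseq c0 Y) y - ser (Wb c0 yb) y)%C <= 425 / 1000000000.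
Proof.
  destruct (geo_asum _ geo_Wb0) as [A HA].
  assert (HB := nrm_asum tau _ _ (Rlt_le _ _ tau_gt) dV_le).
  rewrite (ser_ext _ _ y Y_W), (ser_plus _ _ _ _ _ HA HB).
  replace (ser (Wb c0 yb) y + ser dV y - ser (Wb c0 yb) y)%C with (ser dV y) by ring.
  apply ser_bound, HB.
Qed.

Lemma W_at_0 : Re (ser (Wseq c0 Y) 0) <= 6 / 100.
Proof.
  assert (H := W_value 0). assert (H2 := re_le_Cmod (ser (Wseq c0 Y) 0 - ser (Wb c0 yb) 0)%C).
  assert (E : Re (ser (Wb c0 yb) 0) <= 51 / 1000).
  { rewrite (fin_sum_ser _ 91 Wb_fin).
    rewrite (zsC_ext _ (cz 1000000000000000 wz (fun _ => 0%Z))) by (intros; rewrite Wb_eq; apply rz_cz).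
    rewrite zsC_cz. cbn [Re fst]. assert (Hw := W_0). apply Z.leb_le, IZR_le in Hw. lra. }
  change (Re (ser (Wseq c0 Y) 0 - ser (Wb c0 yb) 0)%C) with
    (Re (ser (Wseq c0 Y) 0) - Re (ser (Wb c0 yb) 0)) in H2.
  assert (H3 : Rabs (Re (ser (Wseq c0 Y) 0) - Re (ser (Wb c0 yb) 0)) <= 425 / 1000000000) by lra.
  apply Rabs_le_between in H3. lra.
Qed.

Lemma W_at_PI : 15 / 10 <= Re (ser (Wseq c0 Y) PI).
Proof.
  assert (H := W_value PI). assert (H2 := re_le_Cmod (ser (Wseq c0 Y) PI - ser (Wb c0 yb) PI)%C).
  assert (E : 153 / 100 <= Re (ser (Wb c0 yb) PI)).
  { rewrite (ser_finite _ 91 _ Wb_fin).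
    rewrite (zsC_ext _ (fun k => rz 1000000000000000 wz k * expi (IZR k * PI))%C)
      by (intros; rewrite Wb_eq; reflexivity).
    rewrite sum_pi_alg. assert (Hw := W_pi). apply Z.leb_le, IZR_le in Hw. lra. }
  change (Re (ser (Wseq c0 Y) PI - ser (Wb c0 yb) PI)%C) with
    (Re (ser (Wseq c0 Y) PI) - Re (ser (Wb c0 yb) PI)) in H2.
  assert (H3 : Rabs (Re (ser (Wseq c0 Y) PI) - Re (ser (Wb c0 yb) PI)) <= 425 / 1000000000) by lra.
  apply Rabs_le_between in H3. lra.
Qed.

Lemma W_slope : asum (fun k => RtoC (IZR k) * Wseq c0 Y k)%C (22 / 10).
Proof.
  apply (nrm_asum 0); [lra|].
  apply (nrm_le _ _ (177 / 100 + 425 / 1000)); [lra|].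
  apply (nrm_ext 0 (fun k => RtoC (IZR k) * Wb c0 yb k + RtoC (IZR k) * dV k)%C);
    [intros k; rewrite Y_W; ring|].
  apply nrm_plus.
  - apply asum_nrm. intros n. eapply Rle_trans; [apply (zs_mono _ n (n + 91)); [intros; apply Cmod_ge_0|lia]|].
    rewrite (zs_finite _ 91 (n + 91)) by
      (try lia; intros k Hk; rewrite (Wb_fin k Hk), Cmult_0_r; apply Cmod_0).
    assert (Hw := W_k). apply Z.leb_le, IZR_le in Hw. rewrite IZR_zsZ in Hw.
    rewrite (zs_ext _ (fun k => IZR (Z.abs (k * wz k)) / 1000000000000000)).
    + rewrite zs_div. lra.
    + intros k _. rewrite Wb_eq, Cmod_mult, Cmod_rz, Cmod_R by lra.
      rewrite !abs_IZR, mult_IZR, Rabs_mult. field.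
  (* The factor [|k|] is paid by the weight: [|k| <= 10^6 exp (tau |k|)], so even this tiny rate
     leaves a contribution of 0.425 to the slope. *)
  - intros n. eapply Rle_trans; [|apply Rle_trans with (1000000 * (425 / 1000000000)); [|lra]].
    2:{ apply Rmult_le_compat_l; [lra|]. apply (dV_le n). }
    rewrite <- zs_scal. apply zs_le. intros k _. unfold wt at 1. rewrite Rmult_0_l, exp_0, Rmult_1_l.
    rewrite Cmod_mult, Cmod_R, <- abs_IZR, <- Rmult_assoc. apply Rmult_le_compat_r; [apply Cmod_ge_0|].
    unfold wt. generalize (exp_ineq1_le (tau * IZR (Z.abs k))). unfold tau. lra.
Qed.

End Values.

Theorem theorem3p2 :
  let c : R := 1.109643839000099 in
  exists v : R -> R,
    smooth v /\
    periodic (2 * PI) v /\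
    (forall x, v (- x) = v x) /\
    RInt v (- PI) PI = 0 /\
    (exists x, v x <> 0) /\
    (forall n : nat, (2 <= n)%nat -> ~ periodic (2 * PI / INR n) v) /\
    travelling_wave c v /\
    exists (lambda : C) (f : R -> C),
      Re (- lambda)%C < 0 /\
      eigenpair (opL c (rescale3 v)) (- lambda)%C f /\
      eigenpair (opA c (rescale3 v)) (- lambda)%C (DeriveC f).
Proof.
  intros c. replace c with c0 by (unfold c, c0; lra). clear c.
  destruct wave_coefficients as (Y & dV & Yg & [Ye Yr] & Y0 & YW & HdV & HW).
  destruct (eigen_coefficients (Wseq c0 Y) dV HdV HW) as (G & nu & Gg & Hnu & HG & Hnz).
  exists (wave Y).
  split; [apply wave_smooth, Yg|]. split; [apply wave_periodic|].
  split; [apply wave_even; assumption|]. split; [apply wave_mean; assumption|].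
  assert (A0 := W_at_0 Y dV HdV HW). assert (A1 := W_at_PI Y dV HdV HW).
  assert (A2 := W_slope Y dV HdV HW).
  (* The gap is comfortable: 0.06 + 2.2 times 0.23 is 0.566, far below 1.5. *)
  split; [apply (wave_nonzero c0 Y Yg Ye Yr (6 / 100) (15 / 10) (22 / 10)); try assumption; lra|].
  split; [intros n Hn; apply (wave_aperiodic c0 Y Yg Ye Yr (6 / 100) (15 / 10) (22 / 10)); try assumption; lra|].
  split; [apply wave_travelling; assumption|].
  (* The eigenvalue [- lambda] is [i nu], with real part [- Im nu]. *)
  exists (- (Ci * nu))%C, (eigf G).
  replace (- - (Ci * nu))%C with (Ci * nu)%C by ring.
  split; [simpl; unfold Im in Hnu; lra|].
  split; [apply eigenpair_L|apply eigenpair_A]; assumption.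
Qed.
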